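(* Let $u\in H_0^1(\Omega)$ be the solution of the TM variational problem $$a_{\rm TM}(u,v)=\int_{\Gamma_R^+} f\,\bar v\,{\rm d}s\qquad\forall\, v\in H_0^1(\Omega).$$ Then there exist a positive integer $N_0$ and a constant $C>0$ such that for all integers $N\ge N_0$ and all $\psi\in H_0^1(\Omega)$, $$\left|\langle (B_{\rm TM}-B_{\rm TM}^N)u,\psi\rangle_{\Gamma_R^+}\right|\le C\left[\Big(\frac{\hat R}{R}\Big)^N+\Big(\frac{e\kappa_0R}{2N}\Big)^{2N+4}\right]\|u^{\rm ref}\|_{H^1(\Omega)}\|\psi\|_{H^1(\Omega)}.$$
   Context: Geometry. $\mathbb R^2_+=\{x=(x_1,x_2): x_2>0\}$. $D\subset\{x_2<0\}$ is a bounded domain (the cavity) with Lipschitz boundary $\partial D=S\cup\Gamma$, where $S$ is the cavity wall and $\Gamma\subset\{x_2=0\}$ is the open aperture; $\Gamma_g=\{x_2=0\}\setminus\overline\Gamma$ is the ground plane. For $R>\hat R>0$ let $B_R^+=\{|x|<R,\ x_2>0\}$, $B_{\hat R}^+=\{|x|<\hat R,\ x_2>0\}$, $\Gamma_R^+=\{|x|=R,\ x_2>0\}$, with $\Gamma\subset\{|x_1|<\hat R\}$. Let $\Omega=B_R^+\cup D$, the two parts being joined through the aperture $\Gamma$ (so that $\Omega$ is a bounded domain with boundary contained in $S\cup\overline{\Gamma_g}\cup\overline{\Gamma_R^+}$). ''On $\Gamma_g$'' for functions on $\Omega$ means on $\Gamma_g\cap\partial\Omega$. Medium. $\omega>0$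 is the angular frequency and $\mu>0$ is a constant. $\epsilon$ (bounded, bounded below by a positive constant) and $\sigma\ge0$ (bounded) are measurable functions with $\epsilon=\epsilon_0>0$ constant and $\sigma=0$ in $\mathbb R^2_+\setminus B_{\hat R}^+$. The wavenumber is $\kappa=(\omega^2\epsilon\mu+{\rm i}\omega\mu\sigma)^{1/2}$, $\Im\kappa\ge0$, and $\kappa_0=\omega(\epsilon_0\mu)^{1/2}$. Incident and reference fields. For an incident angle $\theta\in(-\pi/2,\pi/2)$ put $\alpha=\kappa_0\sin\theta$, $\beta=\kappa_0\cos\theta$, $u^{\rm i}=e^{{\rm i}(\alpha x_1-\beta x_2)}$, $u^{\rm r}=-e^{{\rm i}(\alpha x_1+\beta x_2)}$, and $u^{\rm ref}=u^{\rm i}+u^{\rm r}$. DtN operators. Write $x=r(\cos\phi,\sin\phi)$. For $u$ on $\Gamma_R^+$ with $u(R,\phi)=\sum_{n\ge1}a_n\sin n\phi$, $a_n=\frac2\pi\int_0^\pi u(R,\phi)\sin n\phi\,{\rm d}\phi$, set $$B_{\rm TM}u=\kappa_0\sum_{n=1}^\infty\frac{H_n^{(1)\prime}(\kappa_0R)}{H_n^{(1)}(\kappa_0R)}a_n\sin n\phi,\qquad B_{\rm TM}^Nu=\kappa_0\sum_{n=1}^N\frac{H_n^{(1)\prime}(\kappa_0R)}{H_n^{(1)}(\kappa_0R)}a_n\sin n\phi,$$ where $H_n^{(1)}$ is the Hankel function of the first kind of order $n$. $\langle u,v\rangle_{\Gamma_R^+}=\int_{\Gamma_R^+}u\bar v\,{\rm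 d}s$ (extended by duality). Variational problem. $H_0^1(\Omega)=\{u\in H^1(\Omega): u=0\text{ on }S\cup\Gamma_g\}$ (complex valued), $$a_{\rm TM}(u,v)=\int_\Omega\nabla u\cdot\nabla\bar v\,{\rm d}x-\int_\Omega\kappa^2u\bar v\,{\rm d}x-\int_{\Gamma_R^+}B_{\rm TM}u\,\bar v\,{\rm d}s,$$ and $f=\partial_\rho u^{\rm ref}-B_{\rm TM}u^{\rm ref}$ on $\Gamma_R^+$, where $\partial_\rho$ is the outward radial derivative. This variational problem has a unique solution in $H_0^1(\Omega)$. The constants $N_0$ and $C$ may depend on $R,\hat R,\kappa,\theta$ and the geometry, but not on $N$ or $\psi$. *)

(* Defs.v *)
From HB Require Import structures.
From mathcomp Require Import all_boot all_order all_algebra.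
From mathcomp Require Import complex.
From mathcomp Require Import all_classical all_reals all_analysis.
Set Implicit Arguments.
Unset Strict Implicit.
Unset Printing Implicit Defensive.
Import Order.TTheory GRing.Theory Num.Theory.
Import numFieldNormedType.Exports.
Local Open Scope classical_set_scope.
Local Open Scope ring_scope.
Local Open Scope complex_scope.

Notation cabs := ComplexField.Normc.normc.

Definition leb1 (R : realType) : {measure set (measurableTypeR R) -> \bar R} :=
  @lebesgue_measure R.

(* The plane carries both its product topology and its product sigma-algebra. *)
Definition leb2 (R : realType) :
    {measure set (measurableTypeR R * measurableTypeR R)%type -> \bar R} :=
  (@lebesgue_measure R \x @lebesgue_measure R)%E.

Section ComplexIntegration.
Context d (T : measurableType d) (R : realType).
Variable mu : {measure set T -> \bar R}.
Implicit Types (A : set T) (f : T -> R[i]).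

Definition cint A f : R[i] :=
  Rintegral mu A (fun x => complex.Re (f x)) +i*
  Rintegral mu A (fun x => complex.Im (f x)).

Definition L2 A f : Prop :=
  [/\ measurable_fun A (fun x => complex.Re (f x)),
      measurable_fun A (fun x => complex.Im (f x)) &
      (\int[mu]_(x in A) ((cabs (f x) ^+ 2)%:E) < +oo)%E].

Definition l2norm A f : R :=
  Num.sqrt (Rintegral mu A (fun x => cabs (f x) ^+ 2)).

End ComplexIntegration.

Section Sobolev.
Variable R : realType.
Local Notation plane := (R * R)%type.
Implicit Types (U : set plane) (u g : plane -> R[i]).

Definition e1 : plane := (1, 0).
Definition e2 : plane := (0, 1).

Fixpoint Ck (k : nat) (f : plane -> R) : Prop :=
  continuous f /\
  if k is k'.+1 then
    [/\ forall x, derivable f x e1, forall x, derivable f x e2,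
        Ck k' ('D_e1 f) & Ck k' ('D_e2 f)]
  else True.

Definition smooth (f : plane -> R) : Prop := forall k, Ck k f.

Definition csmooth u : Prop :=
  smooth (fun x => complex.Re (u x)) /\ smooth (fun x => complex.Im (u x)).

Definition test_function U (f : plane -> R) : Prop :=
  smooth f /\
  exists2 K : set plane, compact K /\ K `<=` U & forall x, ~ K x -> f x = 0.

(* g is the weak derivative of u on U in direction e. Real test functions
   suffice, by linearity. *)
Definition is_weak_deriv U (e : plane) u g : Prop :=
  L2 (@leb2 R) U g /\
  forall f, test_function U f ->
    cint (@leb2 R) U (fun x => u x * ('D_e f x)%:C) =
    - cint (@leb2 R) U (fun x => g x * (f x)%:C).

(* Elements of H^1(U) are represented by functions on the whole plane; only
   their values almost everywhere in U matter. *)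
Definition H1 U u : Prop :=
  [/\ L2 (@leb2 R) U u, exists g, is_weak_deriv U e1 u g
    & exists g, is_weak_deriv U e2 u g].

(* unique up to a null set when it exists *)
Definition weak_deriv U (e : plane) u : plane -> R[i] :=
  xget (fun=> 0) [set g | is_weak_deriv U e u g].

Definition H1norm U u : R :=
  Num.sqrt (l2norm (@leb2 R) U u ^+ 2 +
            l2norm (@leb2 R) U (weak_deriv U e1 u) ^+ 2 +
            l2norm (@leb2 R) U (weak_deriv U e2 u) ^+ 2).

(* g is the trace of u, from inside U, along the piece of the boundary of U
   parametrized by c : I -> plane, i.e. the extension by continuity, from
   H^1(U) to L^2(I), of the restriction of functions smooth up to the
   boundary. The parametrizations used below have a speed bounded above and
   away from 0, so that L^2(I, dt) is L^2 for the arc length. *)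
Definition is_trace U (c : R -> plane) (I : set R) u (g : R -> R[i]) : Prop :=
  L2 (@leb1 R) I g /\
  exists phi : nat -> plane -> R[i],
    [/\ forall k, csmooth (phi k),
        (fun k => H1norm U (fun x => phi k x - u x)) @ \oo --> (0 : R) &
        (fun k => l2norm (@leb1 R) I (fun t => phi k (c t) - g t)) @ \oo
          --> (0 : R)].

Definition trace U (c : R -> plane) (I : set R) u : R -> R[i] :=
  xget (fun=> 0) [set g | is_trace U c I u g].

Definition trace_vanishes U (c : R -> plane) (I : set R) (E : set plane) u :=
  exists2 g, is_trace U c I u g &
    {ae @leb1 R, forall t, I t -> E (c t) -> g t = 0}.

Definition boundary U : set plane := closure U `\` U°.

(* The point with coordinates (t, s) in the orthonormal frame centred at p
   obtained by rotating the standard one by the angle of cosine a and sine b. *)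
Definition frame (p : plane) (a b t s : R) : plane :=
  (p.1 + a * t - b * s, p.2 + b * t + a * s).

(* In the box |t| < delta, |s| < eta of the frame, U is the region strictly
   below the graph of the Lipschitz function h, so that the part of the
   boundary of U in this box is the graph itself. *)
Definition lipschitz_chart U (p : plane) (a b delta eta : R) (h : R -> R) :=
  [/\ a ^+ 2 + b ^+ 2 = 1, 0 < delta /\ 0 < eta,
      exists L : R, forall t1 t2, `|h t1 - h t2| <= L * `|t1 - t2|,
      forall t, `|t| < delta -> `|h t| < eta &
      forall t s, `|t| < delta -> `|s| < eta ->
        (U (frame p a b t s) <-> s < h t)].

Definition lipschitz_boundary U : Prop :=
  forall p, boundary U p ->
    exists a b delta eta h, lipschitz_chart U p a b delta eta h.

(* The trace of u from inside the Lipschitz domain U vanishes on E. *)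
Definition boundary_trace_vanishes U (E : set plane) u : Prop :=
  forall p a b delta eta h,
    boundary U p -> lipschitz_chart U p a b delta eta h ->
    trace_vanishes U (fun t => frame p a b t (h t))
      [set t | `|t| < delta] E u.

End Sobolev.

Section Hankel.
Variable R : realType.
Implicit Types (n : nat) (x : R).

Definition besselJ n x : R :=
  lim ((series (fun k : nat =>
    (-1) ^+ k / (k`! * (n + k)`!)%:R * (x / 2) ^+ (n + k.*2))) @ \oo).

Definition harmonic_sum n : R := \sum_(1 <= k < n.+1) k%:R^-1.

Definition euler_gamma : R :=
  lim ((fun n => harmonic_sum n - ln n%:R) @ \oo).

(* Bessel function of the second kind of integer order n, for x > 0 *)
Definition besselY n x : R :=
  2 / pi * (ln (x / 2) + euler_gamma) * besselJ n x
  - pi^-1 * \sum_(k < n)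
      (n - k).-1`!%:R / k`!%:R * (x / 2) ^+ k.*2 / (x / 2) ^+ n
  - pi^-1 * lim ((series (fun k : nat =>
      (-1) ^+ k / (k`! * (n + k)`!)%:R
      * (harmonic_sum k + harmonic_sum (n + k))
      * (x / 2) ^+ (n + k.*2))) @ \oo).

Definition hankel1 n x : R[i] := besselJ n x +i* besselY n x.

Definition hankel1' n x : R[i] := derive1 (besselJ n) x +i* derive1 (besselY n) x.

End Hankel.

(* The domain cav is the cavity and apert the set of abscissae of the aperture. *)
Record cavity (R : realType) := Cavity {
  cav : set (R * R);
  apert : set R;
  Rhat : R;
  Rad : R;
  cav_open : open cav;
  cav_connected : connected cav;
  cav_nonempty : cav !=set0;
  cav_bounded : bounded_set cav;
  cav_below : forall x, cav x -> x.2 < 0;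
  cav_lipschitz : lipschitz_boundary cav;
  apert_open : open apert;
  apert_nonempty : apert !=set0;
  apert_boundary : forall t, apert t -> boundary cav (t, 0);
  apert_Rhat : forall t, apert t -> `|t| < Rhat;
  Rhat_gt0 : 0 < Rhat;
  Rhat_lt_Rad : Rhat < Rad
}.

Section Geometry.
Variables (R : realType) (G : cavity R).
Local Notation plane := (R * R)%type.

Definition half_plane : set plane := [set x | 0 < x.2].

Definition half_disk (r : R) : set plane :=
  [set x | x.1 ^+ 2 + x.2 ^+ 2 < r ^+ 2 /\ 0 < x.2].

Definition aperture : set plane := [set x | apert G x.1 /\ x.2 = 0].

Definition wall : set plane := boundary (cav G) `\` aperture.

Definition ground : set plane := [set x | x.2 = 0] `\` closure aperture.

Definition Omega : set plane := half_disk (Rad G) `|` aperture `|` cav G.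

Definition arc_point (t : R) : plane := (Rad G * cos t, Rad G * sin t).

Definition arc_trace (u : plane -> R[i]) : R -> R[i] :=
  trace (half_disk (Rad G)) arc_point `]0, pi[ u.

(* H^1_0(Omega). Since Omega may fail to be Lipschitz at the edge of the
   aperture, traces are taken from each of its two Lipschitz parts. *)
Definition H10 (u : plane -> R[i]) : Prop :=
  [/\ H1 Omega u,
      trace_vanishes (half_disk (Rad G)) (fun t => (t, 0))
        [set t | `|t| < Rad G] (wall `|` ground) u &
      boundary_trace_vanishes (cav G) (wall `|` ground) u].

(* int_{Gamma_R^+} g \bar h ds, for g and h functions of the angle *)
Definition arc_pairing (g h : R -> R[i]) : R[i] :=
  (Rad G)%:C * cint (@leb1 R) `]0, pi[ (fun t => g t * (h t)^*).

End Geometry.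

(* Material parameters; the space above the ground plane together with the
   cavity is the region occupied by the medium. *)
Definition medium_region (R : realType) (G : cavity R) : set (R * R) :=
  @half_plane R `|` aperture G `|` cav G.

Record medium (R : realType) (G : cavity R) := Medium {
  omega : R;
  permeability : R;
  eps0 : R;
  eps : R * R -> R;
  sigma : R * R -> R;
  omega_gt0 : 0 < omega;
  permeability_gt0 : 0 < permeability;
  eps0_gt0 : 0 < eps0;
  eps_measurable : @measurable_fun _ _
    (measurableTypeR R * measurableTypeR R)%type (measurableTypeR R)
    (medium_region G) eps;
  sigma_measurable : @measurable_fun _ _
    (measurableTypeR R * measurableTypeR R)%type (measurableTypeR R)
    (medium_region G) sigma;
  eps_bounded : exists m M : R, 0 < m /\
    forall x, medium_region G x -> m <= eps x <= M;
  sigma_bounded : exists M : R,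
    forall x, medium_region G x -> 0 <= sigma x <= M;
  eps_exterior : forall x,
    half_plane x -> ~ half_disk (Rhat G) x -> eps x = eps0;
  sigma_exterior : forall x,
    half_plane x -> ~ half_disk (Rhat G) x -> sigma x = 0
}.

Section Problem.
Variables (R : realType) (G : cavity R) (M : medium G).
Local Notation plane := (R * R)%type.
Local Notation leb2 := (@leb2 R).

(* sqrtC is the square root with nonnegative imaginary part *)
Definition kappa (x : plane) : R[i] :=
  sqrtC ((omega M ^+ 2 * eps M x * permeability M) +i* (omega M * permeability M * sigma M x)).

Definition kappa0 : R := omega M * Num.sqrt (eps0 M * permeability M).

Definition expi (t : R) : R[i] := cos t +i* sin t.

Definition alpha (theta : R) : R := kappa0 * sin theta.
Definition beta (theta : R) : R := kappa0 * cos theta.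

Definition u_inc (theta : R) (x : plane) : R[i] :=
  expi (alpha theta * x.1 - beta theta * x.2).

Definition u_refl (theta : R) (x : plane) : R[i] :=
  - expi (alpha theta * x.1 + beta theta * x.2).

Definition u_ref (theta : R) (x : plane) : R[i] :=
  u_inc theta x + u_refl theta x.

Definition d_rho (u : plane -> R[i]) (t : R) : R[i] :=
  derive1 (fun r => complex.Re (u (r * cos t, r * sin t))) (Rad G) +i*
  derive1 (fun r => complex.Im (u (r * cos t, r * sin t))) (Rad G).

Definition sine_coef (g : R -> R[i]) (n : nat) : R[i] :=
  (2 / pi)%:C * cint (@leb1 R) `]0, pi[ (fun t => g t * (sin (n%:R * t))%:C).

Definition B_TM_N (N : nat) (g : R -> R[i]) (t : R) : R[i] :=
  kappa0%:C * \sum_(1 <= n < N.+1)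
    hankel1' n (kappa0 * Rad G) / hankel1 n (kappa0 * Rad G)
    * sine_coef g n * (sin (n%:R * t))%:C.

(* <B_TM g, h>. The series defining B_TM g converges in the dual of the trace
   space, in general not pointwise: the duality pairing with h is the limit of
   the integrals of its partial sums against \bar h. *)
Definition B_TM_pairing (g h : R -> R[i]) : R[i] :=
  lim ((fun N => complex.Re (arc_pairing G (B_TM_N N g) h)) @ \oo) +i*
  lim ((fun N => complex.Im (arc_pairing G (B_TM_N N g) h)) @ \oo).

Definition a_TM (u v : plane -> R[i]) : R[i] :=
  let W := Omega G in
  cint leb2 W (fun x => weak_deriv W (@e1 R) u x * (weak_deriv W (@e1 R) v x)^*
                      + weak_deriv W (@e2 R) u x * (weak_deriv W (@e2 R) v x)^*)
  - cint leb2 W (fun x => kappa x ^+ 2 * u x * (v x)^*)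
  - B_TM_pairing (arc_trace G u) (arc_trace G v).

(* int_{Gamma_R^+} f \bar v ds with f = d_rho u_ref - B_TM u_ref; u_ref is
   continuous, hence its trace is its restriction. *)
Definition source (theta : R) (v : plane -> R[i]) : R[i] :=
  arc_pairing G (d_rho (u_ref theta)) (arc_trace G v)
  - B_TM_pairing (fun t => u_ref theta (arc_point G t)) (arc_trace G v).

Definition TM_solution (theta : R) (u : plane -> R[i]) : Prop :=
  H10 G u /\ forall v, H10 G v -> a_TM u v = source theta v.

End Problem.

(* Main.v *)
Require Import Defs.
From mathcomp Require Import all_boot all_order all_algebra.
From mathcomp Require Import complex.
From mathcomp Require Import all_classical all_reals all_analysis measurable_realfun.
From mathcomp Require Import ring lra zify.
Set Implicit Arguments.
Unset Strict Implicit.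
Unset Printing Implicit Defensive.
Import Order.TTheory GRing.Theory Num.Theory.
Import numFieldNormedType.Exports.
Local Open Scope classical_set_scope.
Local Open Scope ring_scope.

(** Outside [|x| <= Rhat] the medium is homogeneous, so the variational problem
    may be tested there against [V(x) = H(|x|^2) r^n sin(n phi)], where [H] is a
    normalized Bessel profile cut off in an annulus of width of order [1/n] at
    [|x| = Rhat]. Green's formula turns this into an equation
    [(Z_n - R kappa_0 F h_n) u_n = (data of u_ref) + T_n] for the [n]-th sine
    coefficient [u_n] of the trace of [u], with [Z_n >= n/2] and
    [h_n = H_n' / H_n]. As [Re h_n <= 0] for large [n], it bounds [n |u_n|].
    The data of [u_ref], an entire function, decay faster than any geometric
    sequence; [T_n] is the pairing of [u] with the defect of [V] in the
    Helmholtz equation, which lives in the annulus, so that Bessel's inequality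
    for the angular derivative of [u] bounds the sum of [|T_n|^2 / (n Rhat^2n)].
    Hence the sum of [n |u_n|^2 (R / Rhat)^2n] is finite. Since
    [|h_n| <= C n] and the sum of [n |psi_n|^2] is at most [C |psi|_{H^1}^2], the
    tail of the series for the pairing is at most [C (Rhat / R)^N |psi|_{H^1}].
    The norm of [u_ref] is a positive constant, and the second term of the
    bracket is nonnegative. *)

(** The obstacle is that [u] is only in $H^1$ and its trace is a chosen limit, so that separation of
    variables in $\hat R<|x|<R$ is not at hand. Testing with one mode at a time replaces it: the DtN
    pairing then reduces to a single coefficient, and convergence of its series plays no part. Since
    $F>0$ and $\Re h_n\le0$, the two terms of $\Re(Z_n-R\kappa_0Fh_n)$ add up, which excludes small
    denominators.

    The width $1/n$ of the annulus is what preserves the ratio $\hat R/R$: there $|x|^{2n}$ stays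
    below a constant multiple of $\hat R^{2n}$, whereas a fixed width would enlarge the ratio. The
    price is a factor $n^2$ in the defect. In squares this is $n^4$, against $1/n$ from the norm of
    a mode and $1/n^2$ from one integration by parts in the angle; what remains is the weight $n$ by
    which $|T_n|^2$ is divided. Dividing the mode equation by $n$ then yields the weight $n|u_n|^2$,
    the exact partner of $n|\psi_n|^2$ under $|h_n|\le Cn$. *)

Lemma eq_cvgn (V : topologicalType) (u v : nat -> V) (l : V) :
  (forall k, u k = v k) -> u @ \oo --> l -> v @ \oo --> l.
Proof. by move=> /funext ->. Qed.

(** * Square integrable functions *)

Section SquareIntegrable.
Context d (T : measurableType d) (R : realType) (mu : {measure set T -> \bar R}).
Variables (A : set T) (mA : measurable A).
Implicit Types f g h : T -> R.
Local Notation itg f := (mu.-integrable A (EFin \o f)).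
Local Notation I f := (Rintegral mu A f).

(** The real counterpart of [L2]: complex functions are handled through their real and imaginary
    parts. *)
Definition sqint f := measurable_fun A f /\ itg (fun x => f x ^+ 2).

Lemma eq_itgE (f g : T -> \bar R) : (forall x, f x = g x) ->
  mu.-integrable A f -> mu.-integrable A g.
Proof. by move=> /funext ->. Qed.

Lemma itgD f g : itg f -> itg g -> itg (fun x => f x + g x).
Proof. by move=> fi gi; exact: (integrableD mA fi gi). Qed.

Lemma itgZ (r : R) f : itg f -> itg (fun x => r * f x).
Proof. by move=> fi; exact: (integrableZl mA r fi). Qed.

Lemma itgN f : itg f -> itg (fun x => - f x).
Proof. by move=> fi; apply: eq_itgE (integrableN fi) => x. Qed.

Lemma itgB f g : itg f -> itg g -> itg (fun x => f x - g x).
Proof. by move=> fi gi; apply: itgD => //; apply: itgN. Qed.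

Lemma itg_sum J (s : seq J) (P : pred J) (h : J -> T -> R) :
  (forall i, P i -> itg (h i)) -> itg (fun x => \sum_(i <- s | P i) h i x).
Proof.
move=> hi; apply: eq_itgE (integrable_sum mA s hi).
by move=> x /=; rewrite sumEFin.
Qed.

Lemma itg_le f g : measurable_fun A f -> (forall x, A x -> `|f x| <= g x) ->
  itg g -> itg f.
Proof.
move=> mf fg gi; apply: (le_integrable mA _ _ gi) => //; first exact/measurable_EFinP.
by move=> x Ax; rewrite /= lee_fin (le_trans (fg x Ax))// ler_norm.
Qed.

Lemma eq_itg f g : (forall x, A x -> f x = g x) -> itg f -> itg g.
Proof.
by move=> fg; apply: (eq_integrable mA) => // x; rewrite inE => Ax /=; rewrite fg.
Qed.

Lemma eq_I f g : (forall x, A x -> f x = g x) -> I f = I g.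
Proof. by move=> fg; apply: eq_Rintegral => x; rewrite inE; exact: fg. Qed.

Lemma Rintegral0 : I (fun=> 0) = 0.
Proof. by rewrite Rintegral_cst// mul0r. Qed.

Lemma Rintegral_sum J (s : seq J) (h : J -> T -> R) :
  (forall i, itg (h i)) -> I (fun x => \sum_(i <- s) h i x) = \sum_(i <- s) I (h i).
Proof.
move=> hi; elim: s => [|i s ih].
  rewrite big_nil -[RHS](Rintegral0); apply: eq_I => x _; rewrite big_nil//.
rewrite big_cons -ih -RintegralD//; last exact: itg_sum.
by apply: eq_I => x _; rewrite big_cons.
Qed.

Lemma RintegralN f : itg f -> I (fun x => - f x) = - I f.
Proof.
move=> fi; rewrite -mulN1r -RintegralZl//; apply: eq_I => x _.
by rewrite mulN1r.
Qed.

Lemma ae_eq_Rintegral f g : measurable_fun A f -> measurable_fun A g ->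
  ae_eq mu A f g -> I f = I g.
Proof.
move=> mf mg fg; congr fine; apply: ae_eq_integral => //.
- exact/measurable_EFinP.
- exact/measurable_EFinP.
- by move: fg; apply: filterS => x /= + Ax => /(_ Ax) ->.
Qed.

(** From $|fg|\le f^2+g^2$, read off from $(f\pm g)^2\ge0$. *)
Lemma sqint_mul f g : sqint f -> sqint g -> itg (fun x => f x * g x).
Proof.
move=> [mf fi] [mg gi]; apply: itg_le (itgD fi gi).
  exact: measurable_funM.
move=> x _; have f2 := sqr_ge0 (f x); have g2 := sqr_ge0 (g x).
have h1 := sqr_ge0 (f x + g x); have h2 := sqr_ge0 (f x - g x).
rewrite ler_norml; apply/andP; split; nra.
Qed.

Lemma sqintZ (r : R) f : sqint f -> sqint (fun x => r * f x).
Proof.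
move=> [mf fi]; split; first by apply: measurable_funM => //.
by apply: eq_itg (itgZ (r ^+ 2) fi) => x _; rewrite exprMn.
Qed.

Lemma sqintD f g : sqint f -> sqint g -> sqint (fun x => f x + g x).
Proof.
move=> sf sg; split; first by apply: measurable_funD; [case: sf|case: sg].
apply: eq_itg (itgD (itgD sf.2 sg.2) (itgZ 2 (sqint_mul sf sg))) => x _ /=.
by ring.
Qed.

Lemma sqintN f : sqint f -> sqint (fun x => - f x).
Proof.
move=> /(sqintZ (-1)) [mf fi]; split.
  by under eq_fun do rewrite -mulN1r.
by apply: eq_itg fi => x _; rewrite mulN1r.
Qed.

Lemma sqintB f g : sqint f -> sqint g -> sqint (fun x => f x - g x).
Proof. by move=> sf /sqintN; exact: sqintD. Qed.

Lemma eq_sqint f g : (forall x, A x -> f x = g x) -> sqint f -> sqint g.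
Proof.
move=> fg [mf fi]; split.
  by apply: eq_measurable_fun mf => x; rewrite inE => /fg.
by apply: eq_itg fi => x /fg ->.
Qed.

Lemma sqint_sum J (s : seq J) (h : J -> T -> R) :
  (forall i, sqint (h i)) -> sqint (fun x => \sum_(i <- s) h i x).
Proof.
move=> hs; elim: s => [|i s ih].
  apply: (@eq_sqint (fun=> 0)) => [x _|]; first by rewrite big_nil.
  split; first exact: measurable_cst.
  by apply: eq_itg (integrable0 mu A) => x _; rewrite expr0n.
apply: eq_sqint (sqintD (hs i) ih) => x _ /=.
by rewrite big_cons.
Qed.

Lemma sqint_bounded (M : R) f g : measurable_fun A g ->
  (forall x, A x -> `|g x| <= M) -> sqint f -> sqint (fun x => g x * f x).
Proof.
move=> mg gM [mf fi]; split; first exact: measurable_funM.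
have mgf : measurable_fun A (fun x => (g x * f x) ^+ 2).
  by apply: measurable_funX; exact: measurable_funM.
apply: itg_le (itgZ (M ^+ 2) fi) => // x Ax.
rewrite normrX normrM exprMn !real_normK ?num_real//.
rewrite ler_wpM2r ?sqr_ge0// -[g x ^+ 2]real_normK ?num_real//.
by rewrite lerXn2r ?nnegrE ?(le_trans _ (gM x Ax)) ?gM.
Qed.

Lemma sqint_cst (r : R) : (mu A < +oo)%E -> sqint (fun=> r).
Proof.
move=> muA; split; first exact: measurable_cst.
apply: measurable_bounded_integrable => //.
by exists (`|r ^+ 2|); split => [|x rx y _]; rewrite ?num_real//= ltW.
Qed.

Lemma sqint_itg f : (mu A < +oo)%E -> sqint f -> itg f.
Proof.
move=> /(sqint_cst 1) s1 sf; apply: eq_itg (sqint_mul sf s1) => x _.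
by rewrite mulr1.
Qed.

Lemma bounded_sqint (M : R) f : (mu A < +oo)%E -> measurable_fun A f ->
  (forall x, A x -> `|f x| <= M) -> sqint f.
Proof.
move=> muA mf fM; apply: eq_sqint (sqint_bounded mf fM (sqint_cst 1 muA)).
by move=> x _; rewrite mulr1.
Qed.

Lemma I_sqr_ge0 f : 0 <= I (fun x => f x ^+ 2).
Proof. by apply: Rintegral_ge0 => x _; exact: sqr_ge0. Qed.

(** The quadratic $t\mapsto\int(f+tg)^2$ is nonnegative; its value at the minimum $t=-b/c$ is the
    claim. *)
Lemma CauchySchwarz f g : sqint f -> sqint g ->
  I (fun x => f x * g x) ^+ 2 <= I (fun x => f x ^+ 2) * I (fun x => g x ^+ 2).
Proof.
move=> sf sg; set a := I (fun x => f x ^+ 2); set b := I (fun x => f x * g x).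
set c := I (fun x => g x ^+ 2).
have quad t : 0 <= c * t ^+ 2 + 2 * b * t + a.
  have : 0 <= I (fun x => (f x + t * g x) ^+ 2) by exact: I_sqr_ge0.
  congr (_ <= _); rewrite mulrC /c -RintegralZl ?sg.2//.
  rewrite (_ : 2 * b * t = 2 * t * b); last by rewrite mulrAC.
  rewrite /b -RintegralZl//; last exact: sqint_mul.
  rewrite -RintegralD//; [|exact: itgZ sg.2|exact/itgZ/sqint_mul].
  rewrite /a -RintegralD//; [|by apply: itgD; [exact: itgZ sg.2|exact/itgZ/sqint_mul]|exact: sf.2].
  by apply: eq_I => x _; ring.
have a0 : 0 <= a := I_sqr_ge0 f.
have := I_sqr_ge0 g; rewrite -/c le_eqVlt => /predU1P[c0|c0].
  suff : b = 0 by move=> ->; rewrite -c0 mulr0 expr0n.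
  apply/eqP; apply: contraT => b0.
  (* When $\int g^2=0$ the quadratic is affine in $t$; this value of $t$ would make it equal to
     $-1$. *)
  have := quad (- (a + 1) / (2 * b)); rewrite -c0 mul0r add0r.
  have -> : 2 * b * (- (a + 1) / (2 * b)) = - (a + 1) by field.
  lra.
have := quad (- b / c).
have -> : c * (- b / c) ^+ 2 + 2 * b * (- b / c) + a = (a * c - b ^+ 2) / c.
  by field; rewrite gt_eqF.
by rewrite pmulr_lge0 ?invr_gt0// subr_ge0.
Qed.

(** Strong convergence in $L^2$ gives convergence of the moments against a fixed [g], by
    Cauchy-Schwarz. *)
Lemma cvg_Rintegral_mul (F : nat -> T -> R) f g :
  (forall k, sqint (F k)) -> sqint f -> sqint g ->
  (fun k => I (fun x => (F k x - f x) ^+ 2)) @ \oo --> 0 ->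
  (fun k => I (fun x => F k x * g x)) @ \oo --> I (fun x => f x * g x).
Proof.
move=> sF sf sg Ff.
set c := I (fun x => g x ^+ 2).
have c0 : 0 <= c := I_sqr_ge0 g.
suff H : (fun k => I (fun x => (F k x - f x) * g x)) @ \oo --> 0.
  have : (fun k => I (fun x => f x * g x) + I (fun x => (F k x - f x) * g x)) @ \oo
      --> I (fun x => f x * g x) + 0 by apply: cvgD => //; exact: cvg_cst.
  rewrite addr0; apply: eq_cvgn => k.
  rewrite -RintegralD//; [|exact: sqint_mul|apply: sqint_mul => //; exact: sqintB].
  by apply: eq_I => x _; ring.
apply: norm_cvg0.
have : (fun k => Num.sqrt (I (fun x => (F k x - f x) ^+ 2) * c)) @ \oo --> Num.sqrt (0 * c).
  apply: continuous_cvg; first exact: sqrt_continuous.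
  by apply: cvgM => //; exact: cvg_cst.
rewrite mul0r sqrtr0 => H.
apply: (@squeeze_cvgr _ _ _ _ (fun=> 0) (fun k => Num.sqrt (I (fun x => (F k x - f x) ^+ 2) * c))) => //; last exact: cvg_cst.
near=> k; rewrite normr_ge0/= -sqrtr_sqr ler_wsqrtr//.
by apply: CauchySchwarz => //; exact: sqintB.
Unshelve. all: by end_near.
Qed.

Lemma sqr_I_eq0 f : sqint f -> I (fun x => f x ^+ 2) = 0 -> ae_eq mu A f (cst 0).
Proof.
move=> [mf fi] I0.
have : ae_eq mu A (fun x => (f x ^+ 2)%:E) (cst 0%E).
  apply/ae_eq_integral_abs => //.
    by apply/measurable_EFinP; exact: measurable_funX.
  have := integrable_fin_num mA fi => /fineK.
  rewrite -[fine _]/(I _) I0 => E; rewrite [RHS]E.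
  by apply: eq_integral => x _ /=; rewrite ger0_norm// sqr_ge0.
apply: filterS => x /= + Ax => /(_ Ax) [/eqP].
by rewrite expf_eq0/= => /eqP.
Qed.

Lemma le_sqr_I (a b : R) : 0 <= b -> a ^+ 2 <= b ^+ 2 -> `|a| <= b.
Proof. by move=> b0 ab; rewrite -(ler_pXn2r (n := 2))// ?nnegrE// real_normK ?num_real. Qed.

(** The [e n] are orthogonal but not normalized, and [E n] has only to dominate their squared norms:
    subtracting $\sum (p_n/E_n)e_n$ from [f] still lowers $\int f^2$ by at least $\sum p_n^2/E_n$.
    Upper bounds for the norms of the modes therefore suffice later. *)
Lemma Bessel_inequality (f : T -> R) (e : nat -> T -> R) (E : nat -> R) (s : seq nat) :
  uniq s -> sqint f -> (forall n, sqint (e n)) ->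
  (forall n, n \in s -> I (fun x => e n x ^+ 2) <= E n) ->
  (forall n, n \in s -> 0 < E n) ->
  (forall n m, n != m -> I (fun x => e n x * e m x) = 0) ->
  \sum_(n <- s) I (fun x => f x * e n x) ^+ 2 / E n <= I (fun x => f x ^+ 2).
Proof.
move=> us sf se eE E0 orth.
pose p n := I (fun x => f x * e n x).
suff H : I (fun x => (f x - \sum_(n <- s) p n / E n * e n x) ^+ 2) <=
    I (fun x => f x ^+ 2) - \sum_(n <- s) p n ^+ 2 / E n.
  by have := le_trans (I_sqr_ge0 _) H; rewrite subr_ge0.
have se' n : sqint (fun x => p n / E n * e n x) by exact: sqintZ.
pose S s x := \sum_(n <- s) p n / E n * e n x.
have sS t : sqint (S t) by exact: sqint_sum.
rewrite -[X in I X]/(fun x => (f x - S s x) ^+ 2).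
have fS t : I (fun x => f x * S t x) = \sum_(n <- t) p n ^+ 2 / E n.
  transitivity (I (fun x => \sum_(n <- t) p n / E n * (f x * e n x))).
    by apply: eq_I => x _; rewrite /S mulr_sumr; apply: eq_bigr => n _; ring.
  rewrite Rintegral_sum; last by move=> n; apply/itgZ/sqint_mul.
  apply: eq_bigr => n _; rewrite RintegralZl//; last exact: sqint_mul.
  by rewrite -/(p n); ring.
have eS n t : n \notin t -> I (fun x => e n x * S t x) = 0.
  move=> nt; transitivity (I (fun x => \sum_(m <- t) p m / E m * (e n x * e m x))).
    by apply: eq_I => x _; rewrite /S mulr_sumr; apply: eq_bigr => m _; ring.
  rewrite Rintegral_sum; last by move=> m; apply/itgZ/sqint_mul.
  rewrite big_seq big1// => m mt; rewrite RintegralZl//; last exact: sqint_mul.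
  by rewrite orth ?mulr0//; apply: contraNneq nt => ->.
(* Induction on the list: the cross term vanishes by orthogonality, and this is where [E n] replaces
   the squared norm. *)
have SS t : uniq t -> {subset t <= s} -> I (fun x => S t x ^+ 2) <= \sum_(n <- t) p n ^+ 2 / E n.
  elim: t => [_ _|n t ih /= /andP[nt ut] ts].
    rewrite big_nil (_ : I _ = 0)// -Rintegral0; apply: eq_I => x _.
    by rewrite /S big_nil expr0n.
  rewrite big_cons.
  have -> : I (fun x => S (n :: t) x ^+ 2) =
     (p n / E n) ^+ 2 * I (fun x => e n x ^+ 2) + 2 * (p n / E n) * I (fun x => e n x * S t x) + I (fun x => S t x ^+ 2).
    rewrite -RintegralZl ?(se n).2// -RintegralZl//; last exact: sqint_mul.
    have i1 : itg (fun x => (p n / E n) ^+ 2 * e n x ^+ 2) by apply: itgZ (se n).2.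
    have i2 : itg (fun x => 2 * (p n / E n) * (e n x * S t x)).
      by apply: itgZ; exact: sqint_mul.
    rewrite -RintegralD// -RintegralD//; [|exact: itgD|exact: (sS t).2].
    by apply: eq_I => x _; rewrite /S big_cons; ring.
  rewrite eS// mulr0 addr0 lerD//; last first.
    by apply: ih => // m mt; apply: ts; rewrite inE mt orbT.
  have ns : n \in s by apply: ts; rewrite inE eqxx.
  have En := E0 n ns.
  apply: (@le_trans _ _ ((p n / E n) ^+ 2 * E n)).
    by rewrite ler_wpM2l ?sqr_ge0// eE.
  by rewrite le_eqVlt; apply/orP; left; apply/eqP; field; rewrite gt_eqF.
have -> : I (fun x => (f x - S s x) ^+ 2) =
    I (fun x => f x ^+ 2) + (-2 * I (fun x => f x * S s x) + I (fun x => S s x ^+ 2)).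
  rewrite -RintegralZl//; last exact: sqint_mul.
  have i2 : itg (fun x => -2 * (f x * S s x)) by apply: itgZ; exact: sqint_mul.
  rewrite -RintegralD//; last exact: (sS s).2.
  rewrite -RintegralD//; [|exact: sf.2|apply: itgD => //; exact: (sS s).2].
  by apply: eq_I => x _; ring.
rewrite fS; have := SS s us (fun _ => id); lra.
Qed.

End SquareIntegrable.

(** * Smooth functions and cutoffs *)

Section PartialDerivatives.
Variable R : realType.
Implicit Types (f g : R * R -> R).

Lemma derive_e1E f (x : R * R) : ('D_(e1 R) f x = 'D_1 (fun t => f (t, x.2)) x.1) *
  (derivable f x (e1 R) <-> derivable (fun t => f (t, x.2)) x.1 1).
Proof.
rewrite /derive /derivable.
suff -> : (fun h => h^-1 *: ((f \o shift x) (h *: e1 R) - f x)) =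
  (fun h => h^-1 *: (((fun t => f (t, x.2)) \o shift x.1) (h *: (1 : R)) -
     (fun t => f (t, x.2)) x.1)) by split.
apply/funext => h /=; rewrite -surjective_pairing; congr (_ *: (f _ - _)).
by case: x => a b; rewrite /e1 /shift/=; congr pair; rewrite /= scaler0 add0r.
Qed.

Lemma derive_e2E f (x : R * R) : ('D_(e2 R) f x = 'D_1 (fun t => f (x.1, t)) x.2) *
  (derivable f x (e2 R) <-> derivable (fun t => f (x.1, t)) x.2 1).
Proof.
rewrite /derive /derivable.
suff -> : (fun h => h^-1 *: ((f \o shift x) (h *: e2 R) - f x)) =
  (fun h => h^-1 *: (((fun t => f (x.1, t)) \o shift x.2) (h *: (1 : R)) -
     (fun t => f (x.1, t)) x.2)) by split.
apply/funext => h /=; rewrite -surjective_pairing; congr (_ *: (f _ - _)).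
by case: x => a b; rewrite /e2 /shift/=; congr pair; rewrite /= scaler0 add0r.
Qed.

Lemma is_derive_e1 f (x : R * R) d :
  is_derive x (e1 R) f d <-> is_derive x.1 1 (fun t => f (t, x.2)) d.
Proof.
have [E [H1 H2]] := derive_e1E f x.
by split=> [[/H1 D V]|[/H2 D V]]; (apply: DeriveDef; [exact: D|]); rewrite -V E.
Qed.

Lemma is_derive_e2 f (x : R * R) d :
  is_derive x (e2 R) f d <-> is_derive x.2 1 (fun t => f (x.1, t)) d.
Proof.
have [E [H1 H2]] := derive_e2E f x.
by split=> [[/H1 D V]|[/H2 D V]]; (apply: DeriveDef; [exact: D|]); rewrite -V E.
Qed.

Lemma CkP k f : Ck k f -> continuous f.
Proof. by case: k => [|k] []. Qed.

Lemma Ck_pred k f : Ck k.+1 f -> Ck k f.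
Proof.
elim: k f => [|k ih] f [cf [d1 d2 C1 C2]]; first by split.
split; first exact: cf.
by split; [exact: d1|exact: d2|exact: (ih _ C1)|exact: (ih _ C2)].
Qed.

Lemma is_derive_eq_fun (f : R * R -> R) (v : R * R) (h : R * R -> R) :
  (forall x, is_derive x v f (h x)) -> 'D_v f = h.
Proof. by move=> H; apply/funext => x; case: (H x). Qed.

Lemma CkS k f f1 f2 : continuous f ->
  (forall x, is_derive x (e1 R) f (f1 x)) ->
  (forall x, is_derive x (e2 R) f (f2 x)) ->
  Ck k f1 -> Ck k f2 -> Ck k.+1 f.
Proof.
move=> cf h1 h2 c1 c2; split; first exact: cf.
split.
- by move=> x; case: (h1 x).
- by move=> x; case: (h2 x).
- rewrite (is_derive_eq_fun h1); exact: c1.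
- rewrite (is_derive_eq_fun h2); exact: c2.
Qed.

Lemma Ck_is_derive k f x : Ck k.+1 f ->
  is_derive x (e1 R) f ('D_(e1 R) f x) /\ is_derive x (e2 R) f ('D_(e2 R) f x).
Proof. by move=> [_ [d1 d2 _ _]]; split; apply: derivableP. Qed.

Lemma Ck_cst k (c : R) : Ck k (fun=> c).
Proof.
elim: k c => [|k ih] c; first by split => //; exact: cst_continuous.
refine (CkS _ _ _ (ih 0) (ih 0)); exact: cst_continuous.
Qed.

Lemma CkD k f g : Ck k f -> Ck k g -> Ck k (fun x => f x + g x).
Proof.
elim: k f g => [|k ih] f g cf cg.
  by split => // x; apply: cvgD; [exact: (CkP cf)|exact: (CkP cg)].
have [_ [_ _ f1 f2]] := cf; have [_ [_ _ g1 g2]] := cg.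
refine (CkS _ _ _ (ih _ _ f1 g1) (ih _ _ f2 g2)).
- by move=> x; apply: cvgD; [exact: (CkP cf)|exact: (CkP cg)].
- move=> x; have [hf _] := Ck_is_derive x cf; have [hg _] := Ck_is_derive x cg.
  exact: is_deriveD.
- move=> x; have [_ hf] := Ck_is_derive x cf; have [_ hg] := Ck_is_derive x cg.
  exact: is_deriveD.
Qed.

Lemma CkM k f g : Ck k f -> Ck k g -> Ck k (fun x => f x * g x).
Proof.
elim: k f g => [|k ih] f g cf cg.
  by split => // x; apply: cvgM; [exact: (CkP cf)|exact: (CkP cg)].
have [_ [_ _ f1 f2]] := cf; have [_ [_ _ g1 g2]] := cg.
have cf' := Ck_pred cf; have cg' := Ck_pred cg.
refine (CkS _ _ _ (CkD (ih _ _ cf' g1) (ih _ _ cg' f1)) (CkD (ih _ _ cf' g2) (ih _ _ cg' f2))).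
- by move=> x; apply: cvgM; [exact: (CkP cf)|exact: (CkP cg)].
- move=> x; have [hf _] := Ck_is_derive x cf; have [hg _] := Ck_is_derive x cg.
  exact: is_deriveM.
- move=> x; have [_ hf] := Ck_is_derive x cf; have [_ hg] := Ck_is_derive x cg.
  exact: is_deriveM.
Qed.

Lemma Ck_fst k : Ck k (@fst R R).
Proof.
case: k => [|k]; first by split => //; move=> x; exact: cvg_fst.
refine (CkS _ _ _ (Ck_cst k 1) (Ck_cst k 0)).
- by move=> x; exact: cvg_fst.
- by move=> x; apply/is_derive_e1; exact: is_derive_id.
- by move=> x; apply/is_derive_e2; exact: is_derive_cst.
Qed.

Lemma Ck_snd k : Ck k (@snd R R).
Proof.
case: k => [|k]; first by split => //; move=> x; exact: cvg_snd.
refine (CkS _ _ _ (Ck_cst k 0) (Ck_cst k 1)).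
- by move=> x; exact: cvg_snd.
- by move=> x; apply/is_derive_e1; exact: is_derive_cst.
- by move=> x; apply/is_derive_e2; exact: is_derive_id.
Qed.

(** Continuity is left out because differentiability at the next order supplies it. This is why
    composition with a [Ck k] function asks for [dk k.+1]. *)
Fixpoint dk (k : nat) (h : R -> R) : Prop :=
  if k is k'.+1 then (forall x : R, derivable h x 1) /\ dk k' (derive1 h) else True.

Definition smooth1 (h : R -> R) := forall k, dk k h.

Lemma dkS k (h h' : R -> R) :
  (forall x : R, is_derive x 1 h (h' x)) -> dk k h' -> dk k.+1 h.
Proof.
move=> H dh; split => [x|]; first by case: (H x).
by rewrite (_ : derive1 h = h')//; apply/funext => x; rewrite derive1E; case: (H x).
Qed.

Lemma dk_is_derive k h (x : R) : dk k.+1 h -> is_derive x 1 h (derive1 h x).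
Proof. by move=> [H _]; rewrite derive1E; exact: derivableP. Qed.

Lemma dk_pred k h : dk k.+1 h -> dk k h.
Proof. by elim: k h => // k ih h [dh /ih]. Qed.

Lemma dkD k (f g : R -> R) : dk k f -> dk k g -> dk k (fun x => f x + g x).
Proof.
elim: k f g => [//|k ih] f g df dg.
have [_ f1] := df; have [_ g1] := dg.
apply: dkS (ih _ _ f1 g1) => x.
have := dk_is_derive x df; have := dk_is_derive x dg => *.
exact: is_deriveD.
Qed.

Lemma dkM k (f g : R -> R) : dk k f -> dk k g -> dk k (fun x => f x * g x).
Proof.
elim: k f g => [//|k ih] f g df dg.
have [_ f1] := df; have [_ g1] := dg.
apply: dkS (dkD (ih _ _ (dk_pred df) g1) (ih _ _ (dk_pred dg) f1)) => x.
have := dk_is_derive x df; have := dk_is_derive x dg => *.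
exact: is_deriveM.
Qed.

Lemma dk_cst k (c : R) : dk k (fun=> c).
Proof.
elim: k c => [//|k ih] c; apply: (@dkS _ _ (fun=> 0)) => // x.
Qed.

Lemma dk_id k : dk k (fun x : R => x).
Proof.
case: k => [//|k]; apply: (@dkS _ _ (fun=> 1)); exact: dk_cst.
Qed.

Lemma dk_comp_affine k (h : R -> R) (a b : R) :
  dk k h -> dk k (fun s => h (a * s + b)).
Proof.
elim: k h => [//|k ih] h dh; have [_ /ih dh'] := dh.
apply: dkS (dkM (dk_cst k a) dh') => x.
have H := dk_is_derive (a * x + b) dh.
have A : is_derive x 1 (fun s : R => a * s + b) a.
  by apply: is_derive_eq; rewrite addr0 /GRing.scale/= mulr1.
have := @is_derive1_comp _ h (fun s => a * s + b) x _ _ H A.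
by rewrite mulrC.
Qed.

(** Any class of functions closed under differentiation consists of smooth functions; it serves for
    the flat functions and for combinations of cosine and sine. *)
Lemma smooth1_coind (P : (R -> R) -> Prop) :
  (forall h, P h -> exists2 h', P h' & forall x : R, is_derive x 1 h (h' x)) ->
  forall h, P h -> smooth1 h.
Proof.
move=> HP h Ph k; elim: k h Ph => [//|k ih] h /HP[h' Ph' hh'].
exact: dkS hh' (ih _ Ph').
Qed.

Lemma smooth1_is_derive h (x : R) : smooth1 h -> is_derive x 1 h (derive1 h x).
Proof. by move=> /(_ 1%N) /dk_is_derive. Qed.

Lemma smooth1_derive h : smooth1 h -> smooth1 (derive1 h).
Proof. by move=> H k; case: (H k.+1). Qed.

Lemma is_derive_continuous (h : R -> R) (x : R) d : is_derive x 1 h d -> {for x, continuous h}.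
Proof. by move=> [/derivable1_diffP/differentiable_continuous]. Qed.

Lemma dk_continuous h k : dk k.+1 h -> continuous h.
Proof. by move=> H x; apply: is_derive_continuous (dk_is_derive x H). Qed.

Lemma Ck_comp k (h : R -> R) g : dk k.+1 h -> Ck k g -> Ck k (fun x => h (g x)).
Proof.
have cont h0 k0 g0 : dk k0.+1 h0 -> continuous g0 -> continuous (fun x => h0 (g0 x)).
  move=> dh cg x; apply: (@continuous_comp _ _ _ g0 h0); first exact: cg.
  exact: (dk_continuous dh).
elim: k h g => [|k ih] h g dh cg.
  by split => //; exact: cont dh (CkP cg).
have [_ [_ _ g1 g2]] := cg; have [_ dh'] := dh.
have C := ih _ _ dh' (Ck_pred cg).
refine (CkS _ _ _ (CkM C g1) (CkM C g2)).
- exact: cont dh (CkP cg).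
- move=> x; apply/is_derive_e1.
  have [/is_derive_e1 H _] := Ck_is_derive x cg.
  have := @is_derive1_comp _ h (fun t => g (t, x.2)) x.1 _ _ (dk_is_derive _ dh) H.
  by rewrite /= -surjective_pairing mulrC.
- move=> x; apply/is_derive_e2.
  have [_ /is_derive_e2 H] := Ck_is_derive x cg.
  have := @is_derive1_comp _ h (fun t => g (x.1, t)) x.2 _ _ (dk_is_derive _ dh) H.
  by rewrite /= -surjective_pairing mulrC.
Qed.

Lemma smooth_cst c : smooth (fun=> c : R). Proof. by move=> k; exact: Ck_cst. Qed.
Lemma smoothD f g : smooth f -> smooth g -> smooth (fun x => f x + g x).
Proof. by move=> sf sg k; exact: CkD. Qed.
Lemma smoothM f g : smooth f -> smooth g -> smooth (fun x => f x * g x).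
Proof. by move=> sf sg k; exact: CkM. Qed.
Lemma smoothZ c f : smooth f -> smooth (fun x => c * f x).
Proof. by move=> sf; apply: smoothM => //; exact: smooth_cst. Qed.
Lemma smoothB f g : smooth f -> smooth g -> smooth (fun x => f x - g x).
Proof.
move=> sf sg; have := smoothD sf (smoothZ (-1) sg).
by under eq_fun do rewrite mulN1r.
Qed.
Lemma smooth_fst : smooth (@fst R R). Proof. by move=> k; exact: Ck_fst. Qed.
Lemma smooth_snd : smooth (@snd R R). Proof. by move=> k; exact: Ck_snd. Qed.
Lemma smooth_comp h g : smooth1 h -> smooth g -> smooth (fun x => h (g x)).
Proof. by move=> sh sg k; exact: Ck_comp. Qed.
Lemma smooth_continuous f : smooth f -> continuous f.
Proof. by move=> /(_ 0%N)/CkP. Qed.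
Lemma smooth_D1 f : smooth f -> smooth ('D_(e1 R) f).
Proof. by move=> sf k; have [_ []] := sf k.+1. Qed.
Lemma smooth_D2 f : smooth f -> smooth ('D_(e2 R) f).
Proof. by move=> sf k; have [_ []] := sf k.+1. Qed.
Lemma smooth_is_derive1 f x : smooth f -> is_derive x (e1 R) f ('D_(e1 R) f x).
Proof. by move=> /(_ 1%N)/(Ck_is_derive x)[]. Qed.
Lemma smooth_is_derive2 f x : smooth f -> is_derive x (e2 R) f ('D_(e2 R) f x).
Proof. by move=> /(_ 1%N)/(Ck_is_derive x)[]. Qed.

End PartialDerivatives.

(** * A smooth transition function built from $e^{-1/x}$ *)

Section FlatFunctions.
Variable R : realType.

Lemma dk_comp k (h g : R -> R) : dk k h -> dk k g -> dk k (fun s => h (g s)).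
Proof.
elim: k h g => [//|k ih] h g dh dg.
have [_ h1] := dh; have [_ g1] := dg.
apply: dkS (dkM (ih _ _ h1 (dk_pred dg)) g1) => x.
exact: is_derive1_comp (dk_is_derive _ dh) (dk_is_derive _ dg).
Qed.

Lemma quadratic_flat (h : R -> R) (C : R) : h 0 = 0 ->
  (forall t, `|h t| <= C * t ^+ 2) -> is_derive (0 : R) 1 h 0.
Proof.
move=> h0 hC.
suff H : (fun t => t^-1 *: ((h \o shift 0) (t *: (1 : R)) - h 0)) @ (0 : R)^' --> (0 : R).
  by apply: DeriveDef; [exact: cvgP H|exact: cvg_lim H].
have C0 : 0 <= C by have := hC 1; rewrite expr1n mulr1; apply: le_trans.
apply: norm_cvg0.
apply: (@squeeze_cvgr _ _ _ _ (fun=> 0) (fun t => C * `|t|)).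
- near=> t; rewrite normr_ge0/=.
  have t0 : t != 0 by near: t; exact: nbhs_dnbhs_neq.
  rewrite h0 subr0 addr0 /GRing.scale/= mulr1 normrM normfV.
  rewrite ler_pdivrMl ?normr_gt0// (le_trans (hC t))//.
  by rewrite -[t ^+ 2]real_normK ?num_real//; rewrite le_eqVlt; apply/orP; left; apply/eqP; ring.
- exact: cvg_cst.
- rewrite -[X in _ --> X](mulr0 C); apply: cvgM; first exact: cvg_cst.
  rewrite -[X in _ --> X](normr0 R); apply: cvg_norm; exact: cvg_within.
Unshelve. all: by end_near.
Qed.

Lemma exprn_le_expR (m : nat) (y : R) : 0 <= y -> y ^+ m <= m`!%:R * expR y.
Proof.
case: m => [|m] y0; first by rewrite expr0 fact0 mul1r (le_trans _ (expR_ge1Dx y))// lerDl.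
rewrite -ler_pdivrMl ?ltr0n ?fact_gt0// mulrC.
by rewrite (le_trans _ (expR_ge1Dxn m y0))// lerDr.
Qed.

Lemma poly_le_expR (p : {poly R}) : exists C, forall y, 0 < y -> `|p.[y]| <= C * expR y.
Proof.
exists (\sum_(i < size p) `|p`_i| * i`!%:R) => y y0.
rewrite horner_coef mulr_suml (le_trans (ler_norm_sum _ _ _))//.
apply: ler_sum => i _; rewrite normrM -mulrA ler_wpM2l//.
by rewrite ger0_norm ?exprn_ge0 ?exprn_le_expR// ltW.
Qed.

(** With a polynomial in $1/x$ as prefactor the family is closed under differentiation, which is
    what makes $e^{-1/x}$, extended by $0$, smooth at the origin. *)
Definition flat (p : {poly R}) (x : R) : R :=
  if 0 < x then p.[x^-1] * expR (- x^-1) else 0.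

Lemma flat_derive p x : is_derive x (1:R) (flat p) (flat ('X ^+ 2 * (p - p^`())) x).
Proof.
have [x0|x0|->] := ltgtP x 0.
- rewrite [X in is_derive _ _ _ X]/flat ltNge (ltW x0)/=.
  apply: (@near_eq_is_derive _ _ _ (fun=> 0)).
  near=> y; rewrite /flat ltNge ltW//=; near: y; exact: lt_nbhsl.
- rewrite [X in is_derive _ _ _ X]/flat x0.
  apply: (@near_eq_is_derive R R R (fun y : R => p.[y^-1] * expR (- y^-1))).
    near=> y; rewrite /flat ifT//; near: y; exact: lt_nbhsr.
  have xn0 : x != 0 by rewrite gt_eqF.
  have Hi : is_derive x (1:R) (fun y : R => y^-1) (- x ^- 2).
    apply: DeriveDef; first exact: derivableV.
    by rewrite deriveV// derive_id /GRing.scale/= mulr1.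
  have HN : is_derive x (1:R) (fun y : R => - y^-1) (x ^- 2).
    by apply: is_derive_eq; rewrite opprK.
  have He : is_derive x (1:R) (fun y : R => expR (- y^-1)) _ :=
    @is_derive1_comp R expR (fun y => - y^-1) x _ _ (is_derive_expR _) HN.
  have Hp : is_derive x (1:R) (fun y : R => p.[y^-1]) _ :=
    @is_derive1_comp R (horner p) (fun y => y^-1) x _ _ (is_derive_poly p _) Hi.
  apply: is_derive_eq; rewrite !hornerE /= /GRing.scale/= exprVn.
  by field.
- rewrite [X in is_derive _ _ _ X]/flat ltxx.
  (* The exponential bound is applied to $X^2p$ instead of $p$: this gains the factor $t^2$ that
     makes the derivative at $0$ vanish. *)
  have [C HC] := poly_le_expR ('X ^+ 2 * p).
  apply: (@quadratic_flat _ `|C|); first by rewrite /flat ltxx.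
  move=> t; rewrite /flat; case: ltP => t0; last by rewrite normr0 mulr_ge0 ?sqr_ge0.
  have ti : 0 < t^-1 by rewrite invr_gt0.
  have := HC _ ti; rewrite hornerM hornerXn normrM (ger0_norm (sqr_ge0 _)) exprVn.
  rewrite ler_pdivrMl ?exprn_gt0// => H.
  rewrite normrM (ger0_norm (expR_ge0 _)) expRN ler_pdivrMr ?expR_gt0//.
  apply: le_trans H _.
  rewrite (_ : _ * (C * _) = C * (t ^+ 2 * expR t^-1)); last by ring.
  rewrite -[leRHS]mulrA ler_wpM2r ?ler_norm// mulr_ge0 ?expR_ge0//.
  by rewrite sqr_ge0.
Unshelve. all: by end_near.
Qed.

Definition rho := flat 1.

Lemma smooth1_rho : smooth1 rho.
Proof.
apply: (@smooth1_coind _ (fun h => exists p, h = flat p)); last by exists 1.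
move=> _ [p ->]; exists (flat ('X ^+ 2 * (p - p^`()))); first by eexists.
exact: flat_derive.
Qed.

Lemma rhoE x : rho x = if 0 < x then expR (- x^-1) else 0.
Proof. by rewrite /rho /flat hornerC mul1r. Qed.

Lemma rho_le0 x : x <= 0 -> rho x = 0.
Proof. by rewrite rhoE ltNge => ->. Qed.

Lemma rho_gt0 x : 0 < x -> 0 < rho x.
Proof. by rewrite rhoE => ->; exact: expR_gt0. Qed.

Lemma rho_ge0 x : 0 <= rho x.
Proof. by rewrite rhoE; case: ifP => // _; exact: expR_ge0. Qed.

Lemma rho_homo : {homo rho : x y / x <= y}.
Proof.
move=> x y xy; have [x0|x0] := leP x 0; first by rewrite (rho_le0 x0) rho_ge0.
have y0 := lt_le_trans x0 xy.
by rewrite !rhoE x0 y0 ler_expR lerN2 lef_pV2.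
Qed.

(** Composing [rho] with itself, instead of dividing by a sum of two bumps, leaves only a constant
    denominator, so that smoothness follows from composition alone. *)
Definition step (s : R) : R := rho (rho 1 - rho (1 - s)) / rho (rho 1).

Lemma smooth1_step : smooth1 step.
Proof.
move=> k; rewrite /step.
under eq_fun do rewrite mulrC.
apply: dkM; first exact: dk_cst.
apply: (@dk_comp _ rho (fun s => rho 1 - rho (1 - s))); first exact: smooth1_rho.
have : dk k (fun s => rho 1 + (-1) * rho ((-1) * s + 1)).
  apply: dkD; first exact: dk_cst.
  apply: dkM; first exact: dk_cst.
  by apply: dk_comp_affine; exact: smooth1_rho.
by under eq_fun do rewrite !mulN1r (addrC (- _)).
Qed.

Lemma step_le0 s : s <= 0 -> step s = 0.
Proof.
move=> s0; rewrite /step rho_le0 ?mul0r// subr_le0 rho_homo// lerBrDr gerDl//.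
Qed.

Lemma step_ge1 s : 1 <= s -> step s = 1.
Proof.
move=> s1; rewrite /step (@rho_le0 (1 - s)) ?subr0 ?divff ?subr_le0//.
by rewrite gt_eqF// rho_gt0// rho_gt0.
Qed.

Lemma step_itv s : 0 <= step s <= 1.
Proof.
have r1 : 0 < rho (rho 1) by rewrite rho_gt0// rho_gt0.
rewrite /step divr_ge0 ?rho_ge0//= ler_pdivrMr// mul1r rho_homo//.
by rewrite gerBl rho_ge0.
Qed.

(** The derivative of $z(s)/s$ is $(z'(s)-z(s)/s)/s$, again a quotient by $s$ whose numerator
    vanishes below $c$; hence the induction. Vanishing below $c>0$ removes the singularity at
    $0$. *)
Lemma dk_div_id k (z : R -> R) (c : R) : 0 < c -> (forall s, s < c -> z s = 0) ->
  dk k z -> dk k (fun s => z s / s).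
Proof.
move=> c0; elim: k z => [//|k ih] z z0 dz; have [_ dz'] := dz.
have z'0 s : s < c -> derive1 z s = 0.
  move=> sc; rewrite derive1E.
  suff : is_derive s (1:R) z 0 by case.
  apply: (@near_eq_is_derive _ _ _ (fun=> 0)).
  near=> y; rewrite z0//; near: y; exact: lt_nbhsl.
have dzs := ih _ z0 (dk_pred dz).
have : dk k (fun s => (derive1 z s - z s / s) / s).
  apply: ih => [s sc|]; first by rewrite z'0// z0// mul0r subr0.
  have := dkD dz' (dkM (dk_cst k (-1)) dzs).
  by under eq_fun do rewrite mulN1r.
apply: dkS => s; have [sc|sc] := ltP s c.
  rewrite z'0// z0// mul0r subr0 mul0r.
  apply: (@near_eq_is_derive _ _ _ (fun=> 0)).
  near=> y; rewrite z0 ?mul0r//; near: y; exact: lt_nbhsl.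
have s0 : s != 0 by rewrite gt_eqF// (lt_le_trans c0).
have Hi : is_derive s (1:R) (fun y : R => y^-1) (- s ^- 2).
  apply: DeriveDef; first exact: derivableV.
  by rewrite deriveV// derive_id /GRing.scale/= mulr1.
have Hz := dk_is_derive s dz.
by apply: is_derive_eq; rewrite /GRing.scale/=; field.
Unshelve. all: by end_near.
Qed.

Lemma smooth1_cst (c : R) : smooth1 (fun=> c).
Proof. by move=> k; exact: dk_cst. Qed.
Lemma smooth1_id : smooth1 (fun s : R => s).
Proof. by move=> k; exact: dk_id. Qed.
Lemma smooth1D (f g : R -> R) : smooth1 f -> smooth1 g -> smooth1 (fun s => f s + g s).
Proof. by move=> sf sg k; exact: dkD. Qed.
Lemma smooth1M (f g : R -> R) : smooth1 f -> smooth1 g -> smooth1 (fun s => f s * g s).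
Proof. by move=> sf sg k; exact: dkM. Qed.
Lemma smooth1_affine (h : R -> R) a b : smooth1 h -> smooth1 (fun s => h (a * s + b)).
Proof. by move=> sh k; exact: dk_comp_affine. Qed.

End FlatFunctions.

(** * Integration over the half-disk *)

Section PlaneMeasure.
Variable R : realType.
Local Notation T1 := (measurableTypeR R).
Local Notation T2 := (T1 * T1)%type.

(** The sigma-algebra of the plane is the product one, so an open set is written as a countable
    union of boxes with rational corners. *)
Lemma open_measurable2 (U : set (R * R)) : open U -> measurable (U : set T2).
Proof.
move=> oU.
pose box (a b c d : rat) : set (R * R) :=
  [set` `]ratr a, ratr b[] `*` [set` `]ratr c, ratr d[].
have mbox a b c d : measurable (box a b c d : set T2) by exact: measurableX.
pose F a b c d : set (R * R) := if `[< box a b c d `<=` U >] then box a b c d else set0.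
have -> : (U : set T2) = \bigcup_a \bigcup_b \bigcup_c \bigcup_d F a b c d.
  apply/seteqP; split => [x Ux|x [a _ [b _ [c _ [d _]]]]]; last first.
    by rewrite /F; case: asboolP => // /[apply].
  have [[A B] /= [nA nB] AB] := oU _ Ux.
  have [e1 /= e10 He1] := nA; have [e2 /= e20 He2] := nB.
  have [a] := @rat_in_itvoo R (x.1 - e1) x.1 (ltac:(by rewrite ltrBlDr ltrDl)).
  have [b] := @rat_in_itvoo R x.1 (x.1 + e1) (ltac:(by rewrite ltrDl)).
  have [c] := @rat_in_itvoo R (x.2 - e2) x.2 (ltac:(by rewrite ltrBlDr ltrDl)).
  have [d] := @rat_in_itvoo R x.2 (x.2 + e2) (ltac:(by rewrite ltrDl)).
  rewrite !in_itv/= => /andP[d1 d2] /andP[c1 c2] /andP[b1 b2] /andP[a1 a2].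
  exists a => //; exists b => //; exists c => //; exists d => //.
  rewrite /F; case: asboolP => [_|[]].
    by split => /=; rewrite in_itv/= ?a2 ?b1 ?c2 ?d1.
  move=> y [/=]; rewrite !in_itv/= => /andP[ya yb] /andP[yc yd].
  apply: AB; split => /=.
    by apply: He1; rewrite /= ltr_distlC; lra.
  by apply: He2; rewrite /= ltr_distlC; lra.
apply: bigcupT_measurable_rat => a; apply: bigcupT_measurable_rat => b.
apply: bigcupT_measurable_rat => c; apply: bigcupT_measurable_rat => d.
by rewrite /F; case: ifP.
Qed.

Lemma continuous_measurable_fun2 (f : R * R -> R) (A : set T2) : continuous f ->
  measurable A -> measurable_fun (A : set T2) (f : T2 -> T1).
Proof.
move=> cf mA; apply: measurable_funTS.
apply: (measurability _ (RGenOInfty.measurableE R)).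
move=> _ [_ [a ->] <-]; apply: measurableI => //; apply: open_measurable2.
by move/continuousP : cf; apply; exact: interval_open.
Qed.

Lemma continuous_bounded_rect (f : R * R -> R) (a b c d : R) : continuous f ->
  exists M, forall x, a <= x.1 <= b -> c <= x.2 <= d -> `|f x| <= M.
Proof.
move=> cf.
have K : compact ([set` `[a, b]] `*` [set` `[c, d]] : set (R * R)).
  by apply: compact_setX; exact: segment_compact.
have : compact (f @` ([set` `[a, b]] `*` [set` `[c, d]])).
  by apply: continuous_compact => //; exact: continuous_subspaceT.
move=> /compact_bounded[M [_ HM]].
exists (M + 1) => x x1 x2; apply: (HM (M + 1)); first by rewrite ltrDl.
by exists x => //; split => /=; rewrite in_itv.
Qed.

Lemma continuous_bounded_itv (f : R -> R) (a b : R) : continuous f ->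
  exists M, forall x, a <= x <= b -> `|f x| <= M.
Proof.
move=> cf; have : compact (f @` [set` `[a, b]]).
  apply: continuous_compact; first exact: continuous_subspaceT.
  exact: segment_compact.
move=> /compact_bounded[M [_ HM]].
exists (M + 1) => x x1; apply: (HM (M + 1)); first by rewrite ltrDl.
by exists x => //=; rewrite in_itv.
Qed.

Local Notation I2 A f := (Rintegral (@leb2 R) A f).
Local Notation I1 A f := (Rintegral (@leb1 R) A f).
Local Notation itg2 A f := ((@leb2 R).-integrable A (EFin \o f)).
Local Notation itg1 A f := ((@leb1 R).-integrable A (EFin \o f)).

Lemma Rintegral_fubini1 (A : set T2) (f : T2 -> R) (G : R -> R) : measurable A ->
  itg2 A f ->
  (forall s, (\int[@leb1 R]_t (((f \_ A) (s, t))%:E) = (G s)%:E)%E) ->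
  I2 A f = I1 setT G.
Proof.
move=> mA fi FG; rewrite Rintegral_mkcond /Rintegral.
have fi' : (@leb2 R).-integrable setT (EFin \o (f \_ A)).
  by rewrite -restrict_EFin; apply/integrable_restrict => //; rewrite setTI.
rewrite -(integral12_prod_meas1 fi'); congr fine.
by apply: eq_integral => s _; rewrite -FG.
Qed.

Lemma Rintegral_fubini2 (A : set T2) (f : T2 -> R) (G : R -> R) : measurable A ->
  itg2 A f ->
  (forall t, (\int[@leb1 R]_s (((f \_ A) (s, t))%:E) = (G t)%:E)%E) ->
  I2 A f = I1 setT G.
Proof.
move=> mA fi FG; rewrite Rintegral_mkcond /Rintegral.
have fi' : (@leb2 R).-integrable setT (EFin \o (f \_ A)).
  by rewrite -restrict_EFin; apply/integrable_restrict => //; rewrite setTI.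
rewrite -(integral21_prod_meas1 fi'); congr fine.
by apply: eq_integral => s _; rewrite -FG.
Qed.

Lemma leb2_rect (a b c d : R) : a <= b -> c <= d ->
  @leb2 R ([set` `[a, b]] `*` [set` `[c, d]]) = ((b - a) * (d - c))%:E.
Proof.
move=> ab cd.
have -> : @leb2 R ([set` `[a, b]] `*` [set` `[c, d]]) =
    (lebesgue_measure ([set` `[a, b]] : set R) * lebesgue_measure ([set` `[c, d]] : set R))%E.
  by apply: product_measure1E; exact: measurable_itv.
rewrite !lebesgue_measure_itv/= !lte_fin.
move: ab cd; rewrite le_eqVlt => /predU1P[->|ab].
  by rewrite ltxx mul0e subrr mul0r.
rewrite le_eqVlt => /predU1P[->|cd].
  by rewrite ltxx mule0 subrr mulr0.
by rewrite ab cd.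
Qed.

Lemma leb1_itv (a b : R) (x y : bool) : a <= b ->
  @leb1 R [set` Interval (BSide x a) (BSide y b)] = (b - a)%:E.
Proof.
move=> ab; have -> : @leb1 R [set` Interval (BSide x a) (BSide y b)] =
    lebesgue_measure ([set` Interval (BSide x a) (BSide y b)] : set R) by [].
rewrite lebesgue_measure_itv/= lte_fin; move: ab; rewrite le_eqVlt => /predU1P[->|->//].
by rewrite ltxx subrr.
Qed.

Lemma itg1_continuous (f : R -> R) (a b : R) (x y : bool) : continuous f ->
  itg1 [set` Interval (BSide x a) (BSide y b)] f.
Proof.
move=> cf; have : itg1 [set` `[a, b]] f.
  by apply: continuous_compact_integrable; [exact: segment_compact|exact: continuous_subspaceT].
apply: integrableS; [exact: measurable_itv|exact: measurable_itv|].
by apply: subset_itv; rewrite bnd_simp; case: x; case: y.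
Qed.

Lemma integral_itv_cc (f : R -> R) (a b : R) (x y : bool) : continuous f ->
  (\int[@leb1 R]_(t in [set` Interval (BSide x a) (BSide y b)]) (f t)%:E =
   \int[@leb1 R]_(t in [set` `[a, b]]) (f t)%:E)%E.
Proof.
move=> cf.
have mf (D : set T1) : measurable_fun D (EFin \o f).
  have H : measurable_fun [set: T1] (f : T1 -> T1) := continuous_measurable_fun cf.
  by apply/measurable_EFinP; exact: measurable_funTS.
transitivity (\int[@leb1 R]_(t in [set` Interval (BLeft a) (BSide y b)]) (f t)%:E)%E.
  case: x => //; rewrite integral_itv_obnd_cbnd//; exact: mf.
case: y => //; rewrite integral_itv_bndo_bndc//; exact: mf.
Qed.

Lemma FTC_itv (f f' : R -> R) (a b : R) (x y : bool) : a <= b ->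
  (forall t : R, is_derive t (1:R) f (f' t)) -> continuous f' ->
  (\int[@leb1 R]_(t in [set` Interval (BSide x a) (BSide y b)]) (f' t)%:E
    = (f b - f a)%:E)%E.
Proof.
move=> ab df cf'; rewrite integral_itv_cc//.
move: ab; rewrite le_eqVlt => /predU1P[->|ab].
  by rewrite set_itv1 integral_set1 subrr.
have cf : continuous f by move=> t; exact: is_derive_continuous (df t).
rewrite (@continuous_FTC2 _ f' f)//; first exact: continuous_subspaceT.
  split; first by move=> t _; case: (df t).
    exact: cvg_at_right_filter (cf a).
  exact: cvg_at_left_filter (cf b).
by move=> t _; rewrite derive1E; case: (df t).
Qed.

Lemma FTC_Rintegral (f f' : R -> R) (a b : R) (x y : bool) : a <= b ->
  (forall t : R, is_derive t (1:R) f (f' t)) -> continuous f' ->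
  I1 [set` Interval (BSide x a) (BSide y b)] f' = f b - f a.
Proof. by move=> ab df cf'; rewrite /Rintegral (FTC_itv _ _ ab df cf'). Qed.

Lemma substitution_decr (F F' g : R -> R) (a b : R) : a <= b ->
  {in `[a, b] &, {homo F : x y /~ (x < y)%R}} ->
  (forall t : R, is_derive t (1:R) F (F' t)) -> continuous F' -> continuous g ->
  I1 `]F b, F a[ g = I1 `]a, b[ (fun t => g (F t) * - F' t).
Proof.
move=> ab hF dF cF' cg; rewrite /Rintegral.
have cF : continuous F by move=> t; exact: is_derive_continuous (dF t).
have FE : derive1 F = F' by apply/funext => t; rewrite derive1E; case: (dF t).
rewrite integral_itv_cc// [in RHS]integral_itv_cc//; last first.
  move=> t; apply: cvgM; last by apply: cvgN; exact: cF'.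
  by apply: continuous_comp; [exact: cF|exact: cg].
rewrite (@integration_by_substitution_decreasing _ F g a b)//.
- by rewrite FE.
- by rewrite FE => t _; exact: cF'.
- by rewrite FE; apply: cvgP; exact: cvg_at_right_filter (cF' a).
- by rewrite FE; apply: cvgP; exact: cvg_at_left_filter (cF' b).
- split; first by move=> t _; case: (dF t).
    exact: cvg_at_right_filter (cF a).
  exact: cvg_at_left_filter (cF b).
- exact: continuous_subspaceT.
Qed.

Lemma substitution_incr (F F' g : R -> R) (a b : R) : a <= b ->
  {in `[a, b] &, {homo F : x y / (x < y)%R}} ->
  (forall t : R, is_derive t (1:R) F (F' t)) -> continuous F' -> continuous g ->
  I1 `]F a, F b[ g = I1 `]a, b[ (fun t => g (F t) * F' t).
Proof.
move=> ab hF dF cF' cg; rewrite /Rintegral.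
have cF : continuous F by move=> t; exact: is_derive_continuous (dF t).
have FE : derive1 F = F' by apply/funext => t; rewrite derive1E; case: (dF t).
rewrite integral_itv_cc// [in RHS]integral_itv_cc//; last first.
  move=> t; apply: cvgM; last exact: cF'.
  by apply: continuous_comp; [exact: cF|exact: cg].
rewrite (@integration_by_substitution_increasing _ F g a b)//.
- by rewrite FE.
- by rewrite FE => t _; exact: cF'.
- by rewrite FE; apply: cvgP; exact: cvg_at_right_filter (cF' a).
- by rewrite FE; apply: cvgP; exact: cvg_at_left_filter (cF' b).
- split; first by move=> t _; case: (dF t).
    exact: cvg_at_right_filter (cF a).
  exact: cvg_at_left_filter (cF b).
- exact: continuous_subspaceT.
Qed.

End PlaneMeasure.

(** * Gauss's formula on the half-disk, by slicing *)

Section HalfDisk.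
Variable R : realType.
Local Notation T1 := (measurableTypeR R).
Local Notation T2 := (T1 * T1)%type.
Local Notation I2 A f := (Rintegral (@leb2 R) A f).
Local Notation I1 A f := (Rintegral (@leb1 R) A f).
Local Notation itg2 A f := ((@leb2 R).-integrable A (EFin \o f)).
Variables (r : R) (r0 : 0 < r).
Local Notation hd := (half_disk r).

Lemma half_disk_open : open hd.
Proof.
apply: openI; last first.
  have := @smooth_continuous _ _ (@smooth_snd R) => /continuousP.
  move=> /(_ [set y | 0 < y]); apply; exact: open_gt.
have : smooth (fun x : R * R => x.1 * x.1 + x.2 * x.2).
  by apply: smoothD; apply: smoothM; (exact: smooth_fst || exact: smooth_snd).
move=> /smooth_continuous /continuousP /(_ [set y | y < r ^+ 2]).
rewrite (_ : _ @^-1` _ = [set x : R * R | x.1 ^+ 2 + x.2 ^+ 2 < r ^+ 2]).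
  by apply; exact: open_lt.
by apply/seteqP; split => x /=; rewrite !expr2.
Qed.

Lemma measurable_half_disk : measurable (hd : set T2).
Proof. by apply: open_measurable2; exact: half_disk_open. Qed.

Lemma lt_sqr_norm (x y : R) : 0 < y -> x ^+ 2 < y ^+ 2 -> `|x| < y.
Proof.
move=> y0 xy; rewrite -(ltr_pXn2r (n := 2))// ?nnegrE ?real_normK ?num_real//.
exact: ltW.
Qed.

Lemma half_disk_rect : hd `<=` [set` `[- r, r]] `*` [set` `[- r, r]].
Proof.
move=> x [/= x1 x2]; rewrite !in_itv/=.
have s1 := sqr_ge0 x.1; have s2 := sqr_ge0 x.2.
by split; rewrite -ler_norml ltW// lt_sqr_norm//; lra.
Qed.

Lemma leb2_half_disk : (@leb2 R hd < +oo)%E.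
Proof.
apply: (@le_lt_trans _ _ (@leb2 R ([set` `[- r, r]] `*` [set` `[- r, r]]))).
  apply: le_measure; rewrite ?inE; [exact: measurable_half_disk| |exact: half_disk_rect].
  by apply: measurableX; exact: measurable_itv.
by rewrite leb2_rect ?ltry// ge0_cp// ltW.
Qed.

Lemma continuous_bounded_half_disk (f : R * R -> R) : continuous f ->
  exists M, forall x, hd x -> `|f x| <= M.
Proof.
move=> /(@continuous_bounded_rect R f (- r) r (- r) r)[M HM]; exists M => x.
by move=> /half_disk_rect[/=]; rewrite !in_itv/=; exact: HM.
Qed.

Lemma sqint_continuous (f : R * R -> R) : continuous f -> sqint (@leb2 R) hd f.
Proof.
move=> cf; have [M HM] := continuous_bounded_half_disk cf.
apply: (bounded_sqint measurable_half_disk leb2_half_disk _ HM).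
by apply: continuous_measurable_fun2 => //; exact: measurable_half_disk.
Qed.

Lemma itg2_continuous (f : R * R -> R) : continuous f -> itg2 hd f.
Proof.
by move=> /sqint_continuous; apply: sqint_itg; [exact: measurable_half_disk|exact: leb2_half_disk].
Qed.

Lemma half_diskE_slice2 (s t : R) :
  hd (s, t) <-> t \in `]0, Num.sqrt (r ^+ 2 - s ^+ 2)[.
Proof.
rewrite in_itv/= /half_disk/=; split => [[h t0]|/andP[t0 ht]].
  have t2 := exprn_gt0 2 t0.
  by rewrite t0/= -[t]gtr0_norm// -sqrtr_sqr ltr_sqrt; lra.
split => //; have : 0 < Num.sqrt (r ^+ 2 - s ^+ 2) by exact: lt_trans ht.
rewrite sqrtr_gt0 => h.
have : Num.sqrt (t ^+ 2) < Num.sqrt (r ^+ 2 - s ^+ 2) by rewrite sqrtr_sqr gtr0_norm.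
by rewrite ltr_sqrt//; lra.
Qed.

Lemma half_diskE_slice1 (s t : R) : 0 < t ->
  hd (s, t) <-> s \in `](- Num.sqrt (r ^+ 2 - t ^+ 2)), Num.sqrt (r ^+ 2 - t ^+ 2)[.
Proof.
move=> t0; rewrite in_itv/= -ltr_norml -sqrtr_sqr /half_disk/=.
have := sqr_ge0 s => s0; split => [[h _]|h].
  by have t2 := exprn_gt0 2 t0; rewrite ltr_sqrt; lra.
split => //; have : 0 < Num.sqrt (r ^+ 2 - t ^+ 2).
  by apply: le_lt_trans h; exact: sqrtr_ge0.
by rewrite sqrtr_gt0 => h'; move: h; rewrite ltr_sqrt//; lra.
Qed.

Let h (s : R) := Num.sqrt (r ^+ 2 - s ^+ 2).

Lemma continuous_slice : continuous h.
Proof.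
move=> s.
have A : {for s, continuous (fun s : R => r ^+ 2 - s ^+ 2)}.
  by apply: cvgB; [exact: cvg_cst|exact: exprn_continuous].
exact: (continuous_comp A (@sqrt_continuous _ _)).
Qed.

Lemma continuous_pair (f : R * R -> R) (g1 g2 : R -> R) :
  continuous f -> continuous g1 -> continuous g2 -> continuous (fun s => f (g1 s, g2 s)).
Proof.
move=> cf c1 c2 s; exact: (continuous_comp (cvg_pair (c1 s) (c2 s)) (cf _)).
Qed.

(** The square root of a negative number is $0$ by convention, so the formula for the slices stays
    valid off the disk, where they are empty. *)
Lemma slice_ge (s : R) : r <= `|s| -> h s = 0.
Proof.
move=> rs; apply/eqP; rewrite sqrtr_eq0 subr_le0.
by rewrite -[leRHS]real_normK ?num_real// lerXn2r// nnegrE// ltW.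
Qed.

Lemma Gauss_slice2 (f : R * R -> R) : smooth f ->
  I2 hd ('D_(e2 R) f) = I1 `](- r), r[ (fun s => f (s, h s) - f (s, 0)).
Proof.
move=> sf; have cf := smooth_continuous sf; have cf2 := smooth_continuous (smooth_D2 sf).
rewrite (@Rintegral_fubini1 _ _ _ (fun s => f (s, h s) - f (s, 0))).
- rewrite [RHS]Rintegral_mkcond; apply: eq_Rintegral => s _.
  rewrite patchE; case: ifPn => //; rewrite notin_setE /= in_itv/= -ltr_norml => /negP.
  by rewrite -leNgt => /slice_ge ->; rewrite subrr.
- exact: measurable_half_disk.
- exact: itg2_continuous.
- move=> s; have h0 : 0 <= h s by exact: sqrtr_ge0.
  have df (t : R) : is_derive t (1:R) (fun t => f (s, t)) ('D_(e2 R) f (s, t)).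
    by have /is_derive_e2 := smooth_is_derive2 (s, t) sf.
  have cD : continuous (fun t => 'D_(e2 R) f (s, t)).
    by apply: (continuous_pair cf2) => t; [exact: cvg_cst|exact: cvg_id].
  rewrite -(FTC_itv false true h0 df cD) [in RHS]integral_mkcond.
  apply: eq_integral => t _; rewrite !patchE.
  have E : ((s, t) \in hd) = (t \in [set` `]0, h s[]).
    by apply/idP/idP; rewrite !inE => /half_diskE_slice2.
  by rewrite E; case: ifP.
Qed.

Lemma Gauss_slice1 (f : R * R -> R) : smooth f ->
  I2 hd ('D_(e1 R) f) = I1 `]0, r[ (fun t => f (h t, t) - f (- h t, t)).
Proof.
move=> sf; have cf := smooth_continuous sf; have cf1 := smooth_continuous (smooth_D1 sf).
rewrite (@Rintegral_fubini2 _ _ _ (fun t => if 0 < t then f (h t, t) - f (- h t, t) else 0)).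
- rewrite [RHS]Rintegral_mkcond; apply: eq_Rintegral => t _.
  rewrite patchE; case: (boolP (t \in `]0, r[%classic)).
    by rewrite inE/= in_itv/= => /andP[->].
  rewrite notin_setE /= in_itv/= => /negP.
  rewrite negb_and; case: ltP => //= t0; rewrite -leNgt => rt.
  by rewrite slice_ge ?oppr0 ?subrr// ger0_norm// ltW.
- exact: measurable_half_disk.
- exact: itg2_continuous.
- move=> t; case: ltP => t0; last first.
    rewrite (eq_integral (fun=> 0%E)) ?integral0// => s _.
    rewrite patchE; case: ifPn => //; rewrite inE => -[/= _].
    by rewrite ltNge t0.
  have h0 : - h t <= h t by have := sqrtr_ge0 (r ^+ 2 - t ^+ 2); rewrite -/(h t); lra.
  have df (s : R) : is_derive s (1:R) (fun s => f (s, t)) ('D_(e1 R) f (s, t)).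
    by have /is_derive_e1 := smooth_is_derive1 (s, t) sf.
  have cD : continuous (fun s => 'D_(e1 R) f (s, t)).
    by apply: (continuous_pair cf1) => s; [exact: cvg_id|exact: cvg_cst].
  rewrite -(FTC_itv false true h0 df cD) [in RHS]integral_mkcond.
  apply: eq_integral => s _; rewrite !patchE.
  have E : ((s, t) \in hd) = (s \in [set` `](- h t), (h t)[]).
    by apply/idP/idP; rewrite !inE => /(half_diskE_slice1 _ t0).
  by rewrite E; case: ifP.
Qed.

Lemma slice_cos (t : R) : h (r * cos t) = r * `|sin t|.
Proof.
rewrite /h (_ : _ - _ = (r * sin t) ^+ 2); last first.
  by rewrite !exprMn sin2cos2; ring.
by rewrite sqrtr_sqr normrM gtr0_norm.
Qed.

Lemma slice_sin (t : R) : h (r * sin t) = r * `|cos t|.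
Proof.
rewrite /h (_ : _ - _ = (r * cos t) ^+ 2); last first.
  by rewrite !exprMn cos2sin2; ring.
by rewrite sqrtr_sqr normrM gtr0_norm.
Qed.

Let is_derive_rcos (t : R) : is_derive t (1:R) (fun t => r * cos t) (- r * sin t).
Proof. by apply: is_derive_eq; rewrite /GRing.scale/=; ring. Qed.

Let is_derive_rsin (t : R) : is_derive t (1:R) (fun t => r * sin t) (r * cos t).
Proof. by apply: is_derive_eq; rewrite /GRing.scale/=; ring. Qed.

Let cont_cst (c : R) : continuous (fun _ : R => c).
Proof. by move=> t; exact: cvg_cst. Qed.

Lemma continuousM_fun (f g : R -> R) : continuous f -> continuous g ->
  continuous (fun t => f t * g t).
Proof. by move=> cf cg t; apply: cvgM; [exact: cf|exact: cg]. Qed.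

(** The top of each vertical slice lies on the arc; the decreasing substitution $s=r\cos t$
    parametrizes it by the angle. No change of variables in the plane is used. *)
Lemma Gauss2 (f : R * R -> R) : smooth f ->
  I2 hd ('D_(e2 R) f) = I1 `]0, pi[ (fun t => f (r * cos t, r * sin t) * (r * sin t))
    - I1 `](- r), r[ (fun s => f (s, 0)).
Proof.
move=> sf; have cf := smooth_continuous sf.
rewrite Gauss_slice2// RintegralB//; last 2 first.
- apply: itg1_continuous; apply: continuous_pair => //; first by move=> s; exact: cvg_id.
  exact: continuous_slice.
- apply: itg1_continuous; apply: continuous_pair => //; first by move=> s; exact: cvg_id.
congr (_ - _); pose F t := r * cos t.
have -> : `](- r), r[%classic = `](F pi), (F 0)[%classic.
  by rewrite /F cospi cos0 mulrN !mulr1.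
have hF : {in `[0, pi] &, {homo F : x y /~ (x < y)%R}}.
  by move=> x y xi yi xy; rewrite /F ltr_pM2l// ltr_cos.
have cF' : continuous (fun t => - r * sin t).
  by apply: continuousM_fun; [exact: cont_cst|exact: continuous_sin].
have cg : continuous (fun s => f (s, h s)).
  apply: continuous_pair => //; first by move=> s; exact: cvg_id.
  exact: continuous_slice.
rewrite (@substitution_decr R F (fun t => - r * sin t) (fun s => f (s, h s)) 0 pi (pi_ge0 _) hF is_derive_rcos cF' cg).
apply: eq_Rintegral => t; rewrite inE/= in_itv/= => /andP[t0 tpi].
  rewrite /F slice_cos ger0_norm ?mulNr ?opprK// sin_ge0_pi// ltW//=; exact: ltW.
Qed.

Lemma Gauss1 (f : R * R -> R) : smooth f ->
  I2 hd ('D_(e1 R) f) = I1 `]0, pi[ (fun t => f (r * cos t, r * sin t) * (r * cos t)).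
Proof.
move=> sf; have cf := smooth_continuous sf.
have cid : continuous (fun s : R => s) by move=> s; exact: cvg_id.
have c1 : continuous (fun t => f (h t, t)).
  by apply: continuous_pair => //; exact: continuous_slice.
have c2 : continuous (fun t => f (- h t, t)).
  by apply: continuous_pair => //; move=> t; apply: cvgN; exact: continuous_slice.
have carc : continuous (fun t => f (r * cos t, r * sin t) * (r * cos t)).
  apply: continuousM_fun.
    apply: continuous_pair => //; apply: continuousM_fun => //.
    - exact: continuous_cos.
    - exact: continuous_sin.
  by apply: continuousM_fun => //; exact: continuous_cos.
rewrite Gauss_slice1// RintegralB//; [|exact: itg1_continuous|exact: itg1_continuous].
have p2 : 0 <= (pi : R) / 2 by rewrite divr_ge0// pi_ge0.
pose F t := r * sin t; pose F' t := r * cos t.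
have cF' : continuous F'.
  by apply: continuousM_fun; [exact: cont_cst|exact: continuous_cos].
(* The right ends of the horizontal slices sweep the quarter arc $(0,\pi/2)$; the left ends, treated
   next, sweep $(\pi/2,\pi)$, where the cosine is negative and provides the sign. *)
have S1 : I1 `]0, r[ (fun t => f (h t, t)) =
    I1 `]0, (pi / 2)[ (fun t => f (r * cos t, r * sin t) * (r * cos t)).
  have -> : `]0, r[%classic = `](F 0), (F (pi / 2))[%classic.
    by rewrite /F sin0 sin_pihalf mulr0 mulr1.
  have hF : {in `[0, pi / 2] &, {homo F : x y / (x < y)%R}}.
    move=> x y; rewrite !in_itv/= => /andP[x0 x1] /andP[y0 y1] xy.
    by rewrite /F ltr_pM2l// ltr_sin// in_itv/=; lra.
  rewrite (@substitution_incr R F F' _ 0 (pi / 2) p2 hF is_derive_rsin cF' c1).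
  apply: eq_Rintegral => t; rewrite inE/= in_itv/= => /andP[t0 tpi].
  by rewrite /F slice_sin ger0_norm// cos_ge0_pihalf//; lra.
have S2 : I1 `]0, r[ (fun t => f (- h t, t)) =
    - I1 `](pi / 2), pi[ (fun t => f (r * cos t, r * sin t) * (r * cos t)).
  have -> : `]0, r[%classic = `](F pi), (F (pi / 2))[%classic.
    by rewrite /F sinpi sin_pihalf mulr0 mulr1.
  have hF : {in `[pi / 2, pi] &, {homo F : x y /~ (x < y)%R}}.
    move=> x y; rewrite !in_itv/= => /andP[x0 x1] /andP[y0 y1] xy.
    rewrite /F ltr_pM2l//.
    (* A shift by $\pi$ moves $[\pi/2,\pi]$ into the interval where the sine increases. *)
    have sE (z : R) : sin (z - pi) = - sin z.
      by rewrite sinB cospi sinpi mulrN1 mulr0 subr0.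
    have : sin (y - pi) < sin (x - pi) by rewrite ltr_sin ?in_itv/=; lra.
    by rewrite !sE ltrN2.
  have p2' : (pi : R) / 2 <= pi by lra.
  rewrite (@substitution_decr R F F' _ (pi / 2) pi p2' hF is_derive_rsin cF' c2).
  rewrite -RintegralN//; last exact: itg1_continuous.
  apply: eq_Rintegral => t; rewrite inE/= in_itv/= => /andP[t0 tpi].
  rewrite /F slice_sin ler0_norm ?mulrN ?opprK//.
  have := @cos_ge0_pihalf R (t - pi); have -> : cos (t - pi) = - cos t.
    by rewrite cosB cospi sinpi mulr0 addr0 mulrN1.
  by rewrite oppr_ge0; apply; lra.
rewrite S1 S2 opprK.
have A : (BRight (0 : R) <= BRight (pi / 2))%O by rewrite bnd_simp.
have B : (BRight ((pi : R) / 2) <= BLeft pi)%O.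
  by rewrite bnd_simp; have := pi_gt0 R; lra.
have E : I1 `]0, pi[ _ - I1 `]0, (pi / 2)] _ = I1 `](pi / 2), pi[ _ :=
  Rintegral_itvB (itg1_continuous 0 pi false true carc) A B.
have -> : I1 `]0, (pi / 2)[ (fun t => f (r * cos t, r * sin t) * (r * cos t)) =
    I1 `]0, (pi / 2)] (fun t => f (r * cos t, r * sin t) * (r * cos t)).
  by congr fine; rewrite [LHS](integral_itv_cc _ _ _ _ carc) [RHS](integral_itv_cc _ _ _ _ carc).
by rewrite -E addrC subrK.
Qed.

End HalfDisk.

(** * Harmonic modes of the half-disk *)

Section Polar.
Variable R : realType.
Local Notation T1 := (measurableTypeR R).
Local Notation I2 A f := (Rintegral (@leb2 R) A f).
Local Notation I1 A f := (Rintegral (@leb1 R) A f).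
Implicit Types (f g q : R * R -> R) (x : R * R).

(** [Eop] and [Aop] are $\rho\,\partial_\rho$ and $\partial_\phi$ in Cartesian form, smooth at the
    origin; they replace polar coordinates throughout. *)
Definition Eop f x : R := x.1 * 'D_(e1 R) f x + x.2 * 'D_(e2 R) f x.
Definition Aop f x : R := x.1 * 'D_(e2 R) f x - x.2 * 'D_(e1 R) f x.
Definition sqn x : R := x.1 ^+ 2 + x.2 ^+ 2.

Lemma D1_cst (c : R) x : 'D_(e1 R) (fun=> c) x = 0.
Proof. by rewrite derive_cst. Qed.
Lemma D2_cst (c : R) x : 'D_(e2 R) (fun=> c) x = 0.
Proof. by rewrite derive_cst. Qed.

Lemma D1_fst x : 'D_(e1 R) (@fst R R) x = 1.
Proof.
suff : is_derive x (e1 R) (@fst R R) 1 by case.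
by apply/is_derive_e1; exact: is_derive_id.
Qed.

Lemma D2_fst x : 'D_(e2 R) (@fst R R) x = 0.
Proof.
suff : is_derive x (e2 R) (@fst R R) 0 by case.
by apply/is_derive_e2; exact: is_derive_cst.
Qed.

Lemma D1_snd x : 'D_(e1 R) (@snd R R) x = 0.
Proof.
suff : is_derive x (e1 R) (@snd R R) 0 by case.
by apply/is_derive_e1; exact: is_derive_cst.
Qed.

Lemma D2_snd x : 'D_(e2 R) (@snd R R) x = 1.
Proof.
suff : is_derive x (e2 R) (@snd R R) 1 by case.
by apply/is_derive_e2; exact: is_derive_id.
Qed.

Lemma D1_M f g x : smooth f -> smooth g ->
  'D_(e1 R) (fun y => f y * g y) x = 'D_(e1 R) f x * g x + f x * 'D_(e1 R) g x.
Proof.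
move=> sf sg; have hf := smooth_is_derive1 x sf; have hg := smooth_is_derive1 x sg.
have H := is_deriveM hf hg; rewrite (@derive_val _ _ _ _ _ _ _ H) /GRing.scale/=; ring.
Qed.

Lemma D2_M f g x : smooth f -> smooth g ->
  'D_(e2 R) (fun y => f y * g y) x = 'D_(e2 R) f x * g x + f x * 'D_(e2 R) g x.
Proof.
move=> sf sg; have hf := smooth_is_derive2 x sf; have hg := smooth_is_derive2 x sg.
have H := is_deriveM hf hg; rewrite (@derive_val _ _ _ _ _ _ _ H) /GRing.scale/=; ring.
Qed.

Lemma D1_D f g x : smooth f -> smooth g ->
  'D_(e1 R) (fun y => f y + g y) x = 'D_(e1 R) f x + 'D_(e1 R) g x.
Proof.
move=> sf sg; have hf := smooth_is_derive1 x sf; have hg := smooth_is_derive1 x sg.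
by have H := is_deriveD hf hg; rewrite (@derive_val _ _ _ _ _ _ _ H).
Qed.

Lemma D2_D f g x : smooth f -> smooth g ->
  'D_(e2 R) (fun y => f y + g y) x = 'D_(e2 R) f x + 'D_(e2 R) g x.
Proof.
move=> sf sg; have hf := smooth_is_derive2 x sf; have hg := smooth_is_derive2 x sg.
by have H := is_deriveD hf hg; rewrite (@derive_val _ _ _ _ _ _ _ H).
Qed.

Lemma D1_Z c f x : smooth f -> 'D_(e1 R) (fun y => c * f y) x = c * 'D_(e1 R) f x.
Proof. by move=> sf; rewrite D1_M ?D1_cst ?mul0r ?add0r//; exact: smooth_cst. Qed.

Lemma D2_Z c f x : smooth f -> 'D_(e2 R) (fun y => c * f y) x = c * 'D_(e2 R) f x.
Proof. by move=> sf; rewrite D2_M ?D2_cst ?mul0r ?add0r//; exact: smooth_cst. Qed.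

Lemma D1_comp (h : R -> R) f x : smooth1 h -> smooth f ->
  'D_(e1 R) (fun y => h (f y)) x = derive1 h (f x) * 'D_(e1 R) f x.
Proof.
move=> sh sf.
suff : is_derive x (e1 R) (fun y => h (f y)) (derive1 h (f x) * 'D_(e1 R) f x) by case.
apply/is_derive_e1; have /is_derive_e1 H := smooth_is_derive1 x sf.
have := @is_derive1_comp _ h (fun t => f (t, x.2)) x.1 _ _ (smooth1_is_derive _ sh) H.
by rewrite /= -surjective_pairing.
Qed.

Lemma D2_comp (h : R -> R) f x : smooth1 h -> smooth f ->
  'D_(e2 R) (fun y => h (f y)) x = derive1 h (f x) * 'D_(e2 R) f x.
Proof.
move=> sh sf.
suff : is_derive x (e2 R) (fun y => h (f y)) (derive1 h (f x) * 'D_(e2 R) f x) by case.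
apply/is_derive_e2; have /is_derive_e2 H := smooth_is_derive2 x sf.
have := @is_derive1_comp _ h (fun t => f (x.1, t)) x.2 _ _ (smooth1_is_derive _ sh) H.
by rewrite /= -surjective_pairing.
Qed.

Lemma smooth_X f n : smooth f -> smooth (fun x => f x ^+ n).
Proof.
move=> sf; elim: n => [|n ih]; first by under eq_fun do rewrite expr0; exact: smooth_cst.
by under eq_fun do rewrite exprS; exact: smoothM.
Qed.

Lemma smooth_sqn : smooth sqn.
Proof. by apply: smoothD; apply: smooth_X; [exact: smooth_fst|exact: smooth_snd]. Qed.

Lemma D1_sqn x : 'D_(e1 R) sqn x = 2 * x.1.
Proof.
have -> : sqn = (fun x => x.1 * x.1 + x.2 * x.2) by apply/funext => y; rewrite /sqn !expr2.
rewrite D1_D; try by apply: smoothM; (exact: smooth_fst || exact: smooth_snd).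
rewrite !D1_M; try (exact: smooth_fst || exact: smooth_snd).
rewrite D1_fst D1_snd; ring.
Qed.

Lemma D2_sqn x : 'D_(e2 R) sqn x = 2 * x.2.
Proof.
have -> : sqn = (fun x => x.1 * x.1 + x.2 * x.2) by apply/funext => y; rewrite /sqn !expr2.
rewrite D2_D; try by apply: smoothM; (exact: smooth_fst || exact: smooth_snd).
rewrite !D2_M; try (exact: smooth_fst || exact: smooth_snd).
rewrite D2_fst D2_snd; ring.
Qed.

Lemma smooth_Eop f : smooth f -> smooth (Eop f).
Proof.
move=> sf; apply: smoothD; apply: smoothM.
- exact: smooth_fst.
- exact: smooth_D1.
- exact: smooth_snd.
- exact: smooth_D2.
Qed.

Lemma smooth_Aop f : smooth f -> smooth (Aop f).
Proof.
move=> sf; apply: smoothB; apply: smoothM.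
- exact: smooth_fst.
- exact: smooth_D2.
- exact: smooth_snd.
- exact: smooth_D1.
Qed.

Lemma EopM f g x : smooth f -> smooth g ->
  Eop (fun y => f y * g y) x = Eop f x * g x + f x * Eop g x.
Proof. by move=> sf sg; rewrite /Eop D1_M// D2_M//; ring. Qed.

Lemma AopM f g x : smooth f -> smooth g ->
  Aop (fun y => f y * g y) x = Aop f x * g x + f x * Aop g x.
Proof. by move=> sf sg; rewrite /Aop D1_M// D2_M//; ring. Qed.

Lemma EopZ c f x : smooth f -> Eop (fun y => c * f y) x = c * Eop f x.
Proof. by move=> sf; rewrite /Eop D1_Z// D2_Z//; ring. Qed.

Lemma AopZ c f x : smooth f -> Aop (fun y => c * f y) x = c * Aop f x.
Proof. by move=> sf; rewrite /Aop D1_Z// D2_Z//; ring. Qed.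

Lemma AopB f g x : smooth f -> smooth g ->
  Aop (fun y => f y - g y) x = Aop f x - Aop g x.
Proof.
move=> sf sg; have E : (fun y => f y - g y) = (fun y => f y + (-1) * g y).
  by apply/funext => y; rewrite mulN1r.
rewrite E /Aop D1_D// ?D2_D//; try exact: smoothZ.
rewrite D1_Z// D2_Z//; ring.
Qed.

Lemma Eop_radial (h : R -> R) x : smooth1 h ->
  Eop (fun y => h (sqn y)) x = 2 * sqn x * derive1 h (sqn x).
Proof.
move=> sh; have ss := smooth_sqn; rewrite /Eop D1_comp// D2_comp// D1_sqn D2_sqn /sqn; ring.
Qed.

Lemma Aop_radial (h : R -> R) x : smooth1 h -> Aop (fun y => h (sqn y)) x = 0.
Proof.
move=> sh; have ss := smooth_sqn; rewrite /Aop D1_comp// D2_comp// D1_sqn D2_sqn /sqn; ring.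
Qed.

Lemma smooth_radial (h : R -> R) : smooth1 h -> smooth (fun y => h (sqn y)).
Proof. by move=> sh; apply: smooth_comp => //; exact: smooth_sqn. Qed.

(* zpow n x holds the real and imaginary parts of (x.1 + i x.2) ^ n. *)
Fixpoint zpow (n : nat) x : R * R :=
  if n is n'.+1 then
    (x.1 * (zpow n' x).1 - x.2 * (zpow n' x).2, x.1 * (zpow n' x).2 + x.2 * (zpow n' x).1)
  else (1, 0).

Definition Qn n x := (zpow n x).1.
Definition Pn n x := (zpow n x).2.

Lemma QnS n : Qn n.+1 = (fun x => x.1 * Qn n x - x.2 * Pn n x). Proof. by []. Qed.
Lemma PnS n : Pn n.+1 = (fun x => x.1 * Pn n x + x.2 * Qn n x). Proof. by []. Qed.

Lemma smooth_PQ n : smooth (Pn n) /\ smooth (Qn n).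
Proof.
elim: n => [|n [sP sQ]]; first by split; exact: smooth_cst.
rewrite PnS QnS; split; [apply: smoothD|apply: smoothB]; apply: smoothM => //;
  (exact: smooth_fst || exact: smooth_snd).
Qed.

Lemma smooth_P n : smooth (Pn n). Proof. by case: (smooth_PQ n). Qed.
Lemma smooth_Q n : smooth (Qn n). Proof. by case: (smooth_PQ n). Qed.

(** $Q_n+iP_n=\rho^ne^{in\phi}$ is homogeneous of degree $n$ and is multiplied by $in$ under
    $\partial_\phi$; both facts are proved by induction from the product rule. *)
Lemma EA_PQ n x : [/\ Eop (Pn n) x = n%:R * Pn n x, Eop (Qn n) x = n%:R * Qn n x,
  Aop (Pn n) x = n%:R * Qn n x & Aop (Qn n) x = - n%:R * Pn n x].
Proof.
elim: n => [|n [EP EQ AP AQ]].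
  by rewrite /Eop /Aop !D1_cst !D2_cst; split; ring.
have sP := smooth_P n; have sQ := smooth_Q n; have s1 := @smooth_fst R; have s2 := @smooth_snd R.
have E1 y : Eop (@fst R R) y = y.1 by rewrite /Eop D1_fst D2_fst; ring.
have E2 y : Eop (@snd R R) y = y.2 by rewrite /Eop D1_snd D2_snd; ring.
have A1 y : Aop (@fst R R) y = - y.2 by rewrite /Aop D1_fst D2_fst; ring.
have A2 y : Aop (@snd R R) y = y.1 by rewrite /Aop D1_snd D2_snd; ring.
have EopD f g y : smooth f -> smooth g -> Eop (fun z => f z + g z) y = Eop f y + Eop g y.
  by move=> sf sg; rewrite /Eop D1_D// D2_D//; ring.
have AopD f g y : smooth f -> smooth g -> Aop (fun z => f z + g z) y = Aop f y + Aop g y.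
  by move=> sf sg; rewrite /Aop D1_D// D2_D//; ring.
have QE : Qn n.+1 = (fun y => y.1 * Qn n y + (-1) * (y.2 * Pn n y)).
  by rewrite QnS; apply/funext => y; rewrite mulN1r.
have sm1 : smooth (fun y : R * R => y.1 * Qn n y) by exact: smoothM.
have sm2 : smooth (fun y : R * R => y.2 * Pn n y) by exact: smoothM.
have sm3 : smooth (fun y : R * R => y.1 * Pn n y) by exact: smoothM.
have sm4 : smooth (fun y : R * R => y.2 * Qn n y) by exact: smoothM.
have sm5 : smooth (fun y : R * R => -1 * (y.2 * Pn n y)) by exact: smoothZ.
rewrite QE PnS !EopD// !AopD// EopZ// AopZ// !EopM// !AopM// EP EQ AP AQ E1 E2 A1 A2.
by rewrite -natr1; split; ring.
Qed.

Lemma zpow_polar n (r t : R) :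
  Qn n (r * cos t, r * sin t) = r ^+ n * cos (n%:R * t) /\
  Pn n (r * cos t, r * sin t) = r ^+ n * sin (n%:R * t).
Proof.
elim: n => [|n [HQ HP]].
  by rewrite /Qn /Pn/= mul0r cos0 sin0 expr0 mulr0 mul1r.
rewrite QnS PnS HQ HP/= -natr1 mulrDl mul1r cosD sinD exprS; split; ring.
Qed.

Lemma Pn_flat n (s : R) : Pn n (s, 0) = 0.
Proof.
elim: n => [//|n ih]; by rewrite PnS/= ih mulr0 mul0r addr0.
Qed.

Lemma sqr_PQ n x : Qn n x ^+ 2 + Pn n x ^+ 2 = sqn x ^+ n.
Proof.
elim: n => [|n ih]; first by rewrite /Qn /Pn/= expr0; ring.
by rewrite [RHS]exprS -ih QnS PnS /sqn; ring.
Qed.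

Lemma sqn_polar (r t : R) : sqn (r * cos t, r * sin t) = r ^+ 2.
Proof. by rewrite /sqn/= !exprMn -mulrDr cos2Dsin2 mulr1. Qed.

Section OnHalfDisk.
Variables (r : R) (r0 : 0 < r).
Local Notation hd := (half_disk r).
Let mhd := @measurable_half_disk R r.

Lemma continuous_arc q : continuous q -> continuous (fun t : R => q (r * cos t, r * sin t)).
Proof.
move=> cq; apply: continuous_pair => //.
- by move=> t; apply: cvgM; [exact: cvg_cst|exact: continuous_cos].
- by move=> t; apply: cvgM; [exact: cvg_cst|exact: continuous_sin].
Qed.

Lemma continuous_flat q : continuous q -> continuous (fun t : R => q (t, 0)).
Proof.
move=> cq; apply: continuous_pair => //.
- by move=> t; exact: cvg_id.
- by move=> t; exact: cvg_cst.
Qed.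

(** The divergence theorem for the field $x\,q(x)$. It is tangent to the flat boundary, so only the
    arc contributes. *)
Lemma Gauss_radial q : smooth q ->
  I2 hd (fun x => Eop q x + 2 * q x) = r ^+ 2 * I1 `]0, pi[ (fun t => q (r * cos t, r * sin t)).
Proof.
move=> sq; have s1 := @smooth_fst R; have s2 := @smooth_snd R.
have sm1 : smooth (fun x : R * R => x.1 * q x) by exact: smoothM.
have sm2 : smooth (fun x : R * R => x.2 * q x) by exact: smoothM.
have ci f : smooth f -> (@leb2 R).-integrable hd (EFin \o f).
  by move=> sf; apply: itg2_continuous => //; exact: smooth_continuous.
transitivity (I2 hd ('D_(e1 R) (fun x : R * R => x.1 * q x)) + I2 hd ('D_(e2 R) (fun x : R * R => x.2 * q x))).
  rewrite -RintegralD//; [|by apply: ci; exact: smooth_D1|by apply: ci; exact: smooth_D2].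
  apply: eq_Rintegral => x _; rewrite D1_M// D2_M// D1_fst D2_snd /Eop; ring.
rewrite Gauss1// Gauss2//=.
have -> : I1 `](- r), r[ (fun s => 0 * q (s, 0)) = 0.
  by under eq_Rintegral do rewrite mul0r; rewrite Rintegral0.
have cc : continuous (fun t : R => r * cos t).
  by move=> t; apply: cvgM; [exact: cvg_cst|exact: continuous_cos].
have cs : continuous (fun t : R => r * sin t).
  by move=> t; apply: cvgM; [exact: cvg_cst|exact: continuous_sin].
have cq := continuous_arc (smooth_continuous sq).
rewrite subr0 -RintegralZl//; last exact: itg1_continuous.
rewrite -RintegralD//; try by apply: itg1_continuous;
  apply: continuousM_fun => //; exact: continuousM_fun.
apply: eq_Rintegral => t _.
transitivity (r ^+ 2 * (cos t ^+ 2 + sin t ^+ 2) * q (r * cos t, r * sin t)); first by ring.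
by rewrite cos2Dsin2 mulr1.
Qed.

(** The divergence theorem for the rotated field $(-x_2,x_1)\,q(x)$. It is tangent to the arc, so
    only the flat boundary contributes. *)
Lemma Gauss_angular q : smooth q ->
  I2 hd (Aop q) = - I1 `](- r), r[ (fun s => s * q (s, 0)).
Proof.
move=> sq; have s1 := @smooth_fst R; have s2 := @smooth_snd R.
have sm1 : smooth (fun x : R * R => x.1 * q x) by exact: smoothM.
have sm2 : smooth (fun x : R * R => x.2 * q x) by exact: smoothM.
have ci f : smooth f -> (@leb2 R).-integrable hd (EFin \o f).
  by move=> sf; apply: itg2_continuous => //; exact: smooth_continuous.
transitivity (I2 hd ('D_(e2 R) (fun x : R * R => x.1 * q x)) - I2 hd ('D_(e1 R) (fun x : R * R => x.2 * q x))).
  rewrite -RintegralB//; [|by apply: ci; exact: smooth_D2|by apply: ci; exact: smooth_D1].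
  apply: eq_Rintegral => x _; rewrite D1_M// D2_M// D1_snd D2_fst /Aop; ring.
rewrite Gauss1// Gauss2//=.
rewrite (_ : I1 `]0, pi[ (fun t => r * cos t * q (r * cos t, r * sin t) * (r * sin t)) =
  I1 `]0, pi[ (fun t => r * sin t * q (r * cos t, r * sin t) * (r * cos t))).
  by rewrite addrAC subrr add0r.
by apply: eq_Rintegral => t _; ring.
Qed.

Lemma Rintegral_D_eq0 q : smooth q ->
  (forall t, q (r * cos t, r * sin t) = 0) -> (forall s, q (s, 0) = 0) ->
  I2 hd ('D_(e1 R) q) = 0 /\ I2 hd ('D_(e2 R) q) = 0.
Proof.
move=> sq qa qf; rewrite Gauss1// Gauss2//.
split; [|rewrite [X in _ - X](_ : _ = 0) ?subr0; last by under eq_Rintegral do rewrite qf; rewrite Rintegral0].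
  by under eq_Rintegral do rewrite qa mul0r; rewrite Rintegral0.
by under eq_Rintegral do rewrite qa mul0r; rewrite Rintegral0.
Qed.

(** Since $|x|^{2n}$ is homogeneous, the radial Gauss formula multiplies its integral by $2n+2$ and
    returns its constant value on the arc. *)
Lemma Rintegral_sqn n : I2 hd (fun x => sqn x ^+ n) = pi * r ^+ n.*2.+2 / n.*2.+2%:R.
Proof.
have sh : smooth1 (fun s : R => s ^+ n).
  elim: n => [|n ih]; first by under eq_fun do rewrite expr0; exact: smooth1_cst.
  by under eq_fun do rewrite exprS; apply: smooth1M => //; exact: smooth1_id.
have ds (s : R) : s * derive1 (fun s => s ^+ n) s = n%:R * s ^+ n.
  rewrite derive1E exp_derive /GRing.scale/= mulr1.
  by case: n {sh} => [|n]; rewrite ?mul0r ?mulr0// exprS; ring.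
have sq : smooth (fun x => sqn x ^+ n) by exact: smooth_radial sh.
have itq : (@leb2 R).-integrable hd (EFin \o (fun x => sqn x ^+ n)).
  by apply: itg2_continuous => //; exact: smooth_continuous.
have := Gauss_radial sq.
have -> : I2 hd (fun x => Eop (fun y => sqn y ^+ n) x + 2 * sqn x ^+ n) =
    n.*2.+2%:R * I2 hd (fun x => sqn x ^+ n).
  rewrite -RintegralZl//; apply: eq_Rintegral => x _.
  have -> : n.*2.+2%:R = 2 * n%:R + 2 :> R by rewrite -addn2 natrD -mul2n natrM.
  by rewrite (Eop_radial x sh) -mulrA ds; ring.
have -> : I1 `]0, pi[ (fun t => sqn (r * cos t, r * sin t) ^+ n) = I1 `]0, pi[ (fun=> (r ^+ 2) ^+ n).
  by apply: eq_Rintegral => t _; rewrite sqn_polar.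
rewrite Rintegral_cst// leb1_itv ?pi_ge0//= subr0.
move=> H; apply: (@mulfI _ n.*2.+2%:R); first by rewrite pnatr_eq0.
have -> : r ^+ n.*2.+2 = r ^+ 2 * r ^+ 2 ^+ n by rewrite -exprM -exprD mul2n.
by rewrite H [RHS]mulrC divfK ?pnatr_eq0//; ring.
Qed.

End OnHalfDisk.

Section Modes.
Variables (r : R) (r0 : 0 < r).
Local Notation hd := (half_disk r).
Let mhd := @measurable_half_disk R r.

(** The integral of $|x|^{2n}$ over the half-disk that contains the support keeps the factor
    $1/(2n+2)$; this saving of one power of $n$ is used in every application of Bessel's inequality
    to modes. *)
Lemma Rintegral_mode_sqr (g : R * R -> R) (G : R -> R) (n : nat) (M r' : R) :
  0 < r' <= r -> smooth1 G -> smooth g -> (forall x, g x ^+ 2 <= sqn x ^+ n) ->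
  (forall s, 0 <= s < r' ^+ 2 -> `|G s| <= M) ->
  (forall s, r' ^+ 2 <= s < r ^+ 2 -> G s = 0) ->
  I2 hd (fun x => (G (sqn x) * g x) ^+ 2) <= M ^+ 2 * (pi * r' ^+ n.*2.+2 / n.*2.+2%:R).
Proof.
move=> /andP[r'0 r'r] sG sg gn GM G0; set hd' := half_disk r'.
have mhd' := @measurable_half_disk R r'.
have r'r2 : r' ^+ 2 <= r ^+ 2 by rewrite lerXn2r// nnegrE ltW.
have hd'hd : hd' `<=` hd.
  by move=> x [/= x1 x2]; split => //; exact: lt_le_trans r'r2.
have -> : I2 hd (fun x => (G (sqn x) * g x) ^+ 2) = I2 hd' (fun x => (G (sqn x) * g x) ^+ 2).
  have := @Rintegral_mkcondr _ _ _ (@leb2 R) hd hd' (fun x => (G (sqn x) * g x) ^+ 2).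
  rewrite setIidr// => ->; apply: eq_Rintegral => x.
  rewrite inE => -[/= x1 x2]; rewrite patchE; case: ifPn => //.
  rewrite notin_setE => Hx; rewrite G0 ?mul0r ?expr0n//.
  apply/andP; split => //; rewrite leNgt; apply/negP => h; apply: Hx; split => //.
have sF : smooth (fun x => (G (sqn x) * g x) ^+ 2).
  by apply: smooth_X; apply: smoothM => //; exact: smooth_radial.
have sn : smooth (fun x => sqn x ^+ n) by apply: smooth_X; exact: smooth_sqn.
rewrite -(Rintegral_sqn r'0 n) -RintegralZl//; last first.
  by apply: itg2_continuous => //; exact: smooth_continuous.
apply: le_Rintegral => //.
- by apply: itg2_continuous => //; exact: smooth_continuous.
- by apply: itg2_continuous => //; apply: smooth_continuous; exact: smoothZ.
move=> x [/= x1 x2]; rewrite exprMn ler_pM ?sqr_ge0//.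
have s0 : 0 <= sqn x by rewrite addr_ge0// sqr_ge0.
have := GM (sqn x); rewrite s0/= => /(_ x1) h.
by rewrite -[G _ ^+ 2]real_normK ?num_real// lerXn2r// nnegrE// (le_trans _ h).
Qed.

Lemma sqr_Pn_le n x : Pn n x ^+ 2 <= sqn x ^+ n.
Proof. by rewrite -sqr_PQ lerDr sqr_ge0. Qed.

Lemma sqr_Qn_le n x : Qn n x ^+ 2 <= sqn x ^+ n.
Proof. by rewrite -sqr_PQ lerDl sqr_ge0. Qed.

(* Both orthogonality relations come from integrating a linear combination of
   Aop (P_n Q_m) and Aop (Q_n P_m), which vanish on the flat boundary. *)
Lemma modes_orthogonal (G H : R -> R) (n m : nat) : smooth1 G -> smooth1 H -> n != m ->
  I2 hd (fun x => (G (sqn x) * Pn n x) * (H (sqn x) * Pn m x)) = 0 /\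
  I2 hd (fun x => (G (sqn x) * Qn n x) * (H (sqn x) * Qn m x)) = 0.
Proof.
move=> sG sH nm; pose K s := G s * H s.
have sK : smooth1 K by exact: smooth1M.
have sP k := smooth_P k; have sQ k := smooth_Q k.
have nm2 : (n%:R ^+ 2 - m%:R ^+ 2 : R) != 0.
  rewrite subr_sqr mulf_neq0// ?subr_eq0 ?eqr_nat// -natrD pnatr_eq0 addn_eq0.
  by apply: contra nm => /andP[/eqP -> /eqP ->].
have sPQ k l : smooth (fun x => Pn k x * Qn l x) by exact: smoothM.
have AK q x : smooth q -> Aop (fun y => K (sqn y) * q y) x = K (sqn x) * Aop q x.
  by move=> sq; rewrite AopM ?Aop_radial ?mul0r ?add0r//; exact: smooth_radial.
have key (q p : R * R -> R) : smooth q -> (forall s, q (s, 0) = 0) ->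
    (forall x, Aop q x = (n%:R ^+ 2 - m%:R ^+ 2) * p x) -> smooth p ->
    I2 hd (fun x => K (sqn x) * p x) = 0.
  move=> sq q0 Aq sp; apply: (mulfI nm2); rewrite mulr0 -RintegralZl//; last first.
    apply: itg2_continuous => //; apply: smooth_continuous; apply: smoothM => //.
    exact: smooth_radial.
  have sKq : smooth (fun y => K (sqn y) * q y) by apply: smoothM => //; exact: smooth_radial.
  have := Gauss_angular r0 sKq; rewrite (_ : I1 _ _ = 0) ?oppr0; last first.
    by rewrite -[RHS](@Rintegral0 _ _ _ (@leb1 R) [set` `](- r), r[])//; apply: eq_Rintegral => s _; rewrite q0 !mulr0.
  move=> H0; rewrite -[RHS]H0; apply: eq_Rintegral => x _.
  transitivity (K (sqn x) * ((n%:R ^+ 2 - m%:R ^+ 2) * p x)); first by ring.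
  by rewrite -Aq; exact/esym/(AK q x sq).
have sq1 : smooth (fun x => m%:R * (Pn n x * Qn m x) - n%:R * (Pn m x * Qn n x)).
  by apply: smoothB; exact: smoothZ.
have sq2 : smooth (fun x => n%:R * (Pn n x * Qn m x) - m%:R * (Pn m x * Qn n x)).
  by apply: smoothB; exact: smoothZ.
split.
  rewrite -(key _ _ sq1 _ _ (smoothM (sP n) (sP m))); last 2 first.
  - by move=> s; rewrite !Pn_flat !mul0r !mulr0 subrr.
  - move=> x; rewrite AopB; try exact: smoothZ.
    rewrite !AopZ// !AopM//.
    have [_ _ -> ->] := EA_PQ n x; have [_ _ -> ->] := EA_PQ m x; ring.
  by apply: eq_Rintegral => x _; rewrite /K; ring.
rewrite -(key _ _ sq2 _ _ (smoothM (sQ n) (sQ m))); last 2 first.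
- by move=> s; rewrite !Pn_flat !mul0r !mulr0 subrr.
- move=> x; rewrite AopB; try exact: smoothZ.
  rewrite !AopZ// !AopM//.
  have [_ _ -> ->] := EA_PQ n x; have [_ _ -> ->] := EA_PQ m x; ring.
by apply: eq_Rintegral => x _; rewrite /K; ring.
Qed.

(* Green's identities for limits in H^1 of smooth functions: [w] has weak
   gradient [(w1, w2)], approximated by [phi]. *)
Section Limits.
Variables (w w1 w2 : R * R -> R) (phi : nat -> R * R -> R).
Hypothesis sw : sqint (@leb2 R) hd w.
Hypothesis sw1 : sqint (@leb2 R) hd w1.
Hypothesis sw2 : sqint (@leb2 R) hd w2.
Hypothesis sphi : forall k, smooth (phi k).
Hypothesis phiw : (fun k => I2 hd (fun x => (phi k x - w x) ^+ 2)) @ \oo --> (0 : R).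
Hypothesis phiw1 : (fun k => I2 hd (fun x => ('D_(e1 R) (phi k) x - w1 x) ^+ 2)) @ \oo --> (0 : R).
Hypothesis phiw2 : (fun k => I2 hd (fun x => ('D_(e2 R) (phi k) x - w2 x) ^+ 2)) @ \oo --> (0 : R).

Let ss (f : R * R -> R) : smooth f -> sqint (@leb2 R) hd f.
Proof. by move=> sf; apply: sqint_continuous => //; exact: smooth_continuous. Qed.

Let cv (q0 q1 q2 : R * R -> R) : smooth q0 -> smooth q1 -> smooth q2 ->
  (fun k => I2 hd (fun x => 'D_(e1 R) (phi k) x * q1 x + 'D_(e2 R) (phi k) x * q2 x + phi k x * q0 x))
  @ \oo --> I2 hd (fun x => w1 x * q1 x + w2 x * q2 x + w x * q0 x).
Proof.
move=> s0 s1 s2.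
have itg (f g : R * R -> R) : sqint (@leb2 R) hd f -> smooth g ->
    (@leb2 R).-integrable hd (EFin \o (fun x => f x * g x)).
  by move=> sf sg; apply: sqint_mul => //; exact: ss.
have E (f1 f2 f : R * R -> R) : sqint (@leb2 R) hd f -> sqint (@leb2 R) hd f1 ->
    sqint (@leb2 R) hd f2 ->
    I2 hd (fun x => f1 x * q1 x + f2 x * q2 x + f x * q0 x) =
    I2 hd (fun x => f1 x * q1 x) + I2 hd (fun x => f2 x * q2 x) + I2 hd (fun x => f x * q0 x).
  move=> sf sf1 sf2; rewrite RintegralD//; [|apply: itgD => //; exact: itg|exact: itg].
  by rewrite RintegralD//; exact: itg.
rewrite E//; apply: (@eq_cvgn _ (fun k => I2 hd (fun x => 'D_(e1 R) (phi k) x * q1 x)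
  + I2 hd (fun x => 'D_(e2 R) (phi k) x * q2 x) + I2 hd (fun x => phi k x * q0 x))).
  move=> k; rewrite E//; apply: ss => //; [exact: smooth_D1|exact: smooth_D2].
apply: cvgD; [apply: cvgD|]; apply: cvg_Rintegral_mul => //; try exact: ss.
- by move=> k; apply: ss; exact: smooth_D1.
- by move=> k; apply: ss; exact: smooth_D2.
- by move=> k; exact: ss.
Qed.

Lemma H1_radial (g : R -> R) (q : R * R -> R) : smooth q ->
  sqint (@leb1 R) `]0, pi[ g ->
  (fun k => I1 `]0, pi[ (fun t => (phi k (r * cos t, r * sin t) - g t) ^+ 2)) @ \oo --> (0 : R) ->
  I2 hd (fun x => (x.1 * w1 x + x.2 * w2 x) * q x + w x * (Eop q x + 2 * q x)) =
  r ^+ 2 * I1 `]0, pi[ (fun t => g t * q (r * cos t, r * sin t)).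
Proof.
move=> sq sg phig; have s1 := @smooth_fst R; have s2 := @smooth_snd R.
have sq0 : smooth (fun x => Eop q x + 2 * q x).
  by apply: smoothD; [exact: smooth_Eop|exact: smoothZ].
have := cv sq0 (smoothM s1 sq) (smoothM s2 sq).
rewrite (_ : I2 hd _ = I2 hd (fun x => (x.1 * w1 x + x.2 * w2 x) * q x + w x * (Eop q x + 2 * q x))); last first.
  by apply: eq_Rintegral => x _; ring.
move=> L.
have m1 : measurable (`]0, pi[%classic : set T1) by exact: measurable_itv.
have fin1 : (@leb1 R (`]0%R, pi[%classic : set R) < +oo)%E by rewrite leb1_itv ?pi_ge0// ltry.
have ss1 (f : R * R -> R) : smooth f -> sqint (@leb1 R) `]0, pi[ (fun t : R => f (r * cos t, r * sin t)).
  move=> sf; have cf := continuous_arc (r := r) (smooth_continuous sf).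
  have [M HM] := continuous_bounded_itv 0 pi cf.
  apply: (bounded_sqint m1 fin1 (M := M)).
    by apply: measurable_funTS; exact: continuous_measurable_fun.
  by move=> t /=; rewrite in_itv/= => /andP[t0 tp]; apply: HM; rewrite !ltW.
have L2 : (fun k => r ^+ 2 * I1 `]0, pi[ (fun t => phi k (r * cos t, r * sin t) * q (r * cos t, r * sin t)))
    @ \oo --> r ^+ 2 * I1 `]0, pi[ (fun t => g t * q (r * cos t, r * sin t)).
  apply: cvgM; first exact: cvg_cst.
  by apply: (cvg_Rintegral_mul m1) => //; [move=> k; exact: ss1|exact: ss1].
apply: (cvg_unique _ L); first exact: Rhausdorff.
apply: eq_cvgn L2 => k; rewrite -(Gauss_radial r0 (smoothM (sphi k) sq)).
by apply: eq_Rintegral => x _; rewrite EopM// /Eop; ring.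
Qed.

(** The boundary condition concerns the product: the trace [g] may vanish on one part of the segment
    and the test function [q] on the rest. *)
Lemma H1_angular (g : R -> R) (q : R * R -> R) : smooth q ->
  sqint (@leb1 R) `](- r), r[ g ->
  (fun k => I1 `](- r), r[ (fun s => (phi k (s, 0) - g s) ^+ 2)) @ \oo --> (0 : R) ->
  ae_eq (@leb1 R) [set` `](- r), r[] (fun s => g s * q (s, 0)) (cst (0 : R)) ->
  I2 hd (fun x => (x.1 * w2 x - x.2 * w1 x) * q x + w x * Aop q x) = 0.
Proof.
move=> sq sg phig gq; have s1 := @smooth_fst R; have s2 := @smooth_snd R.
have := cv (smooth_Aop sq) (smoothZ (-1) (smoothM s2 sq)) (smoothM s1 sq).
rewrite (_ : I2 hd _ = I2 hd (fun x => (x.1 * w2 x - x.2 * w1 x) * q x + w x * Aop q x)); last first.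
  by apply: eq_Rintegral => x _; ring.
move=> L.
have m1 : measurable (`](- r), r[%classic : set T1) by exact: measurable_itv.
have rr : - r <= r by rewrite ge0_cp// ltW.
have fin1 : (@leb1 R (`](- r)%R, r[%classic : set R) < +oo)%E by rewrite (leb1_itv _ _ rr) ltry.
have ss1 (f : R -> R) : continuous f -> sqint (@leb1 R) `](- r), r[ f.
  move=> cf; have [M HM] := continuous_bounded_itv (- r) r cf.
  apply: (bounded_sqint m1 fin1 (M := M)).
    by apply: measurable_funTS; exact: continuous_measurable_fun.
  by move=> t /=; rewrite in_itv/= => /andP[t0 tp]; apply: HM; rewrite !ltW.
have cq : continuous (fun s : R => s * q (s, 0)).
  apply: continuousM_fun; first by move=> s; exact: cvg_id.
  by apply: continuous_flat; exact: smooth_continuous.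
have L2 : (fun k => - I1 `](- r), r[ (fun s => phi k (s, 0) * (s * q (s, 0))))
    @ \oo --> - I1 `](- r), r[ (fun s => g s * (s * q (s, 0))).
  apply: cvgN; apply: (cvg_Rintegral_mul m1) => //; last exact: ss1.
  by move=> k; apply: ss1; apply: continuous_flat; exact: smooth_continuous.
have I0 : I1 `](- r), r[ (fun s => g s * (s * q (s, 0))) = 0.
  have mgq : measurable_fun `](- r), r[ (fun s => g s * (s * q (s, 0))).
    apply: measurable_funM; first by case: sg.
    by apply: measurable_funTS; exact: continuous_measurable_fun.
  rewrite (@ae_eq_Rintegral _ _ _ _ _ m1 _ (cst 0) mgq)//; first exact: Rintegral0.
  apply: filterS gq => s /= + si => /(_ si) H.
  by rewrite mulrCA H mulr0.
rewrite -[RHS]oppr0 -I0.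
apply: (cvg_unique _ L); first exact: Rhausdorff.
apply: eq_cvgn L2 => k; have <- : I2 hd (Aop (fun x => phi k x * q x)) =
    - I1 `](- r), r[ (fun s => phi k (s, 0) * (s * q (s, 0))).
  rewrite (Gauss_angular r0 (smoothM (sphi k) sq)); congr (- _).
  by apply: eq_Rintegral => s _; ring.
apply: eq_Rintegral => x _; have E := AopM x (sphi k) sq.
by apply: etrans E _; rewrite /Aop; ring.
Qed.

End Limits.

End Modes.

End Polar.

Lemma Rintegral_subset0 d (T : measurableType d) (R : realType)
    (mu : {measure set T -> \bar R}) (A B : set T) (f : T -> R) :
  B `<=` A -> (forall x, A x -> ~ B x -> f x = 0) -> Rintegral mu A f = Rintegral mu B f.
Proof.
move=> BA f0; have := @Rintegral_mkcondr _ _ _ mu A B f.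
rewrite setIidr// => ->; apply: eq_Rintegral => x.
rewrite inE => Ax; rewrite patchE; case: ifPn => //.
by rewrite notin_setE => /f0 ->.
Qed.

(** * Weak derivatives and traces *)

Section FundamentalLemma.
Variable R : realType.
Local Notation T1 := (measurableTypeR R).
Local Notation T2 := (T1 * T1)%type.
Local Notation I2 A f := (Rintegral (@leb2 R) A f).

Let ray (a : R) : set R := [set` `]a, +oo[].
(** A family stable under intersection that generates the product sigma-algebra, as required by the
    Dynkin argument below. *)
Let quadrants : set (set T2) := [set A | exists a c, A = (ray a `*` ray c)].

Let measurable_quadrants : @measurable _ T2 = <<s quadrants >>.
Proof.
apply/seteqP; split; last first.
  apply: smallest_sub; first exact: sigma_algebra_measurable.
  by move=> _ [a [c ->]]; apply: measurableX; exact: measurable_itv.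
rewrite measurable_prod_measurableType; apply: smallest_sub.
  exact: smallest_sigma_algebra.
have ray_setT : \bigcup_n ray (- n%:R) = setT.
  apply/seteqP; split => // x _.
  exists (Num.bound `|x|) => //; rewrite /ray/= in_itv/= andbT ltrNl.
  by apply: le_lt_trans (archi_boundP (normr_ge0 x)); rewrite ler_normr lexx orbT.
have m1 : measurable_fun [set: g_sigma_algebraType quadrants] (fst : g_sigma_algebraType quadrants -> T1).
  apply: (@measurability _ _ (g_sigma_algebraType quadrants) T1 setT fst _ (RGenOInfty.measurableE R)).
  move=> _ [_ [a ->] <-].
  rewrite setTI (_ : _ @^-1` _ = \bigcup_n (ray a `*` ray (- n%:R))).
    apply: bigcupT_measurable => n; apply: sub_sigma_algebra.
    by exists a, (- n%:R).
  by rewrite -setX_bigcupr ray_setT; apply/seteqP; split => x //= -[].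
have m2 : measurable_fun [set: g_sigma_algebraType quadrants] (snd : g_sigma_algebraType quadrants -> T1).
  apply: (@measurability _ _ (g_sigma_algebraType quadrants) T1 setT snd _ (RGenOInfty.measurableE R)).
  move=> _ [_ [a ->] <-].
  rewrite setTI (_ : _ @^-1` _ = \bigcup_n (ray (- n%:R) `*` ray a)).
    apply: bigcupT_measurable => n; apply: sub_sigma_algebra.
    by exists (- n%:R), a.
  by rewrite -setX_bigcupl ray_setT; apply/seteqP; split => x //= -[].
move=> _ [A mA] [B mB] <-.
have -> : A `*` B = (fst @^-1` A) `&` (snd @^-1` B) by [].
apply: (@measurableI _ (g_sigma_algebraType quadrants)).
  by rewrite -[X in measurable X]setTI; exact: m1.
by rewrite -[X in measurable X]setTI; exact: m2.
Qed.

Definition obox (a b c d : R) : set (R * R) := [set` `]a, b[] `*` [set` `]c, d[].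
Definition cbox (a b c d : R) : set (R * R) := [set` `[a, b]] `*` [set` `[c, d]].

Lemma measurable_obox a b c d : measurable (obox a b c d : set T2).
Proof. by apply: measurableX; exact: measurable_itv. Qed.

(** The sets over which [g], restricted to the box, integrates to $0$ form a Dynkin system. It
    contains every quadrant, because a quadrant cuts out of the box a smaller box with the same
    upper right corner; this is why only [a'] and [c'] vary. *)
Lemma ae_eq0_box (g : T2 -> R) a b c d :
  (@leb2 R).-integrable (obox a b c d) (EFin \o g) ->
  (forall a' c', a <= a' -> c <= c' -> I2 (obox a' b c' d) g = 0) ->
  ae_eq (@leb2 R) (obox a b c d : set T2) g (cst 0).
Proof.
move=> gi g0; set Q := obox a b c d.
have mQ : measurable (Q : set T2) := measurable_obox a b c d.
have giS (E : set T2) : measurable E -> E `<=` Q -> (@leb2 R).-integrable E (EFin \o g).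
  by move=> mE EQ; apply: integrableS gi.
pose P (E : set T2) := (\int[@leb2 R]_(x in E `&` Q) (g x)%:E = 0)%E.
have I0 (E : set T2) : measurable E -> E `<=` Q -> I2 E g = 0 ->
    (\int[@leb2 R]_(x in E) (g x)%:E = 0)%E.
  move=> mE EQ h; have := integrable_fin_num mE (giS E mE EQ) => /fineK.
  by rewrite -[fine _]/(I2 E g) h => <-.
have PQ : (\int[@leb2 R]_(x in Q) (g x)%:E = 0)%E by apply: I0 => //; exact: g0.
have allP (S : set T2) : measurable S -> P S.
  rewrite measurable_quadrants; apply: (dynkin_induction measurable_quadrants).
  - move=> _ _ [a1 [c1 ->]] [a2 [c2 ->]].
    exists (Num.max a1 a2), (Num.max c1 c2); rewrite -setXI; congr (_ `*` _).
      apply/seteqP; split => x; rewrite /ray/= !in_itv/= !andbT gt_max.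
        by move=> [-> ->].
      by move=> /andP.
    apply/seteqP; split => x; rewrite /ray/= !in_itv/= !andbT gt_max.
      by move=> [-> ->].
    by move=> /andP.
  - by rewrite /P setTI.
  - move=> _ [a1 [c1 ->]]; rewrite /P.
    have -> : (ray a1 `*` ray c1) `&` Q = obox (Num.max a a1) b (Num.max c c1) d.
      apply/seteqP; split => x; rewrite /Q /obox /ray/= !in_itv/= !andbT !gt_max.
        by move=> [[-> ->]] [/andP[-> ->] /andP[-> ->]].
      by move=> [/andP[/andP[-> ->] ->] /andP[/andP[-> ->] ->]].
    apply: I0; first exact: measurable_obox.
      move=> x; rewrite /Q /obox/= !in_itv/= !gt_max.
      by move=> [/andP[/andP[-> _] ->] /andP[/andP[-> _] ->]].
    by apply: g0; rewrite le_max lexx.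
  - move=> E mE PE; rewrite /P.
    have := @integral_setU_EFin _ _ _ (@leb2 R) (E `&` Q) (~` E `&` Q) g.
    rewrite -setIUl setUv setTI PQ PE add0e => <- //.
    + exact: measurableI.
    + by apply: measurableI => //; exact: measurableC.
    + by case/integrableP: gi => /measurable_EFinP.
    + by rewrite disj_set2E; apply/eqP; rewrite setIACA setICr set0I.
  - move=> F mF tF PF; rewrite /P setI_bigcupl integral_bigcup.
    + by rewrite eseries0// => k _ _; exact: PF.
    + exact: trivIset_setIr.
    + by move=> k; apply: measurableI.
    + apply: giS; last by move=> x [k _ []].
      by apply: bigcupT_measurable => k; exact: measurableI.
have : ae_eq (@leb2 R) Q (EFin \o g) (cst 0%E).
  apply: integral_ae_eq => //.
  move=> E EQ mE; rewrite integral0; have := allP _ mE.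
  by rewrite /P setIidl.
by apply: filterS => x /= + Qx => /(_ Qx) [].
Qed.

(** Countably many rational boxes whose closures lie in [U] cover it; they are enumerated by
    decoding integers. *)
Lemma ae_eq0_cover (U : set (R * R)) (g : T2 -> R) : open U ->
  (forall a b c d, cbox a b c d `<=` U -> ae_eq (@leb2 R) (obox a b c d : set T2) g (cst 0)) ->
  ae_eq (@leb2 R) (U : set T2) g (cst 0).
Proof.
move=> oU H.
pose q (n : nat) : rat * rat * rat * rat :=
  odflt (0, 0, 0, 0) (unpickle n).
pose a n : R := ratr (q n).1.1.1. pose b n : R := ratr (q n).1.1.2.
pose c n : R := ratr (q n).1.2. pose d n : R := ratr (q n).2.
have : {ae @leb2 R, forall x, forall n, cbox (a n) (b n) (c n) (d n) `<=` U ->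
    obox (a n) (b n) (c n) (d n) x -> g x = 0}.
  apply: ae_foralln => n.
  have [/H|nU] := pselect (cbox (a n) (b n) (c n) (d n) `<=` U).
    by apply: filterS => x /= h _.
  exact: aeW.
move=> [N [mN N0 NS]]; exists N; split => // x /= nx; apply: NS => /= h.
apply: nx => Ux.
have [[A B] /= [nA nB] AB] := oU _ Ux.
have [r1 /= r10 Hr1] := nA; have [r2 /= r20 Hr2] := nB.
have [a'] := @rat_in_itvoo R (x.1 - r1) x.1 (ltac:(by rewrite ltrBlDr ltrDl)).
have [b'] := @rat_in_itvoo R x.1 (x.1 + r1) (ltac:(by rewrite ltrDl)).
have [c'] := @rat_in_itvoo R (x.2 - r2) x.2 (ltac:(by rewrite ltrBlDr ltrDl)).
have [d'] := @rat_in_itvoo R x.2 (x.2 + r2) (ltac:(by rewrite ltrDl)).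
rewrite !in_itv/= => /andP[d1 d2] /andP[c1 c2] /andP[b1 b2] /andP[a1 a2].
have := h (pickle (a', b', c', d')); rewrite /a /b /c /d /q pickleK/=; apply.
  move=> y [/=]; rewrite !in_itv/= => /andP[ya yb] /andP[yc yd].
  apply: AB; split => /=.
    by apply: Hr1; rewrite /= ltr_distlC; lra.
  by apply: Hr2; rewrite /= ltr_distlC; lra.
by split => /=; rewrite in_itv/= ?a2 ?b1 ?c2 ?d1.
Qed.

(** Test functions carried by the closed box which tend pointwise, as $k\to\infty$, to the indicator
    of the open box. *)
Let bump (a b c d : R) (k : nat) (x : R * R) : R :=
  step (k%:R * x.1 + - (k%:R * a)) * step (- k%:R * x.1 + k%:R * b) *
  (step (k%:R * x.2 + - (k%:R * c)) * step (- k%:R * x.2 + k%:R * d)).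

Let test_bump (U : set (R * R)) a b c d k : cbox a b c d `<=` U ->
  test_function U (bump a b c d k).
Proof.
move=> QU; have sf (f : R * R -> R) u v : smooth f -> smooth (fun x => step (u * f x + v)).
  by move=> sf; apply: (@smooth_comp _ (fun s => step (u * s + v))) => //; apply: smooth1_affine; exact: smooth1_step.
split.
  by apply: smoothM; apply: smoothM; apply: sf; (exact: smooth_fst || exact: smooth_snd).
exists (cbox a b c d).
  by split => //; apply: compact_setX; exact: segment_compact.
have k0 : 0 <= k%:R :> R by [].
move=> x nx; rewrite /bump.
have [xa|xa] := leP x.1 a.
  by rewrite step_le0 ?mul0r// -mulrBr mulr_ge0_le0// subr_le0.
have [xb|xb] := leP b x.1.
  rewrite [X in _ * X * _]step_le0 ?mulr0 ?mul0r// mulNr addrC -mulrBr.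
  by rewrite mulr_ge0_le0// subr_le0.
have [xc|xc] := leP x.2 c.
  by rewrite [X in _ * (X * _)]step_le0 ?mul0r ?mulr0// -mulrBr mulr_ge0_le0// subr_le0.
have [xd|xd] := leP d x.2.
  rewrite [X in _ * (_ * X)]step_le0 ?mulr0// mulNr addrC -mulrBr.
  by rewrite mulr_ge0_le0// subr_le0.
by exfalso; apply: nx; split => /=; rewrite in_itv/= !ltW.
Qed.

(** The integral of [g] over a box is, by dominated convergence, the limit of its integrals against
    [bump], all of which vanish. *)
Lemma fundamental_lemma (U : set (R * R)) (g : R * R -> R) : open U ->
  sqint (@leb2 R) U g ->
  (forall f, test_function U f -> I2 U (fun x => g x * f x) = 0) ->
  ae_eq (@leb2 R) (U : set T2) (g : T2 -> R) (cst 0).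
Proof.
move=> oU sg H; have mU := open_measurable2 oU.
apply: ae_eq0_cover => // a b c d QU.
have fin (a' c' : R) : (@leb2 R (obox a' b c' d : set T2) < +oo)%E.
  have -> : @leb2 R (obox a' b c' d : set T2) =
    (lebesgue_measure ([set` `]a', b[] : set R) * lebesgue_measure ([set` `]c', d[] : set R))%E.
    by apply: product_measure1E; exact: measurable_itv.
  by rewrite !lebesgue_measure_itv/=; case: ifP => _; case: ifP => _;
    rewrite ?mul0e ?mule0 ?ltry// -!EFinD -EFinM ltry.
have obU (a' c' : R) : a <= a' -> c <= c' -> obox a' b c' d `<=` U.
  move=> aa cc x [/=]; rewrite !in_itv/= => /andP[x1 x2] /andP[x3 x4].
  by apply: QU; split; rewrite /= in_itv/= !ltW// (le_lt_trans _ x1, le_lt_trans _ x3).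
have gi (a' c' : R) : a <= a' -> c <= c' -> (@leb2 R).-integrable (obox a' b c' d) (EFin \o g).
  move=> aa cc; apply: sqint_itg; [exact: measurable_obox|exact: fin|].
  case: sg => mg g2; split.
    by apply: measurable_funS mg => //; exact: obU.
  by apply: integrableS g2 => //; [exact: measurable_obox|exact: obU].
apply: ae_eq0_box; first exact: gi.
move=> a' c' aa cc; set Q := obox a' b c' d.
have mQ : measurable (Q : set T2) := measurable_obox a' b c' d.
have cU : cbox a' b c' d `<=` U.
  move=> x [/=]; rewrite !in_itv/= => /andP[x1 x2] /andP[x3 x4].
  by apply: QU; split; rewrite /= in_itv/= ?x2 ?x4 andbT (le_trans _ x1, le_trans _ x3).
have k0 (k : nat) : 0 <= k%:R :> R by [].
have bQ k : I2 Q (fun x => g x * bump a' b c' d k x) = 0.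
  rewrite -(H _ (test_bump k cU)); apply/esym; apply: Rintegral_subset0; first exact: obU.
  move=> x _ nx; suff -> : bump a' b c' d k x = 0 by rewrite mulr0.
  rewrite /bump.
  have [xa|xa] := leP x.1 a'.
    by rewrite step_le0 ?mul0r// -mulrBr mulr_ge0_le0// subr_le0.
  have [xb|xb] := leP b x.1.
    rewrite [X in _ * X * _]step_le0 ?mulr0 ?mul0r// mulNr addrC -mulrBr.
    by rewrite mulr_ge0_le0// subr_le0.
  have [xc|xc] := leP x.2 c'.
    by rewrite [X in _ * (X * _)]step_le0 ?mul0r ?mulr0// -mulrBr mulr_ge0_le0// subr_le0.
  have [xd|xd] := leP d x.2.
    rewrite [X in _ * (_ * X)]step_le0 ?mulr0// mulNr addrC -mulrBr.
    by rewrite mulr_ge0_le0// subr_le0.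
  by exfalso; apply: nx; split => /=; rewrite in_itv/= ?xa ?xb ?xc ?xd.
have mg : measurable_fun (Q : set T2) (g : T2 -> R).
  by have := gi _ _ aa cc => /integrableP[/measurable_EFinP].
have mb k : measurable_fun (Q : set T2) (bump a' b c' d k : T2 -> R).
  by apply: continuous_measurable_fun2 => //; apply: smooth_continuous; case: (test_bump k cU).
have b01 k x : `|bump a' b c' d k x| <= 1.
  have p01 (p q : R) : 0 <= p <= 1 -> 0 <= q <= 1 -> 0 <= p * q <= 1.
    by move=> /andP[p0 p1] /andP[q0 q1]; rewrite mulr_ge0//= mulr_ile1.
  suff /andP[b0 b1] : 0 <= bump a' b c' d k x <= 1 by rewrite ger0_norm.
  by apply: (p01); apply: (p01); exact: step_itv.
have ev (y u : R) : u < y -> \forall k \near \oo, 1 <= k%:R * (y - u).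
  move=> uy; near=> k; rewrite -ler_pdivrMr ?subr_gt0//.
  near: k; exact: nbhs_infty_ger.
have cvb x : Q x -> (fun k => (g x * bump a' b c' d k x)%:E) @ \oo --> (g x)%:E.
  move=> [/=]; rewrite !in_itv/= => /andP[x1 x2] /andP[x3 x4].
  apply: cvg_near_cst; near=> k.
  have h1 : 1 <= k%:R * (x.1 - a') by near: k; exact: ev.
  have h2 : 1 <= k%:R * (b - x.1) by near: k; exact: ev.
  have h3 : 1 <= k%:R * (x.2 - c') by near: k; exact: ev.
  have h4 : 1 <= k%:R * (d - x.2) by near: k; exact: ev.
  by rewrite /bump !step_ge1 ?mulr1//; lra.
have := @dominated_cvg _ _ _ (@leb2 R) Q mQ (fun k x => (g x * bump a' b c' d k x)%:E)
  (EFin \o g) (fun x => (`|g x|)%:E).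
have gi' := gi _ _ aa cc.
move=> /(_ _ cvb _ _ _)/= L.
have {}L : (fun k => \int[@leb2 R]_(x in Q) (g x * bump a' b c' d k x)%:E)%E @ \oo -->
    (\int[@leb2 R]_(x in Q) (g x)%:E)%E.
  apply: L => //.
  - by move=> k; apply/measurable_EFinP; exact: measurable_funM.
  - exact: integrable_norm gi'.
  - by move=> k x _; rewrite lee_fin normrM ler_piMr.
have : (fun k => \int[@leb2 R]_(x in Q) (g x * bump a' b c' d k x)%:E)%E @ \oo --> 0%E.
  apply: cvg_near_cst; near=> k.
  have igb : (@leb2 R).-integrable Q (EFin \o (fun x => g x * bump a' b c' d k x)).
    apply: (@itg_le _ _ _ _ _ mQ _ (fun x => `|g x|)); first exact: measurable_funM.
      by move=> x _; rewrite normrM ler_piMr.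
    exact: integrable_norm gi'.
  have := integrable_fin_num mQ igb => /fineK.
  by rewrite -[fine _]/(I2 Q (fun x => g x * bump a' b c' d k x)) bQ => <-.
move=> /(cvg_unique _ L) E; rewrite /Rintegral E//.
Unshelve. all: by end_near.
Qed.

End FundamentalLemma.

(** * Real and imaginary parts *)

Section ComplexParts.
Variable R : realType.

(** Indexing the two parts by a boolean allows each real statement to be proved once and used for
    both. *)
Definition part (b : bool) (z : R[i]) : R := if b then complex.Re z else complex.Im z.

Lemma partD b z w : part b (z + w) = part b z + part b w.
Proof. by case: z w b => a c [a' c'] []. Qed.

Lemma partN b z : part b (- z) = - part b z.
Proof. by case: z b => a c []. Qed.

Lemma partB b z w : part b (z - w) = part b z - part b w.
Proof. by rewrite partD partN. Qed.

Lemma partM b z (r : R) : part b (z * r%:C)%C = part b z * r.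
Proof. by case: z b => a c []; rewrite /part/= mulr0 ?subr0 ?add0r. Qed.

Lemma part0 b : part b 0 = 0. Proof. by case: b. Qed.

Lemma part_ext (z w : R[i]) : (forall b, part b z = part b w) -> z = w.
Proof. by case: z w => a c [a' c'] H; have /= -> := H true; have /= -> := H false. Qed.

Lemma sqr_cabs (z : R[i]) : cabs z ^+ 2 = part true z ^+ 2 + part false z ^+ 2.
Proof. by case: z => a c /=; rewrite sqr_sqrtr// addr_ge0// sqr_ge0. Qed.

Lemma sqr_part_le b (z : R[i]) : part b z ^+ 2 <= cabs z ^+ 2.
Proof. by rewrite sqr_cabs; case: b; rewrite ?lerDl ?lerDr sqr_ge0. Qed.

Lemma cabs_ge0 (z : R[i]) : 0 <= cabs z.
Proof. by case: z => a c; exact: sqrtr_ge0. Qed.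

Lemma part_le_cabs b (z : R[i]) : `|part b z| <= cabs z.
Proof. by apply: le_sqr_I; [exact: cabs_ge0|exact: sqr_part_le]. Qed.

Lemma cabs_le_parts (z : R[i]) : cabs z <= `|part true z| + `|part false z|.
Proof.
rewrite -[cabs z]ger0_norm ?cabs_ge0//; apply: le_sqr_I; first by rewrite addr_ge0.
rewrite sqr_cabs sqrrD !real_normK ?num_real//.
by rewrite addrAC lerDl mulrn_wge0// mulr_ge0.
Qed.

End ComplexParts.

Lemma sqintS d (T : measurableType d) (R : realType) (mu : {measure set T -> \bar R})
    (A B : set T) (f : T -> R) : measurable A -> measurable B -> B `<=` A ->
  sqint mu A f -> sqint mu B f.
Proof.
move=> mA mB BA [mf f2]; split; first exact: measurable_funS mf.
exact: integrableS f2.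
Qed.

Section L2Parts.
Context d (T : measurableType d) (R : realType) (mu : {measure set T -> \bar R}).
Variables (A : set T) (mA : measurable A).
Implicit Types f : T -> R[i].

Lemma part_cint b f : part b (cint mu A f) = Rintegral mu A (fun x => part b (f x)).
Proof. by case: b. Qed.

Lemma L2P f : L2 mu A f <-> forall b, sqint mu A (fun x => part b (f x)).
Proof.
split=> [[m1 m2 fi] b|H].
  have mb c : measurable_fun A (fun x => part c (f x)) by case: c.
  split; first exact: mb.
  apply: (@itg_le _ _ _ _ _ mA _ (fun x => cabs (f x) ^+ 2)); first exact: measurable_funX.
    by move=> x _; rewrite ger0_norm ?sqr_ge0// sqr_part_le.
  apply/integrableP; split.
    apply/measurable_EFinP; rewrite (_ : (fun x => _) =
      (fun x => part true (f x) ^+ 2 + part false (f x) ^+ 2)).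
      by apply: measurable_funD; exact: measurable_funX.
    by apply/funext => x; rewrite sqr_cabs.
  by under eq_integral do rewrite /= ger0_norm ?sqr_ge0//.
have [m1 i1] := H true; have [m2 i2] := H false.
split => //.
have /integrableP[_] := itgD mA i1 i2.
rewrite (eq_integral (fun x => (cabs (f x) ^+ 2)%:E))// => x _.
by rewrite sqr_cabs /= ger0_norm// addr_ge0// sqr_ge0.
Qed.

Lemma sqr_l2norm f : L2 mu A f ->
  l2norm mu A f ^+ 2 = Rintegral mu A (fun x => part true (f x) ^+ 2) +
                       Rintegral mu A (fun x => part false (f x) ^+ 2).
Proof.
move=> /L2P H; rewrite sqr_sqrtr; last by apply: Rintegral_ge0 => x _; exact: sqr_ge0.
rewrite -RintegralD//; [|exact: (H true).2|exact: (H false).2].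
by apply: eq_Rintegral => x _; exact: sqr_cabs.
Qed.

Lemma part_le_l2norm b f : L2 mu A f ->
  Rintegral mu A (fun x => part b (f x) ^+ 2) <= l2norm mu A f ^+ 2.
Proof.
move=> fL; rewrite sqr_l2norm//.
by case: b; rewrite ?lerDl ?lerDr; apply: Rintegral_ge0 => x _; exact: sqr_ge0.
Qed.

Lemma l2norm_cvg0 b (F : nat -> T -> R[i]) : (forall k, L2 mu A (F k)) ->
  (fun k => l2norm mu A (F k)) @ \oo --> (0 : R) ->
  (fun k => Rintegral mu A (fun x => part b (F k x) ^+ 2)) @ \oo --> (0 : R).
Proof.
move=> FL F0.
have : (fun k => l2norm mu A (F k) * l2norm mu A (F k)) @ \oo --> (0 * 0 : R).
  exact: cvgM.
rewrite mulr0 => H; apply: (squeeze_cvgr _ _ H); last exact: cvg_cst.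
near=> k; apply/andP; split; first by apply: Rintegral_ge0 => x _; exact: sqr_ge0.
by rewrite -expr2 part_le_l2norm.
Unshelve. all: by end_near.
Qed.

End L2Parts.

Section WeakDerivatives.
Variable R : realType.
Local Notation T1 := (measurableTypeR R).
Local Notation T2 := (T1 * T1)%type.
Local Notation I2 A f := (Rintegral (@leb2 R) A f).
Local Notation I1 A f := (Rintegral (@leb1 R) A f).
Implicit Types (U V : set (R * R)) (e : R * R).

Definition wd U e (w g : R * R -> R) :=
  sqint (@leb2 R) U g /\ forall f, test_function U f ->
  I2 U (fun x => w x * 'D_e f x) = - I2 U (fun x => g x * f x).

Lemma is_weak_derivP U e (u g : R * R -> R[i]) : measurable (U : set T2) ->
  is_weak_deriv U e u g <-> forall b, wd U e (fun x => part b (u x)) (fun x => part b (g x)).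
Proof.
move=> mU; split=> [[gL H] b|H].
  split; first exact: ((L2P _ mU g).1 gL).
  move=> f /H /(congr1 (part b)); rewrite partN !part_cint.
  under eq_Rintegral do rewrite partM.
  by under [in RHS]eq_Rintegral do rewrite partM.
split; first by apply/L2P => // b; case: (H b).
move=> f tf; apply: part_ext => b; rewrite partN !part_cint.
under eq_Rintegral do rewrite partM.
under [in RHS]eq_Rintegral do rewrite partM.
by have [_] := H b; apply.
Qed.

Lemma test_off U (f : R * R -> R) x : test_function U f -> ~ U x ->
  f x = 0 /\ forall e, 'D_e f x = 0.
Proof.
move=> [_ [K [cK KU fK]]] nU.
have nK : ~ K x by move=> /KU.
split; first exact: fK.
move=> e; suff : is_derive x e f 0 by case.
apply: (@near_eq_is_derive _ _ _ (fun=> 0)).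
have oK : open (~` K).
  by rewrite openC; apply: compact_closed => //; exact: norm_hausdorff.
have : nbhs x (~` K) by apply: open_nbhs_nbhs; split.
by apply: filterS => y /fK ->.
Qed.

Lemma test_functionS U V f : V `<=` U -> test_function V f -> test_function U f.
Proof. by move=> VU [sf [K [cK KV fK]]]; split => //; exists K => //; split => // x /KV /VU. Qed.

Lemma wdS U V e w g : V `<=` U -> measurable (U : set T2) -> measurable (V : set T2) ->
  wd U e w g -> wd V e w g.
Proof.
move=> VU mU mV [sg H]; split; first exact: sqintS sg.
move=> f tf; have := H f (test_functionS VU tf).
have -> := @Rintegral_subset0 _ T2 R (@leb2 R) U V (fun x => w x * 'D_e f x) VU.
  have -> // := @Rintegral_subset0 _ T2 R (@leb2 R) U V (fun x => g x * f x) VU.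
  by move=> x _ /(test_off tf)[-> _]; rewrite mulr0.
by move=> x _ /(test_off tf)[_ ->]; rewrite mulr0.
Qed.

Lemma test_sqint U f : measurable (U : set T2) -> test_function U f -> sqint (@leb2 R) U f.
Proof.
move=> mU [sm [K [cK KU fK]]].
have bd (g : R * R -> R) : smooth g -> exists2 M, 0 <= M & forall x, K x -> `|g x| <= M.
  move=> sg; have : compact (g @` K).
    by apply: continuous_compact => //; apply: continuous_subspaceT; exact: smooth_continuous.
  move=> /compact_bounded[M [_ HM]]; exists (`|M| + 1); first by rewrite addr_ge0.
  move=> x Kx; apply: (HM (`|M| + 1)); first by rewrite (le_lt_trans (ler_norm _))// ltrDl.
  by exists x.
have mf : measurable_fun (U : set T2) (f : T2 -> T1).
  by apply: continuous_measurable_fun2 => //; exact: smooth_continuous.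
have [M M0 fM] := bd _ sm.
have [N1 N10 HN1] := bd _ (@smooth_fst R); have [N2 N20 HN2] := bd _ (@smooth_snd R).
have mK : measurable (K : set T2).
  have : closed K by apply: compact_closed => //; exact: norm_hausdorff.
  by rewrite -openC => /open_measurable2 /measurableC; rewrite setCK.
have finK : (@leb2 R (K : set T2) < +oo)%E.
  apply: (@le_lt_trans _ _ (@leb2 R (cbox (- N1) N1 (- N2) N2))).
    apply: le_measure; rewrite ?inE//; first by apply: measurableX; exact: measurable_itv.
    by move=> x Kx; split; rewrite /= in_itv/= -ler_norml ?HN1 ?HN2.
  by rewrite leb2_rect ?ltry// ge0_cp.
split => //.
apply: (@itg_le _ _ _ _ _ mU _ (fun x => M ^+ 2 * \1_K x)).
- exact: measurable_funX.
- move=> x _; rewrite ger0_norm ?sqr_ge0//.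
  have [Kx|nK] := pselect (K x); last by rewrite fK// expr0n mulr_ge0 ?sqr_ge0.
  rewrite indicE mem_set// mulr1 -[leLHS]real_normK ?num_real//.
  by rewrite lerXn2r ?nnegrE// fM.
- apply: itgZ => //; apply/integrableP; split.
    by apply/measurable_EFinP; exact: measurable_indic.
  under eq_integral do rewrite /= ger0_norm//.
  rewrite integral_indic//; apply: le_lt_trans finK.
  by apply: le_measure; rewrite ?inE//; exact: measurableI.
Qed.

Lemma test_D U f : test_function U f ->
  test_function U ('D_(e1 R) f) /\ test_function U ('D_(e2 R) f).
Proof.
move=> [sm [K [cK KU fK]]].
have tK : test_function K f by split; [exact: sm|exists K; [split|exact: fK]].
split; (split; [|exists K; [by split|]]).
- exact: smooth_D1.
- by move=> x nK; have [_ ->] := test_off tK nK.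
- exact: smooth_D2.
- by move=> x nK; have [_ ->] := test_off tK nK.
Qed.

Lemma wd_uniq U e w g h : open U -> wd U e w g -> wd U e w h ->
  ae_eq (@leb2 R) (U : set T2) (g : T2 -> R) h.
Proof.
move=> oU [sg Hg] [sh Hh]; have mU := open_measurable2 oU.
have sgh : sqint (@leb2 R) U (fun x => g x - h x) by exact: sqintB.
have H f : test_function U f -> I2 U (fun x => (g x - h x) * f x) = 0.
  move=> tf; have sf := test_sqint mU tf.
  transitivity (I2 U (fun x => g x * f x) - I2 U (fun x => h x * f x)).
    rewrite -RintegralB//; [|exact: sqint_mul|exact: sqint_mul].
    by apply: eq_Rintegral => x _; ring.
  by apply/eqP; rewrite subr_eq0 -eqr_opp -Hg// -Hh.
have := fundamental_lemma oU sgh H; apply: filterS => x /= + Ux => /(_ Ux) /eqP.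
by rewrite subr_eq0 => /eqP.
Qed.

(** The product of [f] with a test function vanishes on the arc and on the flat boundary, so Gauss's
    formula leaves no boundary term. *)
Lemma wd_smooth (r : R) (f : R * R -> R) : 0 < r -> smooth f ->
  wd (half_disk r) (e1 R) f ('D_(e1 R) f) /\ wd (half_disk r) (e2 R) f ('D_(e2 R) f).
Proof.
move=> r0 sf; have mhd := @measurable_half_disk R r.
have it (g : R * R -> R) : smooth g -> (@leb2 R).-integrable (half_disk r) (EFin \o g).
  by move=> sg; apply: itg2_continuous => //; exact: smooth_continuous.
have arc (t : R) : ~ half_disk r (r * cos t, r * sin t).
  by rewrite /half_disk/= => -[]; rewrite !exprMn -mulrDr cos2Dsin2 mulr1 ltxx.
have flat (s : R) : ~ half_disk r (s, 0) by rewrite /half_disk/= ltxx => -[].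
have sq1 : sqint (@leb2 R) (half_disk r) ('D_(e1 R) f).
  by apply: sqint_continuous => //; apply: smooth_continuous; exact: smooth_D1.
have sq2 : sqint (@leb2 R) (half_disk r) ('D_(e2 R) f).
  by apply: sqint_continuous => //; apply: smooth_continuous; exact: smooth_D2.
split; [split; [exact: sq1|]|split; [exact: sq2|]].
- move=> g tg; have [sg _] := tg; apply/eqP; rewrite -addr_eq0; apply/eqP.
  have va (t : R) : f (r * cos t, r * sin t) * g (r * cos t, r * sin t) = 0.
    by rewrite (test_off tg (arc t)).1 mulr0.
  have vf (t : R) : f (t, 0) * g (t, 0) = 0 by rewrite (test_off tg (flat t)).1 mulr0.
  have [H _] := @Rintegral_D_eq0 _ _ r0 _ (smoothM sf sg) va vf.
  rewrite -[RHS]H -RintegralD//.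
  + by apply: eq_Rintegral => x _; rewrite D1_M//; ring.
  + by apply: it; apply: smoothM => //; exact: smooth_D1.
  + by apply: it; apply: smoothM => //; exact: smooth_D1.
- move=> g tg; have [sg _] := tg; apply/eqP; rewrite -addr_eq0; apply/eqP.
  have va (t : R) : f (r * cos t, r * sin t) * g (r * cos t, r * sin t) = 0.
    by rewrite (test_off tg (arc t)).1 mulr0.
  have vf (t : R) : f (t, 0) * g (t, 0) = 0 by rewrite (test_off tg (flat t)).1 mulr0.
  have [_ H] := @Rintegral_D_eq0 _ _ r0 _ (smoothM sf sg) va vf.
  rewrite -[RHS]H -RintegralD//.
  + by apply: eq_Rintegral => x _; rewrite D2_M//; ring.
  + by apply: it; apply: smoothM => //; exact: smooth_D2.
  + by apply: it; apply: smoothM => //; exact: smooth_D2.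
Qed.

Lemma weak_derivP U e (u g : R * R -> R[i]) : is_weak_deriv U e u g ->
  is_weak_deriv U e u (weak_deriv U e u).
Proof. by move=> H; apply: (@xgetPex _ (fun=> 0) [set h | is_weak_deriv U e u h]); exists g. Qed.

Lemma wdB U e w w' g g' : measurable (U : set T2) ->
  sqint (@leb2 R) U w -> sqint (@leb2 R) U w' -> e = e1 R \/ e = e2 R ->
  wd U e w g -> wd U e w' g' -> wd U e (fun x => w x - w' x) (fun x => g x - g' x).
Proof.
move=> mU sw sw' He [sg H] [sg' H']; split; first exact: sqintB.
move=> f tf; have sf := test_sqint mU tf.
have sdf : sqint (@leb2 R) U ('D_e f).
  by have [t1 t2] := test_D tf; case: He => ->; exact: test_sqint.
transitivity (I2 U (fun x => w x * 'D_e f x) - I2 U (fun x => w' x * 'D_e f x)).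
  by rewrite -RintegralB//; [apply: eq_Rintegral => x _; ring|exact: sqint_mul|exact: sqint_mul].
rewrite H// H'// -opprD; congr (- _).
rewrite -RintegralB//; [|exact: sqint_mul|exact: sqint_mul].
by apply: eq_Rintegral => x _; ring.
Qed.

Lemma sqr_H1norm U (u : R * R -> R[i]) :
  H1norm U u ^+ 2 = l2norm (@leb2 R) U u ^+ 2 +
    l2norm (@leb2 R) U (weak_deriv U (e1 R) u) ^+ 2 + l2norm (@leb2 R) U (weak_deriv U (e2 R) u) ^+ 2.
Proof. by rewrite sqr_sqrtr// !addr_ge0// sqr_ge0. Qed.

Section TraceData.
Variable G : cavity R.
Local Notation r := (Rad G).
Local Notation hd := (half_disk r).

Lemma Rad_gt0 : 0 < r.
Proof. exact: lt_trans (Rhat_gt0 G) (Rhat_lt_Rad G). Qed.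

Lemma measurable_aperture : measurable (aperture G : set T2).
Proof.
have -> : aperture G = apert G `*` [set 0] by [].
by apply: measurableX; [exact: (open_measurable (@apert_open R G))|exact: measurable_set1].
Qed.

Lemma leb2_aperture : @leb2 R (aperture G : set T2) = 0%E.
Proof.
have -> : aperture G = apert G `*` [set 0] by [].
have -> : @leb2 R (apert G `*` [set 0]) =
    (lebesgue_measure (apert G) * lebesgue_measure ([set (0 : R)%R] : set R))%E.
  apply: product_measure1E; [exact: (open_measurable (@apert_open R G))|exact: measurable_set1].
by rewrite lebesgue_measure_set1 mule0.
Qed.

Lemma measurable_cav : measurable (cav G : set T2).
Proof. by apply: open_measurable2; exact: cav_open. Qed.

Lemma measurable_Omega : measurable (Omega G : set T2).
Proof.
apply: measurableU; last exact: measurable_cav.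
by apply: measurableU; [exact: measurable_half_disk|exact: measurable_aperture].
Qed.

Lemma half_disk_Omega : hd `<=` Omega G.
Proof. by move=> x ?; left; left. Qed.

Lemma cav_Omega : cav G `<=` Omega G.
Proof. by move=> x ?; right. Qed.

(** Uniqueness holds on the half-disk and on the cavity, which are open, and the aperture between
    them is a null set; openness of [Omega G] is never called upon. *)
Lemma wd_Omega_uniq e w g h : wd (Omega G) e w g -> wd (Omega G) e w h ->
  ae_eq (@leb2 R) (Omega G : set T2) (g : T2 -> R) h.
Proof.
move=> H1 H2; have mO := measurable_Omega.
have [N1 [mN1 N10 NS1]] := wd_uniq (@half_disk_open _ r) (wdS half_disk_Omega mO (@measurable_half_disk _ r) H1)
  (wdS half_disk_Omega mO (@measurable_half_disk _ r) H2).
have [N2 [mN2 N20 NS2]] := wd_uniq (@cav_open _ G) (wdS cav_Omega mO measurable_cav H1)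
  (wdS cav_Omega mO measurable_cav H2).
exists (N1 `|` N2 `|` aperture G); split.
- by apply: measurableU; [exact: measurableU|exact: measurable_aperture].
- apply/eqP; rewrite -measure_le0.
  apply: le_trans (measureU2 _ _ _) _; [exact: measurableU|exact: measurable_aperture|].
  have -> : (@leb2 R (N1 `|` N2) + @leb2 R (aperture G) = @leb2 R (N1 `|` N2))%E.
    by rewrite [X in (_ + X)%E](leb2_aperture) adde0.
  apply: le_trans (measureU2 _ _ _) _ => //.
  by rewrite [X in (X + _)%E](N10) [X in (_ + X)%E](N20) adde0.
- move=> x /= nx; have [ax|nax] := pselect (aperture G x); first by right.
  left; have [hx|nhx] := pselect (hd x).
    by left; apply: NS1 => /= h'; apply: nx => _; exact: h'.
  right; apply: NS2 => /= h'; apply: nx => -[[//|//]|cx]; exact: h'.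
Qed.

Lemma is_weak_deriv_hd (phi u g1 g2 : R * R -> R[i]) : csmooth phi ->
  L2 (@leb2 R) (Omega G) u ->
  is_weak_deriv (Omega G) (e1 R) u g1 -> is_weak_deriv (Omega G) (e2 R) u g2 ->
  forall b,
  wd hd (e1 R) (fun x => part b (phi x - u x)) (fun x => 'D_(e1 R) (fun y => part b (phi y)) x - part b (g1 x)) /\
  wd hd (e2 R) (fun x => part b (phi x - u x)) (fun x => 'D_(e2 R) (fun y => part b (phi y)) x - part b (g2 x)).
Proof.
move=> sphi Lu w1 w2 b; have mO := measurable_Omega; have mhd := @measurable_half_disk R r.
have spb : smooth (fun y => part b (phi y)) by case: b; case: sphi.
have sqb : sqint (@leb2 R) hd (fun y => part b (phi y)).
  by apply: sqint_continuous; [exact: Rad_gt0|exact: smooth_continuous].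
have squ : sqint (@leb2 R) hd (fun y => part b (u y)).
  exact: sqintS mO mhd half_disk_Omega ((L2P _ mO u).1 Lu b).
have [d1 d2] := wd_smooth Rad_gt0 spb.
have := (is_weak_derivP _ _ _ mO).1 w1 b => /(wdS half_disk_Omega mO mhd) v1.
have := (is_weak_derivP _ _ _ mO).1 w2 b => /(wdS half_disk_Omega mO mhd) v2.
have -> : (fun x => part b (phi x - u x)) = (fun x => part b (phi x) - part b (u x)).
  by apply/funext => x; rewrite partB.
split.
  exact: (wdB mhd sqb squ (or_introl erefl) d1 v1).
exact: (wdB mhd sqb squ (or_intror erefl) d2 v2).
Qed.

Lemma sqint_sub_Omega b (f : R * R -> R[i]) : L2 (@leb2 R) (Omega G) f ->
  sqint (@leb2 R) hd (fun x => part b (f x)).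
Proof.
move=> /(L2P _ measurable_Omega) /(_ b).
exact: sqintS measurable_Omega (@measurable_half_disk _ _) half_disk_Omega.
Qed.

(** A trace comes with approximations measured by [H1norm] of the difference on the half-disk. Here
    this becomes separate $L^2$ limits towards [u] and towards its weak derivatives on the whole of
    [Omega G], one real part at a time. *)
Lemma trace_data (c : R -> R * R) (I : set T1) (u : R * R -> R[i]) (g : R -> R[i]) :
  measurable I -> H1 (Omega G) u -> is_trace hd c I u g ->
  (forall f : R * R -> R, smooth f -> sqint (@leb1 R) I (fun t => f (c t))) ->
  forall b, exists phi : nat -> R * R -> R,
  [/\ forall k, smooth (phi k),
     (fun k => I2 hd (fun x => (phi k x - part b (u x)) ^+ 2)) @ \oo --> (0 : R),
     (fun k => I2 hd (fun x => ('D_(e1 R) (phi k) x - part b (weak_deriv (Omega G) (e1 R) u x)) ^+ 2)) @ \oo --> (0 : R),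
     (fun k => I2 hd (fun x => ('D_(e2 R) (phi k) x - part b (weak_deriv (Omega G) (e2 R) u x)) ^+ 2)) @ \oo --> (0 : R) &
     (fun k => I1 I (fun t => (phi k (c t) - part b (g t)) ^+ 2)) @ \oo --> (0 : R)].
Proof.
move=> mI [Lu [h1 hh1] [h2 hh2]] [Lg [phi [sphi cvH cvI]]] sqI b.
have w1 := weak_derivP hh1; have w2 := weak_derivP hh2.
set g1 := weak_deriv _ _ u in w1 *; set g2 := weak_deriv _ (e2 R) u in w2 *.
have mhd := @measurable_half_disk R r.
have spb k c' : smooth (fun y => part c' (phi k y)) by case: c'; case: (sphi k).
have D k := is_weak_deriv_hd (sphi k) Lu w1 w2.
pose dphi e k x : R[i] := ('D_e (fun y => part true (phi k y)) x +i* 'D_e (fun y => part false (phi k y)) x)%C.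
have dE e k c' x : part c' (dphi e k x) = 'D_e (fun y => part c' (phi k y)) x by case: c'.
have W1 k : is_weak_deriv hd (e1 R) (fun x => phi k x - u x) (fun x => dphi (e1 R) k x - g1 x).
  apply/is_weak_derivP => // c'; have [+ _] := D k c'.
  by congr wd; apply/funext => x; rewrite partB dE.
have W2 k : is_weak_deriv hd (e2 R) (fun x => phi k x - u x) (fun x => dphi (e2 R) k x - g2 x).
  apply/is_weak_derivP => // c'; have [_] := D k c'.
  by congr wd; apply/funext => x; rewrite partB dE.
have V1 k := weak_derivP (W1 k); have V2 k := weak_derivP (W2 k).
have Lphi k : L2 (@leb2 R) hd (fun x => phi k x - u x).
  apply/L2P => // c'; have -> : (fun x => part c' (phi k x - u x)) = (fun x => part c' (phi k x) - part c' (u x)).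
    by apply/funext => x; rewrite partB.
  apply: sqintB => //; last exact: sqint_sub_Omega.
  by apply: sqint_continuous; [exact: Rad_gt0|exact: smooth_continuous].
have H0 : (fun k => H1norm hd (fun x => phi k x - u x) * H1norm hd (fun x => phi k x - u x)) @ \oo --> (0 : R).
  by rewrite -[X in _ --> X](mulr0 0); exact: cvgM.
have sq (F : nat -> R) : (forall k, 0 <= F k <= H1norm hd (fun x => phi k x - u x) ^+ 2) ->
    F @ \oo --> (0 : R).
  move=> HF; apply: (squeeze_cvgr _ _ H0); last exact: cvg_cst.
  by near=> k; rewrite -expr2; exact: HF.
have I0 (f : R * R -> R) : 0 <= I2 hd (fun x => f x ^+ 2).
  by apply: Rintegral_ge0 => x _; exact: sqr_ge0.
exists (fun k x => part b (phi k x)); split => //.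
- apply: sq => k; rewrite I0/= sqr_H1norm.
  have := part_le_l2norm mhd b (Lphi k) => /le_trans.
  under eq_Rintegral do rewrite partB.
  by apply; rewrite -addrA lerDl addr_ge0// sqr_ge0.
- apply: sq => k; rewrite I0/= sqr_H1norm.
  (* [H1norm] involves a chosen weak derivative of the difference; uniqueness up to a null set
     identifies it with the difference of the derivatives. *)
  have E : I2 hd (fun x => ('D_(e1 R) (fun y => part b (phi k y)) x - part b (g1 x)) ^+ 2) =
      I2 hd (fun x => part b (weak_deriv hd (e1 R) (fun x => phi k x - u x) x) ^+ 2).
    have [[mD _] _] := (D k b).1; have v := (is_weak_derivP _ _ _ mhd).1 (V1 k) b.
    apply: ae_eq_Rintegral => //; [exact: measurable_funX|by apply: measurable_funX; case: v => -[]|].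
    have := wd_uniq (@half_disk_open _ r) (D k b).1 v.
    by apply: filterS => x /= + hx => /(_ hx) ->.
  rewrite E; have := part_le_l2norm mhd b (V1 k).1 => /le_trans; apply.
  by rewrite addrAC lerDr addr_ge0// sqr_ge0.
- apply: sq => k; rewrite I0/= sqr_H1norm.
  have E : I2 hd (fun x => ('D_(e2 R) (fun y => part b (phi k y)) x - part b (g2 x)) ^+ 2) =
      I2 hd (fun x => part b (weak_deriv hd (e2 R) (fun x => phi k x - u x) x) ^+ 2).
    have [[mD _] _] := (D k b).2; have v := (is_weak_derivP _ _ _ mhd).1 (V2 k) b.
    apply: ae_eq_Rintegral => //; [exact: measurable_funX|by apply: measurable_funX; case: v => -[]|].
    have := wd_uniq (@half_disk_open _ r) (D k b).2 v.
    by apply: filterS => x /= + hx => /(_ hx) ->.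
  rewrite E; have := part_le_l2norm mhd b (V2 k).1 => /le_trans; apply.
  by rewrite lerDr addr_ge0// sqr_ge0.
- have LI k : L2 (@leb1 R) I (fun t => phi k (c t) - g t).
    apply/L2P => // c'; have -> : (fun t => part c' (phi k (c t) - g t)) = (fun t => part c' (phi k (c t)) - part c' (g t)).
      by apply/funext => t; rewrite partB.
    by apply: sqintB => //; [exact: (sqI (fun y => part c' (phi k y)) (spb k c'))|exact: ((L2P _ mI g).1 Lg)].
  have := l2norm_cvg0 mI b LI cvI; apply: eq_cvgn => k.
  by apply: eq_Rintegral => t _; rewrite partB.
Unshelve. all: by end_near.
Qed.

End TraceData.

End WeakDerivatives.

(** * Bessel and Hankel functions of large order *)

Section EntireSeries.
Variable R : realType.
Implicit Types (c : nat -> R) (x : R).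

Lemma cvgn_mull (r : R) (u : nat -> R) l : u @ \oo --> l -> (fun k => r * u k) @ \oo --> r * l.
Proof. by move=> h; apply: cvgM => //; exact: cvg_cst. Qed.

Lemma cvgn_add (u v : nat -> R) l m : u @ \oo --> l -> v @ \oo --> m ->
  (fun k => u k + v k) @ \oo --> l + m.
Proof. by move=> hu hv; exact: cvgD. Qed.

(** Coefficients dominated by those of $Me^{ax}$. The condition survives differentiation and gives
    convergence everywhere with an explicit exponential bound. *)
Definition expb (M a : R) c := forall k, `|c k| <= M * (a ^+ k / k`!%:R).

Definition ps c x : R := limn (pseries c x).

Lemma expb_ge0 M a c : expb M a c -> 0 <= M.
Proof. by move=> /(_ 0%N); rewrite expr0 fact0 divr1 mulr1; apply: le_trans. Qed.

Lemma expb_norm_le M a c x k : 0 <= a -> expb M a c ->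
  `|c k * x ^+ k| <= M * exp_coeff (a * `|x|) k.
Proof.
move=> a0 /(_ k) h; rewrite normrM normrX exp_coeffE /= exprMn.
have -> : M * (k`!%:R^-1 * (a ^+ k * `|x| ^+ k)) = M * (a ^+ k / k`!%:R) * `|x| ^+ k by ring.
by rewrite ler_wpM2r// exprn_ge0.
Qed.

Lemma is_cvg_ps_exp (M a x : R) : cvgn (series (fun k => M * exp_coeff (a * `|x|) k)).
Proof.
have : cvgn (series (exp_coeff (a * `|x|))) by exact: is_cvg_series_exp_coeff.
move=> /(cvgn_mull (r := M)) H; apply: cvgP; apply: eq_cvgn H => n.
by rewrite /series/= mulr_sumr.
Qed.

Lemma normed_cvg_ps M a c x : 0 <= a -> expb M a c ->
  cvgn [normed series (fun k => c k * x ^+ k)].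
Proof.
move=> a0 h; have := @is_cvg_ps_exp M a x; apply: series_le_cvg => n.
- exact: normr_ge0.
- by apply: le_trans (expb_norm_le x n a0 h).
- exact: expb_norm_le.
Qed.

Lemma is_cvg_ps M a c x : 0 <= a -> expb M a c -> cvgn (pseries c x).
Proof. by move=> a0 h; apply: normed_cvg; exact: normed_cvg_ps h. Qed.

Lemma ps_le M a c x : 0 <= a -> expb M a c -> `|ps c x| <= M * expR (a * `|x|).
Proof.
move=> a0 h; apply: le_trans (lim_series_norm (normed_cvg_ps a0 h)) _.
have -> : M * expR (a * `|x|) = limn (series (fun k => M * exp_coeff (a * `|x|) k)).
  have : series (exp_coeff (a * `|x|)) @ \oo --> expR (a * `|x|).
    by rewrite expRE /pseries -exp_coeffE; exact: is_cvg_series_exp_coeff.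
  move=> /(cvgn_mull (r := M)) H; apply/esym/cvg_lim => //; apply: eq_cvgn H => n.
  by rewrite /series/= mulr_sumr.
apply: lim_series_le => //; [exact: normed_cvg_ps h|exact: is_cvg_ps_exp|].
by move=> n; exact: expb_norm_le.
Qed.

Lemma expb_diffs M a c : 0 <= a -> expb M a c -> expb (M * a) a (pseries_diffs c).
Proof.
move=> a0 h k; rewrite /pseries_diffs normrM ger0_norm//.
have := h k.+1; rewrite exprS factS natrM invfM => h'.
rewrite -(ler_pM2l (x := k.+1%:R^-1)) ?invr_gt0// mulrA mulVf// mul1r.
apply: le_trans h' _; rewrite le_eqVlt; apply/orP; left; apply/eqP; ring.
Qed.

Lemma is_derive_ps M a c x : 0 <= a -> expb M a c ->
  is_derive x (1 : R) (ps c) (ps (pseries_diffs c) x).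
Proof.
move=> a0 h; apply: (@pseries_snd_diffs _ _ (`|x| + 1)).
- exact: is_cvg_ps h.
- exact: is_cvg_ps (expb_diffs a0 h).
- exact: is_cvg_ps (expb_diffs a0 (expb_diffs a0 h)).
- by rewrite [ltRHS]ger0_norm ?addr_ge0// ltrDl.
Qed.

Lemma psD M a c M' a' c' x : 0 <= a -> expb M a c -> 0 <= a' -> expb M' a' c' ->
  ps (fun k => c k + c' k) x = ps c x + ps c' x.
Proof.
move=> a0 h a'0 h'; apply/cvg_lim => //.
have := cvgn_add (is_cvg_ps (x := x) a0 h) (is_cvg_ps (x := x) a'0 h').
move=> H; apply: eq_cvgn H => n /=.
by rewrite /pseries /series/= -big_split; apply: eq_bigr => k _; rewrite mulrDl.
Qed.

Lemma psZ M a c (r : R) x : 0 <= a -> expb M a c -> ps (fun k => r * c k) x = r * ps c x.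
Proof.
move=> a0 h; apply/cvg_lim => //.
have := cvgn_mull (r := r) (is_cvg_ps (x := x) a0 h).
move=> H; apply: eq_cvgn H => n /=.
by rewrite /pseries /series/= mulr_sumr; apply: eq_bigr => k _; rewrite mulrA.
Qed.

Lemma ps_shift M a c x : 0 <= a -> expb M a c ->
  ps (fun k => if k is k'.+1 then c k' else 0) x = x * ps c x.
Proof.
move=> a0 h; apply/cvg_lim => //.
have := cvgn_mull (r := x) (is_cvg_ps (x := x) a0 h) => H.
rewrite -cvg_shiftS; apply: eq_cvgn H => n /=.
rewrite /pseries /series/= big_nat_recl// mul0r add0r mulr_sumr.
by apply: eq_bigr => k _; rewrite exprS; ring.
Qed.

Lemma ps_delta0 x (r : R) : ps (fun k => if k is 0%N then r else 0) x = r.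
Proof.
apply/cvg_lim => //; rewrite -cvg_shiftS; apply: (@eq_cvgn _ (fun=> r)); last exact: cvg_cst.
move=> n; rewrite /pseries /series/= big_nat_recl//= expr0 mulr1 big1 ?addr0// => k _.
by rewrite mul0r.
Qed.

Definition jc (n k : nat) : R := (-1) ^+ k / (k`! * (n + k)`!)%:R.
(** The Bessel-Clifford function, the entire factor of $J_n(x)=(x/2)^n\,\mathrm{fB}_n((x/2)^2)$. Its
    derivative is minus the one of index $n+1$, which keeps all later computations algebraic. *)
Definition fB n : R -> R := ps (jc n).

Lemma norm_jc n k : `|jc n k| = (k`!%:R * (n + k)`!%:R)^-1.
Proof. by rewrite normrM normrX normrN1 expr1n mul1r natrM normfV ger0_norm. Qed.

Lemma fact_le_add n k : (n`!)%:R <= (n + k)`!%:R :> R.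
Proof. by rewrite ler_nat leq_fact// leq_addr. Qed.

Lemma fact_gt0R n : 0 < (n`!)%:R :> R.
Proof. by rewrite ltr0n fact_gt0. Qed.

Lemma expb_jc n : expb (n`!%:R^-1) 1 (jc n).
Proof.
move=> k; rewrite norm_jc expr1n mul1r -invfM lef_pV2 ?posrE ?mulr_gt0 ?fact_gt0R//.
by rewrite mulrC ler_wpM2l// fact_le_add.
Qed.

Lemma jc_diffs n : pseries_diffs (jc n) = (fun k => - jc n.+1 k).
Proof.
apply/funext => k; rewrite /pseries_diffs /jc addSnnS exprS factS.
rewrite !natrM; have := fact_gt0R k; have := fact_gt0R (n + k.+1) => h1 h2.
by field; rewrite !gt_eqF//= ltr0Sn.
Qed.

Lemma is_derive_fB n x : is_derive x (1 : R) (fB n) (- fB n.+1 x).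
Proof.
have := is_derive_ps x ler01 (expb_jc n).
rewrite jc_diffs (_ : ps _ x = - fB n.+1 x)//.
have -> : (fun k => - jc n.+1 k) = (fun k => (-1) * jc n.+1 k) by apply/funext => k; rewrite mulN1r.
by rewrite (psZ _ _ ler01 (expb_jc n.+1)) mulN1r.
Qed.

(** Because differentiation shifts the index, this three-term relation is Bessel's equation
    $zf''+(n+1)f'+f=0$. *)
Lemma fB_recurrence n x : x * fB n.+2 x = n.+1%:R * fB n.+1 x - fB n x.
Proof.
have H2 := expb_jc n.+2; have H1 := expb_jc n.+1; have H0 := expb_jc n.
rewrite /fB -(ps_shift x ler01 H2) -(psZ n.+1%:R x ler01 H1).
have -> : - ps (jc n) x = ps (fun k => (-1) * jc n k) x by rewrite (psZ (-1) x ler01 H0) mulN1r.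
have E1 : expb (n.+1%:R * (n.+1)`!%:R^-1) 1 (fun k => n.+1%:R * jc n.+1 k).
  by move=> k; rewrite normrM ger0_norm// -mulrA ler_wpM2l// H1.
have E2 : expb (n`!%:R^-1) 1 (fun k => (-1) * jc n k).
  by move=> k; rewrite mulN1r normrN H0.
rewrite -(psD x ler01 E1 ler01 E2); congr (ps _ x); apply/funext => -[|k].
  rewrite /jc !addn0 fact0 !mul1n expr0 factS natrM.
  by have h := fact_gt0R n; field; rewrite !gt_eqF ?ltr0Sn.
rewrite /jc exprS !addSn addnS factS [in RHS]factS [(n + k).+1`!]factS !natrM.
have := fact_gt0R k; have := fact_gt0R (n + k) => h1 h2.
have h3 : 0 < k.+1%:R :> R by rewrite ltr0Sn.
have h4 : 0 < (n + k).+1%:R :> R by rewrite ltr0Sn.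
have h5 : 0 < (n + k).+2%:R :> R by rewrite ltr0Sn.
have -> : n.+1%:R = (n + k).+2%:R - k.+1%:R :> R.
  by apply/esym/eqP; rewrite subr_eq -natrD addSn addnS.
by field; rewrite !gt_eqF.
Qed.

Lemma smooth1_fB n : smooth1 (fB n).
Proof.
move=> k; elim: k n => [//|k ih] n.
apply: (@dkS _ _ _ (fun x => (-1) * fB n.+1 x)); last by apply: dkM => //; exact: dk_cst.
by move=> x; rewrite mulN1r; exact: is_derive_fB.
Qed.

(** Once the constant term is removed, the coefficients of $n!\,\mathrm{fB}_n$ carry
    $n!/(n+k)!\le1/(n+1)$ with $k\ge1$; the rest sums to an exponential. *)
Lemma fB_approx n x : `|n`!%:R * fB n x - 1| <= expR `|x| / n.+1%:R.
Proof.
have H := expb_jc n.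
rewrite -(psZ n`!%:R x ler01 H) -[X in _ - X](ps_delta0 x 1).
have E1 : expb (n`!%:R * n`!%:R^-1) 1 (fun k => n`!%:R * jc n k).
  by move=> k; rewrite normrM ger0_norm// -mulrA ler_wpM2l// H.
have E2 : expb 1 1 (fun k => if k is 0%N then (-1 : R) else 0).
  by move=> [|k]; rewrite expr1n mul1r mul1r ?normrN1 ?fact0 ?invr1// normr0 invr_ge0.
have -> : - ps (fun k => if k is 0%N then (1 : R) else 0) x = ps (fun k => if k is 0%N then -1 else 0) x.
  by rewrite !ps_delta0.
rewrite -(psD x ler01 E1 ler01 E2).
rewrite mulrC -[X in expR X]mul1r; apply: ps_le => // -[|k].
  by rewrite /jc addn0 fact0 mul1n expr0 mul1r divff ?subrr ?normr0 ?expr0 ?mul1r ?divr1 ?invr_ge0// gt_eqF// fact_gt0R.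
rewrite addr0 normrM norm_jc ger0_norm// expr1n mul1r invfM mulrCA mulrC.
rewrite ler_wpM2r ?invr_ge0// ler_pdivrMr ?fact_gt0R// ler_pdivlMl ?ltr0Sn//.
rewrite -natrM ler_nat -factS; apply: leq_trans (_ : (n + k.+1)`! <= _)%N => //.
by rewrite leq_fact// addnS ltnS leq_addr.
Qed.

End EntireSeries.

(** * The quotient $H_n'/H_n$ for large order *)

Section HankelAsymptotics.
Variable R : realType.
Implicit Types (x : R).

Lemma besselJE n x : besselJ n x = (x / 2) ^+ n * fB n ((x / 2) ^+ 2).
Proof.
apply/cvg_lim => //.
have := cvgn_mull (r := (x / 2) ^+ n) (is_cvg_ps (x := (x / 2) ^+ 2) ler01 (@expb_jc R n)).
move=> H; apply: eq_cvgn H => N; rewrite /series/= mulr_sumr; apply: eq_bigr => k _ /=.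
by rewrite /jc -exprM mul2n exprD; ring.
Qed.

Definition yc (n k : nat) : R :=
  (-1) ^+ k / (k`! * (n + k)`!)%:R * (harmonic_sum R k + harmonic_sum R (n + k)).
Definition gB n : R -> R := ps (yc n).

Lemma harmonic_sum_bound n : 0 <= harmonic_sum R n <= n%:R.
Proof.
rewrite /harmonic_sum big_add1/= sumr_ge0//=.
have -> : n%:R = \sum_(0 <= k < n) 1 :> R by rewrite big_const_nat iter_addr_0 subn0.
by apply: ler_sum => k _; rewrite invf_le1// ler1n.
Qed.

(** The crude bound $H_k+H_{m+1+k}\le2(m+1+k)$ for the harmonic sums is absorbed by the top factor
    of $(m+1+k)!$, whence $2/m!$ and an index of the form $m+1$. *)
Lemma expb_yc m : expb (2 / m`!%:R) 1 (yc m.+1).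
Proof.
move=> k; rewrite /yc normrM -/(jc R m.+1 k) norm_jc expr1n mul1r.
have /andP[h1 h2] := harmonic_sum_bound k; have /andP[h3 h4] := harmonic_sum_bound (m.+1 + k).
rewrite (ger0_norm (addr_ge0 h1 h3)).
have k0 := fact_gt0R R k; have m0 := fact_gt0R R m.
have mk0 := fact_gt0R R (m + k).
have s0 : 0 < (m + k).+1%:R :> R by rewrite ltr0Sn.
apply: (@le_trans _ _ ((k`!%:R * (m.+1 + k)`!%:R)^-1 * (2 * (m + k).+1%:R))).
  rewrite ler_wpM2l ?invr_ge0 ?mulr_ge0//.
  have : k%:R <= (m + k).+1%:R :> R by rewrite ler_nat; lia.
  by rewrite addSn in h4 *; lra.
rewrite addSn factS natrM.
have -> : (k`!%:R * ((m + k).+1%:R * (m + k)`!%:R))^-1 * (2 * (m + k).+1%:R) =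
    2 * (k`!%:R^-1 * ((m + k)`!%:R)^-1) :> R by field; rewrite !gt_eqF.
rewrite -mulrA ler_wpM2l// mulrC ler_wpM2r ?invr_ge0// lef_pV2 ?posrE//.
exact: fact_le_add.
Qed.

Lemma cabs_parts_div (w v : R[i]) : v != 0 ->
  complex.Re (w / v) = (complex.Re w * complex.Re v + complex.Im w * complex.Im v) /
    (complex.Re v ^+ 2 + complex.Im v ^+ 2).
Proof.
move: w v => [a b] [c d] v0 /=.
by rewrite mulrN opprK mulrDl !mulrA.
Qed.

(** The terms of the finite singular sum in $Y_n$; the one with $k=0$ dominates everything else for
    large $n$. *)
Definition tn n k (x : R) : R := (n - k).-1`!%:R / k`!%:R * (x / 2) ^+ k.*2 / (x / 2) ^+ n.

Definition Tn n x : R := \sum_(k < n) tn n k x.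

Lemma besselYE m x :
  besselY m.+1 x = 2 / pi * (ln (x / 2) + euler_gamma R) * besselJ m.+1 x
    - pi^-1 * Tn m.+1 x - pi^-1 * ((x / 2) ^+ m.+1 * gB m.+1 ((x / 2) ^+ 2)).
Proof.
congr (_ - _ * _); apply/cvg_lim => //.
have := cvgn_mull (r := (x / 2) ^+ m.+1) (is_cvg_ps (x := (x / 2) ^+ 2) ler01 (@expb_yc m)).
move=> H; apply: eq_cvgn H => N; rewrite /series/= mulr_sumr; apply: eq_bigr => k _ /=.
by rewrite /yc -exprM mul2n exprD; ring.
Qed.

Lemma is_derive_halfpow p x : 0 < x ->
  is_derive x (1 : R) (fun x => (x / 2) ^+ p) (p%:R / x * (x / 2) ^+ p).
Proof.
move=> x0; have h : is_derive x (1 : R) (fun x => x / 2) (2^-1).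
  by apply: is_derive_eq; rewrite /GRing.scale/=; ring.
case: p => [|p]; first by rewrite !mul0r; exact: is_derive_cst.
have := is_deriveX p.+1 h; rewrite exprfctE => H.
rewrite (_ : p.+1%:R / x * _ = (p.+1%:R * (x / 2) ^+ p) *: 2^-1).
  exact: H.
by rewrite exprS /GRing.scale/=; field; rewrite gt_eqF.
Qed.

Lemma is_derive_halfseries p (f : R -> R) f' x : 0 < x ->
  is_derive ((x / 2) ^+ 2) (1 : R) f f' ->
  is_derive x (1 : R) (fun x => (x / 2) ^+ p * f ((x / 2) ^+ 2))
    (x^-1 * (p%:R * ((x / 2) ^+ p * f ((x / 2) ^+ 2)) + (x / 2) ^+ p * (2 * (x / 2) ^+ 2 * f'))).
Proof.
move=> x0 hf; have h1 := is_derive_halfpow p x0; have h2 := is_derive_halfpow 2 x0.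
have h3 := @is_derive1_comp R f (fun x => (x / 2) ^+ 2) x _ _ hf h2.
have H := is_deriveM h1 h3.
apply: is_derive_eq; rewrite /GRing.scale/=; field; rewrite gt_eqF//.
Qed.

Lemma is_derive_Tn n x : 0 < x ->
  is_derive x (1 : R) (Tn n) (x^-1 * \sum_(k < n) (k.*2%:R - n%:R) * tn n k x).
Proof.
move=> x0.
have h (k : 'I_n) : is_derive x (1 : R) (tn n k) (x^-1 * ((k.*2%:R - n%:R) * tn n k x)).
  have h1 := is_derive_halfpow k.*2 x0; have h2 := is_derive_halfpow n x0.
  have y0 : (x / 2) ^+ n != 0 by rewrite expf_neq0// mulf_neq0 ?gt_eqF// invr_eq0.
  have h3 : is_derive x (1 : R) (fun x => ((x / 2) ^+ n)^-1) (- ((x / 2) ^+ n) ^- 2 * (n%:R / x * (x / 2) ^+ n)).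
    apply: DeriveDef; first by apply: derivableV => //; case: h2.
    by rewrite deriveV//; case: h2 => _ ->.
  have H := is_deriveM h1 h3.
  have H2 := is_deriveZ ((n - k).-1`!%:R / k`!%:R) H.
  have E : tn n k = ((n - k).-1`!%:R / k`!%:R) \*: ((fun x => (x / 2) ^+ k.*2) * (fun x => ((x / 2) ^+ n)^-1)).
    by apply/funext => y; rewrite /tn /GRing.scale/= -mulrA.
  rewrite {1}E; move: H2; congr is_derive; rewrite /tn /GRing.scale/=.
  move: y0; move: ((x / 2) ^+ n) ((x / 2) ^+ k.*2) (_`!%:R / _) (n%:R : R) (k.*2%:R : R) => B A c p q B0.
  by field; rewrite B0 gt_eqF.
  have := is_derive_sum h; rewrite -mulr_sumr.
congr is_derive; apply/funext => y; rewrite /Tn /tn.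
elim/big_ind2 : _ => // [f g a b <- <-]; by [].
Qed.

Lemma series_exp_coeff_le x n : 0 <= x -> series (exp_coeff x) n <= expR x.
Proof.
move=> x0; rewrite expRE /pseries -exp_coeffE.
apply: nondecreasing_cvgn_le; last exact: is_cvg_series_exp_coeff.
by apply: nondecreasing_series => k _ _; exact: exp_coeff_ge0.
Qed.

Lemma Tn_bounds m x (t := m`!%:R / (x / 2) ^+ m.+1) : 0 < x ->
  2 * expR ((x / 2) ^+ 2) <= m%:R ->
  t <= Tn m.+1 x <= 2 * t /\
  m.+1%:R * t / 2 <= - (\sum_(k < m.+1) (k.*2%:R - m.+1%:R) * tn m.+1 k x) <= 2 * (m.+1%:R * t).
Proof.
move=> x0 hm; set z := (x / 2) ^+ 2.
have y0 : 0 < x / 2 by rewrite divr_gt0.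
have m0 : 0 < m%:R :> R by apply: lt_le_trans hm; rewrite mulr_gt0// expR_gt0.
have m1 : (0 < m)%N by rewrite -(ltr0n R).
have t0 : 0 < t by rewrite divr_gt0 ?exprn_gt0// fact_gt0R.
have E0 : tn m.+1 0 x = t by rewrite /tn/= fact0 divr1 double0 expr0 mulr1.
have tn0 k : 0 <= tn m.+1 k x.
  by rewrite !mulr_ge0// ?invr_ge0// exprn_ge0// ltW.
have tnle (i : 'I_m) : tn m.+1 i.+1 x <= t / m%:R * exp_coeff z i.+1.
  rewrite /tn /t exp_coeffE/= -mul2n exprM -/z subSS.
  set c := (_`!%:R : R).
  have -> : m`!%:R / (x / 2) ^+ m.+1 / m%:R * ((i.+1)`!%:R^-1 * z ^+ i.+1) =
     (m`!%:R / m%:R) / (i.+1)`!%:R * z ^+ i.+1 / (x / 2) ^+ m.+1 by ring.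
  rewrite ler_wpM2r//; first by rewrite invr_ge0 exprn_ge0// ltW.
  rewrite ler_wpM2r//; first exact: exprn_ge0 (sqr_ge0 _).
  rewrite ler_wpM2r ?invr_ge0// ler_pdivlMr// -natrM ler_nat.
  case: m m1 {hm m0 t t0 E0 tn0 c} i => // m _ i.
  by rewrite factS mulnC leq_mul2l leq_fact ?orbT//; lia.
have S0 : 0 <= \sum_(i < m) tn m.+1 i.+1 x by apply: sumr_ge0.
have S1 : \sum_(i < m) tn m.+1 i.+1 x <= t / 2.
  apply: (@le_trans _ _ (\sum_(i < m) t / m%:R * exp_coeff z i.+1)).
    by apply: ler_sum => i _.
  rewrite -mulr_sumr -mulrA ler_pM2l// ler_pdivrMl//.
  have := @series_exp_coeff_le z m.+1 (sqr_ge0 _).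
  rewrite /series/= big_nat_recl// big_mkord.
  have : 0 <= exp_coeff z 0 by apply: exp_coeff_ge0; exact: sqr_ge0.
  move: (exp_coeff z 0) (\sum_(i < m) _) hm => p q; rewrite -/z; move: (expR z) => w.
  by lra.
have S2 : `|\sum_(i < m) (i.+1.*2%:R - m.+1%:R) * tn m.+1 i.+1 x| <= m.+1%:R * (t / 2).
  apply: le_trans (ler_norm_sum _ _ _) _.
  apply: le_trans (ler_wpM2l _ S1) => //; rewrite mulr_sumr; apply: ler_sum => i _.
  rewrite normrM [X in _ * X]ger0_norm// ler_wpM2r// ler_norml.
  have := ltn_ord i => hi.
  have h1 : i.+1.*2%:R <= m.+1%:R + m.+1%:R :> R by rewrite -natrD ler_nat; lia.
  have h2 : 0 <= i.+1.*2%:R :> R by [].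
  by lra.
split.
  rewrite /Tn big_ord_recl/= E0; under eq_bigr do rewrite /bump/= add1n.
  by move: S0 S1; set S := (\sum_(i < m) _) => S0 S1; apply/andP; split; lra.
rewrite big_ord_recl/= E0 double0 sub0r; under eq_bigr do rewrite /bump/= add1n.
move: S2; rewrite ler_norml; set S := (\sum_(i < m) _) => /andP[h1 h2].
rewrite mulNr; have : 0 < m.+1%:R * t by rewrite mulr_gt0.
move: h1 h2; rewrite mulrA; move: (m.+1%:R * t) => w h1 h2 w0.
by apply/andP; split; lra.
Qed.

(** Here $c=1/\pi$. The dominant parts [b] of $Y$ and [b'] of $Y'$ have opposite signs and sizes of
    order $t$ and $nt$, while the parts of $J$ are below $t/8$. Hence $Y'Y$ outweighs $J'J$, which
    settles the sign of $\Re(H_n'/H_n)$, and the ratio of moduli is of order $n$. *)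
Lemma hankel_quotient_bounds (x t n J' Y' J Y a b a' b' c : R) :
  0 < x -> 0 < t -> 1 <= n -> 4^-1 <= c <= 2^-1 ->
  J = a -> Y = c * b -> J' = x^-1 * a' -> Y' = x^-1 * (c * b') ->
  `|a| <= t / 8 -> `|a'| <= t / 8 ->
  - (17 / 8 * t) <= b <= - (7 / 8 * t) ->
  3 / 8 * (n * t) <= b' <= 17 / 8 * (n * t) ->
  J' * J + Y' * Y <= 0 /\
  J' ^+ 2 + Y' ^+ 2 <= (8 / x * n) ^+ 2 * (J ^+ 2 + Y ^+ 2).
Proof.
move=> x0 t0 n1 /andP[c1 c2] -> -> -> ->.
rewrite !ler_norml => /andP[ha1 ha2] /andP[ha'1 ha'2] /andP[hb1 hb2] /andP[hb'1 hb'2].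
have nt : t <= n * t by rewrite ler_peMl// ltW.
have sa : a ^+ 2 <= (t / 8) ^+ 2 by rewrite -real_normK ?num_real// lerXn2r ?nnegrE// ?ler_norml ?divr_ge0 ?(ltW t0)//; apply/andP.
have sa' : a' ^+ 2 <= (t / 8) ^+ 2 by rewrite -real_normK ?num_real// lerXn2r ?nnegrE// ?ler_norml ?divr_ge0 ?(ltW t0)//; apply/andP.
have aa : a' * a <= (t / 8) ^+ 2 by have := sqr_ge0 (a' - a); nra.
have cc1 : 16^-1 <= c ^+ 2 by nra.
have cc2 : c ^+ 2 <= 4^-1 by nra.
have bb : b' * (- b) >= 3 / 8 * t * (7 / 8 * t) by apply: ler_pM; lra.
have b2 : (7 / 8 * t) ^+ 2 <= b ^+ 2 by rewrite -(sqrrN b) lerXn2r ?nnegrE; lra.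
have b'2 : b' ^+ 2 <= (17 / 8 * (n * t)) ^+ 2 by rewrite lerXn2r ?nnegrE; lra.
have t2 : 0 < t ^+ 2 by rewrite exprn_gt0.
have nt2 : t ^+ 2 <= (n * t) ^+ 2 by rewrite lerXn2r ?nnegrE; lra.
split.
  have -> : x^-1 * a' * a + x^-1 * (c * b') * (c * b) = x^-1 * (a' * a - c ^+ 2 * (b' * (- b))) by ring.
  rewrite pmulr_rle0 ?invr_gt0// subr_le0; apply: le_trans aa _.
  have : 16^-1 * (3 / 8 * t * (7 / 8 * t)) <= c ^+ 2 * (b' * - b).
    by apply: ler_pM => //; nra.
  by apply: le_trans; nra.
have -> : (x^-1 * a') ^+ 2 + (x^-1 * (c * b')) ^+ 2 = (x^-1) ^+ 2 * (a' ^+ 2 + c ^+ 2 * b' ^+ 2) by ring.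
have -> : (8 / x * n) ^+ 2 * (a ^+ 2 + (c * b) ^+ 2) =
  (x^-1) ^+ 2 * (64 * (n ^+ 2 * (a ^+ 2 + c ^+ 2 * b ^+ 2))) by ring.
rewrite ler_wpM2l ?sqr_ge0//.
have h1 : c ^+ 2 * b' ^+ 2 <= 4^-1 * (17 / 8 * (n * t)) ^+ 2 by apply: ler_pM => //; exact: sqr_ge0.
have h2 : 16^-1 * (7 / 8 * t) ^+ 2 <= c ^+ 2 * b ^+ 2 by apply: ler_pM => //; exact: sqr_ge0.
have h3 : n ^+ 2 * (16^-1 * (7 / 8 * t) ^+ 2) <= n ^+ 2 * (a ^+ 2 + c ^+ 2 * b ^+ 2).
  by rewrite ler_wpM2l ?sqr_ge0//; have := sqr_ge0 a; lra.
have h4 : n ^+ 2 * (16^-1 * (7 / 8 * t) ^+ 2) = 49 / 1024 * (n * t) ^+ 2 by field.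
move: h3; rewrite h4 => h3.
have h5 : (17 / 8 * (n * t)) ^+ 2 = 289 / 64 * (n * t) ^+ 2 by field.
have h6 : (t / 8) ^+ 2 = t ^+ 2 / 64 by field.
by rewrite h5 in h1; rewrite h6 in sa'; lra.
Qed.

Lemma derive1_val (f : R -> R) (x df : R) : is_derive x (1 : R) f df -> derive1 f x = df.
Proof. by move=> [_ <-]; rewrite derive1E. Qed.

Lemma derive1_besselJ n x : 0 < x ->
  is_derive x (1 : R) (@besselJ R n) (x^-1 * (n%:R * besselJ n x +
    (x / 2) ^+ n * (2 * (x / 2) ^+ 2 * - fB n.+1 ((x / 2) ^+ 2)))).
Proof.
move=> x0; rewrite besselJE.
rewrite (_ : @besselJ R n = fun x => (x / 2) ^+ n * fB n ((x / 2) ^+ 2)); last first.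
  by apply/funext => y; exact: besselJE.
by apply: is_derive_halfseries => //; exact: is_derive_fB.
Qed.

Lemma derive1_besselY m x : 0 < x ->
  is_derive x (1 : R) (@besselY R m.+1) (x^-1 * (pi^-1 *
   (2 * besselJ m.+1 x + 2 * (ln (x / 2) + euler_gamma R) *
      (m.+1%:R * besselJ m.+1 x + (x / 2) ^+ m.+1 * (2 * (x / 2) ^+ 2 * - fB m.+2 ((x / 2) ^+ 2)))
    - (\sum_(k < m.+1) (k.*2%:R - m.+1%:R) * tn m.+1 k x)
    - (m.+1%:R * ((x / 2) ^+ m.+1 * gB m.+1 ((x / 2) ^+ 2)) +
       (x / 2) ^+ m.+1 * (2 * (x / 2) ^+ 2 * ps (pseries_diffs (yc m.+1)) ((x / 2) ^+ 2)))))).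
Proof.
move=> x0; have y0 : 0 < x / 2 by rewrite divr_gt0.
have hl : is_derive x (1 : R) (fun x => ln (x / 2)) (x^-1).
  have h : is_derive x (1 : R) (fun x => x / 2) (2^-1).
    by apply: is_derive_eq; rewrite /GRing.scale/=; ring.
  have H := @is_derive1_comp R (@ln R) (fun x => x / 2) x _ _ (is_derive1_ln y0) h.
  rewrite (_ : x^-1 = (x / 2)^-1 * 2^-1) //.
  by field; rewrite gt_eqF.
have hT := is_derive_Tn m.+1 x0; have hJ := derive1_besselJ m.+1 x0.
have hG := is_derive_halfseries m.+1 x0 (is_derive_ps ((x / 2) ^+ 2) ler01 (@expb_yc m)).
rewrite (_ : @besselY R m.+1 = fun x => 2 / pi * (ln (x / 2) + euler_gamma R) * besselJ m.+1 x
    - pi^-1 * Tn m.+1 x - pi^-1 * ((x / 2) ^+ m.+1 * gB m.+1 ((x / 2) ^+ 2))); last first.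
  by apply/funext => y; exact: besselYE.
have hl2 := is_deriveD hl (is_derive_cst (euler_gamma R) x (1 : R)).
have h1 := is_deriveM (is_deriveZ (2 / pi) hl2) hJ.
have H := is_deriveB (is_deriveB h1 (is_deriveZ (pi^-1) hT)) (is_deriveZ (pi^-1) hG).
move: H; congr is_derive; rewrite /GRing.scale/= fctE /GRing.scale/= addr0 /gB.
move: (ps (yc _) _) (ps (pseries_diffs _) _) (\sum_(_ < _) _) (ln _ + _) (fB _ _) (besselJ _ _) => A1 A2 A3 A4 A5 A6.
by ring.
Qed.

Lemma ps_bound (M : R) c (z : R) : 0 <= z -> expb M 1 c -> `|ps c z| <= M * expR z.
Proof. by move=> z0 h; have := ps_le z ler01 h; rewrite mul1r (ger0_norm z0). Qed.

(** Apart from the finite sum [Tn], the functions $J_n$, $Y_n$ and their derivatives are, up to the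
    factors $1/x$ and $1/\pi$, made of $D=(x/2)^n$ times entire functions and of the logarithmic
    factor $L$. All these pieces are put under one bound of order $n\,w$. *)
Lemma hankel_remainders (D z L w F F2 g g' n : R) :
  0 <= z -> 1 <= n -> `|D * F| <= w -> `|D * F2| <= w -> `|D * g| <= 2 * w -> `|D * g'| <= 2 * w ->
  let K := (4 + 2 * `|L|) * (1 + 2 * z) * (n * w) in
  let a' := n * (D * F) + D * (2 * z * - F2) in
  [/\ `|D * F| <= K, `|a'| <= K, `|2 * L * (D * F) - D * g| <= K &
      `|2 * (D * F) + 2 * L * a' - (n * (D * g) + D * (2 * z * g'))| <= K].
Proof.
move=> z0 n1 hF hF2 hg hg' K a'.
have w0 : 0 <= w by apply: le_trans hF.
have L0 : 0 <= `|L| by [].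
have nw : w <= n * w by rewrite ler_peMl.
have zw : z * w <= z * (n * w) by rewrite ler_wpM2l.
set v := n * w in K nw zw *.
have v0 : 0 <= v by apply: le_trans nw.
have zv : 0 <= z * v by apply: mulr_ge0.
have Lv : 0 <= `|L| * v by apply: mulr_ge0.
have Lzv : 0 <= `|L| * (z * v) by apply: mulr_ge0.
have EK : K = 4 * v + 8 * (z * v) + 2 * (`|L| * v) + 4 * (`|L| * (z * v)) by rewrite /K; ring.
have Ha' : `|a'| <= v + 2 * (z * v).
  apply: le_trans (ler_normD _ _) _; rewrite normrM (ger0_norm (le_trans ler01 n1)).
  apply: lerD; first by rewrite ler_wpM2l// (le_trans ler01).
  rewrite (_ : D * _ = - (2 * z * (D * F2))); last by ring.
  by rewrite normrN normrM ger0_norm ?mulr_ge0// -mulrA ler_wpM2l// (le_trans _ zw)// ler_wpM2l.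
have HLF : `|2 * L * (D * F)| <= 2 * (`|L| * v).
  rewrite !normrM -!normrM normrM normrM ger0_norm// -mulrA ler_wpM2l// ler_wpM2l//.
  exact: le_trans nw.
have HLa : `|2 * L * a'| <= 2 * (`|L| * v) + 4 * (`|L| * (z * v)).
  rewrite normrM normrM ger0_norm// -mulrA.
  have : `|L| * `|a'| <= `|L| * (v + 2 * (z * v)) by rewrite ler_wpM2l.
  by rewrite mulrDr mulrCA; lra.
have Hg : `|n * (D * g)| <= 2 * v.
  rewrite normrM (ger0_norm (le_trans ler01 n1)) /v mulrCA ler_wpM2l// (le_trans ler01)//.
have Hg' : `|D * (2 * z * g')| <= 4 * (z * v).
  rewrite (_ : D * _ = 2 * z * (D * g')); last by ring.
  rewrite normrM ger0_norm ?mulr_ge0// -mulrA.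
  have : z * `|D * g'| <= z * (2 * w) by rewrite ler_wpM2l.
  by rewrite mulrCA; lra.
rewrite EK; split.
- by lra.
- by lra.
- apply: le_trans (ler_normB _ _) _; lra.
- apply: le_trans (ler_normB _ _) _.
  have h1 := ler_normD (2 * (D * F)) (2 * L * a').
  have h2 := ler_normD (n * (D * g)) (D * (2 * z * g')).
  have h3 : `|2 * (D * F)| = 2 * `|D * F| by rewrite normrM ger0_norm.
  by lra.
Qed.

(** With $z^{m+1}=D^2$, the second inequality says that the remainders $K\,n\,w$, for $w=De^z/m!$,
    are at most one eighth of the leading term $t=m!/D$. *)
Lemma hankel_large_order (z K : R) : 0 < z -> 0 <= K ->
  exists m0 : nat, forall m, (m0 <= m)%N ->
    2 * expR z <= m%:R /\ 8 * (K * (m.+1%:R * (z ^+ m.+1 * expR z))) <= m`!%:R ^+ 2.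
Proof.
move=> z0 K0; set A := 8 * K * expR z * z.
have A0 : 0 <= A by rewrite !mulr_ge0// ?expR_ge0// ltW.
(* The limit is taken with $2z$ instead of $z$ so that the spare $2^m$ absorbs the factor $m+1$. *)
have := @cvg_exp_coeff R (2 * z); move=> /cvgrPdist_lt /(_ ((A + 1)^-1)).
rewrite invr_gt0 ltr_wpDl// => /(_ isT)[m1 _ hm1].
have [m2 hm2] : exists m2 : nat, 2 * expR z <= m2%:R.
  by exists (Num.bound (2 * expR z)); apply/ltW/archi_boundP; rewrite mulr_ge0// expR_ge0.
exists (maxn m1 m2) => m; rewrite geq_max => /andP[l1 l2]; split.
  by apply: le_trans hm2 _; rewrite ler_nat.
have := hm1 m l1; rewrite /= sub0r normrN exp_coeffE/= ger0_norm; last first.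
  by rewrite mulr_ge0 ?invr_ge0// exprn_ge0// mulr_ge0// ltW.
rewrite ltr_pdivrMl ?fact_gt0R// -[X in _ < X]/(_ / _) => /ltW h.
have hA : A * (2 * z) ^+ m <= m`!%:R.
  rewrite ler_pdivlMr in h; last by rewrite ltr_wpDl.
  have : 0 <= (2 * z) ^+ m by rewrite exprn_ge0// mulr_ge0// ltW.
  by rewrite mulrDr mulr1 mulrC in h; lra.
apply: le_trans (_ : A * (2 * z) ^+ m <= _).
  rewrite /A exprMn exprS.
  have -> : 8 * (K * (m.+1%:R * (z * z ^+ m * expR z))) =
    (8 * K * expR z * z) * z ^+ m * m.+1%:R by ring.
  rewrite -/A [X in _ <= X](_ : _ = A * z ^+ m * 2 ^+ m); last by ring.
  rewrite ler_wpM2l ?mulr_ge0// ?exprn_ge0// ?(ltW z0)//.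
  by rewrite -natrX ler_nat ltn_expl.
apply: le_trans hA _; rewrite expr2 ler_peMl// ler1n fact_gt0//.
Qed.

(** For large order $\pi Y_n$ is close to $-(n-1)!\,(2/x)^n$ and swamps $J_n$, so that $H_n'/H_n$
    behaves like $-n/x$. *)
Theorem hankel_asymptotics (x : R) : 0 < x ->
  exists (n0 : nat) (C : R), 0 < C /\ forall n, (n0 <= n)%N ->
    complex.Re (hankel1' n x / hankel1 n x) <= 0 /\
    cabs (hankel1' n x / hankel1 n x) <= C * n%:R.
Proof.
move=> x0; set y := x / 2; set z := y ^+ 2; set L := ln y + euler_gamma R.
have y0 : 0 < y by rewrite divr_gt0.
have z0 : 0 < z by rewrite exprn_gt0.
set K := (4 + 2 * `|L|) * (1 + 2 * z).
have K0 : 0 <= K by rewrite mulr_ge0// addr_ge0// mulr_ge0// ltW.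
have [m0 hm0] := hankel_large_order z0 K0.
exists m0.+1, (8 / x); split; first by rewrite divr_gt0.
case=> // m; rewrite ltnS => /hm0[h1 h2].
set D := y ^+ m.+1.
have D0 : 0 < D by rewrite exprn_gt0.
set w := D * (expR z / m`!%:R); set t := m`!%:R / D.
have f0 := fact_gt0R R m.
have t0 : 0 < t by rewrite divr_gt0.
have n1 : 1 <= m.+1%:R :> R by rewrite ler1n.
have hK : K * (m.+1%:R * w) <= t / 8.
  rewrite /t ler_pdivlMr// ler_pdivlMr//.
  have zE : z ^+ m.+1 = D ^+ 2 by rewrite /z /D -!exprM mulnC.
  have : 8 * (K * (m.+1%:R * (z ^+ m.+1 * expR z))) / m`!%:R <= m`!%:R.
    by rewrite ler_pdivrMr// -expr2.
  by rewrite zE; congr (_ <= _); rewrite /w; ring.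
have bnd (c : nat -> R) r : 0 <= r -> expb (r / m`!%:R) 1 c -> `|D * ps c z| <= r * w.
  move=> r0 hc; rewrite normrM (ger0_norm (ltW D0)) /w mulrCA ler_wpM2l ?(ltW D0)//.
  by have := ps_bound (ltW z0) hc; congr (_ <= _); ring.
have expbW (c : nat -> R) r r' : r <= r' -> expb r 1 c -> expb r' 1 c.
  by move=> rr hc k; apply: le_trans (hc k) _; rewrite ler_wpM2r// mulr_ge0 ?invr_ge0 ?exprn_ge0.
have hj k : (m <= k)%N -> `|D * fB k z| <= w.
  move=> mk; rewrite -[w]mul1r; apply: bnd => //; apply: expbW (expb_jc R k).
  by rewrite mul1r lef_pV2 ?posrE ?fact_gt0R// ler_nat leq_fact.
have hg : `|D * gB m.+1 z| <= 2 * w by apply: bnd => //; exact: expb_yc.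
have hg' : `|D * ps (pseries_diffs (yc m.+1)) z| <= 2 * w.
  by apply: bnd => //; have := expb_diffs ler01 (expb_yc m); rewrite mulr1.
have [r1 r2 r3 r4] := hankel_remainders L (ltW z0) n1 (hj m.+1 (leqW (leqnn _))) (hj m.+2 (leqW (leqW (leqnn _)))) hg hg'.
have {}r1 := le_trans r1 hK; have {}r2 := le_trans r2 hK.
have {}r3 := le_trans r3 hK; have {}r4 := le_trans r4 hK.
have [] := Tn_bounds x0 h1; rewrite -/y -/D -/t => /andP[T1 T2] /andP[S1 S2].
have nt : t <= m.+1%:R * t by rewrite ler_peMl// ltW.
have pi2 := pi_ge2 R; have [/andP[_ pi4] _] := pihalf_02_cos_pihalf R.
have p0 : 0 < pi :> R := pi_gt0 R.
have pc : 4^-1 <= (pi : R)^-1 <= 2^-1 by rewrite !lef_pV2 ?posrE// pi2 andbT; lra.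
have JE : besselJ m.+1 x = D * fB m.+1 z by rewrite besselJE.
have YE : besselY m.+1 x = pi^-1 * (2 * L * (D * fB m.+1 z) - D * gB m.+1 z - Tn m.+1 x).
  by rewrite besselYE JE -/y -/D -/z -/L; ring.
have J'E := derive1_val (derive1_besselJ m.+1 x0).
have Y'E := derive1_val (derive1_besselY m x0).
rewrite -/y -/D -/z JE in J'E; rewrite -/y -/D -/z -/L JE in Y'E.
move: r4; set a' := (m.+1%:R * (D * fB m.+1 z) + _) in r2 J'E Y'E * => r4.
set S := (\sum_(k < m.+1) _) in S1 S2 Y'E.
move: r3 r4; rewrite !ler_norml => /andP[r31 r32] /andP[r41 r42].
have [||q1 q2] := hankel_quotient_bounds x0 t0 n1 pc JE YE J'E Y'E r1 r2.
- by move: r31 r32 T1 T2 t0; clear; move=> *; apply/andP; split; lra.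
- by move: nt S1 S2 r41 r42; clear; move: (m.+1%:R * t) => nt *; apply/andP; split; lra.
(* The dominant term also shows that $H_n$ does not vanish, so the quotient is a genuine one. *)
have Y0 : besselY m.+1 x != 0.
  have h : 2 * L * (D * fB m.+1 z) - D * gB m.+1 z - Tn m.+1 x < 0.
    by move: r32 T1 t0; clear; lra.
  by rewrite YE mulf_neq0 ?invr_neq0// ?(lt_eqF h)// gt_eqF.
have v0 : hankel1 m.+1 x != 0 by rewrite eq_complex negb_and /= Y0 orbT.
split.
  rewrite cabs_parts_div//= pmulr_lle0// invr_gt0 ltr_wpDl ?sqr_ge0//.
  by rewrite lt_neqAle sqr_ge0 andbT eq_sym expf_neq0.
rewrite ComplexField.Normc.normcM ComplexField.Normc.normcV ler_pdivrMr; last first.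
  by rewrite lt_neqAle cabs_ge0 andbT eq_sym; apply: contra v0 => /eqP/ComplexField.Normc.eq0_normc ->.
have C0 : 0 <= 8 / x * m.+1%:R * cabs (hankel1 m.+1 x).
  by rewrite !mulr_ge0 ?cabs_ge0// invr_ge0 ltW.
rewrite -[X in X <= _]ger0_norm ?cabs_ge0//; apply: le_sqr_I => //.
by rewrite exprMn !sqr_cabs.
Qed.

End HankelAsymptotics.

(** * Sine coefficients of traces *)

Section GreenData.
Variables (R : realType) (G : cavity R).
Local Notation T1 := (measurableTypeR R).
Local Notation I2 A f := (Rintegral (@leb2 R) A f).
Local Notation I1 A f := (Rintegral (@leb1 R) A f).
Local Notation r := (Rad G).
Local Notation hd := (half_disk r).
Local Notation arc := (`]0%R, pi[%classic : set R).
Implicit Types (w q : R * R -> R) (g : R -> R) (u : R * R -> R[i]).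

(** The radial Gauss formula for a product $wq$ with [w] in $H^1$. Beyond its square integrability,
    the trace on the arc enters the estimates only through this identity. *)
Definition radial_identity w (w1 w2 : R * R -> R) g := forall q, smooth q ->
  I2 hd (fun x => (x.1 * w1 x + x.2 * w2 x) * q x + w x * (Eop q x + 2 * q x)) =
  r ^+ 2 * I1 arc (fun t => g t * q (r * cos t, r * sin t)).

(** The test function must vanish on $|s|\le\hat R$, since over the aperture the trace of [w] is
    unknown. *)
Definition angular_identity w (w1 w2 : R * R -> R) := forall q, smooth q ->
  (forall s, `|s| <= Rhat G -> q (s, 0) = 0) ->
  I2 hd (fun x => (x.1 * w2 x - x.2 * w1 x) * q x + w x * Aop q x) = 0.

Lemma sqint_arc_smooth (f : R * R -> R) : smooth f ->
  sqint (@leb1 R) arc (fun t => f (arc_point G t)).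
Proof.
move=> sf; have cf := continuous_arc (r := r) (smooth_continuous sf).
have [M HM] := continuous_bounded_itv 0 pi cf.
have mA : measurable (arc : set T1) by exact: measurable_itv.
have fin : (@leb1 R arc < +oo)%E by rewrite leb1_itv ?pi_ge0// ltry.
apply: (bounded_sqint mA fin (M := M)).
- by apply: measurable_funTS; exact: continuous_measurable_fun.
- by move=> t /=; rewrite in_itv/= => /andP[t0 tp]; apply: HM; rewrite !ltW.
Qed.

Lemma sqint_flat_smooth (f : R * R -> R) : smooth f ->
  sqint (@leb1 R) `](- r), r[ (fun t => f (t, 0)).
Proof.
move=> sf; have cf := continuous_flat (smooth_continuous sf).
have rr : - r <= r by rewrite ge0_cp// ltW// Rad_gt0.
have [M HM] := continuous_bounded_itv (- r) r cf.
have mA : measurable (`](- r), r[%classic : set T1) by exact: measurable_itv.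
have fin : (@leb1 R (`](- r)%R, r[%classic : set R) < +oo)%E by rewrite (leb1_itv _ _ rr) ltry.
apply: (bounded_sqint mA fin (M := M)).
- by apply: measurable_funTS; exact: continuous_measurable_fun.
- by move=> t /=; rewrite in_itv/= => /andP[t0 tp]; apply: HM; rewrite !ltW.
Qed.

Lemma trace_radial u (g : R -> R[i]) : H1 (Omega G) u ->
  is_trace hd (arc_point G) arc u g -> forall b,
  sqint (@leb1 R) arc (fun t => part b (g t)) /\
  radial_identity (fun x => part b (u x)) (fun x => part b (weak_deriv (Omega G) (e1 R) u x))
    (fun x => part b (weak_deriv (Omega G) (e2 R) u x)) (fun t => part b (g t)).
Proof.
move=> Hu tg b; have marc : measurable (arc : set T1) by exact: measurable_itv.
have [Lg _] := tg; have sg := (L2P _ marc g).1 Lg b.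
have [phi [sphi c0 c1 c2 cg]] := trace_data marc Hu tg sqint_arc_smooth b.
have [Lu [h1 /weak_derivP[L1 _]] [h2 /weak_derivP[L2 _]]] := Hu.
split=> // q sq.
exact: (H1_radial (Rad_gt0 G) (sqint_sub_Omega b Lu) (sqint_sub_Omega b L1)
  (sqint_sub_Omega b L2) sphi c0 c1 c2 sq sg cg).
Qed.

Lemma H10_angular u : H10 G u -> forall b,
  angular_identity (fun x => part b (u x)) (fun x => part b (weak_deriv (Omega G) (e1 R) u x))
    (fun x => part b (weak_deriv (Omega G) (e2 R) u x)).
Proof.
move=> [Hu [g tg g0] _] b.
have E : [set t : R | `|t| < r] = `](- r), r[%classic.
  by apply/seteqP; split => t /=; rewrite in_itv/= ltr_norml.
have {}g0 : {ae @leb1 R, forall t, `](- r), r[%classic t -> (wall G `|` ground G) (t, 0) -> g t = 0}.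
  by rewrite -E.
rewrite E in tg.
have mI : measurable (`](- r), r[%classic : set T1) by exact: measurable_itv.
have [Lg _] := tg; have sg := (L2P _ mI g).1 Lg b.
have [phi [sphi c0 c1 c2 cg]] := trace_data mI Hu tg sqint_flat_smooth b.
have [Lu [h1 /weak_derivP[L1 _]] [h2 /weak_derivP[L2 _]]] := Hu.
move=> q sq q0.
apply: (H1_angular (Rad_gt0 G) (sqint_sub_Omega b Lu) (sqint_sub_Omega b L1)
  (sqint_sub_Omega b L2) sphi c0 c1 c2 sq sg cg).
case: g0 => N [mN N0 NS]; exists N; split => // s /= ns; apply: NS => /= gs; apply: ns => si.
have [sR|sR] := leP `|s| (Rhat G); first by rewrite q0// mulr0.
have {}gs := gs si.
(* A flat boundary point with $|s|>\hat R$ is on the ground plane: the closure of the aperture stays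
   within $|x_1|\le\hat R$. *)
rewrite gs ?part0 ?mul0r//; right; split => // cl.
suff : `|s| <= Rhat G by rewrite leNgt sR.
have cF : closed [set x : R * R | `|x.1| <= Rhat G].
  have -> : [set x : R * R | `|x.1| <= Rhat G] = (fun x => `|x.1|) @^-1` [set y | y <= Rhat G] by [].
  apply: closed_comp; last exact: closed_le.
  by move=> x _; apply: continuous_comp; [exact: cvg_fst|exact: norm_continuous].
apply: (cF (s, 0)).
by apply: closure_subset cl => x [/apert_Rhat /ltW].
Qed.

(** The $n$-th sine coefficient of a real function of the angle, unrelated to the cardinal sine. *)
Definition sinc g n : R := 2 / pi * I1 arc (fun t => g t * sin (n%:R * t)).

Lemma part_sine_coef b (g : R -> R[i]) n :
  part b (sine_coef g n) = sinc (fun t => part b (g t)) n.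
Proof.
rewrite /sine_coef mulrC partM part_cint mulrC; congr (_ * _).
by apply: eq_Rintegral => t _; rewrite partM.
Qed.

End GreenData.

(** * Cutoff functions and their derivatives *)

Section ModeEstimates.
Variables (R : realType).

(** Continuity of the derivative carries its vanishing to the endpoints, where the function is known
    to be constant on one side only. *)
Lemma derive1_closure (h : R -> R) (a : R) (U : set R) : open U -> smooth1 h ->
  (forall s, U s -> h s = a) -> forall s, closure U s -> derive1 h s = 0.
Proof.
move=> oU sh ha.
have hU s : U s -> derive1 h s = 0.
  move=> Us; suff H : is_derive s (1 : R) h 0 by rewrite derive1E; case: H.
  apply: (@near_eq_is_derive _ _ _ (fun=> a)).
  have : nbhs s U by apply: open_nbhs_nbhs.
  by apply: filterS => y /ha ->.
move=> s cs; apply/eqP; apply/negPn/negP => n0.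
have cf : {for s, continuous (derive1 h)} := is_derive_continuous (smooth1_is_derive s (smooth1_derive sh)).
have : \forall y \near s, derive1 h y != 0 by exact: cvgr_neq0 cf n0.
by move=> /cs[y [/hU ->]] /=; rewrite eqxx.
Qed.

Lemma derive1_left (h : R -> R) (c : R) : smooth1 h -> (forall s, s <= c -> h s = 0) ->
  forall s, s <= c -> derive1 h s = 0.
Proof.
move=> sh h0 s sc; apply: (@derive1_closure h 0 [set y | y < c]) ; [exact: open_lt|exact: sh|by move=> y /ltW /h0|].
move=> B [e /= e0 sB]; have e2 : 0 < e / 2 by rewrite divr_gt0.
exists (s - e / 2); split => /=; first by move: sc e2; lra.
apply: sB; rewrite /ball_/= opprB addrC subrK ger0_norm ?divr_ge0 ?ltW//.
by rewrite ltr_pdivrMr// ltr_pMr// ltr1n.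
Qed.

Lemma derive1_right (h : R -> R) (a c : R) : smooth1 h -> (forall s, c <= s -> h s = a) ->
  forall s, c <= s -> derive1 h s = 0.
Proof.
move=> sh h0 s sc; apply: (@derive1_closure h a [set y | c < y]) ; [exact: open_gt|exact: sh|by move=> y /ltW /h0|].
move=> B [e /= e0 sB]; have e2 : 0 < e / 2 by rewrite divr_gt0.
exists (s + e / 2); split => /=; first by move: sc e2; lra.
apply: sB; rewrite /ball_/= opprD addrA subrr sub0r normrN ger0_norm ?divr_ge0 ?ltW//.
by rewrite ltr_pdivrMr// ltr_pMr// ltr1n.
Qed.

Definition cutoff (c d s : R) : R := step (d^-1 * s + - (d^-1 * c)).

Lemma smooth1_cutoff c d : smooth1 (cutoff c d).
Proof. exact/smooth1_affine/smooth1_step. Qed.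

Lemma is_derive_affine (h : R -> R) (a b s : R) : smooth1 h ->
  is_derive s (1 : R) (fun s => h (a * s + b)) (a * derive1 h (a * s + b)).
Proof.
move=> sh; have H : is_derive s (1 : R) (fun s => a * s + b) a.
  by apply: is_derive_eq; rewrite /GRing.scale/=; ring.
have := @is_derive1_comp R h (fun s => a * s + b) s _ _ (smooth1_is_derive _ sh) H.
by rewrite mulrC.
Qed.

Lemma derive1_cutoff c d s : derive1 (cutoff c d) s = d^-1 * derive1 (@step R) (d^-1 * s + - (d^-1 * c)).
Proof. by rewrite derive1E; case: (is_derive_affine d^-1 (- (d^-1 * c)) s (@smooth1_step R)). Qed.

Lemma derive2_cutoff c d s : derive1 (derive1 (cutoff c d)) s =
  d^-1 ^+ 2 * derive1 (derive1 (@step R)) (d^-1 * s + - (d^-1 * c)).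
Proof.
have -> : derive1 (cutoff c d) = (fun s => d^-1 * derive1 (@step R) (d^-1 * s + - (d^-1 * c))).
  by apply/funext => y; exact: derive1_cutoff.
have H := is_derive_affine d^-1 (- (d^-1 * c)) s (smooth1_derive (@smooth1_step R)).
have H2 := is_deriveZ d^-1 H.
by rewrite derive1E (@derive_val _ _ _ _ _ _ _ H2) /GRing.scale/= expr2 mulrA.
Qed.

Lemma cutoff_le c d s : 0 < d -> s <= c -> cutoff c d s = 0.
Proof. by move=> d0 sc; apply: step_le0; rewrite subr_le0 ler_pM2l ?invr_gt0. Qed.

Lemma cutoff_ge c d s : 0 < d -> c + d <= s -> cutoff c d s = 1.
Proof.
move=> d0 sc; apply: step_ge1; rewrite -mulrBr mulrC ler_pdivlMr// mul1r.
by rewrite lerBrDl.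
Qed.

(** Both derivatives vanish outside $[0,1]$ and are bounded inside by compactness. *)
Lemma step_bounds : exists2 M : R, 1 <= M & forall y : R,
  `|derive1 (@step R) y| <= M /\ `|derive1 (derive1 (@step R)) y| <= M.
Proof.
have s1 := @smooth1_step R; have s2 := smooth1_derive s1; have s3 := smooth1_derive s2.
have c (h : R -> R) : smooth1 h -> continuous h by move=> sh x; exact: is_derive_continuous (smooth1_is_derive x sh).
have [M1 H1] := continuous_bounded_itv 0 1 (c _ s2).
have [M2 H2] := continuous_bounded_itv 0 1 (c _ s3).
have d1 (y : R) : y <= 0 -> derive1 (@step R) y = 0 by apply: derive1_left => // s; exact: step_le0.
have d2 (y : R) : 1 <= y -> derive1 (@step R) y = 0 by apply: (derive1_right (a := 1)) => // s; exact: step_ge1.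
have d3 (y : R) : y <= 0 -> derive1 (derive1 (@step R)) y = 0 by apply: derive1_left.
have d4 (y : R) : 1 <= y -> derive1 (derive1 (@step R)) y = 0 by apply: (derive1_right (a := 0)).
exists (1 + `|M1| + `|M2|); first by rewrite -addrA lerDl addr_ge0.
move=> y; have a1 := ler_norm M1; have a2 := ler_norm M2.
have n1 := normr_ge0 M1; have n2 := normr_ge0 M2.
have [y0|y0] := leP y 0; first by rewrite d1// d3// normr0; split; lra.
have [y1|y1] := leP 1 y; first by rewrite d2// d4// normr0; split; lra.
have yy : 0 <= y <= 1 by rewrite !ltW.
by have := H1 y yy; have := H2 y yy; split; lra.
Qed.

End ModeEstimates.

(** * Moments against modes, and a trace inequality for sine coefficients *)

Section GreenEstimates.
Variables (R : realType) (G : cavity R).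
Local Notation T1 := (measurableTypeR R).
Local Notation I2 A f := (Rintegral (@leb2 R) A f).
Local Notation I1 A f := (Rintegral (@leb1 R) A f).
Local Notation r := (Rad G).
Local Notation hd := (half_disk r).
Local Notation arc := (`]0%R, pi[%classic : set R).
Implicit Types (w f : R * R -> R) (g : R -> R) (K : R -> R).
Let r0 : 0 < r := Rad_gt0 G.
Let mhd := @measurable_half_disk R r.

Definition radial_part (w1 w2 : R * R -> R) (x : R * R) := x.1 * w1 x + x.2 * w2 x.
Definition angular_part (w1 w2 : R * R -> R) (x : R * R) := x.1 * w2 x - x.2 * w1 x.

Lemma sqint_smoothM (a : R * R -> R) f : smooth a -> sqint (@leb2 R) hd f ->
  sqint (@leb2 R) hd (fun x => a x * f x).
Proof.
move=> sa sf; have ca := smooth_continuous sa.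
have [M HM] := continuous_bounded_half_disk r0 ca.
by apply: (sqint_bounded mhd _ HM sf); exact: continuous_measurable_fun2.
Qed.

(** Pointwise, $(\rho\partial_\rho w)^2+(\partial_\phi w)^2=|x|^2|\nabla w|^2$. *)
Lemma polar_parts (w1 w2 : R * R -> R) : sqint (@leb2 R) hd w1 -> sqint (@leb2 R) hd w2 ->
  [/\ sqint (@leb2 R) hd (radial_part w1 w2), sqint (@leb2 R) hd (angular_part w1 w2) &
   I2 hd (fun x => radial_part w1 w2 x ^+ 2) + I2 hd (fun x => angular_part w1 w2 x ^+ 2) <=
   r ^+ 2 * (I2 hd (fun x => w1 x ^+ 2) + I2 hd (fun x => w2 x ^+ 2))].
Proof.
move=> s1 s2; have f1 := @smooth_fst R; have f2 := @smooth_snd R.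
have sr : sqint (@leb2 R) hd (radial_part w1 w2).
  by apply: sqintD => //; exact: sqint_smoothM.
have sa : sqint (@leb2 R) hd (angular_part w1 w2).
  by apply: sqintB => //; exact: sqint_smoothM.
split => //.
have i1 := s1.2; have i2 := s2.2; have ir := sr.2; have ia := sa.2.
rewrite -RintegralD// -RintegralD// -RintegralZl//; last exact: itgD.
apply: le_Rintegral => //; first exact: itgD.
  by apply: itgZ => //; exact: itgD.
move=> x [/= /ltW x1 _].
have -> : radial_part w1 w2 x ^+ 2 + angular_part w1 w2 x ^+ 2 =
   (x.1 ^+ 2 + x.2 ^+ 2) * (w1 x ^+ 2 + w2 x ^+ 2) by rewrite /radial_part /angular_part; ring.
by rewrite ler_wpM2r// addr_ge0// sqr_ge0.
Qed.

(** [true] selects $\rho^n\sin n\phi$ and [false] selects $\rho^n\cos n\phi$, the companion produced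
    by an integration by parts in the angle. *)
Definition mode (b : bool) n : R * R -> R := if b then Pn n else Qn n.

Lemma smooth_mode b n K : smooth1 K -> smooth (fun x => K (sqn x) * mode b n x).
Proof.
move=> sK; apply: smoothM; first exact: smooth_radial.
by case: b; [exact: smooth_P|exact: smooth_Q].
Qed.

Lemma mode_flat n K (s : R) : K (sqn (s, 0)) * Pn n (s, 0) = 0.
Proof. by rewrite Pn_flat mulr0. Qed.

(** An integration by parts in the angle, tested with the cosine mode, whose angular derivative is
    $-n$ times the sine mode. The profile [K] vanishes up to $\hat R^2$, which removes the unknown
    boundary values over the aperture. The gain is the factor $1/n$. *)
Lemma angular_transfer w (w1 w2 : R * R -> R) K n : angular_identity G w w1 w2 ->
  sqint (@leb2 R) hd w -> sqint (@leb2 R) hd w1 -> sqint (@leb2 R) hd w2 ->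
  smooth1 K -> (forall s, s <= Rhat G ^+ 2 -> K s = 0) -> (0 < n)%N ->
  I2 hd (fun x => w x * (K (sqn x) * Pn n x)) =
  n%:R^-1 * I2 hd (fun x => angular_part w1 w2 x * (K (sqn x) * Qn n x)).
Proof.
move=> ang sw s1 s2 sK K0 n0.
have sq := smooth_mode false n sK; have sp := smooth_mode true n sK.
have n0' : n%:R != 0 :> R by rewrite pnatr_eq0 -lt0n.
have [_ sa _] := polar_parts s1 s2.
have flat (s : R) : `|s| <= Rhat G -> K (sqn (s, 0)) * mode false n (s, 0) = 0.
  move=> sR; rewrite K0 ?mul0r// /sqn/= expr0n/= addr0 -real_normK ?num_real//.
  by rewrite lerXn2r// nnegrE// ltW// Rhat_gt0.
have sc f : smooth f -> sqint (@leb2 R) hd f.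
  by move=> sf; apply: sqint_continuous => //; exact: smooth_continuous.
have := ang _ sq flat.
have E x : Aop (fun y => K (sqn y) * mode false n y) x = - n%:R * (K (sqn x) * Pn n x).
  rewrite AopM; [|exact: smooth_radial|exact: smooth_Q].
  rewrite Aop_radial// mul0r add0r; have [_ _ _ H] := EA_PQ n x.
  by rewrite (_ : Aop (mode false n) x = - n%:R * Pn n x)//; ring.
under eq_Rintegral do rewrite E.
rewrite (_ : I2 hd _ = I2 hd (fun x => angular_part w1 w2 x * (K (sqn x) * Qn n x)) -
   n%:R * I2 hd (fun x => w x * (K (sqn x) * Pn n x))).
  move/eqP; rewrite subr_eq0 => /eqP ->.
  by rewrite mulrA mulVf// mul1r.
rewrite -RintegralZl//; last by apply: sqint_mul => //; exact: sc.
rewrite -RintegralB//; [|by apply: sqint_mul => //; exact: (sc _ sq)|].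
  by apply: eq_Rintegral => x _; rewrite /angular_part /mode; ring.
by apply: itgZ => //; apply: sqint_mul => //; exact: (sc _ sp).
Qed.

(** Orthogonality depends on the angular frequencies alone, so every mode may have its own profile,
    bound and support radius. *)
Lemma modes_bessel b f (K : nat -> R -> R) (rr M : nat -> R) N :
  sqint (@leb2 R) hd f -> (forall n, smooth1 (K n)) ->
  (forall n, 0 < rr n <= r) -> (forall n, 0 < M n) ->
  (forall n s, (0 < n)%N -> 0 <= s < rr n ^+ 2 -> `|K n s| <= M n) ->
  (forall n s, (0 < n)%N -> rr n ^+ 2 <= s < r ^+ 2 -> K n s = 0) ->
  \sum_(1 <= n < N) I2 hd (fun x => f x * (K n (sqn x) * mode b n x)) ^+ 2 /
    (M n ^+ 2 * (pi * rr n ^+ n.*2.+2 / n.*2.+2%:R)) <= I2 hd (fun x => f x ^+ 2).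
Proof.
move=> sf sK hr M0 KM K0.
apply: (@Bessel_inequality _ _ _ (@leb2 R) hd mhd f
  (fun n x => K n (sqn x) * mode b n x)) => //.
- exact: iota_uniq.
- by move=> n; apply: sqint_continuous => //; apply: smooth_continuous; exact: smooth_mode.
- move=> n; rewrite mem_index_iota => /andP[n0 _].
  apply: Rintegral_mode_sqr => //.
  + by case: (b); [exact: smooth_P|exact: smooth_Q].
  + by move=> x; case: (b); [exact: sqr_Pn_le|exact: sqr_Qn_le].
  + by move=> s; exact: KM.
  + by move=> s; exact: K0.
- move=> n _; have /andP[rn _] := hr n.
  apply: mulr_gt0; first exact: exprn_gt0.
  apply: divr_gt0; last by rewrite ltr0n.
  by apply: mulr_gt0; [exact: pi_gt0|exact: exprn_gt0].
- by move=> n m nm; have [H1 H2] := modes_orthogonal r0 (sK n) (sK m) nm; case: (b).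
Qed.

Lemma arc_mode n K t : K (sqn (r * cos t, r * sin t)) * Pn n (r * cos t, r * sin t) =
  K (r ^+ 2) * r ^+ n * sin (n%:R * t).
Proof. by rewrite sqn_polar (zpow_polar n r t).2 mulrA. Qed.

Lemma Eop_mode n K x : smooth1 K -> Eop (fun x => K (sqn x) * Pn n x) x =
  (2 * sqn x * derive1 K (sqn x) + n%:R * K (sqn x)) * Pn n x.
Proof.
move=> sK; rewrite EopM; [|exact: smooth_radial|exact: smooth_P].
by have [-> _ _ _] := EA_PQ n x; rewrite Eop_radial//; ring.
Qed.

Lemma itg_sine (g : R -> R) n : sqint (@leb1 R) arc g ->
  (@leb1 R).-integrable arc (EFin \o (fun t => g t * sin (n%:R * t))).
Proof.
have marc : measurable (arc : set T1) by exact: measurable_itv.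
have fin : (@leb1 R arc < +oo)%E by rewrite leb1_itv ?pi_ge0// ltry.
move=> sg; apply: sqint_mul => //; apply: (bounded_sqint marc fin (M := 1)).
  apply: measurable_funTS; apply: continuous_measurable_fun => t.
  apply: continuous_comp; last exact: continuous_sin.
  by apply: cvgM; [exact: cvg_cst|exact: cvg_id].
by move=> t _; rewrite ler_norml sin_geN1 sin_le1.
Qed.

(** The weight of [w] is $\rho\partial_\rho+2$ applied to the mode, and on the arc the mode is a
    multiple of $\sin n\phi$. *)
Lemma radial_identity_mode w (w1 w2 : R * R -> R) g K n :
  radial_identity G w w1 w2 g -> sqint (@leb2 R) hd w -> sqint (@leb2 R) hd w1 ->
  sqint (@leb2 R) hd w2 -> sqint (@leb1 R) arc g -> smooth1 K ->
  I2 hd (fun x => radial_part w1 w2 x * (K (sqn x) * Pn n x)) +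
  I2 hd (fun x => w x * ((2 * sqn x * derive1 K (sqn x) + (n%:R + 2) * K (sqn x)) * Pn n x)) =
  r ^+ 2 * (K (r ^+ 2) * r ^+ n * (pi / 2 * sinc g n)).
Proof.
move=> rad sw s1 s2 sg sK; have sp := smooth_mode true n sK.
have [sr _ _] := polar_parts s1 s2.
have sc f : smooth f -> sqint (@leb2 R) hd f.
  by move=> sf; apply: sqint_continuous => //; exact: smooth_continuous.
pose L s := 2 * s * derive1 K s + (n%:R + 2) * K s.
have sL : smooth1 L.
  apply: smooth1D; last by apply: smooth1M => //; exact: smooth1_cst.
  apply: smooth1M; last exact: smooth1_derive.
  by apply: smooth1M; [exact: smooth1_cst|exact: smooth1_id].
have := rad _ sp.
rewrite (_ : I1 _ _ = K (r ^+ 2) * r ^+ n * (pi / 2 * sinc g n)) => [<-|].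
  rewrite -RintegralD//; last 2 first.
  - by apply: sqint_mul => //; exact: (sc _ sp).
  - by apply: sqint_mul => //; exact: (sc _ (smooth_mode true n sL)).
  apply: eq_Rintegral => x _.
  rewrite (_ : Eop _ x = (2 * sqn x * derive1 K (sqn x) + n%:R * K (sqn x)) * Pn n x); last exact: Eop_mode.
  by rewrite /radial_part /=; ring.
have -> : pi / 2 * sinc g n = I1 arc (fun t => g t * sin (n%:R * t)).
  rewrite /sinc; set J := I1 _ _; have pn : pi != 0 :> R by rewrite gt_eqF ?pi_gt0.
  by move: (@pi R) pn J => p pn J; field.
rewrite -RintegralZl//; last exact: itg_sine.
  by apply: eq_Rintegral => t _; rewrite arc_mode; ring.
Qed.

Lemma smooth1_radial_weight K (a : R) : smooth1 K ->
  smooth1 (fun s => 2 * s * derive1 K s + a * K s).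
Proof.
move=> sK; apply: smooth1D; last by apply: smooth1M => //; exact: smooth1_cst.
apply: smooth1M; last exact: smooth1_derive.
by apply: smooth1M; [exact: smooth1_cst|exact: smooth1_id].
Qed.

Lemma cutoff_itv (c d s : R) : 0 <= cutoff c d s <= 1.
Proof. exact: step_itv. Qed.

(** A trace inequality of order $1/2$. Tested with a cut-off mode, the radial identity expresses the
    coefficient as a radial moment plus a moment of [w], which [angular_transfer] turns into an
    angular one. Bessel's inequality bounds both families, and the squared norms of the modes, of
    order $r^{2n}/n$, produce the weight $n$. *)
Lemma sine_coef_bound : exists2 C : R, 0 < C &
  forall w (w1 w2 : R * R -> R) g, radial_identity G w w1 w2 g -> angular_identity G w w1 w2 ->
  sqint (@leb2 R) hd w -> sqint (@leb2 R) hd w1 -> sqint (@leb2 R) hd w2 ->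
  sqint (@leb1 R) arc g -> forall N,
  \sum_(1 <= n < N) n%:R * sinc g n ^+ 2 <=
    C * (I2 hd (fun x => w1 x ^+ 2) + I2 hd (fun x => w2 x ^+ 2)).
Proof.
set c := Rhat G ^+ 2; set d := r ^+ 2 - Rhat G ^+ 2.
have d0 : 0 < d by rewrite subr_gt0 ltrXn2r// ?nnegrE ?Rhat_lt_Rad// ltW// ?Rhat_gt0// Rad_gt0.
pose eta := cutoff c d.
have seta : smooth1 eta by exact: smooth1_cutoff.
have eta0 s : s <= c -> eta s = 0 by move=> sc; exact: cutoff_le.
have eta1 : eta (r ^+ 2) = 1 by apply: cutoff_ge => //; rewrite /c /d; lra.
(* The profile that multiplies [w] in the radial identity, divided by $n$: the angular transfer
   returns this factor, and the quotient is bounded uniformly in $n$. *)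
pose K n s := n%:R^-1 * (2 * s * derive1 eta s + (n%:R + 2) * eta s).
have sK n : smooth1 (K n).
  by apply: smooth1M; [exact: smooth1_cst|exact: smooth1_radial_weight].
have K0 n s : s <= c -> K n s = 0.
  by move=> sc; rewrite /K eta0// (derive1_left seta eta0)// !mulr0 addr0 mulr0.
have [S S1 HS] := step_bounds R.
pose M := 2 * r ^+ 2 * (d^-1 * S) + 3.
have q0 : 0 <= r ^+ 2 by exact: sqr_ge0.
have di0 : 0 <= d^-1 by rewrite invr_ge0 ltW.
have M1 : 1 <= M.
  have S0 : 0 <= S by apply: le_trans S1.
  have h : 0 <= 2 * r ^+ 2 * (d^-1 * S) by apply: mulr_ge0; apply: mulr_ge0.
  by rewrite /M; move: (2 * _ * _) h => z; lra.
have KM n s : (0 < n)%N -> 0 <= s < r ^+ 2 -> `|K n s| <= M.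
  move=> n0 /andP[s0 sr]; rewrite /K normrM normfV (ger0_norm (ler0n R n)).
  have n1 : 1 <= n%:R :> R by rewrite ler1n.
  rewrite ler_pdivrMl ?ltr0n//; apply: le_trans (ler_normD _ _) _.
  have h1 : `|2 * s * derive1 eta s| <= 2 * r ^+ 2 * (d^-1 * S).
    rewrite derive1_cutoff !normrM (ger0_norm s0) (ger0_norm di0) (ger0_norm (ler0n R 2)).
    have [h _] := HS (d^-1 * s + - (d^-1 * c)).
    apply: ler_pM => //; [exact: mulr_ge0|exact: mulr_ge0| |].
      by rewrite ler_wpM2l// ltW.
    by rewrite ler_wpM2l.
  have h2 : `|(n%:R + 2) * eta s| <= n%:R + 2.
    have /andP[e0 e1] := cutoff_itv c d s.
    by rewrite normrM (ger0_norm e0) ger0_norm ?addr_ge0// ler_piMr ?addr_ge0.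
  have h3 : 0 <= 2 * r ^+ 2 * (d^-1 * S) by apply: le_trans h1.
  move: h1 h2 h3; rewrite /M; move: (2 * r ^+ 2 * _) => Z h1 h2 h3.
  have : Z <= n%:R * Z by rewrite ler_peMl.
  by rewrite mulrDr; lra.
exists (4 / pi * (1 + M ^+ 2)); first by rewrite mulr_gt0 ?divr_gt0 ?pi_gt0// ltr_wpDr ?sqr_ge0.
move=> w w1 w2 g rad ang sw s1 s2 sg N.
have [sr sa Hra] := polar_parts s1 s2.
pose X n := I2 hd (fun x => radial_part w1 w2 x * (eta (sqn x) * mode true n x)).
pose Y n := I2 hd (fun x => angular_part w1 w2 x * (K n (sqn x) * mode false n x)).
pose E n := pi * r ^+ n.*2.+2 / n.*2.+2%:R.
have key n : (0 < n)%N -> X n + Y n = r ^+ 2 * (r ^+ n * (pi / 2 * sinc g n)).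
  move=> n0; have := radial_identity_mode n rad sw s1 s2 sg seta; rewrite eta1 mul1r => <-.
  congr (_ + _); have := angular_transfer ang sw s1 s2 (sK n) (K0 n) n0 => H.
  have n0' : n%:R != 0 :> R by rewrite pnatr_eq0 -lt0n.
  apply: (mulfI (invr_neq0 n0')); rewrite -H -RintegralZl//.
    by apply: eq_Rintegral => x _; rewrite /K; ring.
  apply: sqint_mul => //; apply: sqint_continuous => //; apply: smooth_continuous.
  exact: (smooth_mode true n (smooth1_radial_weight (n%:R + 2) seta)).
have rr : 0 < r <= r by rewrite r0 lexx.
have BX : \sum_(1 <= n < N) X n ^+ 2 / (1 ^+ 2 * E n) <= I2 hd (fun x => radial_part w1 w2 x ^+ 2).
  apply: (modes_bessel true (K := fun=> eta) (rr := fun=> r) (M := fun=> 1)) => //.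
    by move=> n s _ _; have /andP[e0 e1] := cutoff_itv c d s; rewrite ger0_norm.
  by move=> n s _ /andP[h1 h2]; move: h2; rewrite ltNge h1.
have BY : \sum_(1 <= n < N) Y n ^+ 2 / (M ^+ 2 * E n) <= I2 hd (fun x => angular_part w1 w2 x ^+ 2).
  apply: (modes_bessel false (K := K) (rr := fun=> r) (M := fun=> M)) => //.
    by move=> _; apply: lt_le_trans M1.
  by move=> n s _ /andP[h1 h2]; move: h2; rewrite ltNge h1.
have p0 := pi_gt0 R.
have M0 : 0 < M ^+ 2 by rewrite exprn_gt0// (lt_le_trans _ M1).
have E0 n : 0 < E n.
  apply: divr_gt0; last by rewrite ltr0n.
  by apply: mulr_gt0 => //; exact: exprn_gt0.
apply: (@le_trans _ _ (4 / (pi * r ^+ 2) * (\sum_(1 <= n < N) X n ^+ 2 / (1 ^+ 2 * E n) +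
    M ^+ 2 * \sum_(1 <= n < N) Y n ^+ 2 / (M ^+ 2 * E n)))).
  rewrite mulr_sumr -big_split/= mulr_sumr; apply: ler_sum_nat => n /andP[n0 _].
  have -> : n%:R * sinc g n ^+ 2 = 4 / pi ^+ 2 * (n%:R * ((X n + Y n) / (r ^+ 2 * r ^+ n)) ^+ 2).
    rewrite key//; have pn : pi != 0 :> R by rewrite gt_eqF.
    have rn : r ^+ n != 0 by rewrite expf_neq0// gt_eqF.
    have rn2 : r != 0 by rewrite gt_eqF.
    by move: (@pi R) pn (r ^+ n) rn (sinc g n) => p pn q qn s; field; rewrite qn rn2 pn.
  have -> : X n ^+ 2 / (1 ^+ 2 * E n) + M ^+ 2 * (Y n ^+ 2 / (M ^+ 2 * E n)) = (X n ^+ 2 + Y n ^+ 2) / E n.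
    have En : E n != 0 by rewrite gt_eqF. have Mn : M != 0 by rewrite gt_eqF// (lt_le_trans _ M1).
    by move: (E n) En => e en; field; rewrite Mn en.
  have xy : (X n + Y n) ^+ 2 <= 2 * (X n ^+ 2 + Y n ^+ 2) by have := sqr_ge0 (X n - Y n); nra.
  rewrite expr_div_n -/(E n).
  have -> : 4 / (pi * r ^+ 2) * ((X n ^+ 2 + Y n ^+ 2) / E n) =
     4 / pi ^+ 2 * ((n.*2.+2%:R * (X n ^+ 2 + Y n ^+ 2)) / (r ^+ 2 * r ^+ n) ^+ 2).
    have -> : E n = pi * (r ^+ 2 * (r ^+ n) ^+ 2) / n.*2.+2%:R.
      by rewrite /E -(exprM r n 2) muln2 -exprD.
    have pn : pi != 0 :> R by rewrite gt_eqF.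
    have rn : r ^+ n != 0 by rewrite expf_neq0// gt_eqF.
    have rn2 : r != 0 by rewrite gt_eqF.
    have nn : n.*2.+2%:R != 0 :> R by [].
    move: (@pi R) pn (r ^+ n) rn (n.*2.+2%:R : R) nn (X n) (Y n) => p pn q qn m mn a b.
    by field; rewrite qn rn2 pn mn.
  rewrite ler_wpM2l ?divr_ge0 ?sqr_ge0// mulrA ler_wpM2r ?invr_ge0 ?sqr_ge0//.
  apply: le_trans (ler_wpM2l _ xy) _ => //; rewrite mulrA ler_wpM2r ?addr_ge0 ?sqr_ge0//.
  by rewrite -natrM ler_nat muln2 -addn2 leq_addr.
have p1 : 0 < 4 / (pi * r ^+ 2) by rewrite divr_gt0// mulr_gt0// exprn_gt0.
apply: le_trans (ler_wpM2l (ltW p1) (lerD BX (ler_wpM2l (ltW M0) BY))) _.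
have -> : 4 / pi * (1 + M ^+ 2) * (I2 hd (fun x => w1 x ^+ 2) + I2 hd (fun x => w2 x ^+ 2)) =
  4 / (pi * r ^+ 2) * ((1 + M ^+ 2) * (r ^+ 2 * (I2 hd (fun x => w1 x ^+ 2) + I2 hd (fun x => w2 x ^+ 2)))).
  have pn : pi != 0 :> R by rewrite gt_eqF.
  have rn2 : r != 0 by rewrite gt_eqF.
  move: (@pi R) pn (I2 _ _ + I2 _ _) => p pn a.
  by field; rewrite rn2 pn.
rewrite ler_pM2l// (le_trans _ (ler_wpM2l _ Hra)) ?addr_ge0 ?(ltW M0)//.
have i1 := I_sqr_ge0 (@leb2 R) hd (radial_part w1 w2).
have i2 := I_sqr_ge0 (@leb2 R) hd (angular_part w1 w2).
have i3 := mulr_ge0 (ltW M0) i1.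
move: i1 i2 i3; rewrite mulrDl mul1r mulrDr.
move: (I2 hd _) (I2 hd _) (M ^+ 2 * _) (M ^+ 2 * _) => *; lra.
Qed.

End GreenEstimates.

(** * Truncated modes *)

Section TestModes.
Variables (R : realType) (G : cavity R).
Local Notation I2 A f := (Rintegral (@leb2 R) A f).
Local Notation r := (Rad G).
Local Notation hd := (half_disk r).
Local Notation arc := (`]0%R, pi[%classic : set R).
Implicit Types (w f : R * R -> R) (g : R -> R) (H K : R -> R).
Let r0 : 0 < r := Rad_gt0 G.
Let mhd := @measurable_half_disk R r.
Let c := Rhat G ^+ 2.
Let c0 : 0 < c. Proof. by rewrite exprn_gt0// Rhat_gt0. Qed.

Lemma smooth1_div_id H : smooth1 H -> (forall s, s <= c -> H s = 0) ->
  smooth1 (fun s => H s / s).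
Proof. by move=> sH H0 k; apply: (dk_div_id c0) => // s /ltW /H0. Qed.

Lemma smooth1_continuous H : smooth1 H -> continuous H.
Proof. by move=> sH x; exact: is_derive_continuous (smooth1_is_derive x sH). Qed.

(* The integrand on the left is the scalar product of the gradients of [w] and
   of [H(|x|^2) P_n]; dividing the polar parts by [|x|^2] is harmless since [H]
   vanishes near [0]. *)
Lemma green_mode w (w1 w2 : R * R -> R) g H n (a : R) :
  radial_identity G w w1 w2 g -> angular_identity G w w1 w2 ->
  sqint (@leb2 R) hd w -> sqint (@leb2 R) hd w1 -> sqint (@leb2 R) hd w2 ->
  sqint (@leb1 R) arc g -> smooth1 H -> (forall s, s <= c -> H s = 0) -> (0 < n)%N ->
  let V := fun x => H (sqn x) * Pn n x in
  I2 hd (fun x => w1 x * 'D_(e1 R) V x + w2 x * 'D_(e2 R) V x) - 4 * a * I2 hd (fun x => w x * V x) =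
  r ^+ n * (2 * r ^+ 2 * derive1 H (r ^+ 2) + n%:R * H (r ^+ 2)) * (pi / 2 * sinc g n)
  - 4 * I2 hd (fun x => w x * ((sqn x * derive1 (derive1 H) (sqn x) +
      n.+1%:R * derive1 H (sqn x) + a * H (sqn x)) * Pn n x)).
Proof.
move=> rad ang sw s1 s2 sg sH H0 n0 V.
have sH1 := smooth1_derive sH; have sH2 := smooth1_derive sH1.
have H10 := derive1_left sH H0.
pose h s := H s / s; have sh : smooth1 h by exact: smooth1_div_id.
have h0 s : s <= c -> h s = 0 by move=> /H0 e; rewrite /h e mul0r.
(* [K] and $n\,h$ are the profiles of the radial and angular derivatives of [V] after division by
   $|x|^2$. *)
pose K s := 2 * derive1 H s + n%:R * h s.
have sK : smooth1 K.
  by apply: smooth1D; apply: smooth1M => //; exact: smooth1_cst.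
have sc f : smooth f -> sqint (@leb2 R) hd f.
  by move=> sf; apply: sqint_continuous => //; exact: smooth_continuous.
have [sr sa _] := polar_parts s1 s2.
have sV : smooth V by exact: (smooth_mode true).
have iw f : smooth f -> (@leb2 R).-integrable hd (EFin \o (fun x => w x * f x)).
  by move=> sf; apply: sqint_mul => //; exact: sc.
have sm b (k : R -> R) : smooth1 k -> smooth (fun x : R * R => k (sqn x) * mode b n x) by exact: smooth_mode.
have snh : smooth1 (fun s => n%:R * h s) by apply: smooth1M => //; exact: smooth1_cst.
have nh0 s : s <= c -> n%:R * h s = 0 by move=> /h0 ->; rewrite mulr0.
have sW := smooth1_radial_weight (n%:R + 2) sK.
have E1 : I2 hd (fun x => w1 x * 'D_(e1 R) V x + w2 x * 'D_(e2 R) V x) =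
   I2 hd (fun x => radial_part w1 w2 x * (K (sqn x) * Pn n x)) +
   I2 hd (fun x => angular_part w1 w2 x * ((n%:R * h (sqn x)) * Qn n x)).
  rewrite -RintegralD//; last 2 first.
  - by apply: sqint_mul => //; exact: (sc _ (sm true _ sK)).
  - by apply: sqint_mul => //; exact: (sc _ (sm false _ snh)).
  apply: eq_Rintegral => x; rewrite inE => -[_ x2].
  have sx : sqn x != 0 by rewrite gt_eqF// /sqn ltr_wpDl ?sqr_ge0// exprn_gt0.
  have EV := Eop_mode n x sH.
  have AV : Aop V x = n%:R * H (sqn x) * Qn n x.
    rewrite AopM; [|exact: smooth_radial|exact: smooth_P].
    by rewrite Aop_radial// mul0r add0r; have [_ _ -> _] := EA_PQ n x; ring.
  apply: (mulfI sx); transitivity (radial_part w1 w2 x * Eop V x + angular_part w1 w2 x * Aop V x).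
    by rewrite /radial_part /angular_part /Eop /Aop /sqn; ring.
  rewrite (_ : Eop V x = (2 * sqn x * derive1 H (sqn x) + n%:R * H (sqn x)) * Pn n x) // AV /K /h.
  by field.
(* Beyond $c$ the derivative of $h$ is found by differentiating $y\,h(y)=H(y)$; up to $c$ everything
   vanishes. *)
have sB s : is_derive s (1 : R) h (s^-1 * (derive1 H s - h s)).
  have D := smooth1_is_derive s sh.
  have [sc'|cs] := leP s c.
    by rewrite H10// h0// subrr mulr0 -(derive1_left sh h0 sc').
  have s0 : s != 0 by rewrite gt_eqF// (lt_trans c0).
  have := is_deriveM (is_derive_id s (1 : R)) D.
  have -> : id * h = (fun y => y * h y) by [].
  move=> DD; have EH : \forall y \near s, y * h y = H y.
    have : nbhs s [set y : R | c < y] by apply: open_nbhs_nbhs; split => //; exact: open_gt.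
    by apply: filterS => y cy; rewrite /h mulrC divfK// gt_eqF// (lt_trans c0).
  have DH : is_derive s (1 : R) (fun y => y * h y) (derive1 H s).
    apply: (@near_eq_is_derive _ _ _ H) (smooth1_is_derive s sH).
    by apply: filterS EH => y ->.
  have := @derive_val _ _ _ _ _ _ _ DH; rewrite (@derive_val _ _ _ _ _ _ _ DD).
  rewrite /GRing.scale/= mulr1 => <-.
  by rewrite addrK mulrA mulVf// mul1r.
have K' s : c < s -> 2 * s * derive1 K s = 4 * s * derive1 (derive1 H) s + 2 * n%:R * (derive1 H s - h s).
  move=> cs; have s0 : s != 0 by rewrite gt_eqF// (lt_trans c0).
  have D1 := is_deriveZ 2 (smooth1_is_derive s sH1).
  have D2 := is_deriveZ n%:R (sB s).
  have := is_deriveD D1 D2 => DD.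
  rewrite (derive1_val (DD : is_derive s (1 : R) K _)).
  by rewrite /GRing.scale/=; field.
rewrite E1.
have := radial_identity_mode n rad sw s1 s2 sg sK => /eqP; rewrite eq_sym -subr_eq => /eqP <-.
have := angular_transfer ang sw s1 s2 snh nh0 n0.
have n0' : n%:R != 0 :> R by rewrite pnatr_eq0 -lt0n.
move=> HT; have -> : I2 hd (fun x => angular_part w1 w2 x * (n%:R * h (sqn x) * Qn n x)) =
    n%:R * I2 hd (fun x => w x * (n%:R * h (sqn x) * Pn n x)).
  by rewrite HT mulrA mulfV// mul1r.
have -> : r ^+ 2 * (K (r ^+ 2) * r ^+ n * (pi / 2 * sinc g n)) =
  r ^+ n * (2 * r ^+ 2 * derive1 H (r ^+ 2) + n%:R * H (r ^+ 2)) * (pi / 2 * sinc g n).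
  have rn : r != 0 by rewrite gt_eqF.
  by rewrite /K /h; move: (pi / 2 * _) (derive1 H _) (H _) => z z' z''; field.
have sL : smooth1 (fun s => s * derive1 (derive1 H) s + n.+1%:R * derive1 H s + a * H s).
  apply: smooth1D; [apply: smooth1D|]; apply: smooth1M => //; [exact: smooth1_id|exact: smooth1_cst|exact: smooth1_cst].
have iL := iw _ (sm true _ sL); have ih := iw _ (sm true _ snh); have iV := iw _ sV.
have -> : I2 hd (fun x => w x * ((2 * sqn x * derive1 K (sqn x) + (n%:R + 2) * K (sqn x)) * Pn n x)) =
   n%:R * I2 hd (fun x => w x * (n%:R * h (sqn x) * Pn n x)) +
   (4 * I2 hd (fun x => w x * ((sqn x * derive1 (derive1 H) (sqn x) +
      n.+1%:R * derive1 H (sqn x) + a * H (sqn x)) * Pn n x)) +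
    (- (4 * a)) * I2 hd (fun x => w x * V x)).
  rewrite -[X in X + (_ + _)]RintegralZl// -[X in _ + (X + _)]RintegralZl// -[X in _ + (_ + X)]RintegralZl//.
  rewrite -RintegralD//; [|exact: itgZ|exact: itgZ].
  rewrite -RintegralD//; [|exact: itgZ|by apply: itgD => //; exact: itgZ].
  apply: eq_Rintegral => x _; rewrite -(natr1 n) /V.
  have [sc'|cs] := leP (sqn x) c.
    rewrite (derive1_left sK _ sc'); last by move=> s hs; rewrite /K H10// h0// !mulr0 addr0.
    by rewrite /K H10// (derive1_left sH1 H10)// h0// H0//; ring.
  have sx : sqn x != 0 by rewrite gt_eqF// (lt_trans c0).
  rewrite (K' _ cs) /K; have -> : H (sqn x) = sqn x * h (sqn x) by rewrite /h mulrC divfK.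
  have hh : 2 * (n%:R * h (sqn x)) - 2 * (n%:R * h (sqn x)) = 0 :> R by rewrite subrr.
  by ring.
by ring.
Qed.
Variable a : R.
Hypothesis a0 : 0 <= a.
Let d := r ^+ 2 - c.
Let d0 : 0 < d.
Proof. by rewrite subr_gt0 ltrXn2r// ?nnegrE ?Rhat_lt_Rad// ltW// ?Rhat_gt0. Qed.

(* Up to a power of s this is J_n, normalized at 0, as a function of s = |x|^2:
   [bessel_profile n (|x|^2) P_n] solves the Helmholtz equation. *)
Definition bessel_profile n (s : R) : R := n`!%:R * fB n (a * s).

(** A cutoff of width $d/n$ has derivatives growing only like powers of $n$, and the $n$-th power of
    the squared radius still changes by a bounded factor across it. *)
Definition mode_profile n (s : R) : R := cutoff c (d / n%:R) s * bessel_profile n s.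

(** The Laplacian of $H(|x|^2)P_n$ is $4(sH''+(n+1)H')P_n$ at $s=|x|^2$, so the defect is a quarter
    of $\Delta+4a$ applied to the truncated mode. *)
Definition mode_defect n (s : R) : R :=
  s * derive1 (derive1 (mode_profile n)) s + n.+1%:R * derive1 (mode_profile n) s
  + a * mode_profile n s.

Lemma derive1_mul (f h : R -> R) : smooth1 f -> smooth1 h ->
  derive1 (fun s => f s * h s) = (fun s => derive1 f s * h s + f s * derive1 h s).
Proof.
move=> sf sh; apply/funext => y.
have H : is_derive y (1 : R) (fun s => f s * h s) _ :=
  is_deriveM (smooth1_is_derive y sf) (smooth1_is_derive y sh).
by rewrite (derive1_val H) /GRing.scale/=; ring.
Qed.

Lemma derive2_mul (f h : R -> R) s : smooth1 f -> smooth1 h ->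
  derive1 (fun s => derive1 f s * h s + f s * derive1 h s) s =
  derive1 (derive1 f) s * h s + 2 * derive1 f s * derive1 h s + f s * derive1 (derive1 h) s.
Proof.
move=> sf sh; have sf1 := smooth1_derive sf; have sh1 := smooth1_derive sh.
have H : is_derive s (1 : R) (fun s => derive1 f s * h s + f s * derive1 h s) _ :=
    is_deriveD (is_deriveM (smooth1_is_derive s sf1) (smooth1_is_derive s sh))
    (is_deriveM (smooth1_is_derive s sf) (smooth1_is_derive s sh1)).
rewrite (derive1_val H) /GRing.scale/=.
move: (derive1 (derive1 f) s) (derive1 (derive1 h) s) (derive1 f s) (derive1 h s) (f s) (h s).
by move=> *; ring.
Qed.

Lemma smooth1_bessel_profile n : smooth1 (bessel_profile n).
Proof.
apply: smooth1M; first exact: smooth1_cst.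
have := smooth1_affine a 0 (@smooth1_fB R n).
by under eq_fun do rewrite addr0.
Qed.

Lemma smooth1_mode_profile n : smooth1 (mode_profile n).
Proof. by apply: smooth1M; [exact: smooth1_cutoff|exact: smooth1_bessel_profile]. Qed.

Lemma derive1_fun_bessel n : derive1 (bessel_profile n) = (fun s => n`!%:R * (- a * fB n.+1 (a * s))).
Proof.
apply/funext => s; have h : is_derive s (1 : R) (fun s => a * s) a.
  by apply: is_derive_eq; rewrite /GRing.scale/= mulr1.
have H := @is_derive1_comp R (fB n) (fun s => a * s) s _ _ (is_derive_fB n (a * s)) h.
rewrite (derive1_val (is_deriveZ n`!%:R H)) /GRing.scale/=; ring.
Qed.

Lemma derive2_bessel n s : derive1 (derive1 (bessel_profile n)) s = n`!%:R * (a ^+ 2 * fB n.+2 (a * s)).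
Proof.
rewrite derive1_fun_bessel; have h : is_derive s (1 : R) (fun s => a * s) a.
  by apply: is_derive_eq; rewrite /GRing.scale/= mulr1.
have H := @is_derive1_comp R (fB n.+1) (fun s => a * s) s _ _ (is_derive_fB n.+1 (a * s)) h.
have := derive1_val (is_deriveZ n`!%:R (is_deriveZ (- a) H)).
rewrite /GRing.scale/= => E; apply: etrans E _; ring.
Qed.

Lemma bessel_equation n s : s * derive1 (derive1 (bessel_profile n)) s +
  n.+1%:R * derive1 (bessel_profile n) s + a * bessel_profile n s = 0.
Proof.
rewrite derive2_bessel derive1_fun_bessel /bessel_profile.
have := fB_recurrence n (a * s) => H.
transitivity (n`!%:R * a * (a * s * fB n.+2 (a * s) - n.+1%:R * fB n.+1 (a * s) + fB n (a * s))); first by ring.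
by rewrite H; ring.
Qed.

Lemma mode_profile_eq0 n s : (0 < n)%N -> s <= c -> mode_profile n s = 0.
Proof.
move=> n0 sc; rewrite /mode_profile cutoff_le ?mul0r//.
by rewrite divr_gt0// ltr0n.
Qed.

(** The terms in which the cutoff is not differentiated add up to Bessel's equation and cancel,
    which confines the defect to the annulus. *)
Lemma mode_defectE n s : mode_defect n s =
  s * (2 * derive1 (cutoff c (d / n%:R)) s * derive1 (bessel_profile n) s +
       derive1 (derive1 (cutoff c (d / n%:R))) s * bessel_profile n s)
  + n.+1%:R * (derive1 (cutoff c (d / n%:R)) s * bessel_profile n s).
Proof.
have s1 := smooth1_cutoff c (d / n%:R); have s2 := smooth1_bessel_profile n.
rewrite /mode_defect; set e := cutoff _ _ in s1 *; set F := bessel_profile n in s2 *.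
have -> : mode_profile n = (fun s => e s * F s) by [].
rewrite derive1_mul// derive2_mul//; have H := bessel_equation n s; rewrite -/F in H.
move: H; rewrite -/e -/F.
move: (derive1 (derive1 e) s) (derive1 (derive1 F) s) (derive1 e s) (derive1 F s) (e s) (F s).
move: (n.+1%:R : R) => k e2 F2 e1 F1 E0 F0 H.
transitivity (s * (2 * e1 * F1 + e2 * F0) + k * (e1 * F0) + E0 * (s * F2 + k * F1 + a * F0)).
  by ring.
by rewrite H mulr0 addr0.
Qed.

Lemma bessel_profile_bound n s : 0 <= s <= r ^+ 2 ->
  `|bessel_profile n s| <= expR (a * r ^+ 2) /\
  `|derive1 (bessel_profile n) s| <= a * expR (a * r ^+ 2).
Proof.
move=> /andP[s0 sr]; have as0 : 0 <= a * s by apply: mulr_ge0.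
have ee : expR (a * s) <= expR (a * r ^+ 2) by rewrite ler_expR ler_wpM2l.
have f0 := fact_gt0R R n.
have b1 := ps_bound as0 (@expb_jc R n); have b2 := ps_bound as0 (@expb_jc R n.+1).
split.
  rewrite normrM (ger0_norm (ltW f0)); apply: le_trans (ler_wpM2l (ltW f0) b1) _.
  by rewrite mulrA mulfV ?gt_eqF// mul1r.
rewrite derive1_fun_bessel mulrCA normrM normrN (ger0_norm a0) ler_wpM2l// normrM (ger0_norm (ltW f0)).
apply: le_trans (ler_wpM2l (ltW f0) b2) _; apply: le_trans ee.
rewrite mulrA ler_piMl ?expR_ge0// ler_pdivrMr ?fact_gt0R// mul1r ler_nat.
by rewrite leq_fact.
Qed.

(** Two derivatives of a cutoff of width $d/n$, or one of them times the coefficient $n+1$, cost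
    $n^2$; the Bessel profile and its derivative are bounded uniformly in $n$. *)
Lemma mode_defect_bound : exists2 M : R, 0 < M & forall n s, (0 < n)%N -> 0 <= s <= r ^+ 2 ->
  `|mode_defect n s| <= M * n%:R ^+ 2.
Proof.
have [S S1 HS] := step_bounds R; set B := expR (a * r ^+ 2).
have B0 : 0 < B by exact: expR_gt0.
have S0 : 0 < S by apply: lt_le_trans S1.
have q0 : 0 <= r ^+ 2 by exact: sqr_ge0.
have di : 0 < d^-1 by rewrite invr_gt0.
pose M := r ^+ 2 * (2 * (d^-1 * S) * (a * B) + d^-1 ^+ 2 * S * B) + 2 * (d^-1 * S * B).
exists M.
  rewrite ltr_wpDl//; last by rewrite mulr_gt0// mulr_gt0// mulr_gt0.
  apply: mulr_ge0 => //; apply: addr_ge0; first by rewrite !mulr_ge0// ltW.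
  by rewrite !mulr_ge0// ?sqr_ge0// ltW.
move=> n s n0 sr; have /andP[s0 sr'] := sr.
have [F0 F1] := bessel_profile_bound n sr.
rewrite mode_defectE derive1_cutoff derive2_cutoff invf_div.
set y := n%:R / d * s + _; have [h1 h2] := HS y.
have n1 : 1 <= n%:R :> R by rewrite ler1n.
have dn : n%:R / d = n%:R * d^-1 by [].
have nd0 : 0 <= n%:R / d by rewrite mulr_ge0// ltW.
have e1 : `|n%:R / d * derive1 (@step R) y| <= n%:R / d * S.
  by rewrite normrM (ger0_norm nd0) ler_wpM2l.
have e2 : `|(n%:R / d) ^+ 2 * derive1 (derive1 (@step R)) y| <= (n%:R / d) ^+ 2 * S.
  by rewrite normrM (ger0_norm (sqr_ge0 _)) ler_wpM2l ?sqr_ge0.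
set E1 := n%:R / d * _ in e1 *; set E2 := _ * derive1 (derive1 (@step R)) y in e2 *.
have t1 : `|E1 * derive1 (bessel_profile n) s| <= n%:R / d * S * (a * B) by rewrite normrM ler_pM.
have t2 : `|E2 * bessel_profile n s| <= (n%:R / d) ^+ 2 * S * B by rewrite normrM ler_pM.
have t3 : `|E1 * bessel_profile n s| <= n%:R / d * S * B by rewrite normrM ler_pM.
apply: le_trans (ler_normD _ _) _; rewrite normrM (ger0_norm s0) normrM (ger0_norm (ler0n R n.+1)).
have t4 : `|2 * E1 * derive1 (bessel_profile n) s + E2 * bessel_profile n s| <=
    2 * (n%:R / d * S * (a * B)) + (n%:R / d) ^+ 2 * S * B.
  apply: le_trans (ler_normD _ _) _; apply: lerD => //.
  by rewrite -mulrA normrM ger0_norm// ler_wpM2l.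
apply: (@le_trans _ _ (r ^+ 2 * (2 * (n%:R / d * S * (a * B)) + (n%:R / d) ^+ 2 * S * B) +
    n.+1%:R * (n%:R / d * S * B))).
  by apply: lerD; [exact: ler_pM|rewrite ler_wpM2l].
rewrite /M (_ : _ * n%:R ^+ 2 = r ^+ 2 * (2 * (n%:R ^+ 2 * (d^-1 * S * (a * B))) + (n%:R / d) ^+ 2 * S * B) +
   (2 * n%:R) * (n%:R / d * S * B)); last by ring.
apply: lerD.
  have -> : n%:R / d * S * (a * B) = n%:R * (d^-1 * S * (a * B)) by ring.
  rewrite ler_wpM2l// lerD2r ler_wpM2l// ler_wpM2r//.
    by apply: mulr_ge0; apply: mulr_ge0 => //; exact: ltW.
  by rewrite expr2 ler_peMl.
rewrite ler_wpM2r//; first by rewrite !mulr_ge0// ltW.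
by rewrite -natr1; lra.
Qed.

Lemma smooth1_mode_defect n : smooth1 (mode_defect n).
Proof.
have s1 := smooth1_mode_profile n; have s2 := smooth1_derive s1; have s3 := smooth1_derive s2.
apply: smooth1D; [apply: smooth1D|]; apply: smooth1M => //;
  [exact: smooth1_id|exact: smooth1_cst|exact: smooth1_cst].
Qed.

Lemma mode_defect_eq0 n s : (0 < n)%N -> s <= c \/ c + d / n%:R <= s -> mode_defect n s = 0.
Proof.
move=> n0 hs; have dn : 0 < d / n%:R by rewrite divr_gt0// ltr0n.
have e1 := smooth1_cutoff c (d / n%:R); have e2 := smooth1_derive e1.
have l1 s' : s' <= c -> derive1 (cutoff c (d / n%:R)) s' = 0.
  by apply: derive1_left => // y; exact: cutoff_le.
have r1 s' : c + d / n%:R <= s' -> derive1 (cutoff c (d / n%:R)) s' = 0.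
  by apply: (derive1_right (a := 1)) => // y; exact: cutoff_ge.
rewrite mode_defectE; case: hs => hs.
  by rewrite l1// (derive1_left e2 l1)// !mulr0 !mul0r addr0 !mulr0 addr0.
by rewrite r1// (derive1_right e2 r1)// !mulr0 !mul0r addr0 !mulr0 addr0.
Qed.

(** With $x=d/c$: $(1+x/n)^{n+1}\le e^{x(n+1)/n}\le e^{2x}$. *)
Lemma shrinking_radius n : (0 < n)%N ->
  (c + d / n%:R) ^+ n.+1 <= c ^+ n.+1 * expR (2 * (d / c)).
Proof.
move=> n0; have n0' : 0 < n%:R :> R by rewrite ltr0n.
have -> : c + d / n%:R = c * (1 + d / c / n%:R).
  by move: (c0) n0'; move: c d (n%:R : R) => c' d' n' h1 h2; field; rewrite !gt_eqF.
rewrite exprMn ler_wpM2l//; first exact: exprn_ge0 (ltW c0).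
have dc : 0 <= d / c by rewrite divr_ge0// ltW.
apply: (@le_trans _ _ (expR (d / c / n%:R) ^+ n.+1)).
  by rewrite lerXn2r ?nnegrE ?expR_ge0// ?expR_ge1Dx// addr_ge0// divr_ge0// ltW.
rewrite -expRM_natl ler_expR.
have -> : n.+1%:R * (d / c / n%:R) = d / c * (n.+1%:R / n%:R) by ring.
rewrite (mulrC 2) ler_wpM2l// ler_pdivrMr// -natrM ler_nat.
by rewrite mul2n -addnn -addn1 leq_add2l.
Qed.

(** The angular transfer writes the moment as $Y_n/n$. Bessel's inequality, with a squared norm of
    order $n^4c^n/n$, controls the sum of $Y_n^2/(n^3c^n)$, which is exactly the weighted sum of the
    squared moments. *)
Lemma mode_defect_sum : exists2 C : R, 0 < C &
  forall w (w1 w2 : R * R -> R), angular_identity G w w1 w2 ->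
  sqint (@leb2 R) hd w -> sqint (@leb2 R) hd w1 -> sqint (@leb2 R) hd w2 -> forall N,
  \sum_(1 <= n < N) I2 hd (fun x => w x * (mode_defect n (sqn x) * Pn n x)) ^+ 2 / (n%:R * c ^+ n) <=
    C * (I2 hd (fun x => w1 x ^+ 2) + I2 hd (fun x => w2 x ^+ 2)).
Proof.
have [M0 M0gt HM] := mode_defect_bound.
have e0 : 0 < expR (2 * (d / c)) by exact: expR_gt0.
have p0 := pi_gt0 R.
pose C0 := M0 ^+ 2 * pi * c * expR (2 * (d / c)) / 2.
have C00 : 0 < C0 by apply: divr_gt0 => //; apply: mulr_gt0 => //; apply: mulr_gt0 => //; apply: mulr_gt0 => //; exact: exprn_gt0.
exists (C0 * r ^+ 2); first by rewrite mulr_gt0// exprn_gt0.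
move=> w w1 w2 ang sw s1 s2 N.
have [sr sa Hra] := polar_parts s1 s2.
pose Y n := I2 hd (fun x => angular_part w1 w2 x * (mode_defect n (sqn x) * mode false n x)).
(* This equals $n$ for $n>0$ and $1$ for $n=0$, where radii and bounds must still be positive. *)
pose k n := n.-1.+1%:R : R.
have k1 n : 1 <= k n by rewrite ler1n.
have kE n : (0 < n)%N -> k n = n%:R by move=> n0; rewrite /k prednK.
have cd n : 0 < c + d / k n by rewrite ltr_wpDr// divr_ge0// ?(ltW d0)// (le_trans ler01).
pose rr n := Num.sqrt (c + d / k n); pose M n := M0 * k n ^+ 2.
have rr2 n : rr n ^+ 2 = c + d / k n by rewrite sqr_sqrtr// ltW.
have Mg n : 0 < M n by rewrite mulr_gt0// exprn_gt0// (lt_le_trans ltr01).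
have rr0 n : 0 < rr n <= r.
  rewrite sqrtr_gt0 cd/= -(ler_pXn2r (n := 2))// ?nnegrE ?sqrtr_ge0 ?(ltW r0)// rr2.
  rewrite -lerBrDl ler_pdivrMr ?(lt_le_trans ltr01)// ler_peMr// ltW//.
have rrr n : rr n ^+ 2 <= r ^+ 2.
  by have /andP[h1 h2] := rr0 n; rewrite lerXn2r// nnegrE ltW.
have B : \sum_(1 <= n < N) Y n ^+ 2 / (M n ^+ 2 * (pi * rr n ^+ n.*2.+2 / n.*2.+2%:R)) <=
    I2 hd (fun x => angular_part w1 w2 x ^+ 2).
  apply: (modes_bessel false (K := mode_defect)) => //.
  - exact: smooth1_mode_defect.
  - move=> n s n0 /andP[s0 sr']; rewrite /M kE//; apply: HM => //.
    by rewrite s0/= ltW// (lt_le_trans sr').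
  - by move=> n s n0; rewrite rr2 kE// => /andP[h _]; apply: mode_defect_eq0 => //; right.
apply: (@le_trans _ _ (C0 * (I2 hd (fun x => angular_part w1 w2 x ^+ 2)))); last first.
  rewrite -mulrA ler_pM2l//; apply: le_trans Hra; rewrite lerDr.
  exact: (I_sqr_ge0 (@leb2 R) hd (radial_part w1 w2)).
apply: le_trans (ler_wpM2l (ltW C00) B); rewrite mulr_sumr.
apply: ler_sum_nat => n /andP[n0 _].
have n0' : 0 < n%:R :> R by rewrite ltr0n.
have D0 s : s <= c -> mode_defect n s = 0 by move=> sc; apply: mode_defect_eq0 => //; left.
rewrite (angular_transfer ang sw s1 s2 (smooth1_mode_defect n) D0 n0) -/(Y n).
rewrite exprMn -[leLHS]mulrA [leLHS]mulrCA [leRHS]mulrCA ler_wpM2l ?sqr_ge0//.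
have E0 : 0 < M n ^+ 2 * (pi * rr n ^+ n.*2.+2 / n.*2.+2%:R).
  apply: mulr_gt0; first exact: exprn_gt0.
  apply: divr_gt0; last by rewrite ltr0n.
  by apply: mulr_gt0 => //; rewrite exprn_gt0//; have /andP[] := rr0 n.
rewrite ler_pdivlMr// exprVn -invfM mulrC ler_pdivrMr; last by rewrite mulr_gt0 ?exprn_gt0// mulr_gt0// exprn_gt0.
have -> : rr n ^+ n.*2.+2 = (c + d / n%:R) ^+ n.+1 by rewrite -doubleS -mul2n exprM rr2 kE.
have S1 := shrinking_radius n0.
rewrite /M kE//.
apply: (@le_trans _ _ ((M0 * n%:R ^+ 2) ^+ 2 * (pi * (c ^+ n.+1 * expR (2 * (d / c))) / (2 * n%:R)))).
  rewrite ler_wpM2l ?sqr_ge0//; apply: ler_pM.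
  - by apply: mulr_ge0; [exact: ltW|rewrite exprn_ge0//; have := cd n; rewrite kE// => /ltW].
  - by rewrite invr_ge0.
  - by rewrite ler_wpM2l// ltW.
  - rewrite lef_pV2 ?posrE// ?mulr_gt0//.
    by rewrite -natrM ler_nat mul2n -addn2 leq_addr.
rewrite le_eqVlt; apply/orP; left; apply/eqP; rewrite /C0 [c ^+ n.+1]exprS.
move: (expR _) (c ^+ n) (@pi R) (n%:R : R) n0' => e' cn p' n' h.
by field; rewrite gt_eqF.
Qed.

(** Since $d/n\le d$, the cutoff has already reached $1$ at $r^2$ and its derivative vanishes
    there. *)
Lemma mode_profile_boundary n : (0 < n)%N ->
  mode_profile n (r ^+ 2) = bessel_profile n (r ^+ 2) /\
  derive1 (mode_profile n) (r ^+ 2) = derive1 (bessel_profile n) (r ^+ 2).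
Proof.
move=> n0; have n0' : 0 < n%:R :> R by rewrite ltr0n.
have dn : 0 < d / n%:R by rewrite divr_gt0.
have cr : c + d / n%:R <= r ^+ 2.
  by rewrite -lerBrDl ler_pdivrMr// ler_peMr ?ler1n// ltW.
have e1 := smooth1_cutoff c (d / n%:R).
rewrite /mode_profile cutoff_ge// mul1r; split => //.
rewrite derive1_mul//; last exact: smooth1_bessel_profile.
rewrite cutoff_ge// mul1r (derive1_right (a := 1) e1 _ cr) ?mul0r ?add0r//.
by move=> s; exact: cutoff_ge.
Qed.

(** The profile at $r^2$ is $1+O(1/n)$ and its derivative stays bounded, so the term $nF$
    prevails. *)
Lemma bessel_profile_large : exists n0 : nat, forall n, (n0 <= n)%N ->
  2^-1 <= bessel_profile n (r ^+ 2) <= 2 /\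
  n%:R / 2 <= 2 * r ^+ 2 * derive1 (bessel_profile n) (r ^+ 2) + n%:R * bessel_profile n (r ^+ 2).
Proof.
set B := expR (a * r ^+ 2); have B0 : 0 < B by exact: expR_gt0.
(* The last summand forces $|F-1|\le1/2$; the first makes half of $n$ outweigh the error of $nF$ and
   the derivative term together. *)
pose Z := 2 * (B + 2 * r ^+ 2 * (a * B)) + 2 * B.
have aB : 0 <= r ^+ 2 * (a * B) by rewrite mulr_ge0 ?sqr_ge0// mulr_ge0// ltW.
have Z0 : 0 <= Z by rewrite /Z; lra.
exists (Num.bound Z) => n hn.
have Zn : Z <= n%:R.
  by apply: (@le_trans _ _ (Num.bound Z)%:R); [exact/ltW/archi_boundP|rewrite ler_nat].
have rr : 0 <= r ^+ 2 <= r ^+ 2 by rewrite sqr_ge0 lexx.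
have [_] := bessel_profile_bound n rr; rewrite -/B ler_norml => /andP[h1 h2].
have as0 : 0 <= a * r ^+ 2 by rewrite mulr_ge0// sqr_ge0.
have := fB_approx n (a * r ^+ 2); rewrite -/(bessel_profile n (r ^+ 2)) (ger0_norm as0) -/B.
rewrite ler_pdivlMr ?ltr0Sn// => h3.
have n1 : 0 <= n%:R :> R by [].
have {}h3 : `|bessel_profile n (r ^+ 2) - 1| * n%:R <= B.
  by apply: le_trans h3; rewrite ler_wpM2l// ler_nat.
have n0 : 0 < n%:R :> R by rewrite (lt_le_trans _ Zn)// /Z; lra.
have h4 : `|bessel_profile n (r ^+ 2) - 1| <= 2^-1.
  by rewrite -(ler_pM2r n0) (le_trans h3)//; move: Zn; rewrite /Z; lra.
have h5 : - B <= (bessel_profile n (r ^+ 2) - 1) * n%:R.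
  by have := ler_norm (- ((bessel_profile n (r ^+ 2) - 1) * n%:R)); rewrite normrN normrM (ger0_norm n1); lra.
have h6 : - (r ^+ 2 * (a * B)) <= r ^+ 2 * derive1 (bessel_profile n) (r ^+ 2).
  by rewrite -mulrN ler_wpM2l// sqr_ge0.
move: h4; rewrite ler_norml => /andP[h7 h8].
split; first by apply/andP; split; lra.
move: Zn h5 h6; rewrite /Z.
have -> : n%:R * bessel_profile n (r ^+ 2) = (bessel_profile n (r ^+ 2) - 1) * n%:R + n%:R by ring.
have -> : 2 * r ^+ 2 * derive1 (bessel_profile n) (r ^+ 2) = 2 * (r ^+ 2 * derive1 (bessel_profile n) (r ^+ 2)) by ring.
have -> : 2 * r ^+ 2 * (a * B) = 2 * (r ^+ 2 * (a * B)) by ring.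
move: (r ^+ 2 * derive1 (bessel_profile n) _) ((bessel_profile n _ - 1) * _) (r ^+ 2 * (a * B)).
by move=> *; lra.
Qed.

End TestModes.

Lemma sqint_extend0 d (T : measurableType d) (R : realType) (mu : {measure set T -> \bar R})
    (A B : set T) (f : T -> R) : measurable A -> measurable B -> A `<=` B ->
  (forall x, B x -> ~ A x -> f x = 0) -> sqint mu A f -> sqint mu B f.
Proof.
move=> mA mB AB f0 [mf fi].
have E : {in B, (f \_ A) =1 f}.
  move=> x /set_mem Bx; rewrite patchE; case: ifPn => // /negP nA; rewrite f0// => Ax.
  by apply: nA; rewrite inE.
split.
  apply: (eq_measurable_fun (f \_ A)) => //; apply: measurable_funTS.
  exact/(measurable_restrictT _ mA).
have : mu.-integrable B ((EFin \o (fun x => f x ^+ 2)) \_ A).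
  by apply: integrableS (measurableT) mB _ _ => //; exact/(integrable_mkcond _ mA).
apply: eq_integrable => // x Bx; rewrite patchE; case: ifPn => //= /negP nA.
by rewrite f0 ?expr0n//; [exact: set_mem|move=> Ax; apply: nA; rewrite inE].
Qed.

Lemma Rintegral_eq0 d (T : measurableType d) (R : realType) (mu : {measure set T -> \bar R})
    (A : set T) (f : T -> R) : (forall x, A x -> f x = 0) -> Rintegral mu A f = 0.
Proof.
by move=> f0; rewrite /Rintegral integral0_eq// => x /f0 ->.
Qed.

Lemma part_real (R : realType) b (x : R) : part b (x%:C)%C = if b then x else 0.
Proof. by case: b. Qed.

Lemma sqint0 d (T : measurableType d) (R : realType) (mu : {measure set T -> \bar R}) (A : set T) :
  sqint mu A (fun=> 0 : R).
Proof.
split; first exact: measurable_cst.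
by under eq_fun do rewrite expr0n; exact: integrable0.
Qed.

Lemma L2_real d (T : measurableType d) (R : realType) (mu : {measure set T -> \bar R}) (A : set T) (f : T -> R) :
  measurable A -> sqint mu A f -> L2 mu A (fun x => (f x)%:C%C).
Proof.
move=> mA sf; apply/L2P => // -[] /=; [exact: sf|exact: sqint0].
Qed.

(** * Testing the variational problem *)

Section TestFunctions.
Variables (R : realType) (G : cavity R).
Local Notation T1 := (measurableTypeR R).
Local Notation T2 := (T1 * T1)%type.
Local Notation I2 A f := (Rintegral (@leb2 R) A f).
Local Notation I1 A f := (Rintegral (@leb1 R) A f).
Local Notation r := (Rad G).
Local Notation hd := (half_disk r).
Local Notation arc := (`]0%R, pi[%classic : set R).
Let r0 : 0 < r := Rad_gt0 G.
Let mhd := @measurable_half_disk R r.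
Let mO := measurable_Omega G.

(** The weak derivative inside [H1norm] is a chosen one, so even for the zero function its vanishing
    has to come from uniqueness. *)
Lemma H1norm_eq0 (U : set (R * R)) (w : R * R -> R[i]) : open U ->
  (forall x, U x -> w x = 0) -> H1norm U w = 0.
Proof.
move=> oU w0; have mU := open_measurable2 oU.
have l0 (z : R * R -> R[i]) : (forall x, U x -> z x = 0) -> l2norm (@leb2 R) U z = 0.
  move=> z0; rewrite /l2norm (_ : Rintegral _ _ _ = 0) ?sqrtr0//.
  by apply: Rintegral_eq0 => x /z0 ->/=; rewrite !expr0n/= addr0 sqrtr0 expr0n.
have L0 : L2 (@leb2 R) U (fun=> 0 : R[i]).
  apply/(L2P _ mU) => b; split; first exact: measurable_cst.
  by under eq_fun do rewrite part0 expr0n; exact: integrable0.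
have W e : is_weak_deriv U e w (fun=> 0).
  split => // f _; apply: part_ext => b; rewrite partN !part_cint.
  have -> : I2 U (fun x => part b (w x * ('D_e f x)%:C%C)) = 0.
    by apply: Rintegral_eq0 => x Ux; rewrite w0// mul0r part0.
  by rewrite Rintegral_eq0 ?oppr0// => x _; rewrite mul0r part0.
have d0 e : l2norm (@leb2 R) U (weak_deriv U e w) ^+ 2 = 0.
  have Wd := weak_derivP (W e).
  rewrite sqr_l2norm//; last by case: Wd.
  have H b : I2 U (fun x => part b (weak_deriv U e w x) ^+ 2) = 0.
    rewrite -[RHS](@Rintegral0 _ T2 _ (@leb2 R) U mU).
    have v := (is_weak_derivP _ _ _ mU).1 Wd b; have v0 := (is_weak_derivP _ _ _ mU).1 (W e) b.
    apply: ae_eq_Rintegral => //; first by apply: measurable_funX; case: v => -[].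
    have := wd_uniq oU v v0; case=> N [mN N0 NS]; exists N; split => // x /= nx; apply: NS => /= H.
    by apply: nx => Ux; rewrite H// part0 expr0n.
  by rewrite !H addr0.
have E : l2norm (@leb2 R) U w ^+ 2 = 0 by rewrite l0// expr0n.
have -> : H1norm U w = Num.sqrt (0 + 0 + 0).
  exact: (congr1 Num.sqrt (f_equal2 +%R (f_equal2 +%R E (d0 (e1 R))) (d0 (e2 R)))).
by rewrite !addr0 sqrtr0.
Qed.

Variable V : R * R -> R.
Hypothesis sV : smooth V.
Hypothesis V_flat : forall s, V (s, 0) = 0.

(** Extension by zero into the cavity, where the polynomials $P_n$ do not vanish. *)
Definition upper (f : R * R -> R) (x : R * R) : R := if 0 < x.2 then f x else 0.

Lemma upper_hd f x : hd x -> upper f x = f x.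
Proof. by move=> [_ x2]; rewrite /upper x2. Qed.

Lemma upper_off f x : Omega G x -> ~ hd x -> upper f x = 0.
Proof.
move=> [[//|[_ x2]]|/cav_below x2] _; rewrite /upper; first by rewrite x2 ltxx.
by rewrite ltNge ltW.
Qed.

Lemma sqint_upper f : smooth f -> sqint (@leb2 R) (Omega G) (upper f).
Proof.
move=> sf; apply: (sqint_extend0 mhd mO (@half_disk_Omega _ G)); first exact: upper_off.
have E x : hd x -> f x = upper f x by move=> hx; rewrite upper_hd.
apply: (eq_sqint mhd E); apply: sqint_continuous => //; exact: smooth_continuous.
Qed.

Lemma Rintegral_upper (f g : R * R -> R) :
  I2 (Omega G) (fun x => upper f x * g x) = I2 hd (fun x => f x * g x).
Proof.
rewrite (@Rintegral_subset0 _ T2 R (@leb2 R) (Omega G) hd); [|exact: half_disk_Omega|].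
  by apply: eq_Rintegral => x; rewrite inE => hx; rewrite upper_hd.
by move=> x Ox nx; rewrite upper_off// mul0r.
Qed.

(** Test functions in [Omega G] vanish on the arc, whose points lie outside the domain, but not
    necessarily on the aperture; there it is [V] that vanishes, so the extension by zero creates no
    jump term. *)
Lemma wd_upper : wd (Omega G) (e1 R) (upper V) (upper ('D_(e1 R) V)) /\
  wd (Omega G) (e2 R) (upper V) (upper ('D_(e2 R) V)).
Proof.
have arc0 f t : test_function (Omega G) f -> arc t -> f (r * cos t, r * sin t) = 0.
  move=> tf; rewrite /= in_itv/= => /andP[t0 tp]; apply: (test_off tf _).1.
  have st : 0 < r * sin t by rewrite mulr_gt0// sin_gt0_pi// t0 tp.
  move=> [[[]|[_ /= e]]|/cav_below /=].
  - by rewrite /= !exprMn -mulrDr cos2Dsin2 mulr1 ltxx.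
  - by rewrite e ltxx in st.
  - by rewrite ltNge ltW.
have it (g : R * R -> R) : smooth g -> (@leb2 R).-integrable hd (EFin \o g).
  by move=> sg; apply: itg2_continuous => //; exact: smooth_continuous.
split; split.
- by apply: sqint_upper; exact: smooth_D1.
- move=> f tf; have [sf _] := tf; rewrite !Rintegral_upper; apply/eqP; rewrite -addr_eq0; apply/eqP.
  have := Gauss1 r0 (smoothM sV sf); rewrite (_ : I1 _ _ = 0); last first.
    by apply: Rintegral_eq0 => t ht; rewrite (arc0 f)// mulr0 mul0r.
  move=> E; rewrite -[RHS]E -RintegralD//.
  + by apply: eq_Rintegral => x _; rewrite D1_M//; ring.
  + by apply: it; apply: smoothM => //; exact: smooth_D1.
  + by apply: it; apply: smoothM => //; exact: smooth_D1.
- by apply: sqint_upper; exact: smooth_D2.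
- move=> f tf; have [sf _] := tf; rewrite !Rintegral_upper; apply/eqP; rewrite -addr_eq0; apply/eqP.
  have := Gauss2 r0 (smoothM sV sf); rewrite (_ : I1 _ _ = 0); last first.
    by apply: Rintegral_eq0 => t ht; rewrite (arc0 f)// mulr0 mul0r.
  rewrite (_ : I1 _ _ = 0) ?subr0; last first.
    by apply: Rintegral_eq0 => s _; rewrite V_flat mul0r.
  move=> E; rewrite -[RHS]E -RintegralD//.
  + by apply: eq_Rintegral => x _; rewrite D2_M//; ring.
  + by apply: it; apply: smoothM => //; exact: smooth_D2.
  + by apply: it; apply: smoothM => //; exact: smooth_D2.
Qed.

Definition upperC (f : R * R -> R) (x : R * R) : R[i] := (upper f x)%:C%C.

Lemma weak_deriv_upperC :
  is_weak_deriv (Omega G) (e1 R) (upperC V) (upperC ('D_(e1 R) V)) /\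
  is_weak_deriv (Omega G) (e2 R) (upperC V) (upperC ('D_(e2 R) V)).
Proof.
have [w1 w2] := wd_upper.
have w0 e : wd (Omega G) e (fun=> 0) (fun=> 0).
  by split; [exact: sqint0|move=> f _; rewrite !Rintegral_eq0 ?oppr0// => x _; rewrite mul0r].
by split; apply/(is_weak_derivP _ _ _ mO) => -[]; [exact: w1|exact: w0|exact: w2|exact: w0].
Qed.

Lemma H1_upperC : H1 (Omega G) (upperC V).
Proof.
have [w1 w2] := weak_deriv_upperC; split; [|by eexists; exact: w1|by eexists; exact: w2].
by apply: L2_real => //; exact: sqint_upper.
Qed.

Lemma csmooth_real (f : R * R -> R) : smooth f -> csmooth (fun x => (f x)%:C%C).
Proof. by move=> sf; split => //; exact: smooth_cst. Qed.

Lemma is_trace_upperC (c : R -> R * R) (I : set R) : measurable (I : set T1) ->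
  sqint (@leb1 R) I (fun t => V (c t)) ->
  is_trace hd c I (upperC V) (fun t => (V (c t))%:C%C).
Proof.
move=> mI sI; split; first exact: L2_real.
exists (fun _ x => (V x)%:C%C); split.
- by move=> _; exact: csmooth_real.
- rewrite (_ : (fun _ => _) = (fun=> 0)); first exact: cvg_cst.
  apply/funext => k; apply: H1norm_eq0; first exact: half_disk_open.
  by move=> x hx; rewrite /upperC upper_hd// subrr.
- rewrite (_ : (fun _ => _) = (fun=> 0)); first exact: cvg_cst.
  apply/funext => k; rewrite /l2norm (_ : Rintegral _ _ _ = 0) ?sqrtr0//.
  apply: Rintegral_eq0 => t _.
  by rewrite subrr/= !expr0n/= addr0 sqrtr0 expr0n.
Qed.

Lemma H10_upperC : H10 G (upperC V).
Proof.
split; first exact: H1_upperC.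
- exists (fun t => (V (t, 0))%:C%C).
    have E : [set t : R | `|t| < r] = `](- r), r[%classic.
      by apply/seteqP; split => t /=; rewrite in_itv/= ltr_norml.
    rewrite E; apply: is_trace_upperC; first exact: measurable_itv.
    exact: sqint_flat_smooth.
  by apply/aeW => t _ _; rewrite V_flat.
(* On the cavity the function is zero, so the zero sequence realizes the zero trace in every
   chart. *)
- move=> p a b delta eta h _ _; exists (fun=> 0); last by apply/aeW.
  split.
    rewrite (_ : (fun=> 0) = (fun _ : R => (0 : R)%:C%C)); last by apply/funext.
    apply: L2_real; last exact: sqint0.
    have E : [set t : R | `|t| < delta] = `](- delta), delta[%classic.
      by apply/seteqP; split => t /=; rewrite in_itv/= ltr_norml.
    by rewrite E; exact: measurable_itv.
  exists (fun _ x => (0 : R)%:C%C); split.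
  + by move=> _; apply: csmooth_real; exact: smooth_cst.
  + rewrite (_ : (fun _ => _) = (fun=> 0)); first exact: cvg_cst.
    apply/funext => k; apply: H1norm_eq0; first exact: cav_open.
    move=> x cx; rewrite /upperC upper_off ?subrr//; first exact: cav_Omega.
    by move=> [_]; have := cav_below cx; rewrite ltNge => /negP h0 /ltW /h0.
  + rewrite (_ : (fun _ => _) = (fun=> 0)); first exact: cvg_cst.
    apply/funext => k; rewrite /l2norm (_ : Rintegral _ _ _ = 0) ?sqrtr0//.
    apply: Rintegral_eq0 => t _.
    by rewrite subrr/= !expr0n/= addr0 sqrtr0 expr0n.
Qed.

End TestFunctions.

(** * Complex integrals and pairings on the arc *)

Section ComplexIntegrals.
Context d (T : measurableType d) (R : realType) (mu : {measure set T -> \bar R}).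
Variables (A : set T) (mA : measurable A).
Local Open Scope complex_scope.
Implicit Types (f g : T -> R[i]) (z w : R[i]).

Definition cintegrable f := forall b, mu.-integrable A (EFin \o (fun x => part b (f x))).

Lemma part_mul b z w : part b (z * w) =
  if b then part true z * part true w - part false z * part false w
  else part true z * part false w + part false z * part true w.
Proof. by case: b z w => [] [z1 z2] [w1 w2]. Qed.

Lemma part_conj b z : part b z^* = if b then part b z else - part b z.
Proof. by case: b z => [] []. Qed.

Lemma cintegrableZ z f : cintegrable f -> cintegrable (fun x => z * f x).
Proof.
move=> fi b; have h c (a : R) := itgZ mA a (fi c).
case: b; under eq_fun do rewrite part_mul/=.
  exact: (itgB mA (h true _) (h false _)).
exact: (itgD mA (h false _) (h true _)).
Qed.

Lemma cintZ z f : cintegrable f -> cint mu A (fun x => z * f x) = z * cint mu A f.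
Proof.
move=> fi; apply: part_ext => b; have h c (a : R) := itgZ mA a (fi c).
have i1 := fi true; have i2 := fi false.
rewrite part_mul !part_cint; case: b; rewrite -(RintegralZl _ mA i1) -(RintegralZl _ mA i2).
  by rewrite -RintegralB//; apply: eq_Rintegral => x _; rewrite part_mul.
by rewrite -RintegralD//; apply: eq_Rintegral => x _; rewrite part_mul.
Qed.

Lemma cintD f g : cintegrable f -> cintegrable g ->
  cint mu A (fun x => f x + g x) = cint mu A f + cint mu A g.
Proof.
move=> fi gi; apply: part_ext => b; rewrite partD !part_cint -RintegralD//.
by apply: eq_Rintegral => x _; rewrite partD.
Qed.

Lemma cint0 : cint mu A (fun=> 0 : R[i]) = 0.
Proof. by apply: part_ext => b; rewrite part_cint part0; apply: Rintegral_eq0 => x _; case: b. Qed.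

Lemma cintegrable0 : cintegrable (fun=> 0 : R[i]).
Proof. by move=> b; under eq_fun do rewrite part0; exact: integrable0. Qed.

Lemma cintegrableD f g : cintegrable f -> cintegrable g -> cintegrable (fun x => f x + g x).
Proof.
by move=> fi gi b; under eq_fun do rewrite partD; exact: (itgD mA (fi b) (gi b)).
Qed.

Lemma cint_sum (I : Type) (s : seq I) (F : I -> T -> R[i]) : (forall i, cintegrable (F i)) ->
  cint mu A (fun x => \sum_(i <- s) F i x) = \sum_(i <- s) cint mu A (F i) /\
  cintegrable (fun x => \sum_(i <- s) F i x).
Proof.
move=> Fi; elim: s => [|i s [ih1 ih2]].
  rewrite big_nil -[RHS]cint0; split.
    by congr cint; apply/funext => x; rewrite big_nil.
  by under eq_fun do rewrite big_nil; exact: cintegrable0.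
have E : (fun x => \sum_(j <- i :: s) F j x) = (fun x => F i x + \sum_(j <- s) F j x).
  by apply/funext => x; rewrite big_cons.
by rewrite E big_cons -ih1 cintD//; split => //; exact: cintegrableD.
Qed.

End ComplexIntegrals.

Section ArcPairing.
Variables (R : realType) (G : cavity R) (M : medium G).
Local Notation T1 := (measurableTypeR R).
Local Notation I1 A f := (Rintegral (@leb1 R) A f).
Local Notation arc := (`]0%R, pi[%classic : set R).
Local Open Scope complex_scope.
Let marc : measurable (arc : set T1). Proof. exact: measurable_itv. Qed.

Definition arcL2 (g : R -> R[i]) := forall b, sqint (@leb1 R) arc (fun t => part b (g t)).

Definition hq (n : nat) : R[i] := hankel1' n (kappa0 M * Rad G) / hankel1 n (kappa0 M * Rad G).

Lemma sine_pairing (g : R -> R[i]) n : arcL2 g ->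
  cintegrable (@leb1 R) arc (fun t => (sin (n%:R * t))%:C * (g t)^*) /\
  cint (@leb1 R) arc (fun t => (sin (n%:R * t))%:C * (g t)^*) = (pi / 2)%:C * (sine_coef g n)^*.
Proof.
move=> sg.
have E b t : part b ((sin (n%:R * t))%:C * (g t)^*) =
    (if b then 1 else -1) * (part b (g t) * sin (n%:R * t)).
  by rewrite part_mul; case: b; rewrite !part_conj/=; ring.
have it b := itg_sine n (sg b).
split=> [b|].
  apply: (eq_itgE _ (itgZ marc (if b then 1 else -1) (it b))) => t.
  by rewrite /= E.
apply: part_ext => b; rewrite part_cint.
under eq_Rintegral do rewrite E.
rewrite RintegralZl//.
have -> : part b ((pi / 2)%:C * (sine_coef g n)^*) = pi / 2 * ((if b then 1 else -1) * part b (sine_coef g n)).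
  by rewrite part_mul; case: b; rewrite !part_conj/=; ring.
rewrite part_sine_coef /sinc; move: (I1 _ _) => J.
have pn : pi != 0 :> R by rewrite gt_eqF ?pi_gt0.
by move: (@pi R) pn => p pn; field.
Qed.

(** Parseval for a finite sum of sines: [g] enters through its coefficients alone, so integrability
    is asked of [h] only. *)
Lemma arc_pairing_B_TM_N (g h : R -> R[i]) N : arcL2 h ->
  arc_pairing G (B_TM_N M N g) h = (Rad G * kappa0 M * (pi / 2))%:C *
    \sum_(1 <= n < N.+1) hq n * sine_coef g n * (sine_coef h n)^*.
Proof.
move=> sh; rewrite /arc_pairing.
pose F n t := (hq n * sine_coef g n) * ((sin (n%:R * t))%:C * (h t)^*).
have iF n : cintegrable (@leb1 R) arc (F n).
  exact: (cintegrableZ marc _ (sine_pairing n sh).1).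
have [E1 E2] := cint_sum marc (index_iota 1 N.+1) iF.
rewrite (_ : (fun t => _) = (fun t => (kappa0 M)%:C * \sum_(1 <= n < N.+1) F n t)); last first.
  apply/funext => t; rewrite /B_TM_N -mulrA mulr_suml; congr (_ * _).
  by apply: eq_bigr => n _; rewrite /F /hq !mulrA.
have -> : (Rad G * kappa0 M * (pi / 2))%:C = (Rad G)%:C * ((kappa0 M)%:C * (pi / 2)%:C).
  by move: (kappa0 M) (pi / 2) => k p; rewrite -mulrA !(rmorphM (real_complex R)).
rewrite (cintZ marc _ E2) E1 -!mulrA; congr (_ * (_ * _)).
rewrite mulr_sumr; apply: eq_bigr => n _.
rewrite (cintZ marc _ (sine_pairing n sh).1) (sine_pairing n sh).2.
by ring.
Qed.

End ArcPairing.

(** * Orthogonality of the sines on $(0,\pi)$ *)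

Section SineOrthogonality.
Variable R : realType.
Local Notation T1 := (measurableTypeR R).
Local Notation I1 A f := (Rintegral (@leb1 R) A f).
Local Notation arc := (`]0%R, pi[%classic : set R).

Lemma continuous_scaled_cos (k : R) : continuous (fun t : R => cos (k * t)).
Proof.
move=> t; apply: continuous_comp; last exact: continuous_cos.
by apply: cvgM; [exact: cvg_cst|exact: cvg_id].
Qed.

Lemma sin_natpi n : sin (n%:R * pi) = 0 :> R.
Proof.
elim: n => [|n ih]; first by rewrite mul0r sin0.
by rewrite -natr1 mulrDl mul1r sinDpi ih oppr0.
Qed.

Lemma Rintegral_cos n : (0 < n)%N -> I1 arc (fun t => cos (n%:R * t)) = 0.
Proof.
move=> n0; have n0' : n%:R != 0 :> R by rewrite pnatr_eq0 -lt0n.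
have D (t : R) : is_derive t (1 : R) (fun t => n%:R^-1 * sin (n%:R * t)) (cos (n%:R * t)).
  have h : is_derive t (1 : R) (fun t => n%:R * t) n%:R.
    by apply: is_derive_eq; rewrite /GRing.scale/= mulr1.
  have H := @is_derive1_comp R (@sin R) (fun t => n%:R * t) t _ _ (is_derive_sin _) h.
  have := is_deriveZ n%:R^-1 H; congr is_derive.
  by rewrite /GRing.scale/= mulrCA mulVf// mulr1.
rewrite (FTC_Rintegral _ _ (pi_ge0 R) D); last exact: continuous_scaled_cos.
by rewrite sin_natpi mulr0 mulr0 sin0 mulr0 subrr.
Qed.

Lemma Rintegral_sin_sin n m : (0 < n)%N ->
  I1 arc (fun t => sin (n%:R * t) * sin (m%:R * t)) = if n == m then pi / 2 else 0.
Proof.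
move=> n0; have marc : measurable (arc : set T1) by exact: measurable_itv.
have ic (k : R) : (@leb1 R).-integrable arc (EFin \o (fun t => cos (k * t))).
  by apply: itg1_continuous; exact: continuous_scaled_cos.
have E (t : R) : sin (n%:R * t) * sin (m%:R * t) =
    2^-1 * (cos ((n%:R - m%:R) * t) - cos ((n + m)%:R * t)).
  by rewrite natrD mulrBl mulrDl cosB cosD; field.
under eq_Rintegral do rewrite E.
rewrite RintegralZl//; last exact: (itgB marc (ic _) (ic _)).
rewrite RintegralB//.
rewrite (@Rintegral_cos (n + m)) ?addn_gt0 ?n0// subr0.
case: eqVneq => [<-|nm].
  under eq_Rintegral do rewrite subrr mul0r cos0.
  rewrite Rintegral_cst//= mul1r leb1_itv ?pi_ge0//= subr0.
  by rewrite mulrC.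
have [lt|le] := ltnP n m.
  under eq_Rintegral do rewrite -opprB mulNr cosN -natrB ?(ltnW lt)//.
  by rewrite Rintegral_cos ?mulr0// subn_gt0.
under eq_Rintegral do rewrite -natrB//.
by rewrite Rintegral_cos ?mulr0// subn_gt0 ltn_neqAle eq_sym nm.
Qed.

Lemma sinc_sin (a : R) n m : (0 < n)%N ->
  sinc (fun t => a * sin (n%:R * t)) m = if n == m then a else 0.
Proof.
move=> n0; rewrite /sinc; have marc : measurable (arc : set T1) by exact: measurable_itv.
under eq_Rintegral do rewrite -mulrA.
rewrite RintegralZl//; last first.
  apply: itg1_continuous; apply: continuousM_fun => t;
    (apply: continuous_comp; [by apply: cvgM; [exact: cvg_cst|exact: cvg_id]|exact: continuous_sin]).
rewrite Rintegral_sin_sin//; case: eqP => _; last by rewrite !mulr0.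
have pn : pi != 0 :> R by rewrite gt_eqF ?pi_gt0.
by move: (@pi R) pn => p pn; field.
Qed.

End SineOrthogonality.

Lemma measurable_part_mulJ d (T : measurableType d) (R : realType) (A : set T) (f g : T -> R[i]) :
  (forall c, measurable_fun A (fun x => part c (f x))) ->
  (forall c, measurable_fun A (fun x => part c (g x))) ->
  forall b, measurable_fun A (fun x => part b (f x * (g x)^*%R)).
Proof.
move=> mf mg b.
have E x : part b (f x * (g x)^*%R) = if b then part true (f x) * part true (g x) + part false (f x) * part false (g x)
    else part false (f x) * part true (g x) - part true (f x) * part false (g x).
  by rewrite part_mul !part_conj; case: b; ring.
under eq_fun do rewrite E; case: b {E}.
  by apply: measurable_funD; exact: measurable_funM.
by apply: measurable_funB; exact: measurable_funM.
Qed.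

Lemma part_mul_upperC (R : realType) b (z : R[i]) (f : R * R -> R) x :
  part b (z * (upperC f x)^*%R) = part b z * upper f x.
Proof. by rewrite part_mul !part_conj /upperC !part_real; case: b; ring. Qed.

Lemma part_mul2_upperC_off (R : realType) (G : cavity R) b (z1 z2 : R[i]) (f1 f2 : R * R -> R) x :
  Omega G x -> ~ half_disk (Rad G) x ->
  part b (z1 * (upperC f1 x)^*%R + z2 * (upperC f2 x)^*%R) = 0.
Proof. by move=> Ox nx; rewrite partD !part_mul_upperC !(upper_off _ Ox nx) !mulr0 addr0. Qed.

Lemma part_mul2_upperC (R : realType) (r : R) b (z1 z2 : R[i]) (f1 f2 : R * R -> R) x :
  half_disk r x -> part b (z1 * (upperC f1 x)^*%R + z2 * (upperC f2 x)^*%R) =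
  part b z1 * f1 x + part b z2 * f2 x.
Proof. by move=> [_ x2]; rewrite partD !part_mul_upperC /upper x2. Qed.

(** * The variational form tested against one mode *)

Section VariationalIdentity.
Variables (R : realType) (G : cavity R) (M : medium G).
Local Notation T1 := (measurableTypeR R).
Local Notation T2 := (T1 * T1)%type.
Local Notation I2 A f := (Rintegral (@leb2 R) A f).
Local Notation I1 A f := (Rintegral (@leb1 R) A f).
Local Notation r := (Rad G).
Local Notation hd := (half_disk r).
Local Notation arc := (`]0%R, pi[%classic : set R).
Local Open Scope complex_scope.
Let marc : measurable (arc : set T1). Proof. exact: measurable_itv. Qed.
Let r0 : 0 < r := Rad_gt0 G.
Let mhd := @measurable_half_disk R r.
Let mO := measurable_Omega G.

Lemma arc_traceP u g : is_trace hd (arc_point G) arc u g ->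
  is_trace hd (arc_point G) arc u (arc_trace G u).
Proof.
by move=> H; apply: (@xgetPex _ (fun=> 0) [set h | is_trace hd (arc_point G) arc u h]); exists g.
Qed.

(** Two traces of one function give the same right-hand side in the radial identity. This weak form
    of uniqueness is enough to compute with the chosen [arc_trace]. *)
Lemma trace_pairing_uniq u (g h : R -> R[i]) q b : H1 (Omega G) u ->
  is_trace hd (arc_point G) arc u g -> is_trace hd (arc_point G) arc u h -> smooth q ->
  I1 arc (fun t => part b (g t) * q (arc_point G t)) = I1 arc (fun t => part b (h t) * q (arc_point G t)).
Proof.
move=> Hu tg th sq; have [_ rg] := trace_radial Hu tg b; have [_ rh] := trace_radial Hu th b.
have r2 : r ^+ 2 != 0 by rewrite expf_neq0// gt_eqF.
by apply: (mulfI r2); rewrite -(rg q sq) -(rh q sq).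
Qed.

Section TestMode.
Variables (V : R * R -> R) (n : nat) (a : R).
Hypothesis n0 : (0 < n)%N.
Hypothesis sV : smooth V.
Hypothesis V_flat : forall s, V (s, 0) = 0.
Hypothesis V_arc : forall t, V (arc_point G t) = a * sin (n%:R * t).
Hypothesis V_inner : forall x, sqn x <= Rhat G ^+ 2 -> V x = 0.
Let v := upperC V.
Let gv := arc_trace G v.

Lemma is_trace_test : is_trace hd (arc_point G) arc v (fun t => (V (arc_point G t))%:C).
Proof. by apply: is_trace_upperC => //; exact: sqint_arc_smooth. Qed.

Lemma arcL2_test : arcL2 gv.
Proof. by have [/(L2P _ marc)] := arc_traceP is_trace_test. Qed.

Lemma test_trace_pairing b q : smooth q ->
  I1 arc (fun t => part b (gv t) * q (arc_point G t)) =
  if b then a * I1 arc (fun t => sin (n%:R * t) * q (arc_point G t)) else 0.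
Proof.
move=> sq; rewrite (trace_pairing_uniq b (H1_upperC G sV V_flat) (arc_traceP is_trace_test) is_trace_test sq).
case: b; last by apply: Rintegral_eq0 => t _; rewrite part_real mul0r.
rewrite -RintegralZl//; first by apply: eq_Rintegral => t _; rewrite part_real V_arc mulrA.
apply: itg1_continuous; apply: continuousM_fun => [t|].
  by apply: continuous_comp; [by apply: cvgM; [exact: cvg_cst|exact: cvg_id]|exact: continuous_sin].
by apply: continuous_arc; exact: smooth_continuous.
Qed.

(** The chosen trace of [v] is accessible only through pairings with smooth functions; $\sin m\phi$
    qualifies, being $r^{-m}P_m$ on the arc. *)
Lemma sine_coef_test m : sine_coef gv m = (if n == m then a else 0)%:C.
Proof.
apply: part_ext => b; rewrite part_sine_coef part_real.
have rm : r ^+ m != 0 by rewrite expf_neq0// gt_eqF.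
have E (g : R -> R) : sqint (@leb1 R) arc g -> sinc g m = (r ^+ m)^-1 * (2 / pi * I1 arc (fun t => g t * Pn m (arc_point G t))).
  move=> sg; rewrite /sinc mulrCA; congr (_ * _); apply: (mulfI rm); rewrite mulrA mulfV// mul1r.
  rewrite -RintegralZl//; last exact: itg_sine.
  by apply: eq_Rintegral => t _; rewrite (zpow_polar m r t).2; ring.
rewrite E; last exact: arcL2_test.
rewrite test_trace_pairing; last exact: smooth_P.
case: b; last by rewrite !mulr0.
rewrite -[RHS](sinc_sin a m n0) E; last first.
  by apply: (eq_sqint marc _ (sqint_arc_smooth G sV)) => t _; rewrite V_arc.
congr (_ * (_ * _)); rewrite -RintegralZl//; first by apply: eq_Rintegral => t _; rewrite mulrA.
apply: itg1_continuous; apply: continuousM_fun => [t|].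
  by apply: continuous_comp; [by apply: cvgM; [exact: cvg_cst|exact: cvg_id]|exact: continuous_sin].
by apply: continuous_arc; apply: smooth_continuous; exact: smooth_P.
Qed.

Lemma conj_sine_coef_test m : ((sine_coef gv m)^*)%R = (if n == m then a else 0)%:C.
Proof. by rewrite sine_coef_test; apply/eqP; rewrite eq_complex /= oppr0 !eqxx. Qed.

(** The partial sums are constant from $N=n$ on, so the limit exists for every [g] and consists of
    one term. *)
Lemma B_TM_pairing_test (g : R -> R[i]) : B_TM_pairing M g gv =
  (r * kappa0 M * (pi / 2) * a)%:C * (hq M n * sine_coef g n).
Proof.
have E N : (n <= N)%N -> arc_pairing G (B_TM_N M N g) gv =
    (r * kappa0 M * (pi / 2) * a)%:C * (hq M n * sine_coef g n).
  move=> nN; rewrite arc_pairing_B_TM_N; last exact: arcL2_test.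
  rewrite (bigD1_seq n) ?iota_uniq//= ?mem_index_iota ?n0//=.
  rewrite conj_sine_coef_test eqxx big1_seq ?addr0 => [|m /andP[mn _]]; last first.
    by rewrite conj_sine_coef_test eq_sym (negbTE mn) mulr0.
  have -> : (r * kappa0 M * (pi / 2) * a)%:C = (r * kappa0 M * (pi / 2))%:C * a%:C.
    by move: (r * _) => p; rewrite (rmorphM (real_complex R)).
  by ring.
have L (f : R[i] -> R) : limn (fun N => f (arc_pairing G (B_TM_N M N g) gv)) =
    f ((r * kappa0 M * (pi / 2) * a)%:C * (hq M n * sine_coef g n)).
  apply/cvg_lim => //; apply: cvg_near_cst; exists n => // N nN; by rewrite E.
by rewrite /B_TM_pairing !L; case: (_ * _).
Qed.

(** The smooth extension [q] of the data makes the weak uniqueness of the trace applicable. *)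
Lemma arc_pairing_test (f : R -> R[i]) :
  (forall b, exists2 q, smooth q & forall t, part b (f t) = q (arc_point G t)) ->
  arc_pairing G f gv = (r * (pi / 2) * a)%:C * sine_coef f n.
Proof.
move=> fq; rewrite /arc_pairing.
have sg := arcL2_test.
have [q1 sq1 fq1] := fq true; have [q2 sq2 fq2] := fq false.
have sq c q : smooth q -> (@leb1 R).-integrable arc (EFin \o (fun t => part c (gv t) * q (arc_point G t))).
  by move=> s; apply: sqint_mul => //; exact: sqint_arc_smooth.
have -> : (r * (pi / 2) * a)%:C = r%:C * (pi / 2 * a)%:C.
  by move: (pi / 2) => p; rewrite -mulrA (rmorphM (real_complex R)).
rewrite -mulrA; congr (_ * _).
have J q : smooth q -> a * I1 arc (fun t => sin (n%:R * t) * q (arc_point G t)) =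
   pi / 2 * a * sinc (fun t => q (arc_point G t)) n.
  move=> s; rewrite /sinc; have pn : pi != 0 :> R by rewrite gt_eqF ?pi_gt0.
  under eq_Rintegral do rewrite mulrC.
  by set j := I1 _ _; move: j (@pi R) pn => j p pn; field.
have E1 : sinc (fun t => part true (f t)) n = sinc (fun t => q1 (arc_point G t)) n.
  by congr (_ * _); apply: eq_Rintegral => t _; rewrite fq1.
have E2 : sinc (fun t => part false (f t)) n = sinc (fun t => q2 (arc_point G t)) n.
  by congr (_ * _); apply: eq_Rintegral => t _; rewrite fq2.
apply: part_ext => b; rewrite part_cint mulrC partM part_sine_coef.
case: b.
  rewrite E1 mulrC -J// -(test_trace_pairing true sq1).
  rewrite -[RHS]addr0 -[X in _ = _ + X](test_trace_pairing false sq2) -RintegralD//; [|exact: sq|exact: sq].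
  by apply: eq_Rintegral => t _; rewrite part_mul !part_conj fq1 fq2; ring.
rewrite E2 mulrC -J// -(test_trace_pairing true sq2).
rewrite -[RHS]subr0 -[X in _ = _ - X](test_trace_pairing false sq1) -RintegralB//; [|exact: sq|exact: sq].
by apply: eq_Rintegral => t _; rewrite part_mul !part_conj fq1 fq2; ring.
Qed.

Lemma kappa_exterior x : 0 < x.2 -> Rhat G ^+ 2 < sqn x -> kappa M x ^+ 2 = (kappa0 M ^+ 2)%:C.
Proof.
move=> x2 sx; have nh : ~ half_disk (Rhat G) x.
  by move=> [h _]; move: sx; rewrite /sqn ltNge => /negP; apply; exact: ltW.
rewrite /kappa sqrtCK (eps_exterior M x2 nh) (sigma_exterior M x2 nh) mulr0.
rewrite /kappa0 exprMn sqr_sqrtr ?mulrA// mulr_ge0// ltW//; [exact: eps0_gt0|exact: permeability_gt0].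
Qed.

Lemma weak_deriv_test :
  ae_eq (@leb2 R) (Omega G : set T2) (weak_deriv (Omega G) (e1 R) v) (upperC ('D_(e1 R) V)) /\
  ae_eq (@leb2 R) (Omega G : set T2) (weak_deriv (Omega G) (e2 R) v) (upperC ('D_(e2 R) V)).
Proof.
have [w1 w2] := weak_deriv_upperC G sV V_flat.
have key e g : is_weak_deriv (Omega G) e v g ->
    ae_eq (@leb2 R) (Omega G : set T2) (weak_deriv (Omega G) e v) g.
  move=> H; have H1 := weak_derivP H.
  have P b := wd_Omega_uniq ((is_weak_derivP _ _ _ mO).1 H1 b) ((is_weak_derivP _ _ _ mO).1 H b).
  apply: filterS2 (P true) (P false) => x /= h1 h2 Ox.
  by apply: part_ext => -[]; [exact: h1|exact: h2].
by split; [exact: (key _ _ w1)|exact: (key _ _ w2)].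
Qed.

(** The test function is real and vanishes in the cavity and in the inner half-disk; in the rest of
    the domain the medium is homogeneous, so $\kappa^2$ becomes $\kappa_0^2$. *)
Lemma a_TM_test u b : H10 G u ->
  part b (a_TM M u v) =
    I2 hd (fun x => part b (weak_deriv (Omega G) (e1 R) u x) * 'D_(e1 R) V x
                  + part b (weak_deriv (Omega G) (e2 R) u x) * 'D_(e2 R) V x)
    - kappa0 M ^+ 2 * I2 hd (fun x => part b (u x) * V x)
    - part b (B_TM_pairing M (arc_trace G u) gv).
Proof.
move=> [[Lu [g1 /weak_derivP W1] [g2 /weak_derivP W2]] _ _].
have [L1 _] := W1; have [L2' _] := W2.
rewrite /a_TM !partB !part_cint; congr (_ - _ - _).
- have [v1 v2] := weak_deriv_test.
  have mp (f : R * R -> R[i]) c : L2 (@leb2 R) (Omega G) f -> measurable_fun (Omega G : set T2) (fun x : T2 => part c (f x)).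
    by move=> /(L2P _ mO) /(_ c) [].
  have [w1 w2] := weak_deriv_upperC G sV V_flat.
  have [Lv1 _] := weak_derivP w1; have [Lv2 _] := weak_derivP w2.
  have [Lu1 _] := w1; have [Lu2 _] := w2.
  have mm (f g : R * R -> R[i]) : L2 (@leb2 R) (Omega G) f -> L2 (@leb2 R) (Omega G) g ->
      measurable_fun (Omega G : set T2) (fun x : T2 => part b (f x * (g x)^*%R)).
    by move=> Lf Lg; apply: (measurable_part_mulJ (d := _) (T := T2)) => c; exact: mp.
  transitivity (I2 (Omega G) (fun x => part b (weak_deriv (Omega G) (e1 R) u x * (upperC ('D_(e1 R) V) x)^*%R
       + weak_deriv (Omega G) (e2 R) u x * (upperC ('D_(e2 R) V) x)^*%R))).
    apply: ae_eq_Rintegral => //.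
    + by under eq_fun do rewrite partD; exact: (measurable_funD (mm _ _ L1 Lv1) (mm _ _ L2' Lv2)).
    + by under eq_fun do rewrite partD; exact: (measurable_funD (mm _ _ L1 Lu1) (mm _ _ L2' Lu2)).
    + by apply: filterS2 v1 v2 => x /= h1 h2 Ox; rewrite h1// h2.
  rewrite (@Rintegral_subset0 _ T2 R (@leb2 R) (Omega G) hd); last 2 first.
  + exact: half_disk_Omega.
  + move=> x Ox nx; exact: part_mul2_upperC_off Ox nx.
  by apply: eq_Rintegral => x; rewrite inE => hx; exact: part_mul2_upperC hx.
- rewrite (@Rintegral_subset0 _ T2 R (@leb2 R) (Omega G) hd); last 2 first.
  + exact: half_disk_Omega.
  + by move=> x Ox nx; rewrite part_mul_upperC (upper_off _ Ox nx) mulr0.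
  have iV : (@leb2 R).-integrable hd (EFin \o (fun x => part b (u x) * V x)).
    apply: sqint_mul => //; first exact: sqint_sub_Omega.
    by apply: sqint_continuous => //; exact: smooth_continuous.
  rewrite -RintegralZl//; apply: eq_Rintegral => x; rewrite inE => hx.
  rewrite part_mul_upperC (upper_hd _ hx).
  have [sx|sx] := leP (sqn x) (Rhat G ^+ 2); first by rewrite V_inner// !mulr0.
  rewrite kappa_exterior//; last by case: hx.
  by move: (kappa0 M ^+ 2) => k; rewrite mulrA; congr (_ * _); rewrite mulrC partM mulrC.
Qed.

End TestMode.
End VariationalIdentity.

(** * Decay of the sine coefficients of the reference field *)

Section PolynomialApproximation.
Variables (R : realType) (B rho : R).
Hypothesis B0 : 0 <= B.
Hypothesis rho0 : 0 < rho <= 1.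

(* [f] is within [O(rho^n)] of a polynomial of degree less than [n] on [-B, B]. *)
Definition approximable (f : R -> R) := exists C : R, forall n, exists p : nat -> R,
  forall y, `|y| <= B -> `|f y - \sum_(k < n) p k * y ^+ k| <= C * rho ^+ n.

Lemma approximable_ps M a (c : nat -> R) : 0 <= a -> expb M a c -> approximable (ps c).
Proof.
move=> a0 hc; have /andP[r0 r1] := rho0.
exists (M * expR (a / rho * B)) => n; exists c => y yB.
pose c' k := if (k < n)%N then 0 else c k.
have M0 := expb_ge0 hc.
(* For $k\ge n$ and $\rho\le1$, $a^k=\rho^k(a/\rho)^k\le\rho^n(a/\rho)^k$: enlarging the exponential
   type makes the tail small. *)
have hc' : expb (M * rho ^+ n) (a / rho) c'.
  move=> k; rewrite /c'; case: ltnP => kn.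
    have r0' := ltW r0; rewrite normr0; apply: mulr_ge0; first by apply: mulr_ge0 => //; exact: exprn_ge0.
    by apply: divr_ge0 => //; apply: exprn_ge0; exact: divr_ge0.
  apply: le_trans (hc k) _; rewrite -[leRHS]mulrA ler_wpM2l// mulrA ler_wpM2r ?invr_ge0//.
  rewrite expr_div_n mulrCA ler_peMr ?exprn_ge0//.
  rewrite ler_pdivlMr ?exprn_gt0// mul1r -(subnK kn) exprD ler_piMl ?exprn_ge0 ?(ltW r0)//.
  by rewrite exprn_ile1// ltW.
have a0' : 0 <= a / rho by rewrite divr_ge0// ltW.
have -> : ps c y - \sum_(k < n) c k * y ^+ k = ps c' y.
  apply/eqP; rewrite subr_eq; apply/eqP; apply/cvg_lim => //.
  have H := is_cvg_ps (x := y) a0' hc'.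
  have : (fun N => pseries c' y N + \sum_(k < n) c k * y ^+ k) @ \oo --> ps c' y + \sum_(k < n) c k * y ^+ k.
    by apply: cvgn_add => //; exact: cvg_cst.
  rewrite -(cvg_shiftn n) -[X in X -> _]/(_ @ \oo --> _) => H2; rewrite -(cvg_shiftn n).
  apply: eq_cvgn H2 => N /=; rewrite /pseries /series/=.
  have split (f : nat -> R) : \sum_(0 <= k < N + n) f k = \sum_(k < n) f k + \sum_(n <= k < N + n) f k.
    by rewrite (big_cat_nat (n := n))//= ?leq_addl// big_mkord.
  rewrite !split big1 ?add0r; last by move=> k _; rewrite /c' ltn_ord mul0r.
  rewrite addrC; congr (_ + _); apply: eq_big_nat => k /andP[nk _].
  by rewrite /c' ltnNge nk.
apply: le_trans (ps_le y a0' hc') _.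
rewrite [leLHS]mulrAC ler_wpM2r//; first by apply: exprn_ge0; exact: ltW.
rewrite ler_wpM2l// ler_expR.
by rewrite ler_wpM2l.
Qed.

Lemma approximable_mulid f : approximable f -> approximable (fun y => y * f y).
Proof.
move=> [C hC]; have /andP[r0 r1] := rho0.
have C0 : 0 <= C.
  have [p /(_ 0)] := hC 0%N; rewrite normr0 expr0 mulr1 => /(_ B0).
  exact: le_trans.
(* Multiplication by $y$ raises the degree by one; the loss of one power of [rho] goes into the
   constant, and $n=0$ is handled by the zero polynomial. *)
exists (B * C / rho) => -[|n].
  exists (fun=> 0) => y yB; have [p /(_ y yB)] := hC 0%N.
  rewrite !big_ord0 !subr0 !expr0 !mulr1 normrM => h.
  apply: (@le_trans _ _ (B * C)); first exact: ler_pM.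
  by rewrite ler_pdivlMr// ler_piMr// mulr_ge0.
have [p hp] := hC n; exists (fun k => if k is k'.+1 then p k' else 0) => y yB.
rewrite big_ord_recl mul0r add0r.
rewrite (_ : \sum_(i < n) _ = y * \sum_(k < n) p k * y ^+ k); last first.
  by rewrite mulr_sumr; apply: eq_bigr => k _; rewrite /= exprS; ring.
rewrite -mulrBr normrM exprS mulrA divfK ?gt_eqF//.
by rewrite -mulrA; apply: ler_pM => //; exact: hp.
Qed.

Lemma approximableN f : approximable f -> approximable (fun y => - f y).
Proof.
move=> [C hC]; exists C => n; have [p hp] := hC n; exists (fun k => - p k) => y yB.
under eq_bigr do rewrite mulNr.
by rewrite sumrN -opprD normrN; exact: hp.
Qed.

Lemma approximable_entire (e : nat -> R) (a : R) : (forall k, `|e k| <= 1) ->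
  approximable (ps (fun k => e k / k`!%:R * a ^+ k)).
Proof.
move=> e1; apply: (@approximable_ps 1 `|a|) => // k.
rewrite mul1r 2!normrM normfV (ger0_norm (ler0n R (k`!))) normrX mulrAC -[leRHS]mul1r -mulrA.
by apply: ler_pM => //; rewrite divr_ge0// exprn_ge0.
Qed.

Lemma approximable_cos (a : R) : approximable (fun y => cos (a * y)).
Proof.
have -> : (fun y => cos (a * y)) = ps (fun k => ((~~ odd k)%:R * (-1) ^+ k./2) / k`!%:R * a ^+ k).
  apply/funext => y; rewrite cosE /ps; congr (limn _); apply/funext => n.
  by rewrite /pseries /series/=; apply: eq_bigr => k _; rewrite exprMn; ring.
apply: approximable_entire => k; rewrite normrM normrX normrN1 expr1n mulr1.
by case: odd; rewrite ?normr0 ?normr1.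
Qed.

Lemma approximable_sin (a : R) : approximable (fun y => sin (a * y)).
Proof.
have -> : (fun y => sin (a * y)) = ps (fun k => ((odd k)%:R * (-1) ^+ k.-1./2) / k`!%:R * a ^+ k).
  apply/funext => y; rewrite sinE /ps; congr (limn _); apply/funext => n.
  by rewrite /pseries /series/=; apply: eq_bigr => k _; rewrite exprMn; ring.
apply: approximable_entire => k; rewrite normrM normrX normrN1 expr1n mulr1.
by case: odd; rewrite ?normr0 ?normr1.
Qed.

End PolynomialApproximation.

(** * Sine coefficients of functions of plane-wave phases *)

Section PlaneWaves.
Variables (R : realType) (al be : R).
Local Notation T1 := (measurableTypeR R).
Local Notation I1 A f := (Rintegral (@leb1 R) A f).
Local Notation arc := (`]0%R, pi[%classic : set R).
Let marc : measurable (arc : set T1). Proof. exact: measurable_itv. Qed.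

(** The phases of the incident and of the reflected wave on the arc, divided by the radius. *)
Definition wave_m (t : R) := al * cos t - be * sin t.
Definition wave_p (t : R) := al * cos t + be * sin t.

Lemma continuousX_fun (f : R -> R) k : continuous f -> continuous (fun t => f t ^+ k).
Proof.
move=> cf; elim: k => [|k ih]; first by under eq_fun do rewrite expr0; move=> t; exact: cvg_cst.
by under eq_fun do rewrite exprS; exact: continuousM_fun.
Qed.

Lemma continuousD_fun (f g : R -> R) : continuous f -> continuous g -> continuous (fun t => f t + g t).
Proof. by move=> cf cg t; apply: cvgD; [exact: cf|exact: cg]. Qed.

Lemma continuousN_fun (f : R -> R) : continuous f -> continuous (fun t => - f t).
Proof. by move=> cf t; apply: cvgN; exact: cf. Qed.

Lemma continuous_cst_fun (a : R) : continuous (fun _ : R => a).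
Proof. by move=> t; exact: cvg_cst. Qed.

Lemma continuous_scaled_sin (k : R) : continuous (fun t : R => sin (k * t)).
Proof.
move=> t; apply: continuous_comp; last exact: continuous_sin.
by apply: cvgM; [exact: cvg_cst|exact: cvg_id].
Qed.

Lemma continuous_waves : continuous wave_m /\ continuous wave_p.
Proof.
have c := @continuous_cos R; have s := @continuous_sin R.
split; apply: continuousD_fun; rewrite ?/wave_m.
- by apply: continuousM_fun => //; exact: continuous_cst_fun.
- by apply: continuousN_fun; apply: continuousM_fun => //; exact: continuous_cst_fun.
- by apply: continuousM_fun => //; exact: continuous_cst_fun.
- by apply: continuousM_fun => //; exact: continuous_cst_fun.
Qed.

(* Multiplying by [wave_m] or [wave_p] shifts frequencies by at most one. *)
Lemma waves_low_frequency k m : (k < m)%N ->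
  I1 arc (fun t => (wave_m t ^+ k - wave_p t ^+ k) * sin (m%:R * t)) = 0 /\
  I1 arc (fun t => (wave_m t ^+ k + wave_p t ^+ k) * cos (m%:R * t)) = 0.
Proof.
have [cm cp] := continuous_waves.
have cD j : continuous (fun t => wave_m t ^+ j + wave_p t ^+ j).
  by apply: continuousD_fun; exact: continuousX_fun.
have cB j : continuous (fun t => wave_m t ^+ j - wave_p t ^+ j).
  by apply: continuousD_fun; [|apply: continuousN_fun]; exact: continuousX_fun.
have iS j l : (@leb1 R).-integrable arc (EFin \o (fun t => (wave_m t ^+ j - wave_p t ^+ j) * sin (l * t))).
  by apply: itg1_continuous; apply: continuousM_fun => //; exact: continuous_scaled_sin.
have iC j l : (@leb1 R).-integrable arc (EFin \o (fun t => (wave_m t ^+ j + wave_p t ^+ j) * cos (l * t))).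
  by apply: itg1_continuous; apply: continuousM_fun => //; exact: continuous_scaled_cos.
elim: k m => [|k ih] m km.
  split.
    by apply: Rintegral_eq0 => t _; rewrite !expr0 subrr mul0r.
  under eq_Rintegral do rewrite !expr0.
  rewrite RintegralZl//; last by apply: itg1_continuous; exact: continuous_scaled_cos.
  by rewrite Rintegral_cos// mulr0.
have [s1 c1] := ih m.+1 (leqW (ltnW km)); have [s2 c2] := ih m.-1 ltac:(lia).
have m0 : (0 < m)%N by lia.
have Em : m.-1%:R = m%:R - 1 :> R by rewrite -subn1 natrB.
have Ep : m.+1%:R = m%:R + 1 :> R by rewrite -natr1.
have T t : [/\ sin (m.+1%:R * t) = sin (m%:R * t) * cos t + cos (m%:R * t) * sin t,
    sin (m.-1%:R * t) = sin (m%:R * t) * cos t - cos (m%:R * t) * sin t,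
    cos (m.+1%:R * t) = cos (m%:R * t) * cos t - sin (m%:R * t) * sin t &
    cos (m.-1%:R * t) = cos (m%:R * t) * cos t + sin (m%:R * t) * sin t :> R].
  by rewrite Em Ep mulrDl mulrBl mul1r sinD cosD sinB cosB.
split.
- transitivity (al / 2 * (I1 arc (fun t => (wave_m t ^+ k - wave_p t ^+ k) * sin (m.+1%:R * t)) +
     I1 arc (fun t => (wave_m t ^+ k - wave_p t ^+ k) * sin (m.-1%:R * t))) -
     be / 2 * (I1 arc (fun t => (wave_m t ^+ k + wave_p t ^+ k) * cos (m.-1%:R * t)) -
     I1 arc (fun t => (wave_m t ^+ k + wave_p t ^+ k) * cos (m.+1%:R * t)))); last first.
    by rewrite s1 s2 c1 c2 !(addr0, subr0, mulr0).
  rewrite -RintegralD// -RintegralB//.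
  rewrite -RintegralZl//; last exact: (itgD marc (iS _ _) (iS _ _)).
  rewrite -RintegralZl//; last exact: (itgB marc (iC _ _) (iC _ _)).
  rewrite -RintegralB//; [|exact: (itgZ marc _ (itgD marc (iS _ _) (iS _ _)))|exact: (itgZ marc _ (itgB marc (iC _ _) (iC _ _)))].
  apply: eq_Rintegral => t _; have [-> -> -> ->] := T t; rewrite !exprS.
  move: (wave_m t ^+ k) (wave_p t ^+ k) => x y; rewrite /wave_m /wave_p.
  by move: (cos t) (sin t) (cos _) (sin _) => *; field.
- transitivity (al / 2 * (I1 arc (fun t => (wave_m t ^+ k + wave_p t ^+ k) * cos (m.+1%:R * t)) +
     I1 arc (fun t => (wave_m t ^+ k + wave_p t ^+ k) * cos (m.-1%:R * t))) -
     be / 2 * (I1 arc (fun t => (wave_m t ^+ k - wave_p t ^+ k) * sin (m.+1%:R * t)) -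
     I1 arc (fun t => (wave_m t ^+ k - wave_p t ^+ k) * sin (m.-1%:R * t)))); last first.
    by rewrite s1 s2 c1 c2 !(addr0, subr0, mulr0).
  rewrite -RintegralD// -RintegralB//.
  rewrite -RintegralZl//; last exact: (itgD marc (iC _ _) (iC _ _)).
  rewrite -RintegralZl//; last exact: (itgB marc (iS _ _) (iS _ _)).
  rewrite -RintegralB//; [|exact: (itgZ marc _ (itgD marc (iC _ _) (iC _ _)))|exact: (itgZ marc _ (itgB marc (iS _ _) (iS _ _)))].
  apply: eq_Rintegral => t _; have [-> -> -> ->] := T t; rewrite !exprS.
  move: (wave_m t ^+ k) (wave_p t ^+ k) => x y; rewrite /wave_m /wave_p.
  by move: (cos t) (sin t) (cos _) (sin _) => *; field.
Qed.

Lemma continuous_poly (p : nat -> R) n : continuous (fun y : R => \sum_(k < n) p k * y ^+ k).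
Proof.
elim: n => [|n ih]; first by under eq_fun do rewrite big_ord0; exact: continuous_cst_fun.
under eq_fun do rewrite big_ord_recr/=.
apply: continuousD_fun => //; apply: continuousM_fun; first exact: continuous_cst_fun.
by apply: continuousX_fun => t; exact: cvg_id.
Qed.

Lemma continuous_comp_fun (f g : R -> R) : continuous f -> continuous g -> continuous (fun t => f (g t)).
Proof. by move=> cf cg t; apply: continuous_comp; [exact: cg|exact: cf]. Qed.

(** A polynomial of degree below $n$ in the phases is orthogonal to $\sin n\phi$ after
    antisymmetrization, so only the approximation error of [f] survives. *)
Lemma waves_decay (rho : R) (f : R -> R) : 0 < rho <= 1 -> continuous f ->
  approximable (`|al| + `|be|) rho f -> exists C, forall n,
  `|I1 arc (fun t => (f (wave_m t) - f (wave_p t)) * sin (n%:R * t))| <= C * rho ^+ n.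
Proof.
move=> r01 cf [C hC]; have [cm cp] := continuous_waves.
exists (2 * C * pi) => n; have [p hp] := hC n.
have bw t : `|wave_m t| <= `|al| + `|be| /\ `|wave_p t| <= `|al| + `|be|.
  have h1 : `|al * cos t| <= `|al| by rewrite normrM ler_piMr// ler_norml cos_geN1 cos_le1.
  have h2 : `|be * sin t| <= `|be| by rewrite normrM ler_piMr// ler_norml sin_geN1 sin_le1.
  by split; [apply: le_trans (ler_normB _ _) _|apply: le_trans (ler_normD _ _) _]; exact: lerD.
pose P (y : R) := \sum_(k < n) p k * y ^+ k.
have cP : continuous P by exact: continuous_poly.
have cs : continuous (fun t : R => sin (n%:R * t)) by exact: continuous_scaled_sin.
have iP : I1 arc (fun t => (P (wave_m t) - P (wave_p t)) * sin (n%:R * t)) = 0.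
  have E t : (P (wave_m t) - P (wave_p t)) * sin (n%:R * t) =
      \sum_(k < n) p k * ((wave_m t ^+ k - wave_p t ^+ k) * sin (n%:R * t)).
    by rewrite /P -sumrB mulr_suml; apply: eq_bigr => k _; ring.
  have ik (k : 'I_n) : (@leb1 R).-integrable arc
      (EFin \o (fun t => (wave_m t ^+ k - wave_p t ^+ k) * sin (n%:R * t))).
    apply: itg1_continuous; apply: continuousM_fun => //.
    by apply: continuousD_fun; [|apply: continuousN_fun]; exact: continuousX_fun.
  under eq_Rintegral do rewrite E.
  rewrite Rintegral_sum//; last by move=> k; exact: itgZ.
  rewrite big1// => k _; rewrite RintegralZl//.
  by rewrite (waves_low_frequency (ltn_ord k)).1 mulr0.
have c1 : continuous (fun t => (f (wave_m t) - f (wave_p t)) * sin (n%:R * t)).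
  apply: continuousM_fun => //; apply: continuousD_fun; first exact: continuous_comp_fun.
  by apply: continuousN_fun; exact: continuous_comp_fun.
have c2 : continuous (fun t => (P (wave_m t) - P (wave_p t)) * sin (n%:R * t)).
  apply: continuousM_fun => //; apply: continuousD_fun; first exact: continuous_comp_fun.
  by apply: continuousN_fun; exact: continuous_comp_fun.
set J := I1 _ _.
have -> : J = I1 arc (fun t => (f (wave_m t) - f (wave_p t)) * sin (n%:R * t) -
    (P (wave_m t) - P (wave_p t)) * sin (n%:R * t)).
  rewrite RintegralB//; [|exact: itg1_continuous|exact: itg1_continuous].
  by rewrite iP subr0.
have c3 := continuousD_fun c1 (continuousN_fun c2).
apply: le_trans (le_normr_Rintegral marc _) _; first exact: itg1_continuous.
have -> : 2 * C * pi * rho ^+ n = I1 arc (fun=> 2 * (C * rho ^+ n)).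
  by rewrite Rintegral_cst//= leb1_itv ?pi_ge0//= subr0; ring.
apply: le_Rintegral => //.
- apply: itg1_continuous.
  exact: (continuous_comp_fun (f := fun x : R => `|x|) (@norm_continuous R R) c3).
- by apply: itg1_continuous; exact: continuous_cst_fun.
move=> t _; rewrite -mulrBl normrM; have [b1 b2] := bw t.
apply: (@le_trans _ _ (`|f (wave_m t) - f (wave_p t) - (P (wave_m t) - P (wave_p t))| * 1)).
  by rewrite ler_wpM2l// ler_norml sin_geN1 sin_le1.
rewrite mulr1 (_ : _ - _ = (f (wave_m t) - P (wave_m t)) - (f (wave_p t) - P (wave_p t))); last by ring.
apply: le_trans (ler_normB _ _) _; have h1 := hp _ b1; have h2 := hp _ b2.
by rewrite /P; lra.
Qed.

End PlaneWaves.

Section ReferenceField.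
Variables (R : realType) (G : cavity R) (M : medium G) (theta : R).
Local Notation r := (Rad G).
Local Notation al := (alpha M theta).
Local Notation be := (beta M theta).
Local Notation I1 A f := (Rintegral (@leb1 R) A f).
Local Notation arc := (`]0%R, pi[%classic : set R).

Lemma smooth1_trig (a b : R) : smooth1 (fun y : R => a * cos y + b * sin y).
Proof.
apply: (@smooth1_coind _ (fun h => exists a b, h = fun y => a * cos y + b * sin y)); last by exists a, b.
move=> _ [{}a [{}b ->]]; exists (fun y => b * cos y + (- a) * sin y); first by exists b, (- a).
move=> x; have H : is_derive x (1 : R) (fun y => a * cos y + b * sin y) _ :=
  is_deriveD (is_deriveZ a (is_derive_cos x)) (is_deriveZ b (is_derive_sin x)).
by move: H; congr is_derive; rewrite /GRing.scale/=; ring.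
Qed.

(** The parts of $iy\,e^{iry}$, the radial derivative of a wave whose phase per unit radius is $y$;
    [ref_trace] gives those of $e^{iry}$. *)
Definition ref_radial (b : bool) (y : R) : R := if b then - (y * sin (r * y)) else y * cos (r * y).
Definition ref_trace (b : bool) (y : R) : R := if b then cos (r * y) else sin (r * y).

Lemma part_u_ref b x : part b (u_ref M theta x) =
  if b then cos (al * x.1 - be * x.2) - cos (al * x.1 + be * x.2)
  else sin (al * x.1 - be * x.2) - sin (al * x.1 + be * x.2).
Proof. by case: b. Qed.

Lemma part_u_ref_arc b t : part b (u_ref M theta (arc_point G t)) =
  ref_trace b (wave_m al be t) - ref_trace b (wave_p al be t).
Proof.
rewrite part_u_ref /ref_trace /wave_m /wave_p /arc_point/=.
by case: b; [congr (cos _ - cos _)|congr (sin _ - sin _)]; ring.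
Qed.

Lemma part_d_rho_u_ref b t : part b (d_rho G (u_ref M theta) t) =
  ref_radial b (wave_m al be t) - ref_radial b (wave_p al be t).
Proof.
have lin (a : R) : is_derive r (1 : R) (fun y => y * a) a.
  by apply: is_derive_eq; rewrite /GRing.scale/=; ring.
have dcos (a : R) : is_derive r (1 : R) (fun y => cos (y * a)) (- sin (r * a) * a).
  exact: (@is_derive1_comp R (@cos R) (fun y => y * a) r _ _ (is_derive_cos _) (lin a)).
have dsin (a : R) : is_derive r (1 : R) (fun y => sin (y * a)) (cos (r * a) * a).
  exact: (@is_derive1_comp R (@sin R) (fun y => y * a) r _ _ (is_derive_sin _) (lin a)).
have E c : (fun y => part c (u_ref M theta (y * cos t, y * sin t))) =
    (fun y => if c then cos (y * wave_m al be t) - cos (y * wave_p al be t)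
      else sin (y * wave_m al be t) - sin (y * wave_p al be t)).
  apply/funext => y; rewrite part_u_ref /wave_m /wave_p/=.
  by case: c; [congr (cos _ - cos _)|congr (sin _ - sin _)]; ring.
have -> : part b (d_rho G (u_ref M theta) t) = derive1 (fun y => part b (u_ref M theta (y * cos t, y * sin t))) r.
  by case: b.
rewrite E /ref_radial; case: b.
  rewrite (derive1_val (is_deriveB (dcos (wave_m al be t)) (dcos (wave_p al be t)))); ring.
rewrite (derive1_val (is_deriveB (dsin (wave_m al be t)) (dsin (wave_p al be t)))); ring.
Qed.

Lemma smooth1_ref_radial b : smooth1 (ref_radial b).
Proof.
have sc (h : R -> R) : smooth1 h -> smooth1 (fun y => h (r * y)).
  by move=> sh; have := smooth1_affine r 0 sh; under eq_fun do rewrite addr0.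
case: b.
  rewrite (_ : ref_radial true = fun y => y * (fun y => 0 * cos y + (-1) * sin y) (r * y)).
    by apply: smooth1M; [exact: smooth1_id|exact: (sc _ (smooth1_trig 0 (-1)))].
  by apply/funext => y; rewrite /ref_radial; ring.
rewrite (_ : ref_radial false = fun y => y * (fun y => 1 * cos y + 0 * sin y) (r * y)).
  by apply: smooth1M; [exact: smooth1_id|exact: (sc _ (smooth1_trig 1 0))].
by apply/funext => y; rewrite /ref_radial; ring.
Qed.

(** [d_rho] is a function of the angle only; a smooth extension to the plane is obtained by writing
    the phases as linear functions of $x/r$. *)
Lemma d_rho_smooth b : exists2 q, smooth q &
  forall t, part b (d_rho G (u_ref M theta) t) = q (arc_point G t).
Proof.
have rn : r != 0 by rewrite gt_eqF// Rad_gt0.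
exists (fun x => ref_radial b (al / r * x.1 + (- (be / r)) * x.2)
      - ref_radial b (al / r * x.1 + be / r * x.2)).
  apply: smoothB; apply: smooth_comp; [exact: smooth1_ref_radial| |exact: smooth1_ref_radial|];
    (apply: smoothD; apply: smoothZ; [exact: smooth_fst|exact: smooth_snd]).
move=> t; rewrite part_d_rho_u_ref /wave_m /wave_p /arc_point/=.
by congr (ref_radial b _ - ref_radial b _); field.
Qed.

Lemma u_ref_decay (rho : R) : 0 < rho <= 1 -> exists2 C, 0 < C & forall n b,
  `|sinc (fun t => part b (d_rho G (u_ref M theta) t)) n| <= C * rho ^+ n /\
  `|sinc (fun t => part b (u_ref M theta (arc_point G t))) n| <= C * rho ^+ n.
Proof.
move=> r01; have /andP[rho0 _] := r01; set B := `|al| + `|be|.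
have B0 : 0 <= B by rewrite addr_ge0.
have ac := approximable_cos B r01 r; have asn := approximable_sin B r01 r.
have c1 := @continuous_cos R; have c2 := @continuous_sin R.
have cont (h : R -> R) : smooth1 h -> continuous h by exact: smooth1_continuous.
have cc : continuous (fun y : R => cos (r * y)) by exact: continuous_scaled_cos.
have cs : continuous (fun y : R => sin (r * y)) by exact: continuous_scaled_sin.
have D (f : R -> R) : continuous f -> approximable B rho f -> exists2 C, 0 <= C & forall n,
   `|I1 arc (fun t => (f (wave_m al be t) - f (wave_p al be t)) * sin (n%:R * t))| <= C * rho ^+ n.
  move=> cf af; have [C HC] := waves_decay r01 cf af; exists C => //.
  by have := HC 0%N; rewrite expr0 mulr1; apply: le_trans.
have [C1 C10 H1] := D _ cc ac; have [C2 C20 H2] := D _ cs asn.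
have [C3 C30 H3] := D _ (cont _ (smooth1_ref_radial true)) (approximableN (approximable_mulid B0 r01 asn)).
have [C4 C40 H4] := D _ (cont _ (smooth1_ref_radial false)) (approximable_mulid B0 r01 ac).
have p2 : 0 <= 2 / pi :> R by rewrite divr_ge0// pi_ge0.
exists (2 / pi * (C1 + C2 + C3 + C4) + 1); first by rewrite ltr_wpDl// mulr_ge0// !addr_ge0.
have fin (f : R -> R) (C : R) n : `|I1 arc (fun t => f t * sin (n%:R * t))| <= C * rho ^+ n ->
    C <= C1 + C2 + C3 + C4 -> `|sinc f n| <= (2 / pi * (C1 + C2 + C3 + C4) + 1) * rho ^+ n.
  move=> h CC; rewrite normrM (ger0_norm p2); apply: le_trans (ler_wpM2l p2 h) _.
  have rn : 0 <= rho ^+ n by rewrite exprn_ge0// ltW.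
  rewrite mulrA ler_wpM2r// (le_trans (ler_wpM2l p2 CC))// lerDl//.
move=> n b; split.
  apply: (fin _ (if b then C3 else C4)); last by case: b; lra.
  under eq_Rintegral do rewrite part_d_rho_u_ref.
  by case: b; [exact: H3|exact: H4].
apply: (fin _ (if b then C1 else C2)); last by case: b; lra.
under eq_Rintegral do rewrite part_u_ref_arc.
by case: b; [exact: H1|exact: H2].
Qed.

End ReferenceField.

(** * The truncation error *)

Section CoefficientBounds.
Variables (R : realType) (G : cavity R) (M : medium G) (theta : R).
Local Notation T1 := (measurableTypeR R).
Local Notation T2 := (T1 * T1)%type.
Local Notation I2 A f := (Rintegral (@leb2 R) A f).
Local Notation r := (Rad G).
Local Notation hd := (half_disk r).
Local Notation arc := (`]0%R, pi[%classic : set R).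
Local Open Scope complex_scope.
Let r0 : 0 < r := Rad_gt0 G.
Let mhd := @measurable_half_disk R r.
Let mO := measurable_Omega G.

Lemma kappa0_gt0 : 0 < kappa0 M.
Proof.
by rewrite mulr_gt0 ?omega_gt0// sqrtr_gt0 mulr_gt0 ?eps0_gt0 ?permeability_gt0.
Qed.

(** In the variable $s=|x|^2$ the Helmholtz operator is four times the operator defining
    [mode_defect], hence the quarter. *)
Let k2 := kappa0 M ^+ 2 / 4.
Let k20 : 0 <= k2. Proof. by rewrite divr_ge0// sqr_ge0. Qed.

Lemma partZ b (x : R) (z : R[i]) : part b (x%:C * z) = x * part b z.
Proof. by rewrite mulrC partM mulrC. Qed.

Definition defect_pairing (u : R * R -> R[i]) n : R[i] :=
  I2 hd (fun x => part true (u x) * (mode_defect G k2 n (sqn x) * Pn n x)) +i*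
  I2 hd (fun x => part false (u x) * (mode_defect G k2 n (sqn x) * Pn n x)).

Lemma part_defect_pairing b u n : part b (defect_pairing u n) =
  I2 hd (fun x => part b (u x) * (mode_defect G k2 n (sqn x) * Pn n x)).
Proof. by case: b. Qed.

Lemma H1_sqint u b : H1 (Omega G) u -> [/\ sqint (@leb2 R) hd (fun x => part b (u x)),
  sqint (@leb2 R) hd (fun x => part b (weak_deriv (Omega G) (e1 R) u x)) &
  sqint (@leb2 R) hd (fun x => part b (weak_deriv (Omega G) (e2 R) u x))].
Proof.
move=> [Lu [g1 /weak_derivP[W1 _]] [g2 /weak_derivP[W2 _]]].
by split; exact: sqint_sub_Omega.
Qed.

(** The truncated mode is an admissible test function. Since $\kappa_0^2=4\,$[k2], Green's formula
    leaves of the volume integrals only the pairing with the defect. *)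
Lemma mode_equation u n : TM_solution M theta u ->
  (exists g, is_trace hd (arc_point G) arc u g) -> (0 < n)%N ->
  let F := bessel_profile k2 n (r ^+ 2) in
  let F1 := derive1 (bessel_profile k2 n) (r ^+ 2) in
  let an := sine_coef (arc_trace G u) n in
  (r ^+ n * (pi / 2))%:C * (((2 * r ^+ 2 * F1 + n%:R * F)%:C - (r * kappa0 M * F)%:C * hq M n) * an) =
  (r * (pi / 2) * (F * r ^+ n))%:C * (sine_coef (d_rho G (u_ref M theta)) n -
     (kappa0 M)%:C * (hq M n * sine_coef (fun t => u_ref M theta (arc_point G t)) n))
  + 4%:C * defect_pairing u n.
Proof.
move=> [Hu Eu] [g tg] n0 F F1 an.
pose H := mode_profile G k2 n; pose V x := H (sqn x) * Pn n x.
have sH : smooth1 H := smooth1_mode_profile G k2 n.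
have H0 s : s <= Rhat G ^+ 2 -> H s = 0 by exact: mode_profile_eq0.
have [HF HF1] : H (r ^+ 2) = F /\ derive1 H (r ^+ 2) = F1 := mode_profile_boundary G k2 n0.
have sV : smooth V by exact: (smooth_mode true).
have Vf s : V (s, 0) = 0 by exact: mode_flat.
have Va t : V (arc_point G t) = F * r ^+ n * sin (n%:R * t).
  by rewrite /V /arc_point arc_mode HF.
have Vi x : sqn x <= Rhat G ^+ 2 -> V x = 0 by move=> h; rewrite /V H0// mul0r.
have tg' := arc_traceP tg.
have /Eu := H10_upperC G sV Vf; rewrite /source.
rewrite (arc_pairing_test sV Vf Va (d_rho_smooth M theta)) (B_TM_pairing_test M n0 sV Vf Va).
move=> E; apply: part_ext => b; move: (congr1 (part b) E).
rewrite (a_TM_test M sV Vf Vi b Hu) (B_TM_pairing_test M n0 sV Vf Va).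
have [Hu1 _ _] := Hu.
have [sg rad] := trace_radial Hu1 tg' b; have ang := H10_angular Hu b.
have [sw s1 s2] := H1_sqint b Hu1.
have -> : kappa0 M ^+ 2 = 4 * k2 by rewrite /k2; field.
rewrite (green_mode k2 rad ang sw s1 s2 sg sH H0 n0) HF HF1.
rewrite -part_sine_coef -/an.
rewrite -[X in _ - 4 * X]part_defect_pairing.
move: (sine_coef (d_rho G (u_ref M theta)) n) (hq M n * sine_coef (fun t => _) n) => D C.
move: an (defect_pairing u n) => A Y.
have sub2 c d (x y : R[i]) : part b (c%:C * x - d%:C * y) = c * part b x - d * part b y.
  by rewrite partB !partZ.
rewrite sub2 partZ; move: (hq M n) => h.
have -> : ((2 * r ^+ 2 * F1 + n%:R * F)%:C - (r * kappa0 M * F)%:C * h) * A =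
    (2 * r ^+ 2 * F1 + n%:R * F)%:C * A - (r * kappa0 M * F)%:C * (h * A).
  by rewrite mulrBl mulrA.
rewrite partD !partZ sub2 partB !partZ.
move: (part b A) (part b (h * A)) (part b Y) (part b D) (part b C).
by move: (kappa0 M) (@pi R) (r ^+ n) => k p q x1 x2 x3 x4 x5 E'; lra.
Qed.

Lemma cabsD (z w : R[i]) : cabs (z + w) <= cabs z + cabs w.
Proof. exact: (@le_normcD R z w). Qed.

Lemma cabsM (z w : R[i]) : cabs (z * w) = cabs z * cabs w.
Proof. exact: ComplexField.Normc.normcM. Qed.

Lemma cabs_real (x : R) : 0 <= x -> cabs (x%:C : R[i]) = x.
Proof. by move=> x0; rewrite /= expr0n/= addr0 sqrtr_sqr ger0_norm. Qed.

Lemma cabsB (z w : R[i]) : cabs (z - w) <= cabs z + cabs w.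
Proof.
apply: le_trans (cabsD z (- w)) _; rewrite lerD2l.
by case: w => a b /=; rewrite !sqrrN.
Qed.

(** Induction, with $n\le2^n$ turning $n4^{-n}$ into the increment $2^{-n}$ of the right-hand
    side. *)
Lemma sum_natr_expr4_le N : \sum_(1 <= n < N.+1) n%:R / 4 ^+ n <= 1 - (2 ^+ N)^-1 :> R.
Proof.
elim: N => [|N ih]; first by rewrite big_geq// expr0 invr1 subrr.
rewrite big_nat_recr//=; apply: le_trans (lerD ih (lexx _)) _.
rewrite [_.+1%:R / _](_ : _ = N.+1%:R / 2 ^+ N.+1 * (2 ^+ N.+1)^-1); last first.
  by rewrite -mulrA -invfM -exprMn -natrM.
have -> : (2 ^+ N)^-1 = 2 * (2 ^+ N.+1)^-1 :> R.
  by rewrite exprS; field; rewrite expf_neq0.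
set t : R := (2 ^+ N.+1)^-1.
have t0 : 0 < t by rewrite invr_gt0 exprn_gt0.
have h : N.+1%:R * t <= 1.
  by rewrite ler_pdivrMr ?exprn_gt0// mul1r -natrX ler_nat ltnW// ltn_expl.
have := ler_wpM2r (ltW t0) h; move: (_ * _ * t) => y; lra.
Qed.

(** Solving the mode equation for the coefficient and squaring: the data of [u_ref] give the
    summable term $n4^{-n}$, and the defect appears with the weight of [mode_defect_sum], because
    $q^nr^n=\hat R^n$. *)
Lemma mode_bound u : TM_solution M theta u ->
  (exists g, is_trace hd (arc_point G) arc u g) ->
  let q := Rhat G / r in
  exists n0 C, [/\ (0 < n0)%N, 0 < C & forall n, (n0 <= n)%N ->
    n%:R * cabs (sine_coef (arc_trace G u) n) ^+ 2 / q ^+ n ^+ 2 <=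
    C * (n%:R / 4 ^+ n + cabs (defect_pairing u n) ^+ 2 / (n%:R * (Rhat G ^+ 2) ^+ n))].
Proof.
move=> Su tg q; have [R0 Rr] := (Rhat_gt0 G, Rhat_lt_Rad G).
have q0 : 0 < q by rewrite divr_gt0.
have q1 : q <= 1 by rewrite ler_pdivrMr// mul1r ltW.
(* The data decay at any geometric rate; half of $q$ leaves the factor $4^{-n}$ after division by
   $q^{2n}$. *)
have rho1 : 0 < q / 2 <= 1 by apply/andP; split; move: q0 q1; lra.
have [Cd Cd0 decay] := u_ref_decay M theta rho1.
have [n1 [Ch [Ch0 hankel]]] := hankel_asymptotics (mulr_gt0 kappa0_gt0 r0).
have [n2 large] := bessel_profile_large G k20.
have p0 := pi_gt0 R; have k0 := kappa0_gt0.
pose B := 2 * r * pi * Cd * (1 + kappa0 M * Ch).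
have B0 : 0 < B by rewrite !mulr_gt0// addr_gt0// mulr_gt0.
exists (maxn 1 (maxn n1 n2)), (32 / pi ^+ 2 * (B ^+ 2 + 16)); split.
- by rewrite leq_max.
- by rewrite mulr_gt0 ?divr_gt0 ?exprn_gt0// addr_gt0 ?exprn_gt0.
move=> n; rewrite !geq_max => /and3P[n0 nn1 nn2].
have [/andP[F_ge F_le] Z_ge] := large n nn2.
have [h_re h_le] := hankel n nn1.
have n1R : 1 <= n%:R :> R by rewrite ler1n.
have := congr1 (@ComplexField.Normc.normc R) (mode_equation Su tg n0).
rewrite -/(hq M n); set A := sine_coef (arc_trace G u) n; set T := defect_pairing u n.
move: F_ge F_le Z_ge; set F := bessel_profile _ _ _; set F1 := derive1 _ _.
move=> F_ge F_le Z_ge E.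
have F0 : 0 < F by move: F_ge; lra.
set Z := (_%:C - _%:C * hq M n) in E.
(* The real part alone suffices: $\Re h_n\le0$ and $F>0$, so the DtN term only adds to the lower
   bound $n/2$. *)
have Z_le : n%:R / 2 <= cabs Z.
  apply: le_trans (part_le_cabs true _); apply: le_trans (ler_norm _).
  rewrite /Z partB partZ; apply: (le_trans Z_ge); rewrite lerBrDr gerDl mulr_ge0_le0//.
  by rewrite (mulr_ge0 (ltW (mulr_gt0 r0 k0)) (ltW F0)).
have c2 (f : R -> R[i]) : (forall b, `|sinc (fun t => part b (f t)) n| <= Cd * (q / 2) ^+ n) ->
    cabs (sine_coef f n) <= 2 * Cd * (q / 2) ^+ n.
  move=> H; apply: (le_trans (cabs_le_parts _)); rewrite !part_sine_coef.
  by have := lerD (H true) (H false); lra.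
have D_le := c2 _ (fun b => (decay n b).1); have c_le := c2 _ (fun b => (decay n b).2).
move: E; set D := sine_coef (d_rho _ _) n; set c := sine_coef (fun t => u_ref _ _ _) n => E.
rewrite -/D in D_le; rewrite -/c in c_le; clearbody D c A T.
have rn0 : 0 < r ^+ n by rewrite exprn_gt0.
have rhon0 : 0 <= (q / 2) ^+ n by case/andP: rho1 => h _; rewrite exprn_ge0// ltW.
have key : r ^+ n * (pi / 2) * (n%:R / 2 * cabs A) <=
    r ^+ n * (n%:R * (q / 2) ^+ n * B) + 4 * cabs T.
  apply: (@le_trans _ _ (cabs ((r ^+ n * (pi / 2))%:C * (Z * A)))).
    rewrite !cabsM cabs_real; last by rewrite mulr_ge0 ?divr_ge0// ltW.
    by rewrite ler_wpM2l ?mulr_ge0 ?divr_ge0 ?(ltW p0) ?(ltW rn0)// ler_wpM2r ?cabs_ge0.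
  rewrite E; apply: (le_trans (cabsD _ _)); rewrite !cabsM (@cabs_real 4)//.
  have pos : 0 <= r * (pi / 2) * (F * r ^+ n).
    exact: (mulr_ge0 (mulr_ge0 (ltW r0) (divr_ge0 (ltW p0) (ler0n _ _))) (mulr_ge0 (ltW F0) (ltW rn0))).
  rewrite lerD2r (cabs_real pos).
  have DC h : cabs h <= Ch * n%:R -> cabs (D - (kappa0 M)%:C * (h * c)) <=
      n%:R * (2 * Cd * (q / 2) ^+ n * (1 + kappa0 M * Ch)).
    move=> hle; apply: (le_trans (cabsB _ _)); rewrite !cabsM (cabs_real (ltW k0)).
    rewrite mulrDr mulr1 mulrDr; apply: lerD.
      apply: (le_trans D_le); rewrite ler_peMl//.
      by rewrite mulr_ge0// mulr_ge0 ?(ltW Cd0).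
    have := ler_pM (cabs_ge0 _) (cabs_ge0 _) hle c_le.
    by move=> /(ler_wpM2l (ltW k0)) /le_trans; apply; rewrite le_eqVlt; apply/orP; left; apply/eqP; ring.
  apply: (@le_trans _ _ (r * (pi / 2) * (2 * r ^+ n) *
      (n%:R * (2 * Cd * (q / 2) ^+ n * (1 + kappa0 M * Ch))))); last first.
    rewrite /B; move: (kappa0 M) (@pi R) (r ^+ n) ((q / 2) ^+ n) => k p x y.
    by rewrite le_eqVlt; apply/orP; left; apply/eqP; field.
  apply: (ler_pM pos (cabs_ge0 _) _ (DC _ h_le)).
  rewrite ler_wpM2l//; first exact: (mulr_ge0 (ltW r0) (divr_ge0 (ltW p0) (ler0n _ _))).
  by rewrite ler_wpM2r// ltW.
have qn0 : 0 < q ^+ n by rewrite exprn_gt0.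
have nR0 : 0 < n%:R :> R by rewrite ltr0n.
have Rn : Rhat G ^+ n = q ^+ n * r ^+ n by rewrite -exprMn /q divfK// gt_eqF.
have F4 : 4 ^+ n = 2 ^+ n ^+ 2 :> R by rewrite exprAC; congr (_ ^+ _); ring.
rewrite (exprAC (Rhat G)) Rn F4; move: key; rewrite expr_div_n.
have two0 : 0 < 2 ^+ n :> R by rewrite exprn_gt0.
have := cabs_ge0 A; have := cabs_ge0 T; move: B0 p0 qn0 nR0 rn0 two0.
move: B (@pi R) (q ^+ n) (n%:R : R) (r ^+ n) (2 ^+ n) (cabs A) (cabs T).
clear=> b p qn n rn w a t b0 p0 q0 n0 rn0 w0 t0 a0 key.
(* The coefficient inequality divided by $r^n\pi/4$. *)
have key' : n * a <= 4 / p * (n * (qn / w) * b + 4 * (t / rn)).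
  rewrite -(ler_pM2l (mulr_gt0 rn0 p0)).
  apply: le_trans (_ : 4 * (rn * (n * (qn / w) * b) + 4 * t) <= _).
    by move: key; lra.
  by rewrite le_eqVlt; apply/orP; left; apply/eqP; field; rewrite !gt_eqF.
have na0 : 0 <= n * a by rewrite mulr_ge0// ltW.
have sq : (n * a) ^+ 2 <= (4 / p) ^+ 2 * (2 * ((n * (qn / w) * b) ^+ 2 + (4 * (t / rn)) ^+ 2)).
  apply: (@le_trans _ _ ((4 / p * (n * (qn / w) * b + 4 * (t / rn))) ^+ 2)).
    by rewrite lerXn2r ?nnegrE// (le_trans na0).
  rewrite exprMn ler_wpM2l ?sqr_ge0//.
  move: (n * (qn / w) * b) (4 * (t / rn)) => x y.
  by have := sqr_ge0 (x - y); lra.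
have m0 : 0 < n * qn ^+ 2 by rewrite mulr_gt0 ?exprn_gt0.
apply: (@le_trans _ _ ((n * a) ^+ 2 / (n * qn ^+ 2))).
  by rewrite le_eqVlt; apply/orP; left; apply/eqP; field; rewrite !gt_eqF.
rewrite ler_pdivrMr//; apply: (le_trans sq).
have -> : (4 / p) ^+ 2 * (2 * ((n * (qn / w) * b) ^+ 2 + (4 * (t / rn)) ^+ 2)) =
  32 / p ^+ 2 * (b ^+ 2 * (n / w ^+ 2) + 16 * (t ^+ 2 / (n * (qn * rn) ^+ 2))) * (n * qn ^+ 2).
  by field; rewrite !gt_eqF.
rewrite (ler_pM2r m0) -[leRHS]mulrA ler_pM2l ?divr_gt0 ?exprn_gt0//.
have x0 : 0 <= n / w ^+ 2 by rewrite divr_ge0 ?sqr_ge0// ltW.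
have y0 : 0 <= t ^+ 2 / (n * (qn * rn) ^+ 2) by rewrite divr_ge0 ?sqr_ge0// mulr_ge0 ?sqr_ge0// ltW.
move: (n / w ^+ 2) (t ^+ 2 / _) x0 y0 => x y x0 y0.
by have := mulr_ge0 (sqr_ge0 b) y0; move: (b ^+ 2) => b2; lra.
Qed.

(** [mode_bound] is summed over $n$: the data term is a convergent series, and [mode_defect_sum] is
    applied to the real and the imaginary part of [u]. *)
Lemma solution_decay u : TM_solution M theta u ->
  (exists g, is_trace hd (arc_point G) arc u g) ->
  exists n0 C, [/\ (0 < n0)%N, 0 < C & forall N,
    \sum_(n0 <= n < N) n%:R * cabs (sine_coef (arc_trace G u) n) ^+ 2 / (Rhat G / r) ^+ n ^+ 2 <= C].
Proof.
move=> Su tg; have [n0 [C [n00 C0 H]]] := mode_bound Su tg.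
have [Cd Cd0 HD] := mode_defect_sum G k20.
have [Hu _] := Su; have [Hu1 _ _] := Hu.
pose I b := I2 hd (fun x => part b (weak_deriv (Omega G) (e1 R) u x) ^+ 2) +
            I2 hd (fun x => part b (weak_deriv (Omega G) (e2 R) u x) ^+ 2).
have I0 b : 0 <= I b by apply: addr_ge0; apply: Rintegral_ge0 => x _; exact: sqr_ge0.
pose t n := n%:R / 4 ^+ n + cabs (defect_pairing u n) ^+ 2 / (n%:R * (Rhat G ^+ 2) ^+ n) : R.
have t0 n : 0 <= t n.
  apply: addr_ge0; first by rewrite divr_ge0// exprn_ge0.
  by rewrite divr_ge0 ?sqr_ge0// mulr_ge0// exprn_ge0// sqr_ge0.
have S N : \sum_(1 <= n < N) t n <= 1 + Cd * (I true + I false).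
  rewrite big_split; apply: lerD.
    case: N => [|N]; first by rewrite big_geq.
    by apply: (le_trans (sum_natr_expr4_le N)); rewrite gerBl invr_ge0 exprn_ge0.
  under eq_bigr do rewrite sqr_cabs mulrDl !part_defect_pairing.
  rewrite big_split mulrDr; apply: lerD.
    by have [sw s1 s2] := H1_sqint true Hu1; exact: (HD _ _ _ (H10_angular Hu true) sw s1 s2 N).
  by have [sw s1 s2] := H1_sqint false Hu1; exact: (HD _ _ _ (H10_angular Hu false) sw s1 s2 N).
exists n0, (C * (1 + Cd * (I true + I false))); split => // [|N].
  by rewrite mulr_gt0// ltr_pwDl// mulr_ge0 ?(ltW Cd0)// addr_ge0.
apply: (@le_trans _ _ (C * \sum_(n0 <= n < N) t n)).
  by rewrite mulr_sumr; apply: ler_sum_nat => n /andP[n0n _]; exact: H.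
rewrite ler_pM2l//; apply: le_trans (S N).
have [Nn|nN] := leqP N n0; first by rewrite big_geq// sumr_ge0.
by rewrite (@big_cat_nat _ _ _ n0 1)//= ?(ltnW nN)// lerDr sumr_ge0.
Qed.

Lemma Rintegral_subset_le (f : R * R -> R) : (@leb2 R).-integrable (Omega G : set T2) (EFin \o f) ->
  (forall x, 0 <= f x) -> I2 hd f <= I2 (Omega G) f.
Proof.
move=> fi f0; have fh := integrableS mO mhd (@half_disk_Omega _ G) fi.
apply: fine_le; [exact: integrable_fin_num|exact: integrable_fin_num|].
apply: ge0_subset_integral => //; [by case/integrableP: fi|by move=> x _; rewrite lee_fin|].
exact: half_disk_Omega.
Qed.

Lemma trace_coef_bound : exists2 C : R, 0 < C & forall v, H10 G v ->
  (exists g, is_trace hd (arc_point G) arc v g) -> forall N,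
  \sum_(1 <= n < N) n%:R * cabs (sine_coef (arc_trace G v) n) ^+ 2 <= C * H1norm (Omega G) v ^+ 2.
Proof.
have [C C0 H] := sine_coef_bound G.
exists C => // v Hv [g tg] N; have [Hv1 _ _] := Hv.
have [Lv [g1 /weak_derivP[W1 _]] [g2 /weak_derivP[W2 _]]] := Hv1.
pose I e b := I2 hd (fun x => part b (weak_deriv (Omega G) e v x) ^+ 2).
have P b : \sum_(1 <= n < N) n%:R * part b (sine_coef (arc_trace G v) n) ^+ 2 <=
    C * (I (e1 R) b + I (e2 R) b).
  have [sg rad] := trace_radial Hv1 (arc_traceP tg) b; have [sw s1 s2] := H1_sqint b Hv1.
  under eq_bigr do rewrite part_sine_coef.
  exact: (H _ _ _ _ rad (H10_angular Hv b) sw s1 s2 sg N).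
have J e : L2 (@leb2 R) (Omega G) (weak_deriv (Omega G) e v) ->
    I e true + I e false <= l2norm (@leb2 R) (Omega G) (weak_deriv (Omega G) e v) ^+ 2.
  move=> L; rewrite (sqr_l2norm mO L); move/(L2P _ mO): L => L.
  apply: lerD; apply: Rintegral_subset_le; try (by move=> x; exact: sqr_ge0).
    exact: (L true).2.
  exact: (L false).2.
under eq_bigr do rewrite sqr_cabs mulrDr.
rewrite big_split; apply: (le_trans (lerD (P true) (P false))).
rewrite -mulrDr ler_pM2l// sqr_H1norm.
by rewrite addrACA -[leRHS]addrA; apply: (le_trans (lerD (J _ W1) (J _ W2))); rewrite lerDr sqr_ge0.
Qed.

End CoefficientBounds.

(** * Positivity of the norm of the reference field *)

Section ReferenceField.
Variables (R : realType) (G : cavity R) (M : medium G) (theta : R).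
Hypothesis theta_range : - (pi / 2) < theta < pi / 2.
Local Notation T1 := (measurableTypeR R).
Local Notation T2 := (T1 * T1)%type.
Local Notation r := (Rad G).
Let r0 : 0 < r := Rad_gt0 G.
Let mO := measurable_Omega G.

Lemma leb2_Omega : (@leb2 R (Omega G : set T2) < +oo)%E.
Proof.
have [K [_ HK]] := @cav_bounded R G.
pose B := Num.max r (K + 1); have rB : r <= B by rewrite le_max lexx.
have KB : K < B by rewrite lt_max ltrDl ltr01 orbT.
have B0 : 0 < B := lt_le_trans r0 rB.
apply: (@le_lt_trans _ _ (@leb2 R ([set` `[- B, B]] `*` [set` `[- B, B]]))).
  apply: le_measure; rewrite ?inE//; first by apply: measurableX; exact: measurable_itv.
  have sub (x : R * R) : `|x.1| <= B -> `|x.2| <= B -> ([set` `[- B, B]] `*` [set` `[- B, B]]) x.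
    by move=> h1 h2; split; rewrite /= in_itv/= -ler_norml.
  move=> x [[[hx x2]|[ax x2]]|cx]; apply: sub.
  - by apply: le_trans rB; apply: le_sqr_I; [exact: ltW|rewrite ltW// (le_lt_trans _ hx)// lerDl sqr_ge0].
  - by apply: le_trans rB; apply: le_sqr_I; [exact: ltW|rewrite ltW// (le_lt_trans _ hx)// lerDr sqr_ge0].
  - by apply: le_trans rB; rewrite ltW// (lt_trans (apert_Rhat ax))// Rhat_lt_Rad.
  - by rewrite x2 normr0 ltW.
  - by have := HK _ KB x cx; apply: le_trans; rewrite /Num.norm/= le_max lexx.
  - by have := HK _ KB x cx; apply: le_trans; rewrite /Num.norm/= le_max lexx orbT.
by rewrite leb2_rect ?ltry// ge0_cp// ltW.
Qed.

Let be := beta M theta.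

Lemma beta_gt0 : 0 < be.
Proof. by rewrite mulr_gt0 ?kappa0_gt0// cos_gt0_pihalf. Qed.

(** Indeed $u^{\rm ref}=-2i\,e^{i\alpha x_1}\sin(\beta x_2)$. *)
Lemma cabs_u_ref (x : R * R) : cabs (u_ref M theta x) ^+ 2 = (2 * sin (be * x.2)) ^+ 2.
Proof.
rewrite sqr_cabs !part_u_ref cosB cosD sinB sinD -/be.
move: (be * x.2) (alpha M theta * x.1) => b a.
rewrite [LHS](_ : _ = 4 * sin b ^+ 2 * (cos a ^+ 2 + sin a ^+ 2)); last by ring.
by rewrite cos2Dsin2; ring.
Qed.

(** A zero norm would force $\sin(\beta x_2)=0$ almost everywhere in the domain. As $\beta>0$, this
    fails on a square of positive measure near the ground. The $L^2$ part of the norm is enough for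
    this. *)
Lemma H1norm_u_ref_gt0 : 0 < H1norm (Omega G) (u_ref M theta).
Proof.
rewrite lt_neqAle sqrtr_ge0 andbT eq_sym; apply/negP => /eqP H0.
pose w (x : R * R) := 2 * sin (be * x.2).
have cw : continuous w.
  move=> x; apply: cvgM; first exact: cvg_cst.
  apply: continuous_comp; last exact: continuous_sin.
  by apply: cvgM; [exact: cvg_cst|exact: (smooth_continuous (@smooth_snd R))].
have sw : sqint (@leb2 R) (Omega G : set T2) w.
  apply: (bounded_sqint mO leb2_Omega (M := 2)); first exact: continuous_measurable_fun2.
  by move=> x _; rewrite normrM ger0_norm// ler_piMr// sin_max.
have I0 : Rintegral (@leb2 R) (Omega G : set T2) (fun x => w x ^+ 2) = 0.
  have : l2norm (@leb2 R) (Omega G) (u_ref M theta) ^+ 2 = 0.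
    apply/eqP; rewrite eq_le sqr_ge0 andbT.
    have := sqr_H1norm (Omega G) (u_ref M theta); rewrite H0 expr0n/= => h; rewrite [leRHS]h.
    by rewrite -addrA lerDl addr_ge0// sqr_ge0.
  rewrite /l2norm sqr_sqrtr; last by apply: Rintegral_ge0 => x _; exact: sqr_ge0.
  by under eq_Rintegral do rewrite cabs_u_ref.
have [N [mN N0 HN]] := sqr_I_eq0 mO sw I0.
have b0 := beta_gt0; have p0 := pi_gt0 R.
(* The bound $r/3$ keeps $[0,d]\times[d,2d]$ in the half-disk, as $5d^2<r^2$; the bound
   $\pi/(3\beta)$ keeps $\beta x_2\le2\pi/3<\pi$. *)
pose d := Num.min (r / 3) (pi / (3 * be)).
have d0 : 0 < d by rewrite lt_min !divr_gt0// mulr_gt0.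
have dr : d <= r / 3 by rewrite ge_min lexx.
have db : d <= pi / (3 * be) by rewrite ge_min lexx orbT.
pose Q : set (R * R) := [set` `[0, d]] `*` [set` `[d, 2 * d]].
have : (@leb2 R Q <= @leb2 R N)%E.
  apply: le_measure; rewrite ?inE//; first by apply: measurableX; exact: measurable_itv.
  move=> [x1 x2] [/=]; rewrite !in_itv/= => /andP[x10 x1d] /andP[x2d x22d]; apply: HN => /= h.
  have : w (x1, x2) = 0.
    apply: h; left; left; split => /=; last exact: lt_le_trans x2d.
    have x20 : 0 <= x2 by rewrite (le_trans (ltW d0)).
    apply: (@le_lt_trans _ _ (d ^+ 2 + (2 * d) ^+ 2)).
      have d20 : 0 <= 2 * d by rewrite mulr_ge0// ltW.
      by apply: lerD; rewrite lerXn2r ?nnegrE// ltW.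
    have : d ^+ 2 <= (r / 3) ^+ 2 by rewrite lerXn2r ?nnegrE ?divr_ge0// ltW.
    by have := exprn_gt0 2 r0; clear; move: d r => a c; lra.
  rewrite /w/=; apply/eqP; rewrite mulf_neq0// gt_eqF// sin_gt0_pi// mulr_gt0//=; last exact: lt_le_trans x2d.
  apply: (@le_lt_trans _ _ (be * (2 * (pi / (3 * be))))).
    by rewrite ler_pM2l// (le_trans x22d)// ler_pM2l.
  rewrite [ltLHS](_ : _ = 2 / 3 * pi); last by field; rewrite gt_eqF.
  by move: p0; move: (@pi R) => p; lra.
rewrite leb2_rect; [|exact: ltW|by move: d0; lra].
rewrite N0 lee_fin leNgt => /negP; apply; rewrite mulr_gt0//; move: d0; lra.
Qed.

End ReferenceField.

(** A weighted Cauchy-Schwarz inequality in which the geometric weight of [a] is extracted as $q^N$,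
    and the result stays linear in [L]. *)
Lemma weighted_pairing_tail (R : realType) (a b : nat -> R) (q A B L : R) n0 N K :
    0 < q <= 1 -> (0 < n0 <= N)%N -> (forall n, 0 <= a n) -> (forall n, 0 <= b n) ->
    0 <= A -> 0 <= B -> 0 <= L ->
    \sum_(n0 <= n < K) n%:R * a n ^+ 2 / q ^+ n ^+ 2 <= A ->
    \sum_(1 <= n < K) n%:R * b n ^+ 2 <= B * L ^+ 2 ->
  \sum_(N <= n < K) n%:R * (a n * b n) <= (A + B) * q ^+ N * L.
Proof.
move=> /andP[q0 q1] /andP[n00 n0N] a0 b0 A0 B0 L0 sA sB.
have tail (f : nat -> R) m : (m <= N)%N -> (forall n, 0 <= f n) ->
    \sum_(N <= n < K) f n <= \sum_(m <= n < K) f n.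
  move=> mN f0; have [KN|NK] := leqP K N; first by rewrite big_geq// sumr_ge0.
  by rewrite (@big_cat_nat _ _ _ N m)//= ?(ltnW NK)// lerDr sumr_ge0.
have qN0 : 0 < q ^+ N by rewrite exprn_gt0.
(* The natural weight is $l=L$, but [L] may be zero; the estimate is proved for every $l>L$, and $l$
   then decreases to $L$. *)
have main l : L < l -> \sum_(N <= n < K) n%:R * (a n * b n) <= (A + B) * q ^+ N * l.
  move=> Ll; have l0 := le_lt_trans L0 Ll.
  (* AM-GM: [2 a b <= q^n (l a^2 / q^2n + b^2 / l)] *)
  apply: (@le_trans _ _ (\sum_(N <= n < K) q ^+ N * (l * (n%:R * a n ^+ 2 / q ^+ n ^+ 2) + l^-1 * (n%:R * b n ^+ 2)))).
    apply: ler_sum_nat => n /andP[Nn _].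
    have qn0 : 0 < q ^+ n by rewrite exprn_gt0.
    have qnN : q ^+ n <= q ^+ N by apply: ler_wiXn2l => //; exact: ltW.
    set y := (X in _ <= _ * X); have y0 : 0 <= y.
      apply: addr_ge0; apply: mulr_ge0; rewrite ?invr_ge0 ?(ltW l0)//; last by rewrite mulr_ge0 ?sqr_ge0.
      by rewrite divr_ge0 ?sqr_ge0// mulr_ge0// sqr_ge0.
    apply: le_trans (ler_wpM2r y0 qnN); rewrite /y {y y0}; move: (a0 n) (b0 n) qn0.
    move: (a n) (b n) (q ^+ n) (ler0n R n) => x y p m0 x0 y0 p0.
    rewrite [leRHS](_ : _ = n%:R * (p * l * (x / p) ^+ 2 + p / l * y ^+ 2)); last by field; rewrite !gt_eqF.
    rewrite ler_wpM2l//.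
    have -> : p * l * (x / p) ^+ 2 + p / l * y ^+ 2 = p / l * (l * (x / p) - y) ^+ 2 + 2 * (x * y).
      by field; rewrite !gt_eqF.
    have : 0 <= p / l * (l * (x / p) - y) ^+ 2 by rewrite mulr_ge0 ?sqr_ge0// divr_ge0 ?ltW.
    by move: (p / l * _ ^+ 2) (x * y) (mulr_ge0 x0 y0) => s t t0 s0; lra.
  rewrite -mulr_sumr (mulrC (A + B)) -mulrA ler_pM2l// big_split/= mulrDl -!mulr_sumr; apply: lerD.
    rewrite mulrC ler_pM2r//; apply: le_trans sA; apply: tail => // n.
    by rewrite divr_ge0 ?sqr_ge0// mulr_ge0// sqr_ge0.
  rewrite mulrC ler_pdivrMr//; apply: (@le_trans _ _ (B * L ^+ 2)).
    by apply: le_trans sB; apply: tail => [|n]; [exact: leq_trans n0N|rewrite mulr_ge0 ?sqr_ge0].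
  by rewrite -mulrA -expr2 ler_wpM2l// lerXn2r ?nnegrE// ltW.
have c0 : 0 <= (A + B) * q ^+ N by rewrite mulr_ge0 ?addr_ge0// ltW.
apply/ler_addgt0Pr => e e0; set c := (A + B) * q ^+ N in main c0 *.
have := main (L + e / (c + 1)); rewrite ltrDl divr_gt0 ?ltr_wpDl// => /(_ isT) /le_trans; apply.
rewrite mulrDr lerD2l mulrCA ger_pMr// ler_pdivrMr ?ltr_wpDl// mul1r lerDl ler01//.
Qed.

(** The uniform geometric bound makes the sequence Cauchy, so that [limn] is a true limit and not a
    default value; the bound then passes to it. *)
Lemma limn_tail_bound (R : realType) (f : nat -> R) (q D : R) n0 : 0 <= q < 1 ->
  (forall N K, (n0 <= N)%N -> (N <= K)%N -> `|f K - f N| <= D * q ^+ N) ->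
  forall N, (n0 <= N)%N -> `|limn f - f N| <= D * q ^+ N.
Proof.
move=> /andP[q0 q1] H.
have D0 : 0 <= D * q ^+ n0 by apply: le_trans (H n0 n0 _ _).
have cf : cvgn f.
  apply: cauchy_cvg; apply: cauchy_exP => e e0.
  have : (fun N => D * q ^+ N) @ \oo --> (0 : R).
    rewrite -[0](mulr0 D); apply: cvgM; first exact: cvg_cst.
    by apply: cvg_expr; rewrite ger0_norm.
  move=> /cvgr0_norm_lt /(_ _ e0) [m _ Hm].
  exists (f (maxn n0 m)); exists (maxn n0 m) => // K /= mK.
  rewrite /ball/= distrC; apply: le_lt_trans (H _ _ (leq_maxl _ _) mK) _.
  by apply: le_lt_trans (ler_norm _) _; apply: Hm; exact: leq_maxr.
move=> N nN; have : (fun K => `|f K - f N|) @ \oo --> `|limn f - f N|.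
  by apply: cvg_norm; apply: cvgB => //; exact: cvg_cst.
move=> c; rewrite -(cvg_lim _ c)//; apply: limr_le; first by apply/cvg_ex; exists `|limn f - f N|.
by exists N => // K NK; exact: H.
Qed.

(** * The tail of the DtN pairing *)

Section TailOfPairing.
Variables (R : realType) (G : cavity R) (M : medium G) (theta : R).
Local Notation r := (Rad G).
Local Notation hd := (half_disk r).
Local Notation arc := (`]0%R, pi[%classic : set R).
Local Open Scope complex_scope.
Let r0 : 0 < r := Rad_gt0 G.

Lemma cabs_conj (z : R[i]) : cabs (z^*)%R = cabs z.
Proof. by case: z => a b /=; rewrite sqrrN. Qed.

Lemma cabs_sum (I : Type) (s : seq I) (P : pred I) (F : I -> R[i]) :
  cabs (\sum_(i <- s | P i) F i) <= \sum_(i <- s | P i) cabs (F i).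
Proof.
elim/big_rec2: _ => [|i y z _ ih]; first by rewrite (cabs_real (lexx 0)).
by apply: (le_trans (cabsD _ _)); rewrite lerD2l.
Qed.

Lemma sine_coef0 n : sine_coef (fun=> 0 : R[i]) n = 0.
Proof.
apply: part_ext => b; rewrite part_sine_coef !part0 /sinc.
by rewrite Rintegral_eq0 ?mulr0// => t _; rewrite mul0r.
Qed.

(* Without a trace on the arc, [arc_trace] is the junk value [0]. *)
Lemma arc_trace_cases (v : R * R -> R[i]) :
  (exists g, is_trace hd (arc_point G) arc v g) \/ arc_trace G v = fun=> 0.
Proof.
have [tg|nt] := pselect (exists g, is_trace hd (arc_point G) arc v g); [by left|right].
by apply: xgetPN => g tg; apply: nt; exists g.
Qed.

Lemma sum_sine_coef0 (f : nat -> R) m N :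
  \sum_(m <= n < N) n%:R * cabs (sine_coef (fun=> 0 : R[i]) n) ^+ 2 * f n = 0.
Proof.
by apply: big1 => n _; rewrite sine_coef0 (cabs_real (lexx 0)) expr0n mulr0 mul0r.
Qed.

(** The difference of two partial sums is a block of the coefficient series. There $|h_n|\le Cn$
    leaves the sum of $n|u_n||\psi_n|$, to be split between the decay of [u] and the trace bound for
    the test function. *)
Lemma pairing_tail u : TM_solution M theta u -> exists n0 C, [/\ (0 < n0)%N, 0 < C &
  forall v, H10 G v -> forall N K, (n0 <= N)%N -> (N <= K)%N ->
  cabs (arc_pairing G (B_TM_N M K (arc_trace G u)) (arc_trace G v) -
        arc_pairing G (B_TM_N M N (arc_trace G u)) (arc_trace G v)) <=
  C * H1norm (Omega G) v * (Rhat G / r) ^+ N].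
Proof.
move=> Su; have [R0 Rr] := (Rhat_gt0 G, Rhat_lt_Rad G).
have q0 : 0 < Rhat G / r by rewrite divr_gt0.
have q1 : Rhat G / r <= 1 by rewrite ler_pdivrMr// mul1r ltW.
have k0 := kappa0_gt0 M; have p0 := pi_gt0 R.
(* If [u] had no trace on the arc, all coefficients would be $0$ and any positive constant would
   do. *)
have [n1 [A [n10 A0 HA]]] : exists n0 C, [/\ (0 < n0)%N, 0 < C & forall N,
    \sum_(n0 <= n < N) n%:R * cabs (sine_coef (arc_trace G u) n) ^+ 2 / (Rhat G / r) ^+ n ^+ 2 <= C].
  have [tg|->] := arc_trace_cases u; first exact: solution_decay Su tg.
  by exists 1%N, 1; split=> // N; rewrite sum_sine_coef0.
have [B B0 HB] := trace_coef_bound G.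
have [n2 [Ch [Ch0 hankel]]] := hankel_asymptotics (mulr_gt0 k0 r0).
pose c := r * kappa0 M * (pi / 2); have c0 : 0 < c by rewrite mulr_gt0 ?divr_gt0// mulr_gt0.
exists (maxn n1 n2), (c * (Ch * (A + B))); split => [|| v Hv N K].
- by rewrite leq_max n10.
- by rewrite (mulr_gt0 c0)// mulr_gt0// addr_gt0.
rewrite geq_max => /andP[n1N n2N] NK.
(* The same alternative for the test function, whose trace is chosen independently. *)
have [sv Hsum] : arcL2 (arc_trace G v) /\ forall N,
    \sum_(1 <= n < N) n%:R * cabs (sine_coef (arc_trace G v) n) ^+ 2 <= B * H1norm (Omega G) v ^+ 2.
  have [[g tg]|->] := arc_trace_cases v.
    split=> [b|N']; last by apply: HB => //; exists g.
    by have [Hv1 _ _] := Hv; have [] := trace_radial Hv1 (arc_traceP tg) b.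
  split=> [b|N'].
    by rewrite part0; exact: sqint0.
  have := sum_sine_coef0 (fun=> 1) 1 N'; under eq_bigr do rewrite mulr1.
  by move=> ->; rewrite mulr_ge0 ?sqr_ge0// ltW.
rewrite !(arc_pairing_B_TM_N _ _ _ sv) -mulrBr.
rewrite (@big_cat_nat _ _ _ N.+1 1 K.+1)//= addrAC subrr add0r.
rewrite cabsM (cabs_real (ltW c0)) -/c; clearbody c; rewrite -!mulrA ler_pM2l//.
apply: (le_trans (cabs_sum _ _ _)).
apply: (@le_trans _ _ (\sum_(N.+1 <= n < K.+1) Ch * (n%:R * (cabs (sine_coef (arc_trace G u) n) * cabs (sine_coef (arc_trace G v) n))))).
  apply: ler_sum_nat => n /andP[Nn _].
  have term (h x y : R[i]) : cabs h <= Ch * n%:R ->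
      cabs (h * x * (y^*)%R) <= Ch * (n%:R * (cabs x * cabs y)).
    by move=> hle; rewrite !cabsM cabs_conj -[leLHS]mulrA [leRHS]mulrA ler_wpM2r// mulr_ge0 ?cabs_ge0.
  by apply: term; apply: (hankel n _).2; rewrite (leq_trans n2N)// ltnW.
rewrite -mulr_sumr ler_pM2l//.
have L0 : 0 <= H1norm (Omega G) v by exact: sqrtr_ge0.
apply: (@le_trans _ _ ((A + B) * (Rhat G / r) ^+ N.+1 * H1norm (Omega G) v)).
  apply: (@weighted_pairing_tail _ _ _ _ _ _ _ n1) => //.
  - by rewrite q0.
  - by rewrite n10 ltnW.
  - by move=> n; exact: cabs_ge0.
  - by move=> n; exact: cabs_ge0.
  - exact: ltW.
  - exact: ltW.
rewrite mulrAC -mulrA ler_wpM2l ?addr_ge0 ?(ltW A0) ?(ltW B0)// ler_wpM2l//.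
by rewrite ler_wiXn2l// ltW.
Qed.

Lemma part_B_TM_pairing b (g h : R -> R[i]) : part b (B_TM_pairing M g h) =
  limn (fun N => part b (arc_pairing G (B_TM_N M N g) h)).
Proof. by case: b. Qed.

Lemma B_TM_truncation u : TM_solution M theta u -> exists n0 C, [/\ (0 < n0)%N, 0 < C &
  forall v, H10 G v -> forall N, (n0 <= N)%N ->
  cabs (B_TM_pairing M (arc_trace G u) (arc_trace G v) -
        arc_pairing G (B_TM_N M N (arc_trace G u)) (arc_trace G v)) <=
  C * H1norm (Omega G) v * (Rhat G / r) ^+ N].
Proof.
move=> Su; have [n0 [C [n00 C0 H]]] := pairing_tail Su.
(* The limit is taken separately in the real and imaginary parts, each of which contributes one
   [C]. *)
exists n0, (2 * C); split => // [|v Hv N nN]; first by rewrite mulr_gt0.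
have q01 : 0 <= Rhat G / r < 1.
  by rewrite divr_ge0 ?(ltW (Rhat_gt0 G)) ?(ltW r0)//= ltr_pdivrMr// mul1r Rhat_lt_Rad.
have P b : `|part b (B_TM_pairing M (arc_trace G u) (arc_trace G v) -
    arc_pairing G (B_TM_N M N (arc_trace G u)) (arc_trace G v))| <= C * H1norm (Omega G) v * (Rhat G / r) ^+ N.
  rewrite partB part_B_TM_pairing.
  apply: (limn_tail_bound (f := fun N => part b (arc_pairing G (B_TM_N M N (arc_trace G u)) (arc_trace G v))) q01 _ nN).
  move=> N' K nN' NK; apply: le_trans (H v Hv _ _ nN' NK).
  by rewrite -partB; exact: part_le_cabs.
apply: (le_trans (cabs_le_parts _)); apply: (le_trans (lerD (P true) (P false))).
by move: (H1norm _ v) (_ ^+ N) => L x; lra.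
Qed.

End TailOfPairing.

Theorem lemma3p5 (R : realType) (G : cavity R) (M : medium G) (theta : R)
    (htheta : - (pi / 2) < theta < pi / 2)
    (u : R * R -> complex R) (hu : TM_solution M theta u) :
  exists (N0 : nat) (C : R), (0 < N0)%N /\ 0 < C /\
    forall (N : nat) (psi : R * R -> complex R),
      (N0 <= N)%N -> H10 G psi ->
      cabs (B_TM_pairing M (arc_trace G u) (arc_trace G psi)
            - arc_pairing G (B_TM_N M N (arc_trace G u)) (arc_trace G psi))
      <= C * ((Rhat G / Rad G) ^+ N
              + (expR 1 * kappa0 M * Rad G / (2 * N%:R)) ^+ (2 * N + 4))
           * H1norm (Omega G) (u_ref M theta) * H1norm (Omega G) psi.
Proof.
have [n0 [C [n00 C0 H]]] := B_TM_truncation hu.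
have V0 := H1norm_u_ref_gt0 M htheta.
have R0 := Rad_gt0 G; have q0 : 0 < Rhat G / Rad G by rewrite divr_gt0 ?Rhat_gt0.
exists n0, (C / H1norm (Omega G) (u_ref M theta)).
split=> //; split => [|N psi nN Hpsi]; first by rewrite divr_gt0.
apply: (le_trans (H psi Hpsi N nN)).
rewrite [leRHS](_ : _ = C * H1norm (Omega G) psi * ((Rhat G / Rad G) ^+ N
  + (expR 1 * kappa0 M * Rad G / (2 * N%:R)) ^+ (2 * N + 4))).
  rewrite ler_wpM2l ?(mulr_ge0 (ltW C0) (sqrtr_ge0 _))// lerDl exprn_ge0//.
  have k0 := ltW (kappa0_gt0 M).
  exact: (divr_ge0 (mulr_ge0 (mulr_ge0 (expR_ge0 _) k0) (ltW R0)) (mulr_ge0 (ler0n _ _) (ler0n _ _))).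
move: (H1norm _ (u_ref M theta)) V0 (H1norm _ psi) (_ + _ ^+ (_ + _)%N) => V V0 L E.
by field; rewrite gt_eqF.
Qed.
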